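(* Let $Z\subseteq\mathbb{C}^g$ be a $\Lambda$-periodic analytic set. Then $Z^{\rm alg}=Z^{\rm torus\ coset}$.
   Context: $\Lambda\subset\mathbb{C}^g$ is a fixed lattice of rank $2g$ (a discrete subgroup generated by $2g$ vectors $\lambda_1,\dots,\lambda_{2g}$ that are linearly independent over $\mathbb{R}$); via this basis $\mathbb{C}^g$ is identified with $\mathbb{R}^{2g}$. A set $Z\subseteq\mathbb{C}^g$ is ($\Lambda$-)periodic if $Z+\Lambda=Z$, where $Z+\Lambda=\{z+\lambda: z\in Z,\lambda\in\Lambda\}$. A set $Z\subseteq\mathbb{C}^g$ is analytic if every point of $\mathbb{C}^g$ has an open neighbourhood $U$ in which $Z\cap U$ is the common zero set of finitely many complex-analytic functions on $U$. $Z^{\rm alg}$ is the union of all connected real semi-algebraic subsets of $\mathbb{R}^{2g}$ of positive dimension contained in $Z$. A real subspace $H$ of $\mathbb{C}^g$ is ($\Lambda$-)full if $H\cap\Lambda$ has rank equal to $\dim_{\mathbb{R}}H$. A torus coset is a set $z+H$ with $z\in\mathbb{C}^g$ and $H$ a complex linear subspace of $\mathbb{C}^g$ that is $\Lambda$-full. $Z^{\rm torus\ coset}$ is the union of all torus cosets of positive dimension contained in $Z$. *)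

(* Defs.v *)
From Stdlib Require Import Reals ZArith.
From Stdlib Require Fin.
Open Scope R_scope.

Fixpoint ffold {A : Type} (op : A -> A -> A) (e : A) (n : nat)
  : (Fin.t n -> A) -> A :=
  match n return (Fin.t n -> A) -> A with
  | O => fun _ => e
  | S m => fun f => op (f Fin.F1) (ffold op e m (fun i => f (Fin.FS i)))
  end.

Fixpoint natsum {A : Type} (op : A -> A -> A) (e : A) (N : nat) (f : nat -> A) : A :=
  match N with
  | O => f O
  | S M => op (natsum op e M f) (f (S M))
  end.

Definition fcons {A : Type} {n : nat} (a : A) (f : Fin.t n -> A) : Fin.t (S n) -> A :=
  fun i => Fin.caseS' i (fun _ => A) a f.

Fixpoint boxsum {A : Type} (op : A -> A -> A) (e : A) (N : nat) (n : nat)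
  : ((Fin.t n -> nat) -> A) -> A :=
  match n return ((Fin.t n -> nat) -> A) -> A with
  | O => fun F => F (fun _ => O)
  | S m => fun F => natsum op e N (fun k => boxsum op e N m (fun b => F (fcons k b)))
  end.

Definition C := (R * R)%type.
Definition C0 : C := (0, 0).
Definition C1 : C := (1, 0).
Definition Cadd (a b : C) : C := (fst a + fst b, snd a + snd b).
Definition Copp (a : C) : C := (- fst a, - snd a).
Definition Csub (a b : C) : C := Cadd a (Copp b).
Definition Cmul (a b : C) : C :=
  (fst a * fst b - snd a * snd b, fst a * snd b + snd a * fst b).
Definition Cmod (a : C) : R := sqrt (fst a * fst a + snd a * snd a).
Definition RtoC (r : R) : C := (r, 0).
Fixpoint Cpow (a : C) (k : nat) : C :=
  match k with O => C1 | S k' => Cmul a (Cpow a k') end.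

Definition Cg (g : nat) := Fin.t g -> C.
Definition vzero {g} : Cg g := fun _ => C0.
Definition vadd {g} (u v : Cg g) : Cg g := fun i => Cadd (u i) (v i).
Definition vscaleC {g} (a : C) (v : Cg g) : Cg g := fun i => Cmul a (v i).
Definition vscaleR {g} (r : R) (v : Cg g) : Cg g := vscaleC (RtoC r) v.
Definition vsum {g n} (f : Fin.t n -> Cg g) : Cg g := ffold vadd vzero n f.

Definition R_indep {g k} (v : Fin.t k -> Cg g) : Prop :=
  forall a : Fin.t k -> R, vsum (fun i => vscaleR (a i) (v i)) = vzero ->
    forall i, a i = 0.

Definition Z_indep {g k} (v : Fin.t k -> Cg g) : Prop :=
  forall a : Fin.t k -> Z, vsum (fun i => vscaleR (IZR (a i)) (v i)) = vzero ->
    forall i, a i = 0%Z.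

Definition in_lattice {g} (lam : Fin.t (2 * g) -> Cg g) (l : Cg g) : Prop :=
  exists n : Fin.t (2 * g) -> Z, l = vsum (fun i => vscaleR (IZR (n i)) (lam i)).

Definition periodic {g} (lam : Fin.t (2 * g) -> Cg g) (Z : Cg g -> Prop) : Prop :=
  forall z, Z z <-> exists z' l, Z z' /\ in_lattice lam l /\ z = vadd z' l.

Definition polydisc {g} (p : Cg g) (r : R) (z : Cg g) : Prop :=
  forall i, Cmod (Csub (z i) (p i)) < r.

Definition open_Cg {g} (U : Cg g -> Prop) : Prop :=
  forall p, U p -> exists r, 0 < r /\ forall z, polydisc p r z -> U z.

Definition mono {g} (p z : Cg g) (alpha : Fin.t g -> nat) : C :=
  ffold Cmul C1 g (fun i => Cpow (Csub (z i) (p i)) (alpha i)).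

Definition analytic_at {g} (f : Cg g -> C) (p : Cg g) : Prop :=
  exists r, 0 < r /\ exists c : (Fin.t g -> nat) -> C,
    forall z, polydisc p r z ->
      (exists M, forall N,
          boxsum Rplus 0 N g (fun al => Cmod (c al) * Cmod (mono p z al)) <= M) /\
      (forall eps, 0 < eps -> exists N0, forall N, (N0 <= N)%nat ->
          Cmod (Csub (boxsum Cadd C0 N g (fun al => Cmul (c al) (mono p z al))) (f z))
            < eps).

Definition analytic_on {g} (U : Cg g -> Prop) (f : Cg g -> C) : Prop :=
  forall p, U p -> analytic_at f p.

Definition analytic_set {g} (Z : Cg g -> Prop) : Prop :=
  forall p : Cg g, exists U, open_Cg U /\ U p /\
    exists (k : nat) (f : Fin.t k -> (Cg g -> C)),
      (forall j, analytic_on U (f j)) /\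
      (forall z, U z -> (Z z <-> forall j, f j z = C0)).

Inductive rpoly (n : nat) : Type :=
| Pconst : R -> rpoly n
| Pvar : Fin.t n -> rpoly n
| Padd : rpoly n -> rpoly n -> rpoly n
| Pmul : rpoly n -> rpoly n -> rpoly n.
Arguments Pconst {n}. Arguments Pvar {n}. Arguments Padd {n}. Arguments Pmul {n}.

Fixpoint peval {n} (p : rpoly n) (x : Fin.t n -> R) : R :=
  match p with
  | Pconst c => c
  | Pvar i => x i
  | Padd p q => peval p x + peval q x
  | Pmul p q => peval p x * peval q x
  end.

Inductive saform (n : nat) : Type :=
| Fpos : rpoly n -> saform n
| Fzero : rpoly n -> saform n
| Fnot : saform n -> saform n
| Fand : saform n -> saform n -> saform n
| For : saform n -> saform n -> saform n.
Arguments Fpos {n}. Arguments Fzero {n}. Arguments Fnot {n}.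
Arguments Fand {n}. Arguments For {n}.

Fixpoint sa_holds {n} (F : saform n) (x : Fin.t n -> R) : Prop :=
  match F with
  | Fpos p => 0 < peval p x
  | Fzero p => peval p x = 0
  | Fnot F => ~ sa_holds F x
  | Fand F G => sa_holds F x /\ sa_holds G x
  | For F G => sa_holds F x \/ sa_holds G x
  end.

Definition semialgebraic {n} (A : (Fin.t n -> R) -> Prop) : Prop :=
  exists F : saform n, forall x, A x <-> sa_holds F x.

Definition open_Rn {n} (U : (Fin.t n -> R) -> Prop) : Prop :=
  forall x, U x -> exists r, 0 < r /\
    forall y, (forall i, Rabs (y i - x i) < r) -> U y.

Definition connected {n} (A : (Fin.t n -> R) -> Prop) : Prop :=
  ~ exists U V, open_Rn U /\ open_Rn V /\
      (exists a, A a /\ U a) /\ (exists b, A b /\ V b) /\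
      (forall x, A x -> U x \/ V x) /\
      (forall x, A x -> U x -> V x -> False).

(* dim A >= d : some coordinate projection R^n -> R^d (given by d distinct
   coordinates) maps A onto a set with nonempty interior *)
Definition dim_ge {n} (A : (Fin.t n -> R) -> Prop) (d : nat) : Prop :=
  exists s : Fin.t d -> Fin.t n,
    (forall i j, s i = s j -> i = j) /\
    exists (c : Fin.t d -> R) (r : R), 0 < r /\
      forall y : Fin.t d -> R, (forall j, Rabs (y j - c j) < r) ->
        exists x, A x /\ forall j, x (s j) = y j.

Definition coord_map {g} (lam : Fin.t (2 * g) -> Cg g) (x : Fin.t (2 * g) -> R) : Cg g :=
  vsum (fun i => vscaleR (x i) (lam i)).

Definition Zalg {g} (lam : Fin.t (2 * g) -> Cg g) (Z : Cg g -> Prop) (w : Cg g) : Prop :=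
  exists A : (Fin.t (2 * g) -> R) -> Prop,
    semialgebraic A /\ connected A /\ dim_ge A 1 /\
    (forall x, A x -> Z (coord_map lam x)) /\
    exists x, A x /\ w = coord_map lam x.

Definition real_subspace {g} (H : Cg g -> Prop) : Prop :=
  H vzero /\ (forall u v, H u -> H v -> H (vadd u v)) /\
  (forall r u, H u -> H (vscaleR r u)).

Definition complex_subspace {g} (H : Cg g -> Prop) : Prop :=
  H vzero /\ (forall u v, H u -> H v -> H (vadd u v)) /\
  (forall a u, H u -> H (vscaleC a u)).

(* rank of H ∩ Λ (max number of Z-independent elements) = dim_R H
   (max number of R-independent elements) *)
Definition full {g} (lam : Fin.t (2 * g) -> Cg g) (H : Cg g -> Prop) : Prop :=
  forall k : nat,
    (exists v : Fin.t k -> Cg g,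
        (forall i, H (v i) /\ in_lattice lam (v i)) /\ Z_indep v) <->
    (exists v : Fin.t k -> Cg g, (forall i, H (v i)) /\ R_indep v).

Definition Ztorus {g} (lam : Fin.t (2 * g) -> Cg g) (Z : Cg g -> Prop) (w : Cg g) : Prop :=
  exists (z : Cg g) (H : Cg g -> Prop),
    complex_subspace H /\ full lam H /\
    (exists v, H v /\ v <> vzero) /\
    (forall h, H h -> Z (vadd z h)) /\
    exists h, H h /\ w = vadd z h.

(* Main.v *)
(* A sequence on the semi-algebraic set tending to [w] can, by quantifier elimination and Rolle's
   theorem, be replaced by sequences of points of the set, with limits as close to [w] as one wants,
   whose real coordinates are algebraic over one nonconstant complex coordinate [x]. Newton-Puiseux
   expansions turn such a sequence into an analytic arc through its limit [w'], which lies in [Z]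
   because it meets [Z] along a sequence. The arc is continued in [Z] along a ray of the [x]-plane up
   to infinity, where a second Puiseux expansion gives [p(s) + r(1/s)] with [p] a nonconstant
   polynomial and [r] vanishing at [0]. As [Z] is closed and invariant under a cocompact lattice,
   moving by the lattice and shifting the lower powers of [s] shows that
   [p(0) + t p_1 + ... + t' p_d + r(1/s)] lies in [Z] for arbitrary coefficients; continuing these
   translated arcs backwards to [w'] yields a whole real line through [w'] in [Z]. The set of points
   having such a line in [Z] is closed, so it contains [w]. Finally a maximal real subspace [H] with
   [w + H] in [Z] is complex by the identity theorem and full by Dirichlet approximation.
   All limits are taken along a fixed nonprincipal ultrafilter, so that bounded sequences converge. *)
From HB Require Import structures.
From Stdlib Require Import Reals ZArith Lra Lia Psatz Classical ClassicalEpsilon FunctionalExtensionality.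
From Stdlib Require Fin.
From mathcomp Require Import all_boot all_order all_algebra.
From mathcomp Require classical_sets filter.
From mathcomp Require Import zify Rstruct.
From mathcomp Require Import complex.
From mathcomp.real_closed Require Import polyrcf ordered_qelim.
From mathcomp.real_closed Require qe_rcf.
Require Import Defs.
Set Implicit Arguments.
Unset Strict Implicit.
Unset Printing Implicit Defensive.

(* The obstacle is the remainder [r(1/s)]: every limit is taken with [s] tending to infinity, so it
   only sees [r(0) = 0]. It is recovered through order of contact. At each point [x] of the real
   span of the polynomial part, the germ [x + r(t)] meets [Z] to every finite order. The order rises
   by one at a time: along the translated curve the coefficients below [k] vanish, and the germ
   itself vanishes at [t = 1/s], so its [k]-th coefficient is [O(1/s)]. Power series are measured by
   the norm [sum |a_i| d^i], which is submultiplicative and passes to limits. Analytic functions of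
   several variables then enter only through their restrictions to curves in one variable, with
   bounds that do not depend on the curve. Continuation runs along real rays whose open part avoids
   the zeros of discriminant-like polynomials, so no monodromy arises. *)
Declare Scope C_scope.
Delimit Scope C_scope with C.
Bind Scope C_scope with Defs.C.
Infix "+" := Cadd : C_scope.
Infix "*" := Cmul : C_scope.
Infix "-" := Csub : C_scope.
Notation "- x" := (Copp x) : C_scope.
Notation "x ^ n" := (Cpow x n) : C_scope.

Open Scope R_scope.

(** * Field structure and modulus of the complex numbers *)

Definition Cinv (a : C) : C :=
  let d := fst a * fst a + snd a * snd a in (fst a / d, - snd a / d).

Lemma C_ext (a b : C) : fst a = fst b -> snd a = snd b -> a = b.
Proof. by case: a; case: b => ? ? ? ? /= -> ->. Qed.

Ltac C_eq := apply: C_ext; rewrite /= ; ring.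

Lemma sqr_sum_neq0 (a : C) : a <> C0 -> fst a * fst a + snd a * snd a <> 0.
Proof.
move=> ha h; apply: ha; apply: C_ext; simpl; nra.
Qed.

Lemma C1_neq_C0 : C1 <> C0.
Proof. by case; apply: R1_neq_R0. Qed.

Lemma Cinv_l a : a <> C0 -> Cmul (Cinv a) a = C1.
Proof.
by move=> /sqr_sum_neq0 h; apply: C_ext; rewrite /Cinv /=; field.
Qed.

Lemma C_ring_theory : ring_theory C0 C1 Cadd Cmul Csub Copp (@eq C).
Proof. by split=> *; C_eq. Qed.

Lemma C_field_theory :
  field_theory C0 C1 Cadd Cmul Csub Copp (fun a b => Cmul a (Cinv b)) Cinv (@eq C).
Proof.
split; [exact: C_ring_theory | exact: C1_neq_C0 | by [] | exact: Cinv_l].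
Qed.

Add Field C_field : C_field_theory.

Lemma Cmod_ge0 a : 0 <= Cmod a.
Proof. exact: sqrt_pos. Qed.

Lemma Cmod_sqr a : Cmod a * Cmod a = fst a * fst a + snd a * snd a.
Proof. by rewrite /Cmod sqrt_sqrt //; nra. Qed.

Lemma sqr_le_compat x y : 0 <= y -> x * x <= y * y -> x <= y.
Proof. by move=> hy h; nra. Qed.

Lemma sqr_eq_compat x y : 0 <= x -> 0 <= y -> x * x = y * y -> x = y.
Proof. by move=> hx hy h; nra. Qed.

Lemma CmodM a b : Cmod (a * b)%C = Cmod a * Cmod b.
Proof.
apply: sqr_eq_compat; first exact: Cmod_ge0.
  by apply: Rmult_le_pos; exact: Cmod_ge0.
have -> : Cmod a * Cmod b * (Cmod a * Cmod b) = (Cmod a * Cmod a) * (Cmod b * Cmod b) by ring.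
rewrite !Cmod_sqr /=; ring.
Qed.

Lemma Cmod_triangle a b : Cmod (a + b)%C <= Cmod a + Cmod b.
Proof.
apply: sqr_le_compat; first by have := Cmod_ge0 a; have := Cmod_ge0 b; lra.
have ha := Cmod_sqr a; have hb := Cmod_sqr b.
have h : fst a * fst b + snd a * snd b <= Cmod a * Cmod b.
  apply: sqr_le_compat; first by apply: Rmult_le_pos; exact: Cmod_ge0.
  have -> : Cmod a * Cmod b * (Cmod a * Cmod b) = (Cmod a * Cmod a) * (Cmod b * Cmod b) by ring.
  rewrite ha hb.
  have := Rle_0_sqr (fst a * snd b - snd a * fst b); rewrite /Rsqr; lra.
rewrite Cmod_sqr /=; nra.
Qed.

Lemma Cmod0 : Cmod C0 = 0.
Proof. by rewrite /Cmod /= Rmult_0_l Rplus_0_l sqrt_0. Qed.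

Lemma Cmod1 : Cmod C1 = 1.
Proof. by rewrite /Cmod /= Rmult_0_l Rplus_0_r Rmult_1_l sqrt_1. Qed.

Lemma CmodN a : Cmod (- a)%C = Cmod a.
Proof. by rewrite /Cmod /=; f_equal; ring. Qed.

Lemma Cmod_sym a b : Cmod (a - b)%C = Cmod (b - a)%C.
Proof. by rewrite -CmodN; f_equal; ring. Qed.

Lemma Cmod_eq0 a : Cmod a = 0 -> a = C0.
Proof. by move=> h; have := Cmod_sqr a; rewrite h => h'; apply: C_ext => /=; nra. Qed.

Lemma Cmod_gt0 a : a <> C0 -> 0 < Cmod a.
Proof. by move=> h; have [|e] := Cmod_ge0 a => // ; case: h; exact: Cmod_eq0. Qed.

Lemma Cmod_gt0_neq a : 0 < Cmod a -> a <> C0.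
Proof. by move=> h e; move: h; rewrite e Cmod0; lra. Qed.

Lemma CmodR r : Cmod (RtoC r) = Rabs r.
Proof. by rewrite /Cmod /= Rmult_0_l Rplus_0_r -/(Rsqr r) sqrt_Rsqr_abs. Qed.

Lemma Cmod_sub_triangle a b c : Cmod (a - c)%C <= Cmod (a - b)%C + Cmod (b - c)%C.
Proof.
have -> : (a - c = (a - b) + (b - c))%C by ring.
exact: Cmod_triangle.
Qed.

Lemma Cmod_sub_le a b : Cmod (a - b)%C <= Cmod a + Cmod b.
Proof. by rewrite -(CmodN b); exact: Cmod_triangle. Qed.

Lemma Cmod_sub_ge a b : Cmod a - Cmod b <= Cmod (a - b)%C.
Proof.
have := Cmod_triangle (a - b)%C b.
have -> : (a - b + b = a)%C by ring.
lra.
Qed.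

Lemma CmodX a n : Cmod (a ^ n)%C = Cmod a ^ n.
Proof. by elim: n => [|n IH] /=; rewrite ?Cmod1 // CmodM IH. Qed.

Lemma re_le_Cmod a : Rabs (fst a) <= Cmod a.
Proof.
apply: sqr_le_compat; first exact: Cmod_ge0.
by rewrite Cmod_sqr -Rabs_mult Rabs_pos_eq; nra.
Qed.

Lemma im_le_Cmod a : Rabs (snd a) <= Cmod a.
Proof.
apply: sqr_le_compat; first exact: Cmod_ge0.
by rewrite Cmod_sqr -Rabs_mult Rabs_pos_eq; nra.
Qed.

Lemma Cmod_le_re_im a : Cmod a <= Rabs (fst a) + Rabs (snd a).
Proof.
have := Cmod_triangle (fst a, 0) (0, snd a).
have -> : ((fst a, 0) + (0, snd a))%C = a by apply: C_ext => /=; ring.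
have -> : Cmod (fst a, 0) = Rabs (fst a) by exact: (CmodR (fst a)).
have -> : Cmod (0, snd a) = Rabs (snd a) => //.
by rewrite /Cmod /= Rmult_0_l Rplus_0_l -/(Rsqr (snd a)) sqrt_Rsqr_abs.
Qed.

Lemma CmodV a : a <> C0 -> Cmod (Cinv a) = / Cmod a.
Proof.
move=> h; have h0 := Cmod_gt0 h.
apply: (Rmult_eq_reg_r (Cmod a)); last by lra.
by rewrite -CmodM Cinv_l // Cmod1 Rinv_l //; lra.
Qed.

Lemma Cmul_eq0 a b : (a * b)%C = C0 -> a = C0 \/ b = C0.
Proof.
move=> h; case: (classic (a = C0)) => ha; [by left | right].
have -> : b = (Cinv a * (a * b))%C by field.
by rewrite h; ring.
Qed.

Lemma Cpow_neq0 a n : a <> C0 -> (a ^ n)%C <> C0.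
Proof.
move=> ha; elim: n => [|n IH] /=; first exact: C1_neq_C0.
by move=> /Cmul_eq0 [].
Qed.

Lemma CpowD a m n : (a ^ (m + n)%N = a ^ m * a ^ n)%C.
Proof. by elim: m => [|m IH] /=; rewrite ?add0n ?addSn /= ?IH; ring. Qed.

Lemma CpowM a m n : (a ^ (m * n)%N = (a ^ m) ^ n)%C.
Proof. by elim: n => [|n IH]; rewrite ?muln0 // mulnS CpowD IH /=. Qed.

Lemma CpowMl a b n : ((a * b) ^ n = a ^ n * b ^ n)%C.
Proof. by elim: n => [|n IH] /=; rewrite ?IH; ring. Qed.

(** * A nonprincipal ultrafilter on the natural numbers *)

Lemma nonprincipal_ultrafilter : exists U : (nat -> Prop) -> Prop,
  [/\ forall P Q : nat -> Prop, (forall k, P k -> Q k) -> U P -> U Q,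
      forall P Q : nat -> Prop, U P -> U Q -> U (fun k => P k /\ Q k),
      forall P : nat -> Prop, U P \/ U (fun k => ~ P k),
      ~ U (fun _ => False) &
      forall N, U (fun k => le N k)].
Proof.
have [G [GU sub]] := filter.ultraFilterLemma filter.eventually_filter.
exists G; split.
- by move=> P Q PQ; exact: filter.filterS.
- by move=> P Q; exact: filter.filterI.
- by move=> P; exact: filter.in_ultra_setVsetC.
- exact: filter.filter_not_empty.
- by move=> N; apply: sub; exists N => // k /= /leP.
Qed.

(** One ultrafilter is fixed for the whole proof. It replaces every passage to a subsequence,
    because it decides each property of the index and splits finite disjunctions. *)
Definition U : (nat -> Prop) -> Prop :=
  proj1_sig (constructive_indefinite_description _ nonprincipal_ultrafilter).

Lemma U_spec :
  [/\ forall P Q : nat -> Prop, (forall k, P k -> Q k) -> U P -> U Q,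
      forall P Q : nat -> Prop, U P -> U Q -> U (fun k => P k /\ Q k),
      forall P : nat -> Prop, U P \/ U (fun k => ~ P k),
      ~ U (fun _ => False) &
      forall N, U (fun k => le N k)].
Proof. exact: (proj2_sig (constructive_indefinite_description _ nonprincipal_ultrafilter)). Qed.

Lemma Um1 (P Q : nat -> Prop) : U P -> (forall k, P k -> Q k) -> U Q.
Proof. by have [h _ _ _ _] := U_spec => hP PQ; exact: (h _ _ PQ hP). Qed.

Lemma Uand (P Q : nat -> Prop) : U P -> U Q -> U (fun k => P k /\ Q k).
Proof. by have [_ h _ _ _] := U_spec; exact: h. Qed.

Lemma Um2 (P1 P2 Q : nat -> Prop) : U P1 -> U P2 ->
  (forall k, P1 k -> P2 k -> Q k) -> U Q.
Proof. by move=> h1 h2 h; apply: (Um1 (Uand h1 h2)) => k []; exact: h. Qed.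

Lemma Um3 (P1 P2 P3 Q : nat -> Prop) : U P1 -> U P2 -> U P3 ->
  (forall k, P1 k -> P2 k -> P3 k -> Q k) -> U Q.
Proof. by move=> h1 h2 h3 h; apply: (Um2 (Uand h1 h2) h3) => k []; exact: h. Qed.

Lemma Um4 (P1 P2 P3 P4 Q : nat -> Prop) : U P1 -> U P2 -> U P3 -> U P4 ->
  (forall k, P1 k -> P2 k -> P3 k -> P4 k -> Q k) -> U Q.
Proof. by move=> h1 h2 h3 h4 h; apply: (Um3 (Uand h1 h2) h3 h4) => k []; exact: h. Qed.

Lemma Uem (P : nat -> Prop) : U P \/ U (fun k => ~ P k).
Proof. by have [_ _ h _ _] := U_spec; exact: h. Qed.

Lemma Ufalse : ~ U (fun _ => False).
Proof. by have [_ _ _ h _] := U_spec. Qed.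

Lemma Ucofin N : U (fun k => le N k).
Proof. by have [_ _ _ _ h] := U_spec. Qed.

Lemma Uall (P : nat -> Prop) : (forall k, P k) -> U P.
Proof. by move=> h; apply: (Um1 (Ucofin 0)). Qed.

Lemma Uex (P : nat -> Prop) : U P -> exists k, P k.
Proof.
move=> h; apply: NNPP => hn; apply: Ufalse; apply: (Um1 h) => k Pk.
by apply: hn; exists k.
Qed.

Lemma Unot (P : nat -> Prop) : ~ U P -> U (fun k => ~ P k).
Proof. by case: (Uem P). Qed.

Lemma Uor (P Q : nat -> Prop) : U (fun k => P k \/ Q k) -> U P \/ U Q.
Proof.
move=> h; case: (Uem P) => hP; [by left | right].
by apply: (Um2 h hP) => k [].
Qed.

Lemma Uchoice (T : Type) (t0 : T) (P : nat -> T -> Prop) :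
  U (fun k => exists x, P k x) -> exists f : nat -> T, U (fun k => P k (f k)).
Proof.
move=> h.
exists (fun k => epsilon (inhabits t0) (P k)).
by apply: (Um1 h) => k; exact: epsilon_spec.
Qed.

Lemma Ufin_forall n (P : Fin.t n -> nat -> Prop) :
  (forall i, U (P i)) -> U (fun k => forall i, P i k).
Proof.
elim: n P => [|n IH] P h.
  by apply: Uall => k i; exact: (Fin.case0 (fun i => P i k)).
have h1 := IH (fun i => P (Fin.FS i)) (fun i => h _).
apply: (Um2 (h Fin.F1) h1) => k hk1 hk2 i.
exact: (Fin.caseS' i (fun i => P i k)).
Qed.

Lemma Ufin_exists n (P : Fin.t n -> nat -> Prop) :
  U (fun k => exists i, P i k) -> exists i, U (P i).
Proof.
move=> h; apply: NNPP => hn.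
have h1 : U (fun k => forall i, ~ P i k).
  by apply: Ufin_forall => i; apply: Unot => hi; apply: hn; exists i.
by apply: Ufalse; apply: (Um2 h h1) => k [i hi] /(_ i).
Qed.

Definition Rlim (x : nat -> R) (l : R) := forall eps, 0 < eps -> U (fun k => Rabs (x k - l) < eps).
Definition Clim (x : nat -> C) (l : C) :=
  forall eps, 0 < eps -> U (fun k => Cmod (x k - l)%C < eps).

(** The limit is the supremum of the [y] that lie below [x k] for [U]-almost all [k]. *)
Lemma Rlim_ex x M : U (fun k => Rabs (x k) <= M) -> exists l, Rlim x l.
Proof.
move=> hM.
pose E y := U (fun k => y <= x k).
have bE : bound E.
  exists M => y hy; apply: Rnot_lt_le => hlt; apply: Ufalse.
  by apply: (Um2 hM hy) => k; move: (Rle_abs (x k)); lra.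
have nE : exists y, E y.
  exists (- M); apply: (Um1 hM) => k; move: (Rle_abs (- x k)); rewrite Rabs_Ropp; lra.
have [l [ub lub]] := completeness E bE nE.
exists l => eps he.
have h1 : ~ E (l + eps / 2) by move=> /ub; lra.
have h2 : E (l - eps / 2).
  apply: NNPP => hn.
  have : l <= l - eps / 2; last lra.
  apply: lub => y Ey; apply: Rnot_lt_le => hlt; apply: hn.
  by apply: (Um1 Ey) => k; lra.
apply: (Um2 (Unot h1) h2) => k h3 h4.
by apply: Rabs_def1; lra.
Qed.

Lemma Clim_re_im x l : Rlim (fun k => fst (x k)) (fst l) ->
  Rlim (fun k => snd (x k)) (snd l) -> Clim x l.
Proof.
move=> h1 h2 eps he.
apply: (Um2 (h1 (eps/2) ltac:(lra)) (h2 (eps/2) ltac:(lra))) => k h3 h4.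
have := Cmod_le_re_im (x k - l)%C; rewrite /= -/(Rminus _ _) -/(Rminus _ _); lra.
Qed.

Lemma Clim_ex x M : U (fun k => Cmod (x k) <= M) -> exists l, Clim x l.
Proof.
move=> h.
have [a ha] : exists l, Rlim (fun k => fst (x k)) l.
  by apply: (@Rlim_ex _ M); apply: (Um1 h) => k; move: (re_le_Cmod (x k)); lra.
have [b hb] : exists l, Rlim (fun k => snd (x k)) l.
  by apply: (@Rlim_ex _ M); apply: (Um1 h) => k; move: (im_le_Cmod (x k)); lra.
by exists (a, b); apply: Clim_re_im.
Qed.

Lemma Clim_const c : Clim (fun _ => c) c.
Proof.
move=> eps he; apply: Uall => _; have -> : (c - c = C0)%C by ring. by rewrite Cmod0.
Qed.

Lemma Clim_ext x y l : U (fun k => x k = y k) -> Clim x l -> Clim y l.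
Proof. by move=> h hx eps he; apply: (Um2 h (hx eps he)) => k ->. Qed.

Lemma Clim_add x y a b : Clim x a -> Clim y b -> Clim (fun k => x k + y k)%C (a + b)%C.
Proof.
move=> h1 h2 eps he.
apply: (Um2 (h1 (eps/2) ltac:(lra)) (h2 (eps/2) ltac:(lra))) => k h3 h4.
have := Cmod_triangle (x k - a)%C (y k - b)%C.
have -> : (x k - a + (y k - b) = x k + y k - (a + b))%C by ring.
lra.
Qed.

Lemma Clim_bound x a : Clim x a -> U (fun k => Cmod (x k) <= Cmod a + 1).
Proof.
move=> h; apply: (Um1 (h 1 Rlt_0_1)) => k.
by move: (Cmod_sub_ge (x k) a); lra.
Qed.

Lemma Clim_mul x y a b : Clim x a -> Clim y b -> Clim (fun k => x k * y k)%C (a * b)%C.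
Proof.
move=> h1 h2 eps he.
pose M := Cmod a + Cmod b + 2.
have hM : 0 < M by have := Cmod_ge0 a; have := Cmod_ge0 b; rewrite /M; lra.
have hq : 0 < eps / (2 * M) by apply: Rdiv_lt_0_compat; lra.
have hMa : Cmod a + 1 <= M by rewrite /M; have := Cmod_ge0 b; lra.
have hMb : Cmod b <= M by rewrite /M; have := Cmod_ge0 a; lra.
clearbody M; apply: (Um3 (h1 _ hq) (h2 _ hq) (Clim_bound h1)) => k h3 h4 h5.
have -> : (x k * y k - a * b = x k * (y k - b) + (x k - a) * b)%C by ring.
have := Cmod_triangle (x k * (y k - b))%C ((x k - a) * b)%C.
rewrite !CmodM => h.
have h6 : Cmod (x k) * Cmod (y k - b)%C <= M * (eps / (2 * M)).
  apply: Rmult_le_compat; try exact: Cmod_ge0; lra.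
have h7 : Cmod (x k - a)%C * Cmod b < eps / (2 * M) * M.
  apply: (Rle_lt_trans _ (Cmod (x k - a)%C * M)).
    by apply: Rmult_le_compat_l; [exact: Cmod_ge0 | lra].
  by apply: Rmult_lt_compat_r.
have e : M * (eps / (2 * M)) = eps / 2 by field; lra.
lra.
Qed.

Lemma Clim_opp x a : Clim x a -> Clim (fun k => - x k)%C (- a)%C.
Proof.
move=> h eps he; apply: (Um1 (h eps he)) => k.
by rewrite -CmodN; congr (Cmod _ < _); ring.
Qed.

Lemma Clim_sub x y a b : Clim x a -> Clim y b -> Clim (fun k => x k - y k)%C (a - b)%C.
Proof. by move=> h1 h2; apply: Clim_add => //; exact: Clim_opp. Qed.

Lemma Clim_mod_le x a M : Clim x a -> U (fun k => Cmod (x k) <= M) -> Cmod a <= M.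
Proof.
move=> h hM; apply: Rnot_lt_le => hlt; apply: Ufalse.
apply: (Um2 hM (h (Cmod a - M) ltac:(lra))) => k.
by rewrite Cmod_sym; move: (Cmod_sub_ge a (x k)); lra.
Qed.

Lemma Clim_mod_ge x a M : Clim x a -> U (fun k => M <= Cmod (x k)) -> M <= Cmod a.
Proof.
move=> h hM; apply: Rnot_lt_le => hlt; apply: Ufalse.
apply: (Um2 hM (h (M - Cmod a) ltac:(lra))) => k.
by move: (Cmod_sub_ge (x k) a); lra.
Qed.

Lemma Clim_uniq x a b : Clim x a -> Clim x b -> a = b.
Proof.
move=> h1 h2.
have h := Clim_sub h1 h2.
have : Cmod (a - b)%C <= 0.
  apply: (Clim_mod_le h); apply: Uall => k.
  have -> : (x k - x k = C0)%C by ring. by rewrite Cmod0; lra.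
move=> h3; have h4 := Cmod_ge0 (a - b)%C.
have /Cmod_eq0 e : Cmod (a - b)%C = 0 by lra.
have -> : (a = a - b + b)%C by ring. by rewrite e; ring.
Qed.

Lemma Clim0_squeeze x y : U (fun k => Cmod (x k) <= y k) -> Rlim y 0 -> Clim x C0.
Proof.
move=> h hy eps he; apply: (Um2 h (hy eps he)) => k h1 h2.
have -> : (x k - C0 = x k)%C by ring.
by move: (Rle_abs (y k - 0)); lra.
Qed.

Lemma Clim0_mod x : Clim x C0 -> Rlim (fun k => Cmod (x k)) 0.
Proof.
move=> h eps he; apply: (Um1 (h eps he)) => k.
have -> : (x k - C0 = x k)%C by ring.
by rewrite Rminus_0_r Rabs_pos_eq //; exact: Cmod_ge0.
Qed.

Lemma Clim_conv (x : nat -> C) l :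
  (forall eps, 0 < eps -> exists N0, forall N, (N0 <= N)%coq_nat -> Cmod (x N - l)%C < eps) -> Clim x l.
Proof.
move=> h eps he; have [N0 hN] := h eps he.
by apply: (Um1 (Ucofin N0)) => k; exact: hN.
Qed.

Lemma Rlim_geom q M : 0 <= q < 1 -> Rlim (fun n => M * q ^ n) 0.
Proof.
move=> hq eps he.
have [N hN] := pow_lt_1_zero q ltac:(rewrite Rabs_pos_eq; lra) (eps / (Rabs M + 1))
   ltac:(apply: Rdiv_lt_0_compat => //; have := Rabs_pos M; lra).
apply: (Um1 (Ucofin N)) => k hk.
have := hN k hk => h.
have h0 := Rabs_pos M.
rewrite Rminus_0_r Rabs_mult.
apply: (Rle_lt_trans _ ((Rabs M + 1) * Rabs (q ^ k))).
  by apply: Rmult_le_compat_r; [exact: Rabs_pos | lra].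
apply: (Rlt_le_trans _ ((Rabs M + 1) * (eps / (Rabs M + 1)))).
  by apply: Rmult_lt_compat_l => //; lra.
by right; field; lra.
Qed.

Lemma Rlim_inv_nat : Rlim (fun n => / (INR n + 1)) 0.
Proof.
move=> eps he.
have [N [hN hN0]] := archimed_cor1 eps he.
apply: (Um1 (Ucofin N)) => k hk.
have hp : 0 < INR N by apply: lt_0_INR.
have hle : INR N <= INR k by apply: le_INR.
rewrite Rminus_0_r Rabs_pos_eq; last by left; apply: Rinv_0_lt_compat; lra.
apply: (Rle_lt_trans _ (/ INR N)) => //.
by apply: Rinv_le_contravar; lra.
Qed.

(** * Convergent power series *)

Fixpoint psum (a : nat -> C) (N : nat) (t : C) : C :=
  match N with
  | O => C0
  | S N' => (a O + t * psum (fun i => a (S i)) N' t)%C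
  end.

Fixpoint pnorm (d : R) (a : nat -> C) (N : nat) : R :=
  match N with
  | O => 0
  | S N' => Cmod (a O) + d * pnorm d (fun i => a (S i)) N'
  end.

(* [h] is on [|t| < d] the sum of a power series whose coefficients satisfy
   [sum |a_i| d^i <= M]. *)
Definition is_ps (a : nat -> C) (d M : R) (h : C -> C) : Prop :=
  (forall N, pnorm d a N <= M) /\
  forall t, Cmod t < d -> forall N, Cmod (h t - psum a N t)%C <= M * (Cmod t / d) ^ N.

Definition PS (d M : R) (h : C -> C) : Prop := exists a, is_ps a d M h.

Lemma PS_M_ge0 d M h : PS d M h -> 0 <= M.
Proof. by move=> [a [h1 _]]; exact: (h1 O). Qed.

Lemma ratio_ge0 t d : 0 < d -> 0 <= Cmod t / d.
Proof. by move=> hd; apply: Rmult_le_pos; [exact: Cmod_ge0 | left; apply: Rinv_0_lt_compat]. Qed.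

Lemma PS_mono d M M' h : 0 < d -> M <= M' -> PS d M h -> PS d M' h.
Proof.
move=> hd hM [a [h1 h2]]; exists a; split=> [N|t ht N].
  by have := h1 N; lra.
have h3 := h2 t ht N.
have h4 : 0 <= (Cmod t / d) ^ N by apply: pow_le; exact: ratio_ge0.
nra.
Qed.

Lemma PS_ext d M h h' : (forall t, Cmod t < d -> h t = h' t) -> PS d M h -> PS d M h'.
Proof. by move=> e [a [h1 h2]]; exists a; split=> // t ht N; rewrite -e //; exact: h2. Qed.

Lemma PS_bound d M h t : PS d M h -> Cmod t < d -> Cmod (h t) <= M.
Proof.
move=> [a [_ h2]] ht; have := h2 t ht O => /=.
have -> : (h t - C0 = h t)%C by ring.
lra.
Qed.

Lemma psum0 N t : psum (fun _ => C0) N t = C0.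
Proof. by elim: N => [|N IH] //=; rewrite IH; ring. Qed.

Lemma pnorm0 d N : pnorm d (fun _ => C0) N = 0.
Proof. by elim: N => [|N IH] //=; rewrite IH Cmod0; ring. Qed.

Lemma PS_const d c : 0 < d -> PS d (Cmod c) (fun _ => c).
Proof.
move=> hd; exists (fun i => match i with O => c | S _ => C0 end); split=> [[|N]|t ht [|N]] /=.
- exact: Cmod_ge0.
- by rewrite pnorm0; lra.
- have -> : (c - C0 = c)%C by ring. by lra.
- rewrite psum0; have -> : (c - (c + t * C0) = C0)%C by ring.
  rewrite Cmod0; apply: Rmult_le_pos; first exact: Cmod_ge0.
  exact: (pow_le _ (S N) (ratio_ge0 t hd)).
Qed.

Lemma PS_mulX d M h : 0 < d -> PS d M h -> PS d (d * M) (fun t => t * h t)%C.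
Proof.
move=> hd ph; have hM := PS_M_ge0 ph; case: (ph) => a [h1 h2].
exists (fun i => match i with O => C0 | S j => a j end); split=> [[|N]|t ht [|N]].
- by apply: Rmult_le_pos; lra.
- rewrite /= Cmod0 Rplus_0_l.
  by apply: Rmult_le_compat_l; [lra | exact: h1].
- rewrite /=; have -> : (t * h t - C0 = t * h t)%C by ring.
  rewrite CmodM; have := PS_bound ph ht; have := Cmod_ge0 t; have := Cmod_ge0 (h t); nra.
- have -> : (t * h t - psum (fun i => match i with O => C0 | S j => a j end) (S N) t
     = t * (h t - psum a N t))%C.
    change ((t * h t - (C0 + t * psum a N t) = t * (h t - psum a N t))%C); ring.
  rewrite CmodM.
  have -> : d * M * (Cmod t / d) ^ S N = Cmod t * (M * (Cmod t / d) ^ N).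
    by rewrite /=; field; lra.
  by apply: Rmult_le_compat_l; [exact: Cmod_ge0 | exact: h2].
Qed.

Lemma psumD a b N t : psum (fun i => a i + b i)%C N t = (psum a N t + psum b N t)%C.
Proof. by elim: N a b => [|N IH] a b /=; rewrite ?IH; ring. Qed.

Lemma pnormD d a b N : 0 <= d -> pnorm d (fun i => a i + b i)%C N <= pnorm d a N + pnorm d b N.
Proof.
move=> hd; elim: N a b => [|N IH] a b /=; first lra.
have := IH (fun i => a (S i)) (fun i => b (S i)); have := Cmod_triangle (a O) (b O).
nra.
Qed.

Lemma PS_add d M1 M2 h1 h2 : 0 < d -> PS d M1 h1 -> PS d M2 h2 ->
  PS d (M1 + M2) (fun t => h1 t + h2 t)%C.
Proof.
move=> hd [a [a1 a2]] [b [b1 b2]].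
exists (fun i => a i + b i)%C; split=> [N|t ht N].
  have := pnormD a b N (Rlt_le _ _ hd); have := a1 N; have := b1 N; lra.
rewrite psumD.
have -> : (h1 t + h2 t - (psum a N t + psum b N t) = (h1 t - psum a N t) + (h2 t - psum b N t))%C by ring.
have := Cmod_triangle (h1 t - psum a N t)%C (h2 t - psum b N t)%C.
by have := a2 t ht N; have := b2 t ht N; lra.
Qed.

Lemma psumZ c a N t : psum (fun i => c * a i)%C N t = (c * psum a N t)%C.
Proof. by elim: N a => [|N IH] a /=; rewrite ?IH; ring. Qed.

Lemma pnormZ d c a N : pnorm d (fun i => c * a i)%C N = Cmod c * pnorm d a N.
Proof. by elim: N a => [|N IH] a /=; rewrite ?IH ?CmodM; ring. Qed.

Lemma PS_scal d M c h : 0 < d -> PS d M h -> PS d (Cmod c * M) (fun t => c * h t)%C.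
Proof.
move=> hd [a [a1 a2]]; exists (fun i => c * a i)%C; split=> [N|t ht N].
  by rewrite pnormZ; apply: Rmult_le_compat_l; [exact: Cmod_ge0 | exact: a1].
rewrite psumZ; have -> : (c * h t - c * psum a N t = c * (h t - psum a N t))%C by ring.
rewrite CmodM Rmult_assoc.
by apply: Rmult_le_compat_l; [exact: Cmod_ge0 | exact: a2].
Qed.

Lemma PS_opp d M h : 0 < d -> PS d M h -> PS d M (fun t => - h t)%C.
Proof.
move=> hd ph; apply: (@PS_ext _ _ (fun t => (- C1) * h t)%C).
  by move=> t _; ring.
have -> : M = Cmod (- C1)%C * M by rewrite CmodN Cmod1; ring.
exact: PS_scal.
Qed.

Lemma PS_sub d M1 M2 h1 h2 : 0 < d -> PS d M1 h1 -> PS d M2 h2 ->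
  PS d (M1 + M2) (fun t => h1 t - h2 t)%C.
Proof. by move=> hd p1 p2; apply: PS_add => //; exact: PS_opp. Qed.

Lemma PS_id d : 0 < d -> PS d d (fun t => t).
Proof.
move=> hd; apply: (@PS_ext _ _ (fun t => t * C1)%C); first by move=> t _; ring.
by rewrite -{2}(Rmult_1_r d) -Cmod1; apply: PS_mulX => //; exact: PS_const.
Qed.

Lemma psum_coef_lim (a : nat -> nat -> C) (b : nat -> C) N t :
  (forall i, Clim (fun k => a k i) (b i)) -> Clim (fun k => psum (a k) N t) (psum b N t).
Proof.
elim: N a b => [|N IH] a b h /=; first exact: Clim_const.
apply: Clim_add; first exact: h.
apply: Clim_mul; first exact: Clim_const.
exact: (IH (fun k i => a k (S i)) (fun i => b (S i)) (fun i => h (S i))).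
Qed.

Lemma pnorm_coef_lim d (a : nat -> nat -> C) (b : nat -> C) N eps : 0 <= d ->
  (forall i, Clim (fun k => a k i) (b i)) -> 0 < eps ->
  U (fun k => pnorm d b N <= pnorm d (a k) N + eps).
Proof.
move=> hd; elim: N a b eps => [|N IH] a b eps h he /=; first by apply: Uall => k; lra.
have h1 := IH (fun k i => a k (S i)) (fun i => b (S i)) (eps / (2 * (d + 1))) (fun i => h (S i))
  ltac:(apply: Rdiv_lt_0_compat; lra).
apply: (Um2 h1 (h O (eps/2) ltac:(lra))) => k h2 h3.
have h4 : Cmod (b O) <= Cmod (a k O) + eps / 2.
  by rewrite Cmod_sym in h3; move: (Cmod_sub_ge (b O) (a k O)); lra.
have h5 : d * (eps / (2 * (d + 1))) <= eps / 2.
  have -> : eps / 2 = (d + 1) * (eps / (2 * (d + 1))) by field; lra.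
  apply: Rmult_le_compat_r; last lra.
  by left; apply: Rdiv_lt_0_compat; lra.
nra.
Qed.

Lemma pnorm_coef d a M i : 0 < d -> (forall N, pnorm d a N <= M) -> Cmod (a i) * d ^ i <= M.
Proof.
move=> hd; elim: i a M => [|i IH] a M h.
  by have := h 1%N; rewrite /= Rmult_0_r; lra.
have h1 : forall N, pnorm d (fun i => a (S i)) N <= M / d.
  move=> N; have := h (S N) => /= h2; have := Cmod_ge0 (a O) => h3.
  apply: (Rmult_le_reg_l d) => //.
  have -> : d * (M / d) = M by field; lra.
  lra.
have := IH _ _ h1 => h2.
have -> : M = (M / d) * d by field; lra.
rewrite /= -Rmult_assoc (Rmult_comm _ d) Rmult_assoc (Rmult_comm d).
by apply: Rmult_le_compat_r; [lra|].
Qed.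

(** A Montel argument: the bound [|a_i| d^i <= M] makes each coefficient converge along [U], and
    both the norm bound and the tail estimate involve finitely many coefficients for each [N], so
    they pass to the limit. *)
Lemma is_ps_lim d M (a : nat -> nat -> C) (h : nat -> C -> C) (h' : C -> C) : 0 < d ->
  U (fun k => is_ps (a k) d M (h k)) ->
  (forall t, Cmod t < d -> Clim (fun k => h k t) (h' t)) ->
  exists b, (forall i, Clim (fun k => a k i) (b i)) /\ is_ps b d M h'.
Proof.
move=> hd ha hh.
have hb : forall i, exists l, Clim (fun k => a k i) l.
  move=> i; apply: (@Clim_ex _ (M / d ^ i)).
  apply: (Um1 ha) => k [h1 _].
  have hp := pow_lt d i hd.
  apply: (Rmult_le_reg_r (d ^ i)) => //.
  have -> : M / d ^ i * d ^ i = M by field; lra.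
  exact: pnorm_coef.
pose b i := proj1_sig (constructive_indefinite_description _ (hb i)).
have hbl i : Clim (fun k => a k i) (b i).
  exact: proj2_sig (constructive_indefinite_description _ (hb i)).
exists b; split=> //; split=> [N|t ht N].
  apply: Rnot_lt_le => hlt; apply: Ufalse.
  have := @pnorm_coef_lim d a b N ((pnorm d b N - M) / 2) (Rlt_le _ _ hd) hbl ltac:(lra) => h1.
  by apply: (Um2 h1 ha) => k h2 [h3 _]; have := h3 N; lra.
have h1 := Clim_sub (hh t ht) (@psum_coef_lim a b N t hbl).
apply: (Clim_mod_le h1).
by apply: (Um1 ha) => k [_ h2]; exact: h2.
Qed.

Lemma PS_lim d M (h : nat -> C -> C) (h' : C -> C) : 0 < d ->
  U (fun k => PS d M (h k)) ->
  (forall t, Cmod t < d -> Clim (fun k => h k t) (h' t)) -> PS d M h'.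
Proof.
move=> hd ha hh.
have [a ha'] := Uchoice (fun _ => C0) ha.
have [b [_ hb]] := is_ps_lim hd ha' hh.
by exists b.
Qed.

Lemma psum_lim a d M h t : 0 < d -> is_ps a d M h -> Cmod t < d ->
  Clim (fun N => psum a N t) (h t).
Proof.
move=> hd [_ h2] ht eps he.
have hq : 0 <= Cmod t / d < 1.
  split; first exact: ratio_ge0.
  by apply: (Rmult_lt_reg_r d) => //; rewrite /Rdiv Rmult_assoc Rinv_l; lra.
apply: (Um1 (Rlim_geom M hq he)) => k h3.
rewrite Cmod_sym; have := h2 t ht k; move: h3; rewrite Rminus_0_r.
by move: (Rle_abs (M * (Cmod t / d) ^ k)); lra.
Qed.

Lemma PS_psum_mul d M a N h : 0 < d -> PS d M h ->
  PS d (pnorm d a N * M) (fun t => psum a N t * h t)%C.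
Proof.
move=> hd ph; elim: N a => [|N IH] a /=.
  apply: (@PS_ext _ _ (fun _ => C0)); first by move=> t _; ring.
  by rewrite Rmult_0_l -Cmod0; exact: PS_const.
apply: (@PS_ext _ _ (fun t => a O * h t + t * (psum (fun i => a (S i)) N t * h t))%C).
  by move=> t _; ring.
rewrite Rmult_plus_distr_r Rmult_assoc.
apply: PS_add => //; first exact: PS_scal.
by apply: PS_mulX.
Qed.

(** The product is the limit of [psum a N * h2], whose norms are bounded uniformly in [N]. This
    avoids the Cauchy product of coefficients. *)
Lemma PS_mul d M1 M2 h1 h2 : 0 < d -> PS d M1 h1 -> PS d M2 h2 ->
  PS d (M1 * M2) (fun t => h1 t * h2 t)%C.
Proof.
move=> hd [a ha] p2.
apply: (@PS_lim d _ (fun N t => psum a N t * h2 t)%C) => //.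
  apply: Uall => N; apply: (@PS_mono _ (pnorm d a N * M2)) => //.
    by apply: Rmult_le_compat_r; [exact: PS_M_ge0 p2 | case: ha].
  exact: PS_psum_mul.
move=> t ht; apply: Clim_mul; last exact: Clim_const.
exact: (psum_lim hd ha).
Qed.

Lemma PS_pow d M h n : 0 < d -> PS d M h -> PS d (M ^ n) (fun t => h t ^ n)%C.
Proof.
move=> hd ph; elim: n => [|n IH] /=.
  by rewrite -Cmod1; exact: PS_const.
exact: PS_mul.
Qed.

Lemma PS_psum_comp d d' a N k : 0 < d -> 0 < d' -> PS d' d k ->
  PS d' (pnorm d a N) (fun t => psum a N (k t)).
Proof.
move=> hd hd' pk; elim: N a => [|N IH] a /=; first by rewrite -Cmod0; exact: PS_const.
apply: PS_add => //; first exact: PS_const.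
exact: PS_mul.
Qed.

(** As for products, the partial sums of [h] are composed with [k] and [PS_lim] is applied. The norm
    bound [d] on [k] keeps these compositions below [M], and the strict pointwise bound gives their
    convergence. *)
Lemma PS_comp d d' M h k : 0 < d -> 0 < d' -> PS d M h -> PS d' d k ->
  (forall t, Cmod t < d' -> Cmod (k t) < d) -> PS d' M (fun t => h (k t)).
Proof.
move=> hd hd' [a ha] pk hk.
apply: (@PS_lim d' M (fun N t => psum a N (k t))) => //.
  apply: Uall => N; apply: (@PS_mono _ (pnorm d a N)) => //; first by case: ha.
  exact: PS_psum_comp.
by move=> t ht; apply: (psum_lim hd ha); exact: hk.
Qed.

Lemma pow_le_1 x n : 0 <= x <= 1 -> 0 <= x ^ n <= 1.
Proof. by move=> hx; elim: n => [|n IH] /=; nra. Qed.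

Lemma pow_le_base x n : 0 <= x <= 1 -> x ^ S n <= x.
Proof. by move=> hx; have := pow_le_1 n hx => /= ?; nra. Qed.

Lemma PS_comp_pow d M h n : 0 < d <= 1 -> PS d M h -> PS d M (fun t => h (t ^ S n)%C).
Proof.
move=> hd ph; apply: (@PS_comp d d) => //; try lra.
  apply: (@PS_mono _ (d ^ S n)); [lra | apply: pow_le_base; lra | apply: PS_pow; [lra | apply: PS_id; lra]].
move=> t ht; rewrite CmodX.
have := Cmod_ge0 t => h0.
by have := @pow_le_base (Cmod t) n ltac:(lra); lra.
Qed.

Lemma PS_shrink d d' M h : 0 < d' <= d -> PS d M h -> PS d' M h.
Proof.
move=> hd ph; apply: (@PS_comp d d' M h (fun t => t)) => //; try lra.
  by apply: (@PS_mono _ d'); [lra | lra | apply: PS_id; lra].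
by move=> t; lra.
Qed.

Lemma PS_scale_arg d M h c : 0 < d -> c <> C0 -> PS d M h -> PS (d / Cmod c) M (fun t => h (c * t)%C).
Proof.
move=> hd hc ph; have hc0 := Cmod_gt0 hc.
have hq : 0 < d / Cmod c by apply: Rdiv_lt_0_compat.
apply: (@PS_comp d) => //.
  have {2}-> : d = Cmod c * (d / Cmod c) by field; lra.
  apply: PS_scal => //; exact: PS_id.
move=> t ht; rewrite CmodM.
have -> : d = Cmod c * (d / Cmod c) by field; lra.
exact: Rmult_lt_compat_l.
Qed.

Lemma PS_div d M h : 0 < d -> PS d M h -> h C0 = C0 ->
  exists h1, PS d (M / d) h1 /\ forall t, Cmod t < d -> h t = (t * h1 t)%C.
Proof.
move=> hd ph h0; case: (ph) => a ha.
have a0 : a O = C0.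
  have := (proj2 ha) C0 ltac:(rewrite Cmod0; lra) 1%N.
  rewrite h0 Cmod0 /Rdiv Rmult_0_l /= Rmult_0_l Rmult_0_r.
  have -> : (C0 - (a O + C0 * C0) = - a O)%C by ring.
  by rewrite CmodN => h1; apply: Cmod_eq0; have := Cmod_ge0 (a O); lra.
have hN : forall N, pnorm d (fun i => a (S i)) N <= M / d.
  move=> N; have := (proj1 ha) (S N) => /= h2; have := Cmod_ge0 (a O) => h3.
  apply: (Rmult_le_reg_l d) => //.
  have -> : d * (M / d) = M by field; lra.
  lra.
(* [Cinv] is useless at [0], so the quotient is given there its limit [a 1]. *)
exists (fun t => if excluded_middle_informative (t = C0) then a 1%N else (Cinv t * h t)%C).
split; last first.
  move=> t ht; case: excluded_middle_informative => [/= e|/= e]; first by rewrite e h0; ring.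
  by field.
exists (fun i => a (S i)); split=> // t ht N.
case: excluded_middle_informative => [/= e|/= e]; last first.
  have := (proj2 ha) t ht (S N).
  have -> : (h t - psum a (S N) t = t * (Cinv t * h t - psum (fun i => a (S i)) N t))%C.
    by rewrite /= a0; field.
  rewrite CmodM => h1.
  have ht0 := Cmod_gt0 e.
  apply: (Rmult_le_reg_l (Cmod t)) => //.
  have -> : Cmod t * (M / d * (Cmod t / d) ^ N) = M * (Cmod t / d) ^ S N by rewrite /=; field; lra.
  exact: h1.
rewrite e Cmod0 /Rdiv Rmult_0_l; case: N => [|N] /=.
  have := hN 1%N => /=; rewrite Rmult_0_r.
  have -> : (a 1%N - C0 = a 1%N)%C by ring. by rewrite /Rdiv; lra.
have -> : (a 1%N - (a 1%N + C0 * psum (fun i => a (S (S i))) N C0) = C0)%C by ring. by rewrite Cmod0; lra.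
Qed.

Lemma psum_lead a n t : (forall i, lt i n -> a i = C0) -> psum a (S n) t = (t ^ n * a n)%C.
Proof.
elim: n a => [|n IH] a h; first by rewrite /=; ring.
have -> : psum a (S (S n)) t = (a O + t * psum (fun i => a (S i)) (S n) t)%C by [].
rewrite IH; first by rewrite h; [rewrite /=; ring | lia].
by move=> i hi; apply: h; lia.
Qed.

Lemma psum_zero a n t : (forall i, lt i n -> a i = C0) -> psum a n t = C0.
Proof.
elim: n a => [|n IH] a h //=.
by rewrite IH ?h; [ring | lia | move=> i hi; apply: h; lia].
Qed.

(** The first nonzero coefficient would dominate the series near [0], and so would contradict the
    bound along the sequence [t]. *)
Lemma is_ps_coef0 a d M h (t : nat -> C) n B : 0 < d -> is_ps a d M h -> Clim t C0 ->
  U (fun k => t k <> C0) -> U (fun k => Cmod (h (t k)) <= B * Cmod (t k) ^ S n) ->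
  forall i, lt i (S n) -> a i = C0.
Proof.
move=> hd ha ht ht0 hB.
have main : forall i, lt i (S n) -> (forall j, lt j i -> a j = C0) -> a i = C0.
  move=> i hi hj.
  apply: Cmod_eq0; apply: Rle_antisym; last exact: Cmod_ge0.
  apply: Rnot_lt_le => hlt; apply: Ufalse.
  (* [K] absorbs both the assumed bound and the tail of the series. Hence [|a_i| <= K |t|], which is
     false once [|t| < |a_i| / K]. *)
  pose K := Rabs B + M / d ^ S i + 1.
  have hM : 0 <= M by apply: (@PS_M_ge0 d _ h); exists a.
  have hp : 0 < d ^ S i by apply: pow_lt.
  have hMd : 0 <= M / d ^ S i by apply: Rmult_le_pos => //; left; apply: Rinv_0_lt_compat.
  have hK : 0 < K by rewrite /K; have := Rabs_pos B; lra.
  have q : 0 < Rmin (Rmin d 1) (Cmod (a i) / K).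
    by apply: Rmin_glb_lt; [apply: Rmin_glb_lt; lra | apply: Rdiv_lt_0_compat].
  apply: (Um3 (ht _ q) ht0 hB) => k h1 h2 h3.
  have e : (t k - C0 = t k)%C by ring.
  rewrite e in h1.
  have h4 := Rmin_l (Rmin d 1) (Cmod (a i) / K).
  have h5 := Rmin_r (Rmin d 1) (Cmod (a i) / K).
  have h6 := Rmin_l d 1; have h7 := Rmin_r d 1.
  have t0 := Cmod_gt0 h2.
  have := (proj2 ha) (t k) ltac:(lra) (S i).
  rewrite psum_lead // => h8.
  have h9 : Cmod (t k) ^ S n <= Cmod (t k) ^ S i.
    have -> : S n = (S i + (n - i))%coq_nat by lia.
    rewrite pow_add; have := @pow_le_1 (Cmod (t k)) (n - i)%coq_nat ltac:(lra).
    have := pow_lt (Cmod (t k)) (S i) t0.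
    move: (Cmod (t k) ^ S i) (Cmod (t k) ^ (n - i)%coq_nat) => x y hx hy.
    have h9 := Rmult_le_pos x (1 - y) ltac:(lra) ltac:(lra); lra.
  have h10 : Cmod (t k) ^ i * Cmod (a i) <= K * Cmod (t k) ^ S i.
    have := Cmod_sub_ge (t k ^ i * a i)%C (h (t k)).
    rewrite Cmod_sym CmodM CmodX => h11.
    have h12 : B * Cmod (t k) ^ S n <= Rabs B * Cmod (t k) ^ S i.
      have h13 := Rle_abs B; have h14 := pow_lt (Cmod (t k)) (S n) t0; have := Rabs_pos B; nra.
    have h15 : M * (Cmod (t k) / d) ^ S i = M / d ^ S i * Cmod (t k) ^ S i.
      by rewrite /Rdiv Rpow_mult_distr pow_inv; ring.
    have h16 := pow_lt (Cmod (t k)) (S i) t0.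
    rewrite /K; lra.
  have h11 : Cmod (a i) <= K * Cmod (t k).
    have h12 := pow_lt (Cmod (t k)) i t0.
    apply: (Rmult_le_reg_l (Cmod (t k) ^ i)) => //.
    by move: h10 => /=; lra.
  have h12 : K * Cmod (t k) < Cmod (a i).
    have -> : Cmod (a i) = K * (Cmod (a i) / K) by field; lra.
    by apply: Rmult_lt_compat_l; lra.
  lra.
move=> i; elim/(well_founded_induction lt_wf): i => i IH hi.
by apply: main => // j hj; apply: IH => //; lia.
Qed.

Lemma is_ps_coef0_zero a d M h : 0 < d -> is_ps a d M h -> (forall i, a i = C0) ->
  forall t, Cmod t < d -> h t = C0.
Proof.
move=> hd ha a0 t ht.
apply: (Clim_uniq (psum_lim hd ha ht)).
apply: Clim_ext (Clim_const C0).
by apply: Uall => k; rewrite psum_zero.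
Qed.

(** Apply [is_ps_coef0] at every order with [B = 0]. *)
Lemma ps_identity d M h (t : nat -> C) : 0 < d -> PS d M h -> Clim t C0 ->
  U (fun k => t k <> C0) -> U (fun k => h (t k) = C0) -> forall s, Cmod s < d -> h s = C0.
Proof.
move=> hd [a ha] ht ht0 hz.
apply: (is_ps_coef0_zero hd ha) => i.
apply: (@is_ps_coef0 a d M h t i 0 hd ha ht ht0); last by lia.
by apply: (Um1 hz) => k ->; rewrite Cmod0; lra.
Qed.

Lemma is_ps_coef0_O a d M h n : 0 < d -> is_ps a d M h -> (forall i, lt i n -> a i = C0) ->
  forall t, Cmod t < d -> Cmod (h t) <= M / d ^ n * Cmod t ^ n.
Proof.
move=> hd ha a0 t ht; have := (proj2 ha) t ht n.
rewrite psum_zero //; have -> : (h t - C0 = h t)%C by ring.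
by rewrite /Rdiv Rpow_mult_distr pow_inv; lra.
Qed.

Lemma PS_lim0 d M h (t : nat -> C) : 0 < d -> PS d M h -> Clim t C0 ->
  Clim (fun k => h (t k)) (h C0).
Proof.
move=> hd [a ha] ht.
have e : h C0 = a O.
  have := (proj2 ha) C0 ltac:(rewrite Cmod0; lra) 1%N.
  rewrite Cmod0 /Rdiv Rmult_0_l /= Rmult_0_l Rmult_0_r.
  have -> : (h C0 - (a O + C0 * C0) = h C0 - a O)%C by ring.
  move=> h1; have /Cmod_eq0 h2 : Cmod (h C0 - a O)%C = 0 by have := Cmod_ge0 (h C0 - a O)%C; lra.
  have -> : (h C0 = (h C0 - a O) + a O)%C by ring. by rewrite h2; ring.
move=> eps he.
have hM : 0 <= M by apply: (@PS_M_ge0 d _ h); exists a.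
have q : 0 < Rmin d (eps * d / (M + 1)).
  apply: Rmin_glb_lt => //; apply: Rdiv_lt_0_compat; nra.
apply: (Um1 (ht _ q)) => k.
have -> : (t k - C0 = t k)%C by ring.
move=> h1; have h2 := Rmin_l d (eps * d / (M + 1)); have h3 := Rmin_r d (eps * d / (M + 1)).
have := (proj2 ha) (t k) ltac:(lra) 1%N.
rewrite /=; have -> : (a O + t k * C0 = a O)%C by ring.
rewrite e Rmult_1_r => h4.
have h5 : Cmod (t k) * (M + 1) < eps * d.
  have -> : eps * d = eps * d / (M + 1) * (M + 1) by field; lra.
  by apply: Rmult_lt_compat_r; lra.
apply: (Rle_lt_trans _ _ _ h4).
apply: (Rmult_lt_reg_r d) => //.
have -> : M * (Cmod (t k) / d) * d = M * Cmod (t k) by field; lra.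
have := Cmod_ge0 (t k); nra.
Qed.

(** * Analytic functions along power series *)

Lemma fin_min n (P : Fin.t n -> R -> Prop) :
  (forall i d d', 0 < d' <= d -> P i d -> P i d') ->
  (forall i, exists d, 0 < d /\ P i d) -> exists d, 0 < d /\ forall i, P i d.
Proof.
elim: n P => [|n IH] P hmon h.
  by exists 1; split; [lra | move=> i; exact: (Fin.case0 (fun i => P i 1))].
have [d1 [h1 h1']] := h Fin.F1.
have [d2 [h2 h2']] := IH (fun i => P (Fin.FS i)) (fun i => hmon _) (fun i => h _).
have h3 := Rmin_l d1 d2; have h4 := Rmin_r d1 d2.
have h5 : 0 < Rmin d1 d2 by apply: Rmin_glb_lt.
exists (Rmin d1 d2); split=> // i.
apply: (Fin.caseS' i (fun i => P i (Rmin d1 d2))).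
  by apply: hmon h1'; lra.
by move=> j; apply: hmon (h2' j); lra.
Qed.

Lemma fin_max n (P : Fin.t n -> R -> Prop) :
  (forall i d d', d <= d' -> P i d -> P i d') ->
  (forall i, exists d, P i d) -> exists d, 0 < d /\ forall i, P i d.
Proof.
elim: n P => [|n IH] P hmon h.
  by exists 1; split; [lra | move=> i; exact: (Fin.case0 (fun i => P i 1))].
have [d1 h1'] := h Fin.F1.
have [d2 [h2 h2']] := IH (fun i => P (Fin.FS i)) (fun i => hmon _) (fun i => h _).
have h3 := Rmax_l d1 d2; have h4 := Rmax_r d1 d2.
exists (Rmax d1 d2); split; first lra; move=> i.
apply: (Fin.caseS' i (fun i => P i (Rmax d1 d2))).
  by apply: hmon h1'; lra.
by move=> j; apply: hmon (h2' j); lra.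
Qed.

Lemma fin_choice n (T : Type) (P : Fin.t n -> T -> Prop) :
  (forall i, exists x, P i x) -> exists f, forall i, P i (f i).
Proof.
move=> h; exists (fun i => proj1_sig (constructive_indefinite_description _ (h i))) => i.
exact: proj2_sig (constructive_indefinite_description _ (h i)).
Qed.

Lemma PS_natsum d N (F : nat -> C -> C) (W : nat -> R) : 0 < d ->
  (forall k, PS d (W k) (F k)) ->
  PS d (natsum Rplus 0 N W) (fun t => natsum Cadd C0 N (fun k => F k t)).
Proof. by move=> hd h; elim: N => [|N IH] /=; [exact: h | apply: PS_add]. Qed.

Lemma PS_boxsum d N n (F : (Fin.t n -> nat) -> C -> C) (W : (Fin.t n -> nat) -> R) : 0 < d ->
  (forall al, PS d (W al) (F al)) ->
  PS d (boxsum Rplus 0 N n W) (fun t => boxsum Cadd C0 N n (fun al => F al t)).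
Proof.
move=> hd; elim: n F W => [|n IH] F W h /=; first exact: h.
apply: (@PS_natsum d N (fun k t => boxsum Cadd C0 N n (fun b => F (fcons k b) t))) => // k.
exact: (IH (fun b => F (fcons k b)) (fun b => W (fcons k b))).
Qed.

Lemma PS_prod d n (F : Fin.t n -> C -> C) (W : Fin.t n -> R) : 0 < d ->
  (forall i, PS d (W i) (F i)) ->
  PS d (ffold Rmult 1 n W) (fun t => ffold Cmul C1 n (fun i => F i t)).
Proof.
move=> hd; elim: n F W => [|n IH] F W h /=; first by rewrite -Cmod1; exact: PS_const.
apply: PS_mul => //.
exact: (IH (fun i => F (Fin.FS i)) (fun i => W (Fin.FS i)) (fun i => h _)).
Qed.

Lemma Cmod_prod n (F : Fin.t n -> C) :
  Cmod (ffold Cmul C1 n F) = ffold Rmult 1 n (fun i => Cmod (F i)).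
Proof. by elim: n F => [|n IH] F /=; rewrite ?Cmod1 // CmodM IH. Qed.

Lemma ffold_ext (A : Type) (op : A -> A -> A) e n (f h : Fin.t n -> A) :
  (forall i, f i = h i) -> ffold op e n f = ffold op e n h.
Proof. by move=> E; congr ffold; apply: functional_extensionality. Qed.

(** Absolute convergence at the single point [z], all of whose coordinates are at distance [r / 2]
    from those of [p], bounds the norm of every partial sum along any curve with coordinates of norm
    at most [r / 2]. So [M] depends neither on [u] nor on [d]. *)
Lemma analytic_at_comp g (f : Cg g -> C) (p : Cg g) : analytic_at f p ->
  exists eta M, 0 < eta /\ forall d (u : C -> Cg g), 0 < d ->
    (forall i, PS d eta (fun t => u t i - p i)%C) -> PS d M (fun t => f (u t)).
Proof.
move=> [r [hr [c hc]]].
have he : 0 < r / 2 by lra.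
pose z : Cg g := fun i => (p i + RtoC (r / 2))%C.
have ez i : (z i - p i = RtoC (r / 2))%C by rewrite /z; ring.
have mz : polydisc p r z.
  by move=> i; rewrite ez CmodR Rabs_pos_eq; lra.
have [[M hM] _] := hc z mz.
exists (r / 2), M; split=> // d u hd hu.
apply: (@PS_lim d M (fun N t => boxsum Cadd C0 N g (fun al => (c al * mono p (u t) al)%C))) => //.
  apply: Uall => N; apply: (@PS_mono _ _ _ _ hd (hM N)).
  apply: (@PS_boxsum d N g (fun al t => c al * mono p (u t) al)%C) => // al.
  apply: PS_scal => //.
  rewrite /mono Cmod_prod.
  apply: (@PS_prod d g (fun i t => (u t i - p i) ^ al i)%C) => // i.
  rewrite CmodX ez CmodR Rabs_pos_eq; last lra.
  exact: PS_pow.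
move=> t ht; apply: Clim_conv.
have hz : polydisc p r (u t).
  by move=> i; have := PS_bound (hu i) ht; lra.
by have [_] := hc _ hz.
Qed.

Lemma analytic_at_lipschitz g (f : Cg g -> C) (p : Cg g) : analytic_at f p ->
  exists eta M, 0 < eta /\ forall e z, 0 < e < 1 ->
    (forall i, Cmod (z i - p i)%C <= eta * e) -> Cmod (f z - f p)%C <= M * e.
Proof.
move=> /analytic_at_comp [eta [M [heta H]]].
exists eta, (M + M); split=> // e z he hz.
(* The complex line through [p] and [z], scaled so that [z] is reached at the parameter [e] and that
   each coordinate has norm at most [eta] on the unit disc. *)
pose u (t : C) : Cg g := fun i => (p i + t * (RtoC (/ e) * (z i - p i)))%C.
have hie : 0 < / e by apply: Rinv_0_lt_compat; lra.
have [a ha] : PS 1 M (fun t => f (u t)).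
  apply: H; first lra.
  move=> i; apply: (@PS_ext _ _ (fun t => t * (RtoC (/ e) * (z i - p i)))%C).
    by move=> t _; rewrite /u; ring.
  have -> : eta = 1 * eta by ring.
  apply: PS_mulX; first lra.
  apply: (@PS_mono _ (Cmod (RtoC (/ e) * (z i - p i))%C)); first lra; last by apply: PS_const; lra.
  rewrite CmodM CmodR Rabs_pos_eq; last lra.
  apply: (Rmult_le_reg_l e); first lra.
  by rewrite -Rmult_assoc Rinv_r; have := hz i; lra.
have e1 : u (RtoC e) = z.
  apply: functional_extensionality => i; rewrite /u.
  have -> : (p i + RtoC e * (RtoC (/ e) * (z i - p i)) = p i + (RtoC e * RtoC (/ e)) * (z i - p i))%C by ring.
  have -> : (RtoC e * RtoC (/ e))%C = C1 by apply: C_ext => /=; field; lra.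
  by ring.
have e0 : u C0 = p by apply: functional_extensionality => i; rewrite /u; ring.
have h1 := (proj2 ha) (RtoC e) ltac:(rewrite CmodR Rabs_pos_eq; lra) 1%N.
have h2 := (proj2 ha) C0 ltac:(rewrite Cmod0; lra) 1%N.
move: h1 h2; rewrite e1 e0 CmodR Cmod0 /= Rabs_pos_eq; last lra.
have -> : (a O + RtoC e * C0 = a O)%C by ring.
have -> : (a O + C0 * C0 = a O)%C by ring.
move=> h1 h2; have := Cmod_sub_triangle (f z) (a O) (f p).
rewrite (Cmod_sym (a O)).
have hM : 0 <= M by apply: (@PS_M_ge0 1 _ (fun t => f (u t))); exists a.
have e2 : M * (e / 1 * 1) = M * e by field.
have e3 : M * (0 / 1 * 1) = 0 by field.
nra.
Qed.

Definition Vlim g (z : nat -> Cg g) (l : Cg g) := forall i, Clim (fun k => z k i) (l i).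

Lemma Vlim_near g (z : nat -> Cg g) l e : Vlim z l -> 0 < e ->
  U (fun k => forall i, Cmod (z k i - l i)%C < e).
Proof. by move=> h he; apply: Ufin_forall => i; exact: h. Qed.

Lemma Vlim_const g (z : Cg g) : Vlim (fun _ => z) z.
Proof. by move=> i; exact: Clim_const. Qed.

Lemma Vlim_add g (x y : nat -> Cg g) a b : Vlim x a -> Vlim y b ->
  Vlim (fun k => vadd (x k) (y k)) (vadd a b).
Proof. by move=> h1 h2 i; apply: Clim_add. Qed.

Lemma Vlim_ext g (x y : nat -> Cg g) a : U (fun k => x k = y k) -> Vlim x a -> Vlim y a.
Proof. by move=> h hx i; apply: Clim_ext (hx i); apply: (Um1 h) => k ->. Qed.

Lemma Vlim_ex g (z : nat -> Cg g) M :
  U (fun k => forall i, Cmod (z k i) <= M) -> exists l, Vlim z l.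
Proof.
move=> h.
have [l hl] : exists l : Fin.t g -> C, forall i, Clim (fun k => z k i) (l i).
  apply: (@fin_choice g C (fun i l => Clim (fun k => z k i) l)) => i.
  by apply: (@Clim_ex _ M); apply: (Um1 h).
by exists l.
Qed.

Lemma analytic_at_lim g (f : Cg g -> C) p z : analytic_at f p -> Vlim z p ->
  Clim (fun k => f (z k)) (f p).
Proof.
move=> /analytic_at_lipschitz [eta [M [heta H]]] hz eps heps.
have hM0 := Rabs_pos M.
pose e := Rmin (1 / 2) (eps / (2 * (Rabs M + 1))).
have he : 0 < e by apply: Rmin_glb_lt; [lra | apply: Rdiv_lt_0_compat; lra].
have he1 : e <= 1 / 2 by apply: Rmin_l.
have he2 : e <= eps / (2 * (Rabs M + 1)) by apply: Rmin_r.
clearbody e.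
apply: (Um1 (Vlim_near hz (Rmult_lt_0_compat _ _ heta he))) => k hk.
have h1 := H e (z k) ltac:(lra) (fun i => Rlt_le _ _ (hk i)).
have h2 := Rle_abs M.
have h3 : (Rabs M + 1) * (eps / (2 * (Rabs M + 1))) = eps / 2 by field; lra.
nra.
Qed.

Lemma analytic_set_closed g (Z : Cg g -> Prop) z p :
  analytic_set Z -> Vlim z p -> U (fun k => Z (z k)) -> Z p.
Proof.
move=> han hz hZ.
have [V [oV [Vp [k [f [fa fz]]]]]] := han p.
apply/(fz p Vp) => j.
have [r [hr hV]] := oV p Vp.
have h1 : Clim (fun n => f j (z n)) C0.
  apply: Clim_ext (Clim_const C0).
  apply: (Um2 hZ (Vlim_near hz hr)) => n h2 h3.
  by have := (fz (z n) (hV _ h3)) => [[h4 _]]; rewrite h4.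
exact: Clim_uniq (analytic_at_lim (fa j p Vp) hz) h1.
Qed.

Lemma analytic_set_chart g (Z : Cg g -> Prop) : analytic_set Z -> forall p, exists eta M k
  (f : Fin.t k -> Cg g -> C),
  [/\ 0 < eta,
      (forall z, (forall i, Cmod (z i - p i)%C <= eta) -> (Z z <-> forall j, f j z = C0)) &
      forall j d (u : C -> Cg g), 0 < d -> (forall i, PS d eta (fun t => u t i - p i)%C) ->
        PS d M (fun t => f j (u t))].
Proof.
move=> han p; have [V [oV [Vp [k [f [fa fz]]]]]] := han p.
have [r [hr hV]] := oV p Vp.
have h1 : forall j, exists eta M, 0 < eta /\ forall d (u : C -> Cg g), 0 < d ->
    (forall i, PS d eta (fun t => u t i - p i)%C) -> PS d M (fun t => f j (u t)).
  by move=> j; exact: analytic_at_comp (fa j p Vp).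
have [eta [heta h2]] : exists eta, 0 < eta /\ forall j, exists M, forall d (u : C -> Cg g), 0 < d ->
    (forall i, PS d eta (fun t => u t i - p i)%C) -> PS d M (fun t => f j (u t)).
  apply: fin_min; last by move=> j; have [e [M [h2 h3]]] := h1 j; exists e; split=> //; exists M.
  move=> j e e' he [M hM]; exists M => d u hd hu; apply: hM => // i.
  by apply: PS_mono (hu i); lra.
have [M [_ h3]] : exists M, 0 < M /\ forall j, forall d (u : C -> Cg g), 0 < d ->
    (forall i, PS d eta (fun t => u t i - p i)%C) -> PS d M (fun t => f j (u t)).
  apply: fin_max; last exact: h2.
  by move=> j M M' hM h3 d u hd hu; apply: (PS_mono hd hM); exact: h3.
have q : 0 < Rmin eta (r / 2) by apply: Rmin_glb_lt; lra.
have q1 := Rmin_l eta (r / 2); have q2 := Rmin_r eta (r / 2).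
exists (Rmin eta (r / 2)), M, k, f; split=> //.
  by move=> z hz; apply: fz; apply: hV => i; have := hz i; lra.
move=> j d u hd hu; apply: h3 => // i.
by apply: PS_mono (hu i); lra.
Qed.

Lemma PS_small d M h eta : 0 < d -> 0 < eta -> PS d M h ->
  exists d', 0 < d' <= d /\ forall d'', 0 < d'' <= d' -> PS d'' eta (fun t => h t - h C0)%C.
Proof.
move=> hd heta ph.
have ph' : PS d (M + Cmod (h C0)) (fun t => h t - h C0)%C.
  by apply: PS_sub => //; exact: PS_const.
have [h1 [ph1 e1]] := PS_div hd ph' ltac:(cbv beta; ring).
have hM := PS_M_ge0 ph1.
pose M1 := (M + Cmod (h C0)) / d.
rewrite -/M1 in hM ph1; clearbody M1.
have q : 0 < eta / (M1 + 1) by apply: Rdiv_lt_0_compat; lra.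
exists (Rmin d (eta / (M1 + 1))); split.
  by split; [apply: Rmin_glb_lt | apply: Rmin_l].
have q1 := Rmin_l d (eta / (M1 + 1)); have q2 := Rmin_r d (eta / (M1 + 1)).
move=> d'' hd''.
apply: (@PS_ext _ _ (fun t => t * h1 t)%C).
  by move=> t ht; rewrite e1 //; lra.
apply: (@PS_mono _ (d'' * M1)); first lra; last first.
  by apply: PS_mulX; [lra | apply: (@PS_shrink d) => //; lra].
have : (M1 + 1) * (eta / (M1 + 1)) = eta by field; lra.
nra.
Qed.

Definition PSV g (d : R) (u : C -> Cg g) := forall i, exists M, PS d M (fun t => u t i).

Lemma PSV_small g d (u : C -> Cg g) eta : 0 < d -> 0 < eta -> PSV d u ->
  exists d', 0 < d' <= d /\ forall i, PS d' eta (fun t => u t i - u C0 i)%C.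
Proof.
move=> hd heta hu.
have [d' [h1 h2]] : exists d', 0 < d' /\ forall i, d' <= d /\ forall d'', 0 < d'' <= d' ->
    PS d'' eta (fun t => u t i - u C0 i)%C.
  apply: fin_min; last first.
    move=> i; have [M hM] := hu i.
    have [d' [h1 h2]] := PS_small hd heta hM.
    by exists d'; split; [lra | split; [lra|]].
  move=> i e e' he [h1 h2]; split; first lra.
  by move=> d'' hd''; apply: h2; lra.
have q : 0 < Rmin d d' by apply: Rmin_glb_lt.
have q1 := Rmin_l d d'; have q2 := Rmin_r d d'.
exists (Rmin d d'); split; first lra.
by move=> i; have [_ h3] := h2 i; apply: h3; lra.
Qed.

(** The identity theorem is applied to the local equations along [u]. The radius [d'] comes from a
    chart at [u C0] and is chosen before the sequence [t], so it serves for all sequences. *)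
Lemma analytic_set_germ g (Z : Cg g -> Prop) d (u : C -> Cg g) : analytic_set Z -> 0 < d ->
  PSV d u -> exists d', 0 < d' <= d /\ forall t : nat -> C, Clim t C0 -> U (fun k => t k <> C0) ->
    U (fun k => Z (u (t k))) -> forall s, Cmod s < d' -> Z (u s).
Proof.
move=> han hd hu.
have [eta [M [k [f [heta fz fc]]]]] := analytic_set_chart han (u C0).
have [d' [hd' h1]] := PSV_small hd heta hu.
exists d'; split=> // t ht ht0 hZ s hs.
apply/fz; first by move=> i; exact: (PS_bound (h1 i)).
move=> j.
have ph := fc j d' u (proj1 hd') h1.
apply: (@ps_identity d' M (fun s => f j (u s)) t) => //; first lra.
apply: (Um2 hZ (ht d' ltac:(lra))) => n h2 h3.
apply: (proj1 (fz (u (t n)) _) h2) => i.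
apply: (PS_bound (h1 i)).
by move: h3; have -> : (t n - C0 = t n)%C by ring.
Qed.

Lemma Clim_inv_nat c : Clim (fun k => c * RtoC (/ (INR k + 1)))%C C0.
Proof.
apply: (@Clim0_squeeze _ (fun k => Cmod c * / (INR k + 1))).
  apply: Uall => k; rewrite CmodM CmodR Rabs_pos_eq; first lra.
  by left; apply: Rinv_0_lt_compat; have := pos_INR k; lra.
move=> eps he.
have hc := Cmod_ge0 c.
have q : 0 < eps / (Cmod c + 1) by apply: Rdiv_lt_0_compat; lra.
apply: (Um1 (Rlim_inv_nat q)) => k.
have h0 : 0 < / (INR k + 1) by apply: Rinv_0_lt_compat; have := pos_INR k; lra.
rewrite !Rminus_0_r Rabs_mult !(Rabs_pos_eq _ hc) => h.
have h1 := Rabs_pos (/ (INR k + 1)).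
have : (Cmod c + 1) * (eps / (Cmod c + 1)) = eps by field; lra.
nra.
Qed.

Lemma RtoC_neq0 r : r <> 0 -> RtoC r <> C0.
Proof. by move=> h [] e; exact: h. Qed.

Lemma inv_nat_gt0 k : 0 < / (INR k + 1).
Proof. by apply: Rinv_0_lt_compat; have := pos_INR k; lra. Qed.

(** * Real induction and continuation of arcs inside an analytic set *)

Lemma real_induction (P : R -> Prop) (a : R) : P a ->
  (forall x, a <= x -> (forall y, a <= y <= x -> P y) ->
     exists e, 0 < e /\ forall y, x <= y <= x + e -> P y) ->
  (forall x, a < x -> (forall y, a <= y < x -> P y) -> P x) ->
  forall x, a <= x -> P x.
Proof.
move=> Pa Pstep Plim x0 hx0; apply: NNPP => nP.
pose E y := a <= y <= x0 /\ forall z, a <= z <= y -> P z.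
have Ea : E a.
  by split; [lra | move=> z hz; have -> : z = a by lra].
have [s [ub lub]] := completeness E ltac:(exists x0 => y [hy _]; lra) (ex_intro _ a Ea).
have has : a <= s by apply: ub.
have below : forall y, a <= y < s -> P y.
  move=> y hy; apply: NNPP => nPy.
  have : s <= y; last lra.
  apply: lub => z [hz1 hz2]; apply: Rnot_lt_le => hlt.
  by apply: nPy; apply: hz2; lra.
have Ps : P s.
  case: (Req_dec s a) => [->//|hne].
  by apply: Plim => //; lra.
have hsx : s <= x0 by apply: lub => z [hz _]; lra.
have hs2 : forall y, a <= y <= s -> P y.
  move=> y hy; case: (Req_dec y s) => [->//|hne].
  by apply: below; lra.
have [e [he h]] := Pstep s has hs2.
case: (Rle_dec x0 (s + e)) => hle.
  by apply: nP; apply: h; lra.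
have : s + e <= s; last lra.
apply: ub; split; first lra.
move=> z hz; case: (Rle_dec z s) => hzs; first by apply: hs2; lra.
by apply: h; lra.
Qed.

(** Real analyticity is expressed by a series in a complex parameter, to which [analytic_set_germ]
    applies with a real sequence of parameters. *)
Definition arc_at g (c : R -> Cg g) (x : R) := exists d (u : C -> Cg g),
  [/\ 0 < d, PSV d u & forall y, Rabs (y - x) < d -> c y = u (RtoC (y - x))].

(** By the identity theorem, an arc that lies in [Z] on one side of a parameter lies in [Z] on a
    full neighbourhood of it. Real induction then pushes the end of the interval to [b]. *)
Lemma arc_right g (Z : Cg g -> Prop) (c : R -> Cg g) (a0 a b : R) : analytic_set Z ->
  (forall x, a0 < x < b -> arc_at c x) -> a0 < a < b ->
  (exists e, 0 < e /\ forall x, a <= x <= a + e -> Z (c x)) ->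
  forall x, a <= x < b -> Z (c x).
Proof.
move=> han harc hab [e0 [he0 h0]] x hx.
suff : x < b -> Z (c x) by apply; lra.
move: x {hx}(proj1 hx).
have germ : forall x, a <= x < b -> exists d, 0 < d /\
    ((exists e, 0 < e /\ ((forall y, x - e < y < x -> Z (c y)) \/ (forall y, x < y < x + e -> Z (c y)))) ->
    forall y, Rabs (y - x) < d -> Z (c y)).
  move=> x hx; have [d [u [hd hu hc]]] := harc x ltac:(lra).
  have [d' [hd' hg]] := analytic_set_germ han hd hu.
  exists d'; split; first lra.
  move=> [e [he hside]] y hy; rewrite hc; last lra.
  (* [sg] is the side of [x] on which the arc is known to lie in [Z]; the test sequence approaches
     [x] from there. *)
  have [sg [hsg hZ]] : exists sg : R, Rabs sg = 1 /\ forall r, 0 < r < e -> Z (c (x + sg * r)).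
    case: hside => h; [exists (-1) | exists 1]; split.
    - by rewrite Rabs_Ropp Rabs_R1.
    - by move=> r hr; apply: h; lra.
    - by rewrite Rabs_R1.
    - by move=> r hr; apply: h; lra.
  apply: (hg (fun k => RtoC sg * RtoC (/ (INR k + 1)))%C).
  - exact: Clim_inv_nat.
  - apply: Uall => k; apply: Cmod_gt0_neq; rewrite CmodM !CmodR hsg.
    have := inv_nat_gt0 k => h; rewrite Rabs_pos_eq; lra.
  - have q : 0 < Rmin e d by apply: Rmin_glb_lt.
    have q1 := Rmin_l e d; have q2 := Rmin_r e d.
    apply: (Um1 (Rlim_inv_nat q)) => k; have h := inv_nat_gt0 k.
    rewrite Rminus_0_r Rabs_pos_eq; last lra.
    move=> hk.
    have e1 : (RtoC sg * RtoC (/ (INR k + 1)) = RtoC (x + sg * / (INR k + 1) - x))%C.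
      by apply: C_ext => /=; ring.
    rewrite e1 -hc; first by apply: hZ; lra.
    have -> : x + sg * / (INR k + 1) - x = sg * / (INR k + 1) by ring.
    rewrite Rabs_mult hsg Rabs_pos_eq; lra.
  - by rewrite CmodR.
apply: (@real_induction (fun x => x < b -> Z (c x))).
- by move=> _; apply: h0; lra.
- move=> x hx h1.
  case: (Rlt_dec x b) => hxb; last by exists 1; split; [lra | move=> y hy hyb; lra].
  have [d [hd h2]] := germ x ltac:(lra).
  exists (d / 2); split; first lra.
  move=> y hy hyb; apply: h2; last by rewrite Rabs_pos_eq; lra.
  case: (Req_dec x a) => [e|hne].
    by exists e0; split=> //; right=> z hz; apply: h0; lra.
  exists (x - a); split; first lra.
  by left=> z hz; apply: h1; lra.
- move=> x hx h1 hxb.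
  have [d [hd h2]] := germ x ltac:(lra).
  apply: h2; last by rewrite Rminus_diag // Rabs_R0.
  exists (x - a); split; first lra.
  by left=> z hz; apply: h1; lra.
Qed.

Lemma arc_at_opp g (c : R -> Cg g) x : arc_at c x -> arc_at (fun y => c (- y)) (- x).
Proof.
move=> [d [u [hd hu hc]]]; exists d, (fun t => u (- t)%C); split=> //.
  move=> i; have [M hM] := hu i; exists M.
  have -> : d = d / Cmod (- C1)%C by rewrite CmodN Cmod1; field.
  apply: (@PS_ext _ _ (fun t => u ((- C1) * t)%C i)).
    by move=> t _; congr (u _ i); ring.
  apply: (@PS_scale_arg d M (fun t => u t i) (- C1)%C) => //.
  by apply: Cmod_gt0_neq; rewrite CmodN Cmod1; lra.
move=> y hy; rewrite hc.
  by congr u; apply: C_ext => /=; ring.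
by rewrite -Rabs_Ropp; have -> : - (- y - x) = y - - x by ring.
Qed.

Lemma arc_left g (Z : Cg g -> Prop) (c : R -> Cg g) (b a b0 : R) : analytic_set Z ->
  (forall x, b < x < b0 -> arc_at c x) -> b < a < b0 ->
  (exists e, 0 < e /\ forall x, a - e <= x <= a -> Z (c x)) ->
  forall x, b < x <= a -> Z (c x).
Proof.
move=> han harc hab [e [he h0]] x hx.
rewrite -(Ropp_involutive x).
apply: (@arc_right g Z (fun y => c (- y)) (- b0) (- a) (- b)) => //.
- move=> y hy; rewrite -(Ropp_involutive y); apply: arc_at_opp; apply: harc; lra.
- lra.
- by exists e; split=> // y hy; apply: h0; lra.
- lra.
Qed.

(** * Polynomial curves modulo a lattice *)

Lemma vadd_eta g (u v : Cg g) i : vadd u v i = (u i + v i)%C. Proof. by []. Qed.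

Ltac V_eq := apply: functional_extensionality => ?;
  rewrite /vadd /vscaleR /vscaleC; apply: C_ext => /=; ring.

Definition closedV g (E : Cg g -> Prop) :=
  forall (z : nat -> Cg g) l, Vlim z l -> U (fun k => E (z k)) -> E l.

Definition invariant g (L E : Cg g -> Prop) := forall z l, E z -> L l -> E (vadd z l).

Definition cocompact g (L : Cg g -> Prop) :=
  [/\ L vzero, (forall u v, L u -> L v -> L (vadd u v)), (forall u, L u -> L (vscaleR (-1) u)) &
      exists B, forall z, exists l, L l /\ forall i, Cmod (vadd z l i) <= B].

Definition Rinf (s : nat -> R) := forall B, U (fun k => B < s k).

Fixpoint vpoly g (p : nat -> Cg g) (d : nat) (s : R) : Cg g :=
  match d with
  | O => p O
  | S d' => vadd (vpoly p d' s) (vscaleR (s ^ d) (p d))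
  end.

(** The powers of [s] in [vpoly] become independent real parameters, while [p 0] keeps the
    coefficient [1]; the value [t 0] does not enter. *)
Fixpoint vspan g (p : nat -> Cg g) (d : nat) (t : nat -> R) : Cg g :=
  match d with
  | O => p O
  | S d' => vadd (vspan p d' t) (vscaleR (t d) (p d))
  end.

Lemma vpoly_vspan g (p : nat -> Cg g) d s : vpoly p d s = vspan p d (fun j => s ^ j).
Proof. by elim: d => [|d IH] //=; rewrite IH. Qed.

Lemma Rinf_nat : Rinf INR.
Proof.
move=> B; have [N hN] := INR_unbounded B.
by apply: (Um1 (Ucofin N)) => k /le_INR; lra.
Qed.

Lemma Clim_RtoC x l : Rlim x l -> Clim (fun k => RtoC (x k)) (RtoC l).
Proof.
move=> h eps he; apply: (Um1 (h eps he)) => k.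
have -> : (RtoC (x k) - RtoC l = RtoC (x k - l))%C by apply: C_ext => /=; ring.
by rewrite CmodR.
Qed.

Lemma Rlim0_squeeze x y : U (fun k => Rabs (x k) <= y k) -> Rlim y 0 -> Rlim x 0.
Proof.
move=> h hy eps he; apply: (Um2 h (hy eps he)) => k; rewrite !Rminus_0_r.
by have := Rle_abs (y k); lra.
Qed.

Lemma Rlim_inv_inf s M : Rinf s -> Rlim (fun k => M * / s k) 0.
Proof.
move=> hs eps he; have hM := Rabs_pos M.
have q : 0 < (Rabs M + 1) / eps by apply: Rdiv_lt_0_compat; lra.
apply: (Um1 (hs ((Rabs M + 1) / eps))) => k hk.
have hk0 : 0 < / s k by apply: Rinv_0_lt_compat; lra.
rewrite Rminus_0_r Rabs_mult (Rabs_pos_eq (/ s k)); last lra.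
apply: (Rmult_lt_reg_r (s k)); first lra.
rewrite Rmult_assoc Rinv_l; last lra.
have : eps * ((Rabs M + 1) / eps) = Rabs M + 1 by field; lra.
nra.
Qed.

(** If the powers of exponent [d + 1] differ by a bounded amount, the lower powers differ by
    [O(1/b)]. This is the estimate behind [root_shift]. *)
Lemma pow_diff a b d j : 1 <= a -> 1 <= b -> le j d ->
  Rabs (a ^ j - b ^ j) * b <= Rabs (a ^ S d - b ^ S d).
Proof.
have main x y : 1 <= y <= x -> le j d -> (x ^ j - y ^ j) * x <= x ^ S d - y ^ S d.
  move=> hxy hj.
  have e : S d = (j + S (d - j)%N)%coq_nat by lia.
  rewrite e !pow_add.
  have h1 : y ^ j <= x ^ j by apply: pow_incr; lra.
  have h2 : y ^ S (d - j)%N <= x ^ S (d - j)%N by apply: pow_incr; lra.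
  have h3 : 0 < y ^ j by apply: pow_lt; lra.
  have h4 : x <= x ^ S (d - j)%N.
    by have := pow_R1_Rle x (d - j)%N ltac:(lra) => /= ?; nra.
  move: (x ^ j) (y ^ j) (x ^ S (d - j)%N) (y ^ S (d - j)%N) h1 h2 h3 h4 => A B D F h1 h2 h3 h4.
  have : A * D - B * F = (A - B) * D + B * (D - F) by ring.
  have := Rmult_le_pos B (D - F) ltac:(lra) ltac:(lra).
  have := Rmult_le_pos (A - B) (D - x) ltac:(lra) ltac:(lra).
  lra.
move=> ha hb hj.
case: (Rle_dec a b) => hab.
  rewrite -(Rabs_Ropp (a ^ j - _)) -(Rabs_Ropp (a ^ S d - _)) !Ropp_minus_distr.
  rewrite !Rabs_pos_eq; first exact: main.
    by have := pow_incr a b (S d) ltac:(lra); lra.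
  by have := pow_incr a b j ltac:(lra); lra.
have h1 : b ^ j <= a ^ j by apply: pow_incr; lra.
have h2 : b ^ S d <= a ^ S d by apply: pow_incr; lra.
rewrite !Rabs_pos_eq; try lra.
have := main a b ltac:(lra) hj.
have : 0 <= (a ^ j - b ^ j) * (a - b) by apply: Rmult_le_pos; lra.
lra.
Qed.

(* Shifting [s^(d+1)] by [t] does not move the lower powers in the limit. *)
Lemma root_shift (s : nat -> R) (t : R) d : Rinf s -> exists s', [/\ Rinf s',
  U (fun k => s' k ^ S d = s k ^ S d + t) &
  forall j, le j d -> Rlim (fun k => s' k ^ j - s k ^ j) 0].
Proof.
move=> hs.
pose s' k := Rpower (s k ^ S d + t) (/ INR (S d)).
have hn : 0 < INR (S d) by apply: lt_0_INR; lia.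
have big : forall B, 1 <= B -> U (fun k => [/\ 1 <= s k, B ^ S d <= s k ^ S d + t & 1 <= s k ^ S d + t]).
  move=> B hB; apply: (Um1 (hs (B ^ S d + Rabs t + 1))) => k hk.
  have h1 : 1 <= B ^ S d by apply: pow_R1_Rle.
  have h2 := Rabs_pos t; have h3 := Rle_abs (- t); rewrite Rabs_Ropp in h3.
  have h4 : s k <= s k ^ S d.
    by have := pow_R1_Rle (s k) d ltac:(lra) => /= ?; nra.
  by split; lra.
have hpow : U (fun k => s' k ^ S d = s k ^ S d + t).
  apply: (Um1 (big 1 (Rle_refl 1))) => k [h1 _ h2].
  have hp : 0 < s' k by apply: exp_pos.
  rewrite -Rpower_pow // /s' Rpower_mult Rinv_l; last lra.
  by rewrite Rpower_1 //; lra.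
have hinf : Rinf s'.
  move=> B; have hB := Rle_abs B; have hB0 := Rabs_pos B.
  apply: (Um2 (big (Rabs B + 2) ltac:(lra)) hpow) => k [h1 h2 h3] h4.
  apply: Rnot_le_lt => hle.
  have hp : 0 < s' k by apply: exp_pos.
  have h5 : s' k ^ S d <= (Rabs B + 1) ^ S d by apply: pow_incr; lra.
  have h6 : (Rabs B + 1) ^ S d < (Rabs B + 2) ^ S d.
    have h7 : (Rabs B + 1) ^ d <= (Rabs B + 2) ^ d by apply: pow_incr; lra.
    have h8 : 0 < (Rabs B + 1) ^ d by apply: pow_lt; lra.
    by rewrite /=; nra.
  lra.
exists s'; split=> // j hj.
apply: (@Rlim0_squeeze _ (fun k => Rabs t * / s k)); last exact: Rlim_inv_inf.
apply: (Um3 hpow (hinf 1) (hs 1)) => k h1 h2 h3.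
have h4 := @pow_diff (s' k) (s k) d j ltac:(lra) ltac:(lra) hj.
have e : s' k ^ S d - s k ^ S d = t by lra.
rewrite e in h4.
apply: (Rmult_le_reg_r (s k)); first lra.
by rewrite Rmult_assoc Rinv_l; lra.
Qed.

Lemma vpoly_diff g (p : nat -> Cg g) (s s' : nat -> R) d :
  (forall j, le j d -> Rlim (fun k => s' k ^ j - s k ^ j) 0) ->
  forall i, Clim (fun k => vpoly p d (s' k) i - vpoly p d (s k) i)%C C0.
Proof.
elim: d => [|d IH] h i.
  by apply: Clim_ext (Clim_const C0); apply: Uall => k /=; ring.
have h1 := IH (fun j hj => h j ltac:(lia)) i.
have h2 := Clim_mul (Clim_RtoC (h (S d) (le_n _))) (@Clim_const (p (S d) i)).
have := Clim_add h1 h2.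
have -> : (C0 + RtoC 0 * p (S d) i = C0)%C by apply: C_ext => /=; ring.
apply: Clim_ext; apply: Uall => k.
by rewrite /= /vadd /vscaleR /vscaleC; apply: C_ext => /=; ring.
Qed.

(** Induction on the degree. With [v] the top coefficient, the set [E'] of points whose whole line
    in direction [v] lies in [E] is again closed and invariant, and it satisfies the hypothesis for
    the polynomial with its top term removed. Indeed, shifting [s^(d+1)] by [r] leaves the lower
    terms unchanged in the limit and moves the limit by [r v]. *)
Lemma polynomial_curve_closure g (L : Cg g -> Prop) (p : nat -> Cg g) d (E : Cg g -> Prop) :
  cocompact L -> closedV E -> invariant L E ->
  (forall s l q, Rinf s -> (forall k, L (l k)) ->
     Vlim (fun k => vadd (vpoly p d (s k)) (l k)) q -> E q) ->
  forall t, E (vspan p d t).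
Proof.
move=> [L0 LD LN [B hB]]; elim: d E => [|d IH] E cE iE H t.
  apply: (H INR (fun _ => vzero)) => //; first exact: Rinf_nat.
  by apply: Vlim_ext (@Vlim_const _ (p O)); apply: Uall => k /=; V_eq.
pose v := p (S d).
pose E' x := forall t, E (vadd x (vscaleR t v)).
suff : E' (vspan p d t) by apply.
apply: IH.
- move=> z l hz hE r; apply: (cE (fun k => vadd (z k) (vscaleR r v))).
    by apply: Vlim_add => //; exact: Vlim_const.
  by apply: (Um1 hE) => k; apply.
- move=> z l hz hl r.
  have -> : vadd (vadd z l) (vscaleR r v) = vadd (vadd z (vscaleR r v)) l by V_eq.
  by apply: iE.
move=> s l q hs hl hq.
(* Modulo [L] the diverging top term stays bounded, hence converges to some [w]. *)
have [mu hmu] : exists mu : nat -> Cg g, forall k, L (mu k) /\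
    forall i, Cmod (vadd (vscaleR (s k ^ S d) v) (mu k) i) <= B.
  exists (fun k => proj1_sig (constructive_indefinite_description _ (hB (vscaleR (s k ^ S d) v)))) => k.
  exact: (proj2_sig (constructive_indefinite_description _ (hB (vscaleR (s k ^ S d) v)))).
have [w hw] : exists w, Vlim (fun k => vadd (vscaleR (s k ^ S d) v) (mu k)) w.
  by apply: (@Vlim_ex _ _ B); apply: Uall => k; have [_ h] := hmu k.
have hE' : E' (vadd q w).
  move=> r.
  have [s' [hs' hpow hdiff]] := @root_shift s r d hs.
  apply: (H s' (fun k => vadd (l k) (mu k))) => //.
    by move=> k; apply: LD; [exact: hl | have [] := hmu k].
  move=> i.
  have h1 := Clim_add (Clim_add (Clim_add (hq i) (hw i)) (vpoly_diff p hdiff i))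
    (@Clim_const (RtoC r * v i)%C).
  have e : (vadd q w i + C0 + RtoC r * v i = vadd (vadd q w) (vscaleR r v) i)%C.
    by rewrite /vadd /vscaleR /vscaleC; ring.
  rewrite vadd_eta in e; rewrite e in h1; apply: Clim_ext h1.
  apply: (Um1 hpow) => k h2.
  have h3 : vpoly p (S d) (s' k) = vadd (vpoly p d (s' k)) (vscaleR (s' k ^ S d) v) by [].
  rewrite h3 h2 /vadd /vscaleR /vscaleC; apply: C_ext => /=; ring.
move=> r.
(* It remains to pass from [q + w] to [q]. The line through [q + w] absorbs [- s^(d+1) v] and
   invariance absorbs [- mu k]; together they tend to [- w]. *)
apply: (cE (fun k => vadd (vadd (vadd q w) (vscaleR (r - s k ^ S d) v)) (vscaleR (-1) (mu k)))).
  move=> i.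
  have h1 := Clim_sub (@Clim_const (q i + w i + RtoC r * v i)%C) (hw i).
  have e : (q i + w i + RtoC r * v i - w i = vadd q (vscaleR r v) i)%C.
    by rewrite /vadd /vscaleR /vscaleC; ring.
  rewrite e in h1; apply: Clim_ext h1; apply: Uall => k.
  by rewrite /vadd /vscaleR /vscaleC; apply: C_ext => /=; ring.
by apply: Uall => k; apply: iE => //; apply: LN; have [] := hmu k.
Qed.

Lemma boundedness_limit g (L : Cg g -> Prop) (x : nat -> Cg g) : cocompact L ->
  exists l q, (forall k, L (l k)) /\ Vlim (fun k => vadd (x k) (l k)) q.
Proof.
move=> [_ _ _ [B hB]].
pose l k := proj1_sig (constructive_indefinite_description _ (hB (x k))).
have hl k : L (l k) /\ forall i, Cmod (vadd (x k) (l k) i) <= B.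
  exact: (proj2_sig (constructive_indefinite_description _ (hB (x k)))).
have [q hq] : exists q, Vlim (fun k => vadd (x k) (l k)) q.
  by apply: (@Vlim_ex _ _ B); apply: Uall => k; have [] := hl k.
by exists l, q; split=> // k; have [] := hl k.
Qed.

(** * Order of contact of the translated remainder with the analytic set *)

Section Contact.
Variables (g : nat) (L Z : Cg g -> Prop) (r : C -> Cg g) (d0 : R).
Hypotheses (hL : cocompact L) (han : analytic_set Z) (hinv : invariant L Z).
Hypotheses (hd0 : 0 < d0) (hr : PSV d0 r) (r0 : r C0 = vzero).

(* The germ at [0] of [t |-> x + r t] has contact of order [>= k] with [Z]. *)
Definition contact (k : nat) (x : Cg g) :=
  forall (V : Cg g -> Prop) (f : Cg g -> C), open_Cg V -> V x -> analytic_on V f ->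
    (forall z, V z -> Z z -> f z = C0) ->
    exists B e, 0 < e /\ forall t, Cmod t < e -> Cmod (f (vadd x (r t))) <= B * Cmod t ^ k.

Lemma coef_of_bound a d M h k B e : 0 < d -> is_ps a d M h -> 0 < e ->
  (forall t, Cmod t < e -> Cmod (h t) <= B * Cmod t ^ k) -> forall i, lt i k -> a i = C0.
Proof.
case: k => [|k] hd ha he hB i hi; first by lia.
apply: (@is_ps_coef0 a d M h (fun j => C1 * RtoC (/ (INR j + 1)))%C k B hd ha _ _ _ i hi).
- exact: Clim_inv_nat.
- apply: Uall => j; apply: Cmod_gt0_neq; rewrite CmodM Cmod1 CmodR.
  by have := inv_nat_gt0 j => h1; rewrite Rabs_pos_eq; lra.
- apply: (Um1 (@Clim_inv_nat C1 e he)) => j hj; apply: hB.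
  by move: hj; congr (Cmod _ < _); ring.
Qed.

(** Translates of the germ [r] to points near [q] share one disc and one bound, so the coefficients
    of [f] along them converge to those at [q]. Conditions on coefficients can therefore be passed
    to the limit. *)
Lemma translates_limit (x : nat -> Cg g) q V f : Vlim x q -> open_Cg V -> V q -> analytic_on V f ->
  exists d M a b, [/\ 0 < d,
    U (fun n => is_ps (a n) d M (fun t => f (vadd (x n) (r t)))),
    is_ps b d M (fun t => f (vadd q (r t))),
    (forall i, Clim (fun n => a n i) (b i)) &
    U (fun n => forall t, Cmod t < d -> V (vadd (x n) (r t)))].
Proof.
move=> hx oV Vq fa.
have [eta [M [heta H]]] := analytic_at_comp (fa q Vq).
have [rho [hrho hV]] := oV q Vq.
(* One [e] pays for the distance from [x n] to [q], the other for the size of [r]. *)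
pose e := Rmin eta (rho / 2) / 2.
have he : 0 < e by have : 0 < Rmin eta (rho / 2); [apply: Rmin_glb_lt; lra | rewrite /e; lra].
have he1 : e + e <= eta by rewrite /e; have := Rmin_l eta (rho / 2); lra.
have he2 : e + e < rho by rewrite /e; have := Rmin_r eta (rho / 2); lra.
have [d [hd hrd]] := PSV_small hd0 he hr.
have near n : (forall i, Cmod (x n i - q i)%C < e) ->
    forall i, PS d (e + e) (fun t => vadd (x n) (r t) i - q i)%C.
  move=> hn i.
  apply: (@PS_ext _ _ (fun t => (x n i - q i) + (r t i - r C0 i))%C).
    by move=> t _; rewrite r0 vadd_eta /vzero; ring.
  apply: PS_add; [lra | | exact: hrd].
  by apply: (@PS_mono _ (Cmod (x n i - q i)%C)); [lra | have := hn i; lra | apply: PS_const; lra].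
have hV2 : U (fun n => forall t, Cmod t < d -> V (vadd (x n) (r t))).
  apply: (Um1 (Vlim_near hx he)) => n hn t ht; apply: hV => i.
  by have := PS_bound (near n hn i) ht; lra.
have hps : U (fun n => PS d M (fun t => f (vadd (x n) (r t)))).
  apply: (Um1 (Vlim_near hx he)) => n hn; apply: H; first lra.
  by move=> i; apply: PS_mono (near n hn i); lra.
have [a ha] := Uchoice (fun _ => C0) hps.
have [b [hb1 hb2]] : exists b, (forall i, Clim (fun n => a n i) (b i)) /\
    is_ps b d M (fun t => f (vadd q (r t))).
  apply: (is_ps_lim (proj1 hd) ha) => t ht.
  apply: (@analytic_at_lim g f (vadd q (r t)) (fun n => vadd (x n) (r t))).
    apply: fa; apply: hV => i.
    have := PS_bound (hrd i) ht; rewrite r0 vadd_eta /vzero.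
    have -> : (r t i - C0 = q i + r t i - q i)%C by ring.
    lra.
  by apply: Vlim_add => //; exact: Vlim_const.
by exists d, M, a, b; split=> //; lra.
Qed.

(** Contact of order [k] means that the coefficients below [k] vanish, and the same [V] and [f] can
    be used at all points near the limit. *)
Lemma contact_closed k : closedV (contact k).
Proof.
move=> x q hx hc V f oV Vq fa fZ.
have [d [M [a [b [hd ha hb hab hV]]]]] := translates_limit hx oV Vq fa.
exists (M / d ^ k), d; split=> //.
apply: (is_ps_coef0_O hd hb) => i hi.
apply: Clim_uniq (hab i) _; apply: Clim_ext (Clim_const C0).
apply: (Um3 ha hc hV) => n han' hcn hVn.
have Vx : V (x n).
  have := hVn C0 ltac:(rewrite Cmod0; lra).
  by have -> : vadd (x n) (r C0) = x n by rewrite r0; apply: functional_extensionality => j; rewrite vadd_eta /vzero; ring.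
have [B [e [he hB]]] := hcn V f oV Vx fa fZ.
by rewrite (coef_of_bound hd han' he hB hi).
Qed.

Lemma boxsum_ext (A : Type) (op : A -> A -> A) e N n (F G : (Fin.t n -> nat) -> A) :
  (forall al, F al = G al) -> boxsum op e N n F = boxsum op e N n G.
Proof. by move=> E; congr boxsum; apply: functional_extensionality. Qed.

Lemma boxsum_idem (A : Type) (op : A -> A -> A) e N n z : op z z = z ->
  boxsum op e N n (fun _ => z) = z.
Proof.
move=> hz; elim: n => [|n IH] //=.
have nz M : natsum op e M (fun _ => z) = z by elim: M => [|M IHM] //=; rewrite IHM.
by rewrite IH nz.
Qed.

Lemma analytic_at_shift (f : Cg g -> C) p l : analytic_at f (vadd p l) ->
  analytic_at (fun z => f (vadd z l)) p.
Proof.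
move=> [rho [hrho [c hc]]]; exists rho; split=> //; exists c => z hz.
have hz' : polydisc (vadd p l) rho (vadd z l).
  by move=> i; move: (hz i); congr (Cmod _ < _); rewrite !vadd_eta; ring.
have em al : mono (vadd p l) (vadd z l) al = mono p z al.
  by apply: ffold_ext => i; congr Cpow; rewrite !vadd_eta; ring.
have [[M hM] hlim] := hc _ hz'; split.
  exists M => N; have := hM N.
  by congr (_ <= _); apply: boxsum_ext => al; rewrite em.
move=> eps he; have [N0 hN] := hlim eps he; exists N0 => N hNN.
have := hN N hNN.
by congr (Cmod (Csub _ _) < _); apply: boxsum_ext => al; rewrite em.
Qed.

Lemma invariant_iff z l : L l -> Z (vadd z l) <-> Z z.
Proof.
case: hL => _ _ LN _ Ll; split=> [h|h]; last exact: hinv.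
have -> : z = vadd (vadd z l) (vscaleR (-1) l) by V_eq.
by apply: hinv => //; exact: LN.
Qed.

(** A test function at [x + l] is pulled back by the translation, which preserves [Z]. *)
Lemma contact_invariant k : invariant L (contact k).
Proof.
move=> x l hx Ll V f oV Vx fa fZ.
have [B [e [he hB]]] : exists B e, 0 < e /\
    forall t, Cmod t < e -> Cmod (f (vadd (vadd x (r t)) l)) <= B * Cmod t ^ k.
  apply: (hx (fun z => V (vadd z l)) (fun z => f (vadd z l))) => //.
  - move=> p Vp; have [rho [hrho h]] := oV _ Vp; exists rho; split=> // z hz; apply: h => i.
    by move: (hz i); congr (Cmod _ < _); rewrite !vadd_eta; ring.
  - by move=> p Vp; apply: analytic_at_shift; exact: fa.
  - by move=> z Vz Zz; apply: fZ => //; exact: hinv.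
exists B, e; split=> // t ht.
have -> : vadd (vadd x l) (r t) = vadd (vadd x (r t)) l by V_eq.
exact: hB.
Qed.

Variables (p : nat -> Cg g) (d : nat) (S0 : R).
Hypothesis (hcurve : forall s, S0 <= s -> Z (vadd (vpoly p d s) (r (RtoC (/ s))))).

(** Induction on [k], with [polynomial_curve_closure] applied to the set of points with contact of
    order [k + 1]. Only limits of lattice translates of the curve remain to be treated, and there
    the point of [Z] at parameter [1/s] gives one more vanishing coefficient. *)
Lemma contact_vspan k t : contact k (vspan p d t).
Proof.
elim: k t => [|k IH] t.
  move=> V f oV Vx fa fZ.
  have [e [M [a [b [he _ hb _ _]]]]] := translates_limit (@Vlim_const _ (vspan p d t)) oV Vx fa.
  exists M, e; split=> // s hs; rewrite /= Rmult_1_r.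
  by apply: (@PS_bound e M (fun t0 => f (vadd (vspan p d t) (r t0)))) => //; exists b.
apply: (polynomial_curve_closure hL (@contact_closed (S k)) (@contact_invariant (S k))).
move=> s l q hs hl hq V f oV Vq fa fZ.
have [e [M [a [b [he ha hb hab hV]]]]] := translates_limit hq oV Vq fa.
exists (M / e ^ S k), e; split=> //.
apply: (is_ps_coef0_O he hb) => i hi.
(* The points [vpoly p d (s n)] belong to the span, so the induction hypothesis applies to them
   before the limit is taken. *)
have low : U (fun n => forall i, lt i k -> a n i = C0).
  apply: (Um2 ha hV) => n han' hVn j hj.
  have Vx : V (vadd (vpoly p d (s n)) (l n)).
    have := hVn C0 ltac:(rewrite Cmod0; lra).
    have -> : vadd (vadd (vpoly p d (s n)) (l n)) (r C0) = vadd (vpoly p d (s n)) (l n) => //.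
    by rewrite r0; apply: functional_extensionality => m; rewrite !vadd_eta /vzero; ring.
  have hc : contact k (vadd (vpoly p d (s n)) (l n)).
    by apply: contact_invariant => //; rewrite vpoly_vspan; exact: IH.
  have [B [e' [he' hB]]] := hc V f oV Vx fa fZ.
  exact: (coef_of_bound he han' he' hB hj).
case: (classic (lt i k)) => hik.
  apply: Clim_uniq (hab i) _; apply: Clim_ext (Clim_const C0).
  by apply: (Um1 low) => n ->.
have -> : i = k by lia.
apply: Clim_uniq (hab k) _.
have hM : 0 <= M by apply: (@PS_M_ge0 e _ (fun t => f (vadd q (r t)))); exists b.
(* The germ vanishes at [1 / s n] and starts with [a n k * t^k]; the tail estimate at order [k + 1]
   then gives [|a n k| <= (M / e^(k+1)) / s n]. *)
apply: (@Clim0_squeeze _ (fun n => M / e ^ S k * / s n)); last exact: Rlim_inv_inf.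
apply: (Um4 ha low hV (Uand (hs (Rmax S0 1)) (hs (/ e)))) => n h1 h2 h3 [h4 h5].
have m1 := Rmax_l S0 1; have m2 := Rmax_r S0 1.
have hs0 : 0 < / s n by apply: Rinv_0_lt_compat; lra.
have hse : / s n < e.
  by rewrite -(Rinv_inv e); apply: Rinv_lt_contravar => //; apply: Rmult_lt_0_compat; [apply: Rinv_0_lt_compat | lra].
have hct : Cmod (RtoC (/ s n)) = / s n by rewrite CmodR Rabs_pos_eq; lra.
have hz : f (vadd (vadd (vpoly p d (s n)) (l n)) (r (RtoC (/ s n)))) = C0.
  apply: fZ; first by apply: h3; rewrite hct.
  have -> : vadd (vadd (vpoly p d (s n)) (l n)) (r (RtoC (/ s n)))
    = vadd (vadd (vpoly p d (s n)) (r (RtoC (/ s n)))) (l n) by V_eq.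
  by apply: hinv => //; apply: hcurve; lra.
have := (proj2 h1) (RtoC (/ s n)) ltac:(rewrite hct; lra) (S k).
rewrite hz psum_lead // hct.
have -> : (C0 - RtoC (/ s n) ^ k * a n k = - (RtoC (/ s n) ^ k * a n k))%C by ring.
rewrite CmodN CmodM CmodX hct => h6.
have hpk : 0 < (/ s n) ^ k by apply: pow_lt.
apply: (Rmult_le_reg_l ((/ s n) ^ k)) => //.
apply: (Rle_trans _ _ _ h6); right.
by rewrite /Rdiv Rpow_mult_distr (pow_inv e) /=; ring.
Qed.

(** Contact of every order forces the local equations to vanish near [0]. That one radius serves all
    [t] follows from cocompactness: counterexamples with shrinking [tau] could be translated to
    converge to a point [q], around which the radius is uniform. *)
Lemma asymptotic_span : exists e, 0 < e /\
  forall t tau, Cmod tau < e -> Z (vadd (vspan p d t) (r tau)).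
Proof.
apply: NNPP => hn.
have [w hw] : exists w : nat -> (nat -> R) * C, forall n, Cmod (snd (w n)) < / (INR n + 1) /\
    ~ Z (vadd (vspan p d (fst (w n))) (r (snd (w n)))).
  have h n : exists w : (nat -> R) * C, Cmod (snd w) < / (INR n + 1) /\
    ~ Z (vadd (vspan p d (fst w)) (r (snd w))).
    apply: NNPP => hnn; apply: hn; exists (/ (INR n + 1)); split; first exact: inv_nat_gt0.
    move=> t tau htau; apply: NNPP => hz; apply: hnn; by exists (t, tau).
  exists (fun n => proj1_sig (constructive_indefinite_description _ (h n))) => n.
  exact: (proj2_sig (constructive_indefinite_description _ (h n))).
have [l [q [hl hq]]] := boundedness_limit (fun n => vspan p d (fst (w n))) hL.
have [V [oV [Vq [m [f [fa fz]]]]]] := han q.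
have hch j := translates_limit hq oV Vq (fa j).
have hj : U (fun n => forall j : Fin.t m,
    f j (vadd (vadd (vspan p d (fst (w n))) (l n)) (r (snd (w n)))) = C0).
  apply: Ufin_forall => j.
  have [e [M [a [b [he ha hb hab hV]]]]] := hch j.
  apply: (Um3 ha hV (Rlim_inv_nat he)) => n h1 h2 h3.
  have Vx : V (vadd (vspan p d (fst (w n))) (l n)).
    have := h2 C0 ltac:(rewrite Cmod0; lra).
    have -> : vadd (vadd (vspan p d (fst (w n))) (l n)) (r C0) = vadd (vspan p d (fst (w n))) (l n) => //.
    by rewrite r0; apply: functional_extensionality => i; rewrite !vadd_eta /vzero; ring.
  apply: (is_ps_coef0_zero he h1).
    move=> i.
    have hc : contact (S i) (vadd (vspan p d (fst (w n))) (l n)).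
      by apply: contact_invariant => //; exact: contact_vspan.
    have [B [e' [he' hB]]] := hc V (f j) oV Vx (fa j) (fun z Vz => fun Zz => proj1 (fz z Vz) Zz j).
    by apply: (coef_of_bound he h1 he' hB); lia.
  have := inv_nat_gt0 n => h4; move: h3; rewrite Rminus_0_r Rabs_pos_eq; last lra.
  by have [h5 _] := hw n; lra.
have hV : U (fun n => V (vadd (vadd (vspan p d (fst (w n))) (l n)) (r (snd (w n))))).
  (* [translates_limit] is used for the function [0] to learn that the translates stay in [V]. This
     also covers the case of an empty list of equations. *)
  have ca : analytic_on V (fun _ : Cg g => C0).
    move=> z _; exists 1; split; first lra; exists (fun _ => C0) => y _.
    have z0 N : boxsum Rplus 0 N g (fun al => Cmod C0 * Cmod (mono z y al)) = 0.
      by rewrite (@boxsum_ext _ _ _ _ _ _ (fun _ => 0)) ?boxsum_idem // => *; rewrite ?Cmod0; ring.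
    have z1 N : boxsum Cadd C0 N g (fun al => C0 * mono z y al)%C = C0.
      by rewrite (@boxsum_ext _ _ _ _ _ _ (fun _ => C0)) ?boxsum_idem // => *; ring.
    split; first by exists 0 => N; rewrite z0; lra.
    move=> eps he; exists O => N _; rewrite z1.
    have -> : (C0 - C0 = C0)%C by ring. by rewrite Cmod0.
  have [e [M [a [b [he ha hb hab hV]]]]] := translates_limit hq oV Vq ca.
  apply: (Um2 hV (Rlim_inv_nat he)) => n h1 h2; apply: h1.
  have := inv_nat_gt0 n => h4; move: h2; rewrite Rminus_0_r Rabs_pos_eq; last lra.
  by have [h5 _] := hw n; lra.
have [n [h1 h2]] := Uex (Uand hj hV).
have [_ []] := hw n.
apply/(@invariant_iff _ (l n)) => //.
have -> : vadd (vadd (vspan p d (fst (w n))) (r (snd (w n)))) (l n)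
  = vadd (vadd (vspan p d (fst (w n))) (l n)) (r (snd (w n))) by V_eq.
by apply/(fz _ h2).
Qed.

End Contact.

(** * Real linear algebra in [Cg g] *)

Definition fin n (i : 'I_n) : Fin.t n := Fin.of_nat_lt (elimT ltP (ltn_ord i)).
Definition unfin n (j : Fin.t n) : 'I_n := Ordinal (introT ltP (proj2_sig (Fin.to_nat j))).

Lemma unfinK n : cancel (@unfin n) (@fin n).
Proof.
move=> j; rewrite /fin -[RHS](Fin.of_nat_to_nat_inv j).
exact: Fin.of_nat_ext.
Qed.

Lemma finK n : cancel (@fin n) (@unfin n).
Proof. by move=> i; apply: val_inj => /=; rewrite /fin Fin.to_nat_of_nat. Qed.

Lemma fin_0 n : fin (@ord0 n) = Fin.F1.
Proof. by []. Qed.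

Lemma fin_lift n (i : 'I_n) : fin (lift ord0 i) = Fin.FS (fin i).
Proof. by rewrite /fin /=; congr Fin.FS; exact: Fin.of_nat_ext. Qed.

(** Real parts followed by imaginary parts: real independence and real spans become the rank and the
    row space of a matrix. *)
Definition rv g (z : Cg g) : 'rV[R]_(g + g) :=
  row_mx (\row_i fst (z (fin i))) (\row_i snd (z (fin i))).

Definition vr g (x : 'rV[R]_(g + g)) : Cg g := fun j =>
  (x ord0 (lshift g (unfin j)), x ord0 (rshift g (unfin j))).

Lemma rvK g : cancel (@rv g) (@vr g).
Proof.
move=> z; apply: functional_extensionality => j; rewrite /vr /rv row_mxEl row_mxEr !mxE unfinK.
by case: (z j).
Qed.

Lemma vrK g : cancel (@vr g) (@rv g).
Proof.
move=> x; apply/rowP => i; rewrite /rv /vr -(splitK i).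
by case: (split i) => j /=; rewrite ?row_mxEl ?row_mxEr mxE finK.
Qed.

Lemma rvD g (u v : Cg g) : rv (vadd u v) = (rv u + rv v)%R.
Proof. by rewrite /rv add_row_mx; congr row_mx; apply/rowP => i; rewrite !mxE. Qed.

Lemma rvZ g (r : R) (v : Cg g) : rv (vscaleR r v) = (r *: rv v)%R.
Proof.
rewrite /rv scale_row_mx; congr row_mx; apply/rowP => i; rewrite !mxE /vscaleR /vscaleC /= -RmultE -?RplusE -?RminusE; ring.
Qed.

Lemma rv0 g : rv (@vzero g) = 0%R.
Proof. by apply/rowP => i; rewrite -(splitK i); case: (split i) => j; rewrite /rv /= ?row_mxEl ?row_mxEr !mxE. Qed.

Definition vmat g n (v : Fin.t n -> Cg g) : 'M[R]_(n, g + g) := \matrix_i rv (v (fin i)).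

Lemma rv_vsum g n (a : Fin.t n -> R) (v : Fin.t n -> Cg g) :
  rv (vsum (fun i => vscaleR (a i) (v i))) = ((\row_i a (fin i)) *m vmat v)%R.
Proof.
rewrite mulmx_sum_row /vsum.
elim: n a v => [|n IH] a v; first by rewrite big_ord0 rv0.
rewrite big_ord_recl /= rvD (IH (fun i => a (Fin.FS i)) (fun i => v (Fin.FS i))) rvZ.
rewrite rowK mxE fin_0; congr (_ + _)%R.
by apply: eq_bigr => i _; rewrite !rowK !mxE fin_lift.
Qed.

Lemma R_indep_row_free g n (v : Fin.t n -> Cg g) : R_indep v <-> row_free (vmat v).
Proof.
split=> [h | h a ha i].
  apply/row_freeP; exists (pinvmx (vmat v)).
  apply/eqP; rewrite -GRing.subr_eq0; apply/eqP/row_matrixP => i; rewrite row0.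
  set x := row i _.
  have hx : (x *m vmat v = 0)%R.
    by rewrite /x -row_mul mulmxBl mul1mx mulmxKpV ?submx_refl // GRing.subrr row0.
  have hx0 : forall j, x ord0 (unfin j) = 0.
    apply: h; apply: (can_inj (@rvK g)).
    rewrite rv_vsum rv0 -hx; congr (_ *m _)%R.
    by apply/rowP => j; rewrite !mxE finK.
  by apply/rowP => j; have := hx0 (fin j); rewrite finK => ->; rewrite mxE.
have := rv_vsum a v; rewrite ha rv0 => /esym /eqP.
rewrite mulmx_free_eq0 // => /eqP /rowP /(_ (unfin i)).
by rewrite !mxE unfinK.
Qed.

Definition rspan g n (v : Fin.t n -> Cg g) (z : Cg g) :=
  exists a : Fin.t n -> R, z = vsum (fun i => vscaleR (a i) (v i)).

Lemma rspanP g n (v : Fin.t n -> Cg g) z : rspan v z <-> (rv z <= vmat v)%MS.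
Proof.
split=> [[a ->]|/submxP [D hD]]; first by rewrite rv_vsum submxMl.
exists (fun j => D ord0 (unfin j)); apply: (can_inj (@rvK g)).
rewrite rv_vsum hD; congr (_ *m _)%R.
by apply/rowP => i; rewrite mxE finK.
Qed.

Lemma rspan_subspace g n (v : Fin.t n -> Cg g) : real_subspace (rspan v).
Proof.
split; first by apply/rspanP; rewrite rv0 sub0mx.
split=> [u u' /rspanP hu /rspanP hu'|r u /rspanP hu]; apply/rspanP.
  by rewrite rvD addmx_sub.
by rewrite rvZ scalemx_sub.
Qed.

Lemma rspan_gen g n (v : Fin.t n -> Cg g) i : rspan v (v i).
Proof.
apply/rspanP; have -> : rv (v i) = row (unfin i) (vmat v) by rewrite rowK unfinK.
exact: row_sub.
Qed.

Lemma R_indep_cons g n (v : Fin.t n -> Cg g) u : R_indep v -> ~ rspan v u -> R_indep (fcons u v).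
Proof.
move=> hv hu a ha.
have ha' : vadd (vscaleR (a Fin.F1) u) (vsum (fun i => vscaleR (a (Fin.FS i)) (v i))) = vzero by [].
have [h0 [hD hZ]] := rspan_subspace v.
have a0 : a Fin.F1 = 0.
  apply: NNPP => hne; apply: hu.
  have -> : u = vscaleR (- / a Fin.F1) (vsum (fun i => vscaleR (a (Fin.FS i)) (v i))).
    move: (vsum _) ha' => s hs; apply: functional_extensionality => j.
    have := f_equal (fun f => f j) hs; rewrite /vadd /vscaleR /vscaleC /vzero => e.
    have e1 := f_equal fst e; have e2 := f_equal snd e; move: e1 e2 => /= e1 e2.
    apply: C_ext => /=.
      have -> : fst (s j) = - (a Fin.F1 * fst (u j)) by lra.
      by field.
    have -> : snd (s j) = - (a Fin.F1 * snd (u j)) by lra.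
    by field.
  by apply: hZ; exists (fun i => a (Fin.FS i)).
move=> i; apply: (Fin.caseS' i (fun i => a i = 0)) => // j.
apply: (hv (fun i => a (Fin.FS i))).
rewrite -ha' a0; apply: functional_extensionality => k; rewrite /vadd.
by rewrite /vscaleR /vscaleC; apply: C_ext => /=; ring.
Qed.

Lemma R_indep_tail g n (v : Fin.t n.+1 -> Cg g) : R_indep v -> R_indep (fun i => v (Fin.FS i)).
Proof.
move=> hv a ha i.
apply: (hv (fcons 0 a) _ (Fin.FS i)).
have -> : vsum (fun i => vscaleR (fcons 0 a i) (v i)) =
  vadd (vscaleR 0 (v Fin.F1)) (vsum (fun i => vscaleR (a i) (v (Fin.FS i)))) by [].
rewrite ha; V_eq.
Qed.

Lemma R_indep_le g n (v : Fin.t n -> Cg g) : R_indep v -> le n (g + g)%N.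
Proof. by move=> /R_indep_row_free; rewrite /row_free => /eqP <-; apply/leP; exact: rank_leq_col. Qed.

Lemma max_exists (P : nat -> Prop) B : P O -> (forall n, P n -> le n B) ->
  exists n, P n /\ forall m, P m -> le m n.
Proof.
move=> P0; elim: B => [|B IH] hB; first by exists O; split=> // m /hB.
case: (classic (P (S B))) => hP; first by exists (S B).
apply: IH => n Pn; have := hB n Pn.
have : n <> S B by move=> e; apply: hP; rewrite -e.
lia.
Qed.

Lemma Rlim_const c : Rlim (fun _ => c) c.
Proof. by move=> e he; apply: Uall => _; rewrite Rminus_diag Rabs_R0. Qed.

Lemma Rlim_re x l : Clim x l -> Rlim (fun k => fst (x k)) (fst l).
Proof. by move=> h e he; apply: (Um1 (h e he)) => k; have := re_le_Cmod (x k - l)%C; rewrite /= /Rminus; lra. Qed.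

Lemma Rlim_im x l : Clim x l -> Rlim (fun k => snd (x k)) (snd l).
Proof. by move=> h e he; apply: (Um1 (h e he)) => k; have := im_le_Cmod (x k - l)%C; rewrite /= /Rminus; lra. Qed.

Lemma Rlim_add x y a b : Rlim x a -> Rlim y b -> Rlim (fun k => x k + y k) (a + b).
Proof.
move=> h1 h2; exact: (Rlim_re (Clim_add (Clim_RtoC h1) (Clim_RtoC h2))).
Qed.

Lemma Rlim_mul x y a b : Rlim x a -> Rlim y b -> Rlim (fun k => x k * y k) (a * b).
Proof.
move=> h1 h2 e he; have := Rlim_re (Clim_mul (Clim_RtoC h1) (Clim_RtoC h2)) he.
move=> h; apply: (Um1 h) => k /=; by rewrite !Rmult_0_l !Rminus_0_r.
Qed.

Lemma Rlim_sum n (x : nat -> 'I_n -> R) l : (forall i, Rlim (fun k => x k i) (l i)) ->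
  Rlim (fun k => \sum_i x k i)%R (\sum_i l i)%R.
Proof.
elim: n x l => [|n IH] x l h.
  rewrite big_ord0; have := @Rlim_const 0; congr (Rlim _ _).
  by apply: functional_extensionality => k; rewrite big_ord0.
rewrite big_ord_recl; have := Rlim_add (h ord0) (IH (fun k i => x k (lift ord0 i)) _ (fun i => h _)).
congr (Rlim _ _).
by apply: functional_extensionality => k; rewrite big_ord_recl.
Qed.

Lemma rv_lim g (z : nat -> Cg g) l i : Vlim z l ->
  Rlim (fun k => rv (z k) ord0 i) (rv l ord0 i).
Proof.
move=> h; rewrite -(splitK i); case: (split i) => j /=.
  rewrite {2}/rv row_mxEl mxE; have := Rlim_re (h (fin j)).
  by congr (Rlim _ _); apply: functional_extensionality => k; rewrite /rv row_mxEl mxE.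
rewrite {2}/rv row_mxEr mxE; have := Rlim_im (h (fin j)).
by congr (Rlim _ _); apply: functional_extensionality => k; rewrite /rv row_mxEr mxE.
Qed.

Lemma rv_mul_lim g n (A : 'M[R]_(g + g, n)) (z : nat -> Cg g) l i : Vlim z l ->
  Rlim (fun k => (rv (z k) *m A)%R ord0 i) ((rv l *m A)%R ord0 i).
Proof.
move=> h; rewrite mxE.
have := @Rlim_sum _ (fun k j => rv (z k) ord0 j * A j i) (fun j => rv l ord0 j * A j i)
  (fun j => Rlim_mul (rv_lim j h) (@Rlim_const (A j i))).
congr (Rlim _ _); apply: functional_extensionality => k; by rewrite mxE.
Qed.

Lemma vr_lim g (x : nat -> 'rV[R]_(g + g)) (l : 'rV[R]_(g + g)) :
  (forall i, Rlim (fun k => x k ord0 i) (l ord0 i)) -> Vlim (fun k => vr (x k)) (vr l).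
Proof. by move=> h i; apply: Clim_re_im => /=; exact: h. Qed.

(** Right multiplication by [pinvmx V *m V] fixes the row space of [V] and maps into it, so its
    complement is a projection with that row space as kernel. Being a matrix product, it is
    continuous. *)
Lemma projection_along g n (v : Fin.t n -> Cg g) : exists pi : Cg g -> Cg g,
  [/\ forall x, rspan v (vadd x (vscaleR (-1) (pi x))),
      forall x, rspan v x -> pi x = vzero,
      forall x y, pi (vadd x y) = vadd (pi x) (pi y),
      forall r x, pi (vscaleR r x) = vscaleR r (pi x) &
      forall x l, Vlim x l -> Vlim (fun k => pi (x k)) (pi l)].
Proof.
pose A := (1%:M - pinvmx (vmat v) *m vmat v)%R.
have vrD (x y : 'rV[R]_(g + g)) : vr (x + y)%R = vadd (vr x) (vr y).
  by apply: (can_inj (@rvK g)); rewrite rvD !vrK.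
have vrZ r (x : 'rV[R]_(g + g)) : vr (r *: x)%R = vscaleR r (vr x).
  by apply: (can_inj (@rvK g)); rewrite rvZ !vrK.
exists (fun x => vr (rv x *m A)%R); split.
- move=> x; apply/rspanP; rewrite rvD rvZ vrK /A mulmxBr mulmx1 GRing.scalerBr mulmxA.
  rewrite -[IZR (-1)]/(- (1 : R))%R GRing.scaleN1r GRing.scaleN1r GRing.opprK GRing.addrA GRing.subrr GRing.add0r.
  exact: submxMl.
- move=> x /rspanP hx; apply: (can_inj (@rvK g)).
  by rewrite vrK rv0 /A mulmxBr mulmx1 mulmxA mulmxKpV // GRing.subrr.
- by move=> x y; rewrite rvD mulmxDl vrD.
- by move=> r x; rewrite rvZ -scalemxAl vrZ.
- by move=> x l hx; apply: vr_lim => i; exact: rv_mul_lim.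
Qed.

Lemma vnorm_ex g (v : Cg g) : v <> vzero ->
  exists s, 0 < s /\ (forall i, Cmod (v i) <= s) /\ exists i, Cmod (v i) = s.
Proof.
move=> hv.
have [i0 hi0] : exists i, v i <> C0.
  apply: NNPP => hn; apply: hv; apply: functional_extensionality => i.
  by apply: NNPP => h; apply: hn; exists i.
have main n (a : Fin.t n -> R) : Fin.t n -> exists i, forall j, a j <= a i.
  elim: n a => [|n IH] a; first exact: Fin.case0.
  case: n a IH => [|n] a IH _.
    exists Fin.F1 => j; apply: (Fin.caseS' j (fun j => a j <= _)); first lra.
    exact: (Fin.case0 (fun j => a (Fin.FS j) <= _)).
  have [i hi] := IH (fun i => a (Fin.FS i)) Fin.F1.
  case: (Rle_dec (a Fin.F1) (a (Fin.FS i))) => h.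
    by exists (Fin.FS i) => j; apply: (Fin.caseS' j (fun j => a j <= _)).
  exists Fin.F1 => j; apply: (Fin.caseS' j (fun j => a j <= _)); first lra.
  by move=> j'; have := hi j'; lra.
have [i hi] := main g (fun i => Cmod (v i)) i0.
exists (Cmod (v i)); split; last by split=> //; exists i.
by have := hi i0; have := Cmod_gt0 hi0; lra.
Qed.

(** One coordinate attains the maximum modulus for [U]-almost all [k], so the normalized limit has a
    coordinate of modulus at least [1]. *)
Lemma unit_limit g (v : nat -> Cg g) : U (fun k => v k <> vzero) ->
  exists (s : nat -> R) u, [/\ U (fun k => 0 < s k), u <> vzero,
    Vlim (fun k => vscaleR (/ s k) (v k)) u & (Vlim v vzero -> Rlim s 0)].
Proof.
move=> hv.
have h1 : U (fun k => exists s, 0 < s /\ (forall i, Cmod (v k i) <= s) /\ exists i, Cmod (v k i) = s).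
  by apply: (Um1 hv) => k; exact: vnorm_ex.
have [s hs] := Uchoice 0 h1.
have [i hi] := @Ufin_exists g (fun i k => Cmod (v k i) = s k) (Um1 hs (fun k h => proj2 (proj2 h))).
have eu k j : 0 < s k -> Cmod (vscaleR (/ s k) (v k) j) = Cmod (v k j) / s k.
  move=> h; rewrite /vscaleR /vscaleC CmodM CmodR Rabs_pos_eq; first by rewrite /Rdiv; ring.
  by left; apply: Rinv_0_lt_compat.
have [u hu] : exists u, Vlim (fun k => vscaleR (/ s k) (v k)) u.
  apply: (@Vlim_ex _ _ 1); apply: (Um1 hs) => k [h2 [h3 _]] j; rewrite eu //.
  apply: (Rmult_le_reg_r (s k)) => //; rewrite /Rdiv Rmult_assoc Rinv_l; last lra.
  by have := h3 j; lra.
exists s, u; split=> //.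
- by apply: (Um1 hs) => k [].
- move=> e; have : 1 <= Cmod (u i); last by rewrite e Cmod0; lra.
  apply: (Clim_mod_ge (hu i)); apply: (Um2 hs hi) => k [h2 _] h3.
  by rewrite eu // h3 /Rdiv Rinv_r; lra.
- move=> h0; have := Clim0_mod (h0 i) => h e he.
  by apply: (Um2 (h e he) hi) => k h2 <-.
Qed.

(** * The lattice *)

Section Lattice.
Variables (g : nat) (lam : Fin.t (Nat.mul 2 g) -> Cg g).
Hypothesis (Hlam : R_indep lam).

Lemma coord_map_surj z : exists x, coord_map lam x = z.
Proof.
have : row_full (vmat lam).
  rewrite /row_full; have /R_indep_row_free := Hlam; rewrite /row_free => /eqP ->.
  by apply/eqP; lia.
move=> /(submx_full (rv z)) /rspanP [a ha]; by exists a.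
Qed.

Lemma vsumD n (f h : Fin.t n -> Cg g) : vsum (fun i => vadd (f i) (h i)) = vadd (vsum f) (vsum h).
Proof.
rewrite /vsum; elim: n f h => [|n IH] f h /=; first by V_eq.
rewrite (IH (fun i => f (Fin.FS i)) (fun i => h (Fin.FS i))).
by move: (ffold _ _ _ _) (ffold _ _ _ _) => a b; V_eq.
Qed.

Lemma vsumZ n r (f : Fin.t n -> Cg g) : vsum (fun i => vscaleR r (f i)) = vscaleR r (vsum f).
Proof.
rewrite /vsum; elim: n f => [|n IH] f /=; first by V_eq.
rewrite (IH (fun i => f (Fin.FS i))).
by move: (ffold _ _ _ _) => a; V_eq.
Qed.

Lemma coord_mapD x y : coord_map lam (fun i => x i + y i) = vadd (coord_map lam x) (coord_map lam y).
Proof. by rewrite /coord_map -vsumD; congr vsum; apply: functional_extensionality => i; V_eq. Qed.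

Lemma coord_mapZ r x : coord_map lam (fun i => r * x i) = vscaleR r (coord_map lam x).
Proof. by rewrite /coord_map -vsumZ; congr vsum; apply: functional_extensionality => i; V_eq. Qed.

Lemma coord_map0 x : coord_map lam x = vzero -> forall i, x i = 0.
Proof. exact: Hlam. Qed.

Lemma in_latticeD u v : in_lattice lam u -> in_lattice lam v -> in_lattice lam (vadd u v).
Proof.
move=> [m ->] [n ->]; exists (fun i => Z.add (m i) (n i)); rewrite -vsumD; congr vsum.
by apply: functional_extensionality => i; rewrite plus_IZR; V_eq.
Qed.

Lemma in_latticeZ (k : Z) u : in_lattice lam u -> in_lattice lam (vscaleR (IZR k) u).
Proof.
move=> [m ->]; exists (fun i => Z.mul k (m i)); rewrite -vsumZ; congr vsum.
by apply: functional_extensionality => i; rewrite mult_IZR; V_eq.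
Qed.

Lemma in_lattice0 : in_lattice lam vzero.
Proof.
by exists (fun _ => Z0); rewrite (vsumZ 0 lam); V_eq.
Qed.

Lemma Cmod_ffold_le n (f : Fin.t n -> Cg g) M j : (forall i, Cmod (f i j) <= M) ->
  Cmod (vsum f j) <= INR n * M.
Proof.
rewrite /vsum; elim: n f => [|n IH] f h; first by rewrite /= /vzero Cmod0; lra.
rewrite S_INR; change (Cmod (f Fin.F1 j + ffold vadd vzero n (fun i => f (Fin.FS i)) j)%C <= (INR n + 1) * M).
have := Cmod_triangle (f Fin.F1 j) (ffold vadd vzero n (fun i => f (Fin.FS i)) j).
have := IH (fun i => f (Fin.FS i)) (fun i => h _); have := h Fin.F1; lra.
Qed.

Lemma lattice_cocompact : cocompact (in_lattice lam).
Proof.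
split; [exact: in_lattice0 | exact: in_latticeD | by move=> u; exact: (@in_latticeZ (Zneg xH)) |].
have [M [hM hlam]] : exists M, 0 < M /\ forall i j, Cmod (lam i j) <= M.
  apply: (@fin_max _ (fun i M => forall j, Cmod (lam i j) <= M)).
    by move=> i d d' hd h j; have := h j; lra.
  move=> i; have [M [hM h]] : exists M, 0 < M /\ forall j, Cmod (lam i j) <= M.
    apply: (@fin_max _ (fun j M => Cmod (lam i j) <= M)); first by move=> *; lra.
    by move=> j; exists (Cmod (lam i j)); lra.
  by exists M.
exists (INR (Nat.mul 2 g) * M) => z.
have [x <-] := coord_map_surj z.
pose n i := Z.opp (Int_part (x i)).
exists (coord_map lam (fun i => IZR (n i))); split; first by exists n.
move=> j; rewrite -coord_mapD; apply: Cmod_ffold_le => i.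
rewrite /vscaleR /vscaleC CmodM CmodR.
have [h1 h2] := base_Int_part (x i).
have : Rabs (x i + IZR (n i)) <= 1.
  by rewrite /n opp_IZR; apply: Rabs_le; lra.
have := hlam i j; have := Cmod_ge0 (lam i j); have := Rabs_pos (x i + IZR (n i)); nra.
Qed.

(** The integer coordinates are recovered linearly, hence tend to [0], and an integer of modulus
    below [1] is [0]. *)
Lemma lattice_discrete (z : nat -> Cg g) : (forall k, in_lattice lam (z k)) -> Vlim z vzero ->
  U (fun k => z k = vzero).
Proof.
move=> hz hl.
have [n hn] : exists n : nat -> Fin.t (Nat.mul 2 g) -> Z, forall k,
    z k = vsum (fun i => vscaleR (IZR (n k i)) (lam i)).
  exists (fun k => proj1_sig (constructive_indefinite_description _ (hz k))) => k.
  exact: (proj2_sig (constructive_indefinite_description _ (hz k))).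
have h0 i : U (fun k => n k i = Z0).
  have := @rv_mul_lim g _ (pinvmx (vmat lam)) z vzero (unfin i) hl 1 Rlt_0_1.
  have hf : row_free (vmat lam) by apply/R_indep_row_free.
  have e0 : ((rv vzero *m pinvmx (vmat lam)) ord0 (unfin i) = 0)%R by rewrite rv0 mul0mx mxE.
  have e k : ((rv (z k) *m pinvmx (vmat lam)) ord0 (unfin i))%R = IZR (n k i).
    by rewrite hn rv_vsum -mulmxA mulmxVp // mulmx1 mxE unfinK.
  move=> hb; apply: (Um1 hb) => k; rewrite e e0 Rminus_0_r => h.
  have : Z.lt (Zneg xH) (n k i) /\ Z.lt (n k i) (Zpos xH); last lia.
  by split; apply: lt_IZR; have := Rabs_def2 _ _ h; lra.
apply: (Um1 (Ufin_forall h0)) => k h; rewrite hn.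
have -> : (fun i => vscaleR (IZR (n k i)) (lam i)) = (fun i => vscaleR 0 (lam i)).
  by apply: functional_extensionality => i; rewrite h.
rewrite (vsumZ 0 lam); V_eq.
Qed.

(** Pigeonhole in the compact quotient: two multiples of [h] that are close modulo the lattice
    differ by a multiple [q h] close to a lattice vector. *)
Lemma dirichlet_lattice h : exists (q : nat -> nat) (n : nat -> Cg g),
  [/\ forall j, le 1 (q j), forall j, in_lattice lam (n j) &
      Vlim (fun j => vadd (vscaleR (INR (q j)) h) (vscaleR (-1) (n j))) vzero].
Proof.
have [l [y [hl hy]]] := boundedness_limit (fun k => vscaleR (INR k) h) lattice_cocompact.
have main j : exists w : nat * Cg g, [/\ le 1 w.1, in_lattice lam w.2 &
    forall i, Cmod (vadd (vscaleR (INR w.1) h) (vscaleR (-1) w.2) i) < / (INR j + 1)].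
  have he := inv_nat_gt0 j.
  have hn := Vlim_near hy (ltac:(lra) : 0 < / (INR j + 1) / 2).
  have [k hk] := Uex hn.
  have [k' [hk' hkk]] := Uex (Uand hn (Ucofin (S k))).
  exists ((k' - k)%N, vadd (l k) (vscaleR (-1) (l k'))); split=> /=.
  - lia.
  - apply: in_latticeD => //; exact: (@in_latticeZ (Zneg xH)).
  - move=> i; have := Cmod_sub_triangle (vadd (vscaleR (INR k') h) (l k') i) (y i) (vadd (vscaleR (INR k) h) (l k) i).
    rewrite (Cmod_sym (y i)); have := hk i; have := hk' i.
    have -> : INR (k' - k)%N = INR k' - INR k by rewrite -minus_INR //; lia.
    have -> : (vadd (vscaleR (INR k' - INR k) h) (vscaleR (-1) (vadd (l k) (vscaleR (-1) (l k')))) i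
      = vadd (vscaleR (INR k') h) (l k') i - vadd (vscaleR (INR k) h) (l k) i)%C.
      by rewrite /vadd /vscaleR /vscaleC; apply: C_ext => /=; ring.
    lra.
pose w j := proj1_sig (constructive_indefinite_description _ (main j)).
have hw j := proj2_sig (constructive_indefinite_description _ (main j)).
exists (fun j => (w j).1), (fun j => (w j).2); split.
- by move=> j; have [] := hw j.
- by move=> j; have [] := hw j.
- move=> i; apply: (@Clim0_squeeze _ (fun j => / (INR j + 1))); last exact: Rlim_inv_nat.
  by apply: Uall => j; have [_ _ h1] := hw j; left; exact: h1.
Qed.

End Lattice.

(** * From lines to torus cosets *)

Definition on_line g (Z : Cg g -> Prop) (w : Cg g) :=
  exists u, u <> vzero /\ forall t, Z (vadd w (vscaleR t u)).

Section Torus.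
Variables (g : nat) (lam : Fin.t (Nat.mul 2 g) -> Cg g) (Z : Cg g -> Prop).
Hypotheses (Hlam : R_indep lam) (Hper : periodic lam Z) (Han : analytic_set Z).

Lemma periodic_invariant : invariant (in_lattice lam) Z.
Proof. by move=> z l hz hl; apply/Hper; exists z, l. Qed.

Lemma Z_closed : closedV Z.
Proof. by move=> z l hz h; apply: analytic_set_closed h. Qed.

(** The directions are normalized, so that their limit is a nonzero direction. *)
Lemma on_line_closed : closedV (on_line Z).
Proof.
move=> z l hz h.
have [u hu] := Uchoice vzero h.
have [s [v [hs hv hlim _]]] := unit_limit (Um1 hu (fun k h => proj1 h)).
exists v; split=> // t.
apply: (Z_closed (z := fun k => vadd (z k) (vscaleR (t * / s k) (u k)))); last first.
  by apply: (Um1 hu) => k [_]; apply.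
have : Vlim (fun k => vadd (z k) (vscaleR t (vscaleR (/ s k) (u k)))) (vadd l (vscaleR t v)).
  apply: Vlim_add => // i; apply: Clim_mul; first exact: Clim_const.
  exact: hlim.
by apply: Vlim_ext; apply: Uall => k; V_eq.
Qed.

Lemma PSV_affine (a b : Cg g) c : PSV 1 (fun s => vadd a (vscaleC (c * s)%C b)).
Proof.
move=> i; exists (Cmod (a i) + 1 * Cmod (c * b i)%C).
apply: (@PS_ext _ _ (fun s => a i + s * (c * b i))%C).
  by move=> t _; rewrite /vadd /vscaleC; ring.
apply: PS_add; [lra | apply: PS_const; lra | apply: PS_mulX; [lra | apply: PS_const; lra]].
Qed.

(** A real line in [Z] fills a small complex disc around [a] by the identity theorem; from there the
    imaginary half-lines are followed by [arc_right]. *)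
Lemma complex_line a b : (forall t, Z (vadd a (vscaleR t b))) ->
  forall t, Z (vadd a (vscaleC (0, t) b)).
Proof.
have half b' : (forall t, Z (vadd a (vscaleR t b'))) -> forall t, 0 <= t -> Z (vadd a (vscaleC (0, t) b')).
  move=> h.
  have [d' [hd' hg]] := analytic_set_germ Han Rlt_0_1 (PSV_affine a b' C1).
  have hs s : Cmod s < d' -> Z (vadd a (vscaleC s b')).
    have := hg (fun k => C1 * RtoC (/ (INR k + 1)))%C (Clim_inv_nat C1).
    have h1 : U (fun k => (C1 * RtoC (/ (INR k + 1)))%C <> C0).
      apply: Uall => k; apply: Cmod_gt0_neq; rewrite CmodM Cmod1 CmodR.
      by have := inv_nat_gt0 k => hk; rewrite Rabs_pos_eq; lra.
    move=> /(_ h1) h2 hsd.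
    have e : (C1 * s)%C = s by ring.
    rewrite -e; apply: h2 => //; apply: Uall => k.
    have := h (/ (INR k + 1)); congr Z; by V_eq.
  move=> t ht.
  apply: (@arc_right g Z (fun x => vadd a (vscaleC (0, x) b')) (- 1) 0 (t + 1) Han); last lra.
  - move=> x _; exists 1, (fun s => vadd (vadd a (vscaleC (0, x) b')) (vscaleC ((0, 1) * s)%C b')).
    split; [lra | exact: PSV_affine | move=> y _; V_eq].
  - lra.
  - exists (d' / 2); split; first lra.
    move=> x hx; apply: hs; have := Cmod_le_re_im (0, x); rewrite /= Rabs_R0 Rabs_pos_eq; lra.
move=> h t; case: (Rle_dec 0 t) => ht; first exact: half.
have h' : forall t, Z (vadd a (vscaleR t (vscaleR (-1) b))).
  by move=> r; have := h (- r); congr Z; V_eq.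
have := half _ h' (- t) ltac:(lra).
by congr Z; V_eq.
Qed.

Lemma dirichlet_simultaneous k (a : Fin.t k -> R) e : 0 < e -> exists q (n : Fin.t k -> BinNums.Z),
  le 1 q /\ forall i, Rabs (IZR (n i) - INR q * a i) < e.
Proof.
move=> he; pose b t i := INR t * a i - IZR (Int_part (INR t * a i)).
have [y hy] : exists y : Fin.t k -> R, forall i, Rlim (fun t => b t i) (y i).
  apply: (@fin_choice k R (fun i y => Rlim (fun t => b t i) y)) => i.
  apply: (@Rlim_ex _ 1); apply: Uall => t; have [h1 h2] := base_Int_part (INR t * a i).
  by rewrite Rabs_pos_eq; rewrite /b; lra.
have hn := Ufin_forall (fun i => hy i (e / 2) ltac:(lra)).
have [t ht] := Uex hn.
have [t' [ht' htt]] := Uex (Uand hn (Ucofin (S t))).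
exists (t' - t)%N, (fun i => Z.sub (Int_part (INR t' * a i)) (Int_part (INR t * a i))).
split; first lia.
move=> i; have := Rabs_def2 _ _ (ht i); have := Rabs_def2 _ _ (ht' i).
have -> : INR (t' - t)%N = INR t' - INR t by rewrite -minus_INR //; lia.
by rewrite minus_IZR /b => h1 h2; apply: Rabs_def1; lra.
Qed.

Lemma vsum_lim k (c : nat -> Fin.t k -> R) c0 (x : Fin.t k -> Cg g) :
  (forall i, Rlim (fun j => c j i) (c0 i)) ->
  Vlim (fun j => vsum (fun i => vscaleR (c j i) (x i))) (vsum (fun i => vscaleR (c0 i) (x i))).
Proof.
rewrite /vsum; elim: k c c0 x => [|k IH] c c0 x h; first exact: Vlim_const.
apply: Vlim_add; last by apply: (IH (fun j i => c j (Fin.FS i))).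
by move=> i; apply: Clim_mul; [apply: Clim_RtoC | exact: Clim_const].
Qed.

(** Approximate [q a] by integers for a real relation [a]. The integer combination equals a
    combination with small coefficients, so it is a lattice vector tending to [0], hence [0].
    Independence over the integers makes the approximants [0], although [|q a_i|] is at least
    [|a_i|]. *)
Lemma Z_indep_R_indep k (x : Fin.t k -> Cg g) : (forall i, in_lattice lam (x i)) ->
  Z_indep x -> R_indep x.
Proof.
move=> hx hZi a ha.
have hL (c : Fin.t k -> BinNums.Z) : in_lattice lam (vsum (fun i => vscaleR (IZR (c i)) (x i))).
  rewrite /vsum; elim: (k) x hx c {hZi a ha} => [|k' IH] x hx c; first exact: in_lattice0.
  apply: in_latticeD; first exact: in_latticeZ.
  exact: (IH (fun i => x (Fin.FS i)) (fun i => hx _) (fun i => c (Fin.FS i))).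
have main j : exists w : nat * (Fin.t k -> BinNums.Z), le 1 w.1 /\
    forall i, Rabs (IZR (w.2 i) - INR w.1 * a i) < / (INR j + 1).
  by have [q [c h]] := dirichlet_simultaneous a (inv_nat_gt0 j); exists (q, c).
pose w j := proj1_sig (constructive_indefinite_description _ (main j)).
have hw j := proj2_sig (constructive_indefinite_description _ (main j)).
have e j : vsum (fun i => vscaleR (IZR ((w j).2 i)) (x i)) =
    vsum (fun i => vscaleR (IZR ((w j).2 i) - INR (w j).1 * a i) (x i)).
  have -> : (fun i => vscaleR (IZR ((w j).2 i) - INR (w j).1 * a i) (x i)) =
    (fun i => vadd (vscaleR (IZR ((w j).2 i)) (x i)) (vscaleR (- INR (w j).1) (vscaleR (a i) (x i)))).
    by apply: functional_extensionality => i; V_eq.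
  rewrite vsumD vsumZ ha; move: (vsum _) => s; rewrite /vzero; V_eq.
have hlim : Vlim (fun j => vsum (fun i => vscaleR (IZR ((w j).2 i)) (x i))) vzero.
  have h := @vsum_lim k (fun j i => IZR ((w j).2 i) - INR (w j).1 * a i) (fun _ => 0) x.
  have e0 : vsum (fun i => vscaleR 0 (x i)) = vzero.
    by rewrite vsumZ; move: (vsum _) => s; rewrite /vzero; V_eq.
  rewrite e0 in h; apply: (@Vlim_ext g _ _ _ _ (h _)); first by apply: Uall => j; rewrite e.
  move=> i; apply: (Rlim0_squeeze _ Rlim_inv_nat); apply: Uall => j.
  by have [_ h1] := hw j; left; exact: h1.
move=> i; apply: NNPP => hne.
apply: Ufalse; apply: (Um2 (lattice_discrete Hlam (fun j => hL (w j).2) hlim) (Rlim_inv_nat (Rabs_pos_lt _ hne))).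
move=> j h1 h2; have h3 := hZi _ h1 i.
have [h4 h5] := hw j; have := h5 i; rewrite h3 => h6.
have h7 := le_INR _ _ h4.
move: h2; rewrite Rminus_0_r (Rabs_pos_eq (/ _)); last by left; exact: inv_nat_gt0.
move: h6; rewrite Rminus_0_l Rabs_Ropp Rabs_mult (Rabs_pos_eq (INR _)); last exact: pos_INR.
have := Rabs_pos (a i); move: h7; rewrite /=; nra.
Qed.

Section Maximal.
Variables (w : Cg g) (m : nat) (v : Fin.t m -> Cg g).
Hypotheses (hv : R_indep v) (hZ : forall h, rspan v h -> Z (vadd w h)).
Hypothesis (hmax : forall v' : Fin.t (S m) -> Cg g, R_indep v' ->
  ~ (forall h, rspan v' h -> Z (vadd w h))).

Lemma maximal_span u : (forall h t, rspan v h -> Z (vadd w (vadd h (vscaleR t u)))) -> rspan v u.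
Proof.
move=> hu; apply: NNPP => hn.
apply: (hmax (R_indep_cons hv hn)) => h [a ->].
have -> : vsum (fun i => vscaleR (a i) (fcons u v i)) =
  vadd (vscaleR (a Fin.F1) u) (vsum (fun i => vscaleR (a (Fin.FS i)) (v i))) by [].
have := hu _ (a Fin.F1) (ex_intro _ (fun i => a (Fin.FS i)) erefl).
by congr Z; move: (vsum _) => s; V_eq.
Qed.

(** Through each point [w + h] the real line in direction [u] lies in [Z], so the line in direction
    [i u] does too, and maximality puts [i u] in the span. *)
Lemma maximal_complex : complex_subspace (rspan v).
Proof.
have [h0 [hD hS]] := rspan_subspace v.
split=> //; split=> // a u hu.
have hiu : rspan v (vscaleC (0, 1) u).
  apply: maximal_span => h t hh.
  have := @complex_line (vadd w h) u.
  have hl r : Z (vadd (vadd w h) (vscaleR r u)).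
    by have := hZ (hD _ _ hh (hS r _ hu)); congr Z; V_eq.
  by move=> /(_ hl t); congr Z; V_eq.
have -> : vscaleC a u = vadd (vscaleR (fst a) u) (vscaleR (snd a) (vscaleC (0, 1) u)) by V_eq.
by apply: hD; exact: hS.
Qed.

Variables (n : nat) (l : Fin.t n -> Cg g).
Hypotheses (hl : R_indep l) (hlH : forall i, rspan v (l i) /\ in_lattice lam (l i)).
Hypothesis (hlmax : forall l' : Fin.t (S n) -> Cg g, R_indep l' ->
  ~ (forall i, rspan v (l' i) /\ in_lattice lam (l' i))).

Lemma lattice_in_span z : rspan v z -> in_lattice lam z -> rspan l z.
Proof.
move=> hz hz'; apply: NNPP => hn.
apply: (hlmax (R_indep_cons hl hn)) => i.
by apply: (Fin.caseS' i (fun i => rspan v (fcons z l i) /\ in_lattice lam (fcons z l i))).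
Qed.

(** Multiples [q h] of [h] are close to lattice vectors [nn]. If these lie in the span of [v], they
    lie in the span of [l], and [h] is forced into the latter. If they do not, their small
    components transverse to the span of [v] accumulate on a new direction along which [Z] could be
    enlarged, contrary to maximality. *)
Lemma maximal_spanned h : rspan v h -> rspan l h.
Proof.
move=> hh.
have [h0 [hD hS]] := rspan_subspace v.
have [q [nn [hq hn hlim]]] := dirichlet_lattice Hlam h.
pose dl j := vadd (vscaleR (INR (q j)) h) (vscaleR (-1) (nn j)).
case: (Uem (fun j => rspan v (nn j))) => hcase.
  (* Modulo the span of [l], the vectors [q h] tend to [0] while [q >= 1], so [h] is [0] there. *)
  have [pi [p1 p2 p3 p4 p5]] := projection_along l.
  suff e : pi h = vzero.
    have := p1 h; rewrite e; congr rspan; by V_eq.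
  apply: functional_extensionality => i; apply: Cmod_eq0.
  apply: Rle_antisym; last exact: Cmod_ge0.
  have := p5 _ _ hlim i.
  have -> : pi vzero i = C0 by rewrite p2 //; have [] := rspan_subspace l.
  move=> hl0; have [M hM] : exists M, M = Cmod (pi h i) by exists (Cmod (pi h i)).
  rewrite -hM -Cmod0; apply: (Clim_mod_ge hl0); apply: (Um1 hcase) => j hj.
  rewrite p3 !p4 (p2 (nn j)); last by apply: lattice_in_span.
  rewrite /vadd /vscaleR /vscaleC /vzero.
  have -> : (RtoC (INR (q j)) * pi h i + RtoC (-1) * C0 = RtoC (INR (q j)) * pi h i)%C by ring.
  rewrite CmodM CmodR Rabs_pos_eq; last exact: pos_INR.
  have := le_INR _ _ (hq j); rewrite hM /= => h1; have := Cmod_ge0 (pi h i); nra.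
(* The transverse components [pi (dl j)] are nonzero and tend to [0]; [u] is the limit of their
   directions and is itself transverse, [pi u = u]. *)
have [pi [p1 p2 p3 p4 p5]] := projection_along v.
have hd0 : U (fun j => pi (dl j) <> vzero).
  apply: (Um1 hcase) => j hj e; apply: hj.
  have := p1 (dl j); rewrite e => h1.
  have -> : nn j = vadd (vscaleR (INR (q j)) h) (vscaleR (-1) (vadd (dl j) (vscaleR (-1) vzero))).
    by rewrite /dl /vzero; V_eq.
  by apply: hD; apply: hS.
have hpl : Vlim (fun j => pi (dl j)) vzero.
  have := p5 _ _ hlim; by rewrite (p2 vzero).
have [s [u [hs hu hul hsl]]] := unit_limit hd0.
have {}hsl := hsl hpl.
have pidem x : pi (pi x) = pi x.
  have e : x = vadd (vadd x (vscaleR (-1) (pi x))) (pi x) by V_eq.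
  rewrite {2}e p3 (p2 _ (p1 x)).
  by rewrite /vzero; V_eq.
exfalso; apply: hu.
have piu : pi u = u.
  apply: functional_extensionality => i.
  apply: Clim_uniq (p5 _ _ hul i) _; apply: Clim_ext (hul i).
  by apply: Uall => k; rewrite p4 pidem.
rewrite -piu; apply: p2; apply: maximal_span => h1 t hh1.
(* Since the lengths [s j] tend to [0], the products [c j * s j] tend to [t]: integer multiples of
   the small vectors reach every point of the line along [u]. *)
pose c j := Int_part (t / s j).
apply: (Z_closed (z := fun j => vadd w (vadd h1 (vscaleR (IZR (c j)) (pi (dl j)))))).
  apply: Vlim_add; first exact: Vlim_const.
  apply: Vlim_add; first exact: Vlim_const.
  move=> i.
  have hcs : Rlim (fun j => IZR (c j) * s j) t.
    move=> e he; apply: (Um2 hs (hsl e he)) => j hsj; rewrite Rminus_0_r Rabs_pos_eq; last lra.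
    move=> hse; have [b1 b2] := base_Int_part (t / s j).
    have e1 : t / s j * s j = t by field; lra.
    by apply: Rabs_def1; rewrite /c; nra.
  have := Clim_mul (Clim_RtoC hcs) (hul i).
  apply: Clim_ext; apply: (Um1 hs) => j hsj.
  by rewrite /vscaleR /vscaleC; apply: C_ext => /=; field; lra.
apply: Uall => j.
(* An integer multiple of [pi (dl j)] is a vector of the span of [v] minus [c j] times the lattice
   vector [nn j], which is why the point lies in [Z]. *)
have e : vadd w (vadd h1 (vscaleR (IZR (c j)) (pi (dl j)))) =
  vadd (vadd w (vadd h1 (vadd (vscaleR (IZR (c j) * INR (q j)) h)
     (vscaleR (- IZR (c j)) (vadd (dl j) (vscaleR (-1) (pi (dl j))))))))
   (vscaleR (IZR (Z.opp (c j))) (nn j)).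
  by rewrite opp_IZR /dl; V_eq.
rewrite e; apply: periodic_invariant; last by apply: in_latticeZ.
apply: hZ; apply: (hD) => //; apply: (hD); apply: (hS) => //; exact: p1.
Qed.

Lemma indep_sub k (P : Cg g -> Prop) (x : Fin.t k -> Cg g) j : (forall i, P (x i)) -> R_indep x ->
  le j k -> exists y : Fin.t j -> Cg g, (forall i, P (y i)) /\ R_indep y.
Proof.
move=> hP hx; elim: k x hP hx => [|k IH] x hP hx hj.
  have -> : j = O by lia.
  by exists x.
case: (Nat.eq_dec j (S k)) => [->|hne]; first by exists x.
apply: (IH (fun i => x (Fin.FS i))) => //; last lia.
exact: R_indep_tail.
Qed.

(** Since [l] consists of lattice vectors and spans the subspace, independent families of either
    kind have at most [n] members, and subfamilies of [l] realize each smaller number. *)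
Lemma maximal_full : full lam (rspan v).
Proof.
move=> k; split=> [[x [hx hxi]]|[x [hx hxi]]].
  exists x; split; first by move=> i; have [] := hx i.
  by apply: Z_indep_R_indep => // i; have [] := hx i.
have hk : le k n.
  have hsub : (vmat x <= vmat l)%MS.
    apply/row_subP => i; rewrite rowK; apply/rspanP; exact: maximal_spanned.
  have /R_indep_row_free := hxi; rewrite /row_free => /eqP <-.
  by apply/leP; apply: (leq_trans (mxrankS hsub)); exact: rank_leq_row.
have [y [hy hyi]] := @indep_sub n (fun z => rspan v z /\ in_lattice lam z) l k hlH hl hk.
exists y; split=> // a ha i.
by apply: eq_IZR; apply: (hyi (fun i => IZR (a i)) ha).
Qed.

End Maximal.

Lemma on_line_torus w : on_line Z w -> Ztorus lam Z w.
Proof.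
move=> [u [hu hZ]].
pose P m := exists v : Fin.t m -> Cg g, R_indep v /\ forall h, rspan v h -> Z (vadd w h).
have P1 : P 1%N.
  exists (fun _ => u); split.
    move=> a ha i; apply: NNPP => hne; apply: hu.
    have ha' : vadd (vscaleR (a Fin.F1) u) vzero = vzero by [].
    have hi : i = Fin.F1.
      by apply: (Fin.caseS' i (fun i => i = Fin.F1)) => // j; exact: (Fin.case0 (fun j => Fin.FS j = Fin.F1)).
    rewrite hi in hne.
    have -> : u = vscaleR (/ a Fin.F1) (vadd (vscaleR (a Fin.F1) u) vzero).
      apply: functional_extensionality => j; rewrite /vadd /vscaleR /vscaleC /vzero.
      by apply: C_ext => /=; field.
    by rewrite ha'; rewrite /vzero; V_eq.
  move=> h [a ->]; have := hZ (a Fin.F1).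
  by congr Z; rewrite /vsum /= /vzero; V_eq.
have hB n : P n -> le n (g + g)%N by move=> [v [hv _]]; exact: R_indep_le hv.
(* The maximum is taken over dimensions [S n], so the maximal subspace is nonzero. *)
have [m' [hm' hmax']] := @max_exists (fun n => P (S n)) (g + g)%N P1 (fun n h => ltac:(have := hB _ h; lia)).
have [v [hv hvZ]] := hm'.
have hmax : forall v' : Fin.t (S (S m')) -> Cg g, R_indep v' -> ~ (forall h, rspan v' h -> Z (vadd w h)).
  move=> v' hv' hv'Z; have : P (S (S m')) by exists v'.
  by move=> /hmax'; lia.
have [n [[l [hl hlH]] hlmax']] := @max_exists (fun n => exists l : Fin.t n -> Cg g, R_indep l /\
   (forall i, rspan v (l i) /\ in_lattice lam (l i))) (g + g)%N
   ltac:(by exists (fun _ => vzero); split; [move=> a _ i; exact: (Fin.case0 (fun i => a i = 0)) | move=> i; exact: (Fin.case0 (fun _ => _))])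
   (fun n h => ltac:(by have [l [hl _]] := h; exact: R_indep_le hl)).
have hlmax : forall l' : Fin.t (S n) -> Cg g, R_indep l' ->
  ~ (forall i, rspan v (l' i) /\ in_lattice lam (l' i)).
  move=> l' hl' hl'H; have := hlmax' (S n) (ex_intro _ l' (conj hl' hl'H)); lia.
exists w, (rspan v); split; first exact: (maximal_complex hv hvZ hmax).
split; first exact: (maximal_full hv hvZ hmax hl hlH hlmax).
split.
  exists (v Fin.F1); split; first exact: rspan_gen.
  move=> e.
  have := hv (fcons 1 (fun _ => 0)).
  have e0 : vsum (fun i => vscaleR (fcons 1 (fun _ => 0) i) (v i)) = vzero.
    have -> : vsum (fun i => vscaleR (fcons 1 (fun _ => 0) i) (v i)) =
      vadd (vscaleR 1 (v Fin.F1)) (vsum (fun i => vscaleR 0 (v (Fin.FS i)))) by [].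
    by rewrite e vsumZ; move: (vsum _) => s; rewrite /vzero; V_eq.
  by move=> /(_ e0 Fin.F1) /= e1; lra.
split=> //; exists vzero; split; first by have [] := rspan_subspace v.
by rewrite /vzero; V_eq.
Qed.

End Torus.

(** * Torus cosets contain real lines *)

Section Lines.
Variables (n : nat) (x0 y : Fin.t n -> R).

Definition line (x : Fin.t n -> R) := exists t, x = fun i => x0 i + t * y i.

Lemma line_connected : connected line.
Proof.
pose c t : Fin.t n -> R := fun i => x0 i + t * y i.
have near W t : open_Rn W -> W (c t) -> exists e, 0 < e /\ forall t', Rabs (t' - t) < e -> W (c t').
  move=> oW hW; have [r [hr h]] := oW _ hW.
  have [M [hM hy]] : exists M, 0 < M /\ forall i, Rabs (y i) <= M.
    by apply: fin_max; [move=> *; lra | move=> i; exists (Rabs (y i)); lra].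
  exists (r / M); split; first exact: Rdiv_lt_0_compat.
  move=> t' ht; apply: h => i.
  have -> : c t' i - c t i = (t' - t) * y i by rewrite /c; ring.
  rewrite Rabs_mult.
  have h1 : Rabs (t' - t) * M < r.
    have -> : r = r / M * M by field; lra.
    exact: Rmult_lt_compat_r.
  have := hy i; have := Rabs_pos (y i); have := Rabs_pos (t' - t); nra.
have main W V a b : open_Rn W -> open_Rn V -> (forall x, line x -> W x \/ V x) ->
   (forall x, line x -> W x -> V x -> False) -> W (c a) -> V (c b) -> a <= b -> False.
  move=> oW oV hc hd hW hV hab.
  have hl t : line (c t) by exists t.
  suff : W (c b) by move=> hWb; exact: (hd _ (hl b)).
  move: hab; apply: (@real_induction (fun t => W (c t))) => //.
  - move=> t ht h; have [e [he h1]] := near W t oW (h t ltac:(lra)).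
    by exists (e / 2); split; [lra | move=> t' ht'; apply: h1; rewrite Rabs_pos_eq; lra].
  - move=> t ht h; case: (hc _ (hl t)) => // hVt.
    have [e [he h1]] := near V t oV hVt.
    have h2 := Rmax_l a (t - e / 2); have h3 := Rmax_r a (t - e / 2).
    have h4 : Rmax a (t - e / 2) < t by apply: Rmax_lub_lt; lra.
    exfalso; apply: (hd _ (hl (Rmax a (t - e / 2)))); first by apply: h; lra.
    by apply: h1; rewrite -Rabs_Ropp Rabs_pos_eq; lra.
move=> [W [V [oW [oV [[a' [[a ->] ha]] [[b' [[b ->] hb]] [hc hd]]]]]]].
case: (Rle_dec a b) => hab; first exact: (main W V a b).
apply: (main V W b a) => //; last lra.
  by move=> x hx; case: (hc x hx); [right | left].
by move=> x hx hV hW; exact: (hd x).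
Qed.

Variable i0 : Fin.t n.
Hypothesis (hy : y i0 <> 0).

Lemma line_dim : dim_ge line 1.
Proof.
exists (fun _ => i0); split.
  move=> i j _.
  have h k : k = Fin.F1 :> Fin.t 1.
    by apply: (Fin.caseS' k (fun k => k = Fin.F1)) => // j'; exact: (Fin.case0 (fun j => Fin.FS j = Fin.F1)).
  by rewrite (h i) (h j).
exists (fun _ => 0), 1; split; first lra.
move=> v _; exists (fun i => x0 i + (v Fin.F1 - x0 i0) / y i0 * y i); split.
  by exists ((v Fin.F1 - x0 i0) / y i0).
move=> j; apply: (Fin.caseS' j (fun j => _ = v j)); last by move=> j'; exact: (Fin.case0 (fun j => _ = v (Fin.FS j))).
by field.
Qed.

Lemma sa_conj m (F : Fin.t m -> saform n) : exists G, forall x, sa_holds G x <-> forall j, sa_holds (F j) x.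
Proof.
elim: m F => [|m IH] F.
  by exists (Fzero (Pconst 0)) => x; split=> // _; exact: Fin.case0.
have [G hG] := IH (fun j => F (Fin.FS j)).
exists (Fand (F Fin.F1) G) => x /=; rewrite hG; split=> [[h1 h2] j|h]; last by split.
by apply: (Fin.caseS' j (fun j => sa_holds (F j) x)).
Qed.

(** The parameter of the line is eliminated through the coordinate [i0], on which it depends
    nontrivially. *)
Lemma line_semialgebraic : semialgebraic line.
Proof.
have [G hG] := @sa_conj n (fun j => Fzero (Padd (Pmul (Pconst (y i0)) (Padd (Pvar j) (Pconst (- x0 j))))
  (Pmul (Pconst (- y j)) (Padd (Pvar i0) (Pconst (- x0 i0)))))).
exists G => x; rewrite hG; split=> [[t ->] j /=|h]; first ring.
exists ((x i0 - x0 i0) / y i0); apply: functional_extensionality => j.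
have /= h1 := h j.
apply: (Rmult_eq_reg_l (y i0)) => //.
have -> : y i0 * (x0 j + (x i0 - x0 i0) / y i0 * y j) = y i0 * x0 j + (x i0 - x0 i0) * y j by field.
lra.
Qed.

End Lines.

(** A real line through the point, in a nonzero direction of the coset, serves as the semi-algebraic
    set. *)
Lemma torus_alg g (lam : Fin.t (Nat.mul 2 g) -> Cg g) (Z : Cg g -> Prop) w :
  R_indep lam -> Ztorus lam Z w -> Zalg lam Z w.
Proof.
move=> Hlam [z [H [[h0 [hD hS]] [_ [[v [hv hv0]] [hZ [h [hh ->]]]]]]]].
have [x0 hx0] := coord_map_surj Hlam (vadd z h).
have [y hy] := coord_map_surj Hlam v.
have [i0 hi0] : exists i, y i <> 0.
  apply: NNPP => hn; apply: hv0; rewrite -hy.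
  have -> : y = fun i => 0 * y i.
    by apply: functional_extensionality => i; rewrite Rmult_0_l; apply: NNPP => hi; apply: hn; exists i.
  by rewrite coord_mapZ; move: (coord_map _ _) => s; rewrite /vzero; V_eq.
exists (line x0 y); split; first exact: line_semialgebraic hi0.
split; first exact: line_connected.
split; first exact: line_dim hi0.
split.
  move=> x [t ->]; rewrite coord_mapD coord_mapZ hx0 hy.
  have -> : vadd (vadd z h) (vscaleR t v) = vadd z (vadd h (vscaleR t v)) by V_eq.
  by apply: hZ; apply: hD => //; exact: hS.
exists x0; split; last by rewrite hx0.
by exists 0; apply: functional_extensionality => i; ring.
Qed.

(** * Polynomials and their analytic roots *)

Definition K : numClosedFieldType := complex R.

Definition toK (z : C) : K := (Complex (fst z) (snd z) : complex R).
Definition ofK (x : K) : C := (complex.Re (x : complex R), complex.Im (x : complex R)).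

Lemma toKK z : ofK (toK z) = z. Proof. by case: z. Qed.
Lemma ofKK x : toK (ofK x) = x. Proof. by case: x. Qed.
Lemma ofKD (x y : K) : ofK (x + y)%R = (ofK x + ofK y)%C. Proof. by case: x; case: y. Qed.
Lemma ofKM (x y : K) : ofK (x * y)%R = (ofK x * ofK y)%C.
Proof. by case: x => a b; case: y => c d; apply: C_ext. Qed.
Lemma ofK0 : ofK (0%R : K) = C0. Proof. by []. Qed.
Lemma toK0 : toK C0 = 0%R. Proof. by []. Qed.
Lemma ofK_inj : injective ofK. Proof. exact: can_inj ofKK. Qed.
Lemma toK_inj : injective toK. Proof. exact: can_inj toKK. Qed.
Lemma ofK_eq0 (x : K) : ofK x = C0 <-> x = 0%R.
Proof. by split=> [h|->//]; apply: ofK_inj. Qed.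
Lemma ofKX (x : K) n : ofK (x ^+ n)%R = (ofK x ^ n)%C.
Proof. by elim: n => [|n IH] //; rewrite GRing.exprS ofKM IH. Qed.

Definition ev (p : {poly K}) (z : C) : C := ofK p.[toK z]%R.
(** A polynomial in [w], the outer variable, with coefficients in [t], the inner one. Derivatives
    below are with respect to [w]. *)
Definition ev2 (Q : {poly {poly K}}) (t w : C) : C := ofK (Q.[(toK w)%:P].[toK t])%R.

Lemma evD (p q : {poly K}) z : ev (p + q)%R z = (ev p z + ev q z)%C.
Proof. by rewrite /ev hornerD ofKD. Qed.
Lemma evM (p q : {poly K}) z : ev (p * q)%R z = (ev p z * ev q z)%C.
Proof. by rewrite /ev hornerM ofKM. Qed.
Lemma evX z : ev 'X%R z = z.
Proof. by rewrite /ev hornerX toKK. Qed.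
Lemma evXn n z : ev ('X^n)%R z = (z ^ n)%C.
Proof. by rewrite /ev hornerXn ofKX toKK. Qed.
Lemma evC c z : ev (c%:P)%R z = ofK c.
Proof. by rewrite /ev hornerC. Qed.
Lemma ev0 z : ev 0%R z = C0.
Proof. by rewrite /ev horner0. Qed.
Lemma evMXaddC p c z : ev (p * 'X + c%:P)%R z = (ev p z * z + ofK c)%C.
Proof. by rewrite evD evM evX evC. Qed.

Lemma ev2D (P Q : {poly {poly K}}) t w : ev2 (P + Q)%R t w = (ev2 P t w + ev2 Q t w)%C.
Proof. by rewrite /ev2 !hornerD ofKD. Qed.
Lemma ev2M (P Q : {poly {poly K}}) t w : ev2 (P * Q)%R t w = (ev2 P t w * ev2 Q t w)%C.
Proof. by rewrite /ev2 !hornerM ofKM. Qed.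
Lemma ev2C c t w : ev2 (c%:P)%R t w = ev c t.
Proof. by rewrite /ev2 hornerC. Qed.
Lemma ev2X t w : ev2 'X%R t w = w.
Proof. by rewrite /ev2 hornerX hornerC toKK. Qed.
Lemma ev2_0 t w : ev2 0%R t w = C0.
Proof. by rewrite /ev2 !horner0. Qed.
Lemma ev2MXaddC P c t w : ev2 (P * 'X + c%:P)%R t w = (ev2 P t w * w + ev c t)%C.
Proof. by rewrite ev2D ev2M ev2X ev2C. Qed.
Lemma ev2_derivMXaddC P (c : {poly K}) t w :
  ev2 (P * 'X + c%:P)^`()%R t w = (ev2 P^`()%R t w * w + ev2 P t w)%C.
Proof. by rewrite derivD derivC GRing.addr0 derivM derivX GRing.mulr1 ev2D ev2M ev2X. Qed.

Lemma ev_PS (p : {poly K}) : exists A, 0 <= A /\ forall d, 0 < d <= 1 ->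
  PS d (A * d) (fun t => ev p t - ev p C0)%C.
Proof.
elim/poly_ind: p => [|p c [A [hA H]]].
  exists 0; split; first lra; move=> d hd; rewrite Rmult_0_l.
  apply: (@PS_ext _ _ (fun _ => C0)); first by move=> t _; rewrite !ev0; ring.
  by rewrite -Cmod0; apply: PS_const; lra.
have h0 := Cmod_ge0 (ev p C0).
exists (A + Cmod (ev p C0)); split; first lra; move=> d hd.
apply: (@PS_ext _ _ (fun t => t * ((ev p t - ev p C0) + ev p C0))%C).
  by move=> t _; rewrite !evMXaddC; ring.
apply: (@PS_mono _ (d * (A * d + Cmod (ev p C0)))); first lra.
  by have := Rmult_le_pos A (1 - d) hA ltac:(lra); nra.
apply: PS_mulX; first lra.
by apply: PS_add; [lra | exact: H | apply: PS_const; lra].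
Qed.

Lemma ev2_PS (Q : {poly {poly K}}) : exists A, 0 <= A /\ forall d e w, 0 < d <= 1 -> 0 < e <= 1 ->
  PS d e w -> PS d (A * (d + e)) (fun t => ev2 Q t (w t) - ev2 Q C0 C0)%C.
Proof.
elim/poly_ind: Q => [|P c [A [hA H]]].
  exists 0; split; first lra; move=> d e w hd he _; rewrite Rmult_0_l.
  apply: (@PS_ext _ _ (fun _ => C0)); first by move=> t _; rewrite !ev2_0; ring.
  by rewrite -Cmod0; apply: PS_const; lra.
have [B [hB H']] := ev_PS c.
have h0 := Cmod_ge0 (ev2 P C0 C0).
exists (A * 2 + Cmod (ev2 P C0 C0) + B); split; first lra; move=> d e w hd he hw.
apply: (@PS_ext _ _ (fun t => ((ev2 P t (w t) - ev2 P C0 C0) + ev2 P C0 C0) * w t + (ev c t - ev c C0))%C).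
  by move=> t _; rewrite !ev2MXaddC; ring.
apply: (@PS_mono _ ((A * (d + e) + Cmod (ev2 P C0 C0)) * e + B * d)); first lra.
  have h1 : A * (d + e) * e <= A * 2 * e.
    by apply: Rmult_le_compat_r; [lra | apply: Rmult_le_compat_l; lra].
  have h2 := Rmult_le_pos _ _ hA (ltac:(lra) : 0 <= d).
  have h3 := Rmult_le_pos _ _ hB (ltac:(lra) : 0 <= e).
  have h4 := Rmult_le_pos _ _ h0 (ltac:(lra) : 0 <= d).
  nra.
apply: PS_add; [lra | | exact: H'].
apply: PS_mul; [lra | | exact: hw].
by apply: PS_add; [lra | exact: H | apply: PS_const; lra].
Qed.

Lemma ev_near0 (p : {poly K}) : exists A, 0 <= A /\ forall t, Cmod t <= 1 ->
  Cmod (ev p t - ev p C0)%C <= A * Cmod t.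
Proof.
elim/poly_ind: p => [|p c [A [hA H]]].
  exists 0; split; first lra; move=> t _; rewrite !ev0.
  have -> : (C0 - C0 = C0)%C by ring.
  by rewrite Cmod0; lra.
have h0 := Cmod_ge0 (ev p C0).
exists (A + Cmod (ev p C0)); split; first lra; move=> t ht.
rewrite !evMXaddC.
have -> : (ev p t * t + ofK c - (ev p C0 * C0 + ofK c) = ((ev p t - ev p C0) + ev p C0) * t)%C by ring.
rewrite CmodM; apply: Rmult_le_compat_r; first exact: Cmod_ge0.
have := Cmod_triangle (ev p t - ev p C0)%C (ev p C0); have := H t ht; have := Cmod_ge0 t; nra.
Qed.

Lemma ev2_near0 (Q : {poly {poly K}}) : exists A, 0 <= A /\ forall t w, Cmod t <= 1 -> Cmod w <= 1 ->
  Cmod (ev2 Q t w - ev2 Q C0 C0)%C <= A * (Cmod t + Cmod w).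
Proof.
elim/poly_ind: Q => [|P c [A [hA H]]].
  exists 0; split; first lra; move=> t w _ _; rewrite !ev2_0.
  have -> : (C0 - C0 = C0)%C by ring.
  by rewrite Cmod0; lra.
have [B [hB H']] := ev_near0 c.
have h0 := Cmod_ge0 (ev2 P C0 C0).
exists (A * 2 + Cmod (ev2 P C0 C0) + B); split; first lra; move=> t w ht hw.
rewrite !ev2MXaddC.
have -> : (ev2 P t w * w + ev c t - (ev2 P C0 C0 * C0 + ev c C0) =
  ((ev2 P t w - ev2 P C0 C0) + ev2 P C0 C0) * w + (ev c t - ev c C0))%C by ring.
apply: (Rle_trans _ _ _ (Cmod_triangle _ _)); rewrite CmodM.
have h1 := Cmod_triangle (ev2 P t w - ev2 P C0 C0)%C (ev2 P C0 C0).
have h2 := H t w ht hw; have h3 := H' t ht; have h4 := Cmod_ge0 t; have h5 := Cmod_ge0 w.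
have h6 : A * (Cmod t + Cmod w) <= A * 2 by apply: Rmult_le_compat_l; lra.
have h7 : Cmod (ev2 P t w - ev2 P C0 C0 + ev2 P C0 C0)%C * Cmod w <= (A * 2 + Cmod (ev2 P C0 C0)) * Cmod w.
  by apply: Rmult_le_compat_r; lra.
have := Rmult_le_pos _ _ hB h5; have := Rmult_le_pos _ _ hA h4; have := Rmult_le_pos _ _ h0 h4; nra.
Qed.

(** The error of the linearization in [w] at the origin has a Lipschitz constant that tends to [0]
    with the arguments. This is what makes the Newton iteration below contract. *)
Lemma ev2_diff (Q : {poly {poly K}}) : exists A, 0 <= A /\ forall t w w', Cmod t <= 1 -> Cmod w <= 1 ->
  Cmod w' <= 1 ->
  Cmod (ev2 Q t w - ev2 Q t w' - ev2 Q^`()%R C0 C0 * (w - w'))%C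
    <= A * (Cmod t + Cmod w + Cmod w') * Cmod (w - w')%C.
Proof.
elim/poly_ind: Q => [|P c [A [hA H]]].
  exists 0; split; first lra; move=> t w w' _ _ _; rewrite deriv0 !ev2_0.
  have -> : (C0 - C0 - C0 * (w - w') = C0)%C by ring.
  by rewrite Cmod0; lra.
have [B [hB H']] := ev2_near0 P.
have h0 := Cmod_ge0 (ev2 P^`()%R C0 C0).
exists (B + A * 3 + Cmod (ev2 P^`()%R C0 C0)); split; first lra; move=> t w w' ht hw hw'.
rewrite !ev2MXaddC ev2_derivMXaddC.
set k := ev2 P^`()%R C0 C0.
have -> : (ev2 P t w * w + ev c t - (ev2 P t w' * w' + ev c t) - (k * C0 + ev2 P C0 C0) * (w - w') =
  (ev2 P t w - ev2 P C0 C0) * (w - w') + ((ev2 P t w - ev2 P t w' - k * (w - w')) + k * (w - w')) * w')%C by ring.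
apply: (Rle_trans _ _ _ (Cmod_triangle _ _)); rewrite !CmodM.
have h1 := H t w w' ht hw hw'; have h2 := H' t w ht hw.
have h3 := Cmod_triangle (ev2 P t w - ev2 P t w' - k * (w - w'))%C (k * (w - w'))%C.
rewrite CmodM in h3.
have h4 := Cmod_ge0 t; have h5 := Cmod_ge0 w; have h6 := Cmod_ge0 w'; have h7 := Cmod_ge0 (w - w')%C.
have h8 : A * (Cmod t + Cmod w + Cmod w') * Cmod (w - w')%C <= A * 3 * Cmod (w - w')%C.
  by apply: Rmult_le_compat_r => //; apply: Rmult_le_compat_l; lra.
rewrite -/k in h0 h1.
have h9 : Cmod (ev2 P t w - ev2 P t w' - k * (w - w') + k * (w - w'))%C <= (A * 3 + Cmod k) * Cmod (w - w')%C by lra.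
have h10 : Cmod (ev2 P t w - ev2 P C0 C0)%C * Cmod (w - w')%C <= B * (Cmod t + Cmod w) * Cmod (w - w')%C.
  by apply: Rmult_le_compat_r.
have h11 : Cmod (ev2 P t w - ev2 P t w' - k * (w - w') + k * (w - w'))%C * Cmod w' <=
   (A * 3 + Cmod k) * Cmod (w - w')%C * Cmod w' by apply: Rmult_le_compat_r.
have -> : (B + A * 3 + Cmod k) * (Cmod t + Cmod w + Cmod w') * Cmod (w - w')%C =
  B * (Cmod t + Cmod w) * Cmod (w - w')%C + (A * 3 + Cmod k) * Cmod (w - w')%C * Cmod w'
  + (B * Cmod w' + (A * 3 + Cmod k) * (Cmod t + Cmod w)) * Cmod (w - w')%C by ring.
have : 0 <= (B * Cmod w' + (A * 3 + Cmod k) * (Cmod t + Cmod w)) * Cmod (w - w')%C.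
  apply: Rmult_le_pos => //.
  have := Rmult_le_pos _ _ hB h6; have := Rmult_le_pos (A * 3 + Cmod k) (Cmod t + Cmod w) ltac:(lra) ltac:(lra); lra.
lra.
Qed.

(** Simplified Newton iteration [w - Q(t, w) / k] with [k] the derivative at the origin. It
    preserves the ball of radius [e] in the series norm, so the limit is a power series, and it
    contracts by [1/2] pointwise, which gives convergence and uniqueness. *)
Lemma implicit_function (Q : {poly {poly K}}) e0 : 0 < e0 -> ev2 Q C0 C0 = C0 ->
  ev2 Q^`()%R C0 C0 <> C0 -> exists d e phi, [/\ 0 < d, 0 < e <= e0, PS d e phi,
    (forall t, Cmod t < d -> ev2 Q t (phi t) = C0) &
    forall t w, Cmod t < d -> Cmod w <= e -> ev2 Q t w = C0 -> w = phi t].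
Proof.
move=> he0 hQ hk.
elim/poly_ind: Q hQ hk => [|P c _]; first by rewrite deriv0 ev2_0.
move=> hQ hk.
have hkP : ev2 (P * 'X + c%:P)^`()%R C0 C0 = ev2 P C0 C0 by rewrite ev2_derivMXaddC; ring.
have hc0 : ev c C0 = C0.
  have -> : ev c C0 = (ev2 P C0 C0 * C0 + ev c C0)%C by ring.
  by rewrite -ev2MXaddC.
have [A [hA HA]] := ev2_PS P.
have [B [hB HB]] := ev_PS c.
have [D [hD HD]] := ev2_diff (P * 'X + c%:P)%R.
move: hk HD; rewrite hkP.
set k := ev2 P C0 C0; set Q := (P * 'X + c%:P)%R => hk HD.
have hk0 := Cmod_gt0 hk.
(* The bound by [|k| / 8] keeps the Lipschitz constant of the iteration below [1/2] and the norm of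
   its term [(P - k) w / k] below [e / 4]. *)
pose e := Rmin (Rmin e0 1) (Cmod k / (8 * (A + D + 1))).
have he : 0 < e.
  by apply: Rmin_glb_lt; [apply: Rmin_glb_lt; lra | apply: Rdiv_lt_0_compat; lra].
have he1 : e <= e0 by apply: (Rle_trans _ _ _ (Rmin_l _ _)); exact: Rmin_l.
have he2 : e <= 1 by apply: (Rle_trans _ _ _ (Rmin_l _ _)); exact: Rmin_r.
have he3 : (A + D + 1) * e <= Cmod k / 8.
  have -> : Cmod k / 8 = (A + D + 1) * (Cmod k / (8 * (A + D + 1))) by field; lra.
  by apply: Rmult_le_compat_l; [lra | exact: Rmin_r].
clearbody e.
(* With this [d] the part of the iteration that depends on [t] alone has norm at most [e / 8]. *)
pose d := Rmin e (e * Cmod k / (8 * (B + 1))).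
have hd : 0 < d by apply: Rmin_glb_lt => //; apply: Rdiv_lt_0_compat; nra.
have hd1 : d <= e by exact: Rmin_l.
have hd2 : (B + 1) * d <= e * Cmod k / 8.
  have -> : e * Cmod k / 8 = (B + 1) * (e * Cmod k / (8 * (B + 1))) by field; lra.
  by apply: Rmult_le_compat_l; [lra | exact: Rmin_r].
clearbody d.
pose q t w := (w - Cinv k * ev2 Q t w)%C.
have qPS w : PS d e w -> PS d e (fun t => q t (w t)).
  move=> hw.
  apply: (@PS_ext _ _ (fun t => (- Cinv k) * ((ev2 P t (w t) - k) * w t + (ev c t - ev c C0)))%C).
    by move=> t _; rewrite /q /Q ev2MXaddC hc0; field.
  apply: (@PS_mono _ (Cmod (- Cinv k)%C * (A * (d + e) * e + B * d))); first lra.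
    rewrite CmodN CmodV //.
    apply: (Rmult_le_reg_l (Cmod k)) => //; rewrite -Rmult_assoc Rinv_r ?Rmult_1_l; last lra.
    have h1 : A * (d + e) <= Cmod k / 4.
      have := Rmult_le_compat_l A (d + e) (e + e) hA ltac:(lra); have := Rmult_le_pos D e hD ltac:(lra); lra.
    have h2 : A * (d + e) * e <= Cmod k / 4 * e by apply: Rmult_le_compat_r; lra.
    nra.
  apply: PS_scal => //; apply: PS_add => //; last by apply: HB; lra.
  apply: PS_mul => //; apply: HA => //; lra.
have qcontr t w w' : Cmod t < d -> Cmod w <= e -> Cmod w' <= e ->
    Cmod (q t w - q t w')%C <= / 2 * Cmod (w - w')%C.
  move=> ht hw hw'.
  have -> : (q t w - q t w' = - Cinv k * (ev2 Q t w - ev2 Q t w' - k * (w - w')))%C by rewrite /q; field.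
  rewrite CmodM CmodN CmodV //.
  have h1 := HD t w w' ltac:(lra) ltac:(lra) ltac:(lra).
  have h2 := Cmod_ge0 (w - w')%C.
  have h3 : D * (Cmod t + Cmod w + Cmod w') <= Cmod k / 2.
    have := Rmult_le_compat_l D (Cmod t + Cmod w + Cmod w') (3 * e) hD ltac:(lra).
    have := Rmult_le_pos A e hA ltac:(lra); lra.
  apply: (Rmult_le_reg_l (Cmod k)) => //; rewrite -Rmult_assoc Rinv_r ?Rmult_1_l; last lra.
  apply: (Rle_trans _ _ _ h1).
  have := Rmult_le_compat_r _ _ _ h2 h3; lra.
pose it n t := iter n (q t) C0.
have itPS n : PS d e (it n).
  elim: n => [|n IH]; last exact: (qPS _ IH).
  apply: (@PS_mono _ 0) => //; first lra.
  by rewrite -Cmod0; apply: PS_const.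
have itb n t : Cmod t < d -> Cmod (it n t) <= e by move=> ht; exact: PS_bound (itPS n) ht.
have itd n t : Cmod t < d -> Cmod (it n.+1 t - it n t)%C <= 2 * e * (/ 2) ^ n.
  move=> ht; elim: n => [|n IH].
    by have := Cmod_sub_le (it 1%N t) (it O t); have := itb 1%N t ht; have := itb O t ht; rewrite /=; lra.
  have := @qcontr t (it n.+1 t) (it n t) ht (itb _ _ ht) (itb _ _ ht).
  have -> : (q t (it n.+1 t) - q t (it n t) = it n.+2 t - it n.+1 t)%C by [].
  have -> : (/ 2) ^ n.+1 = / 2 * (/ 2) ^ n by [].
  lra.
have hphi t : exists l, Cmod t < d -> Clim (fun n => it n t) l.
  case: (Rlt_dec (Cmod t) d) => ht; last by exists C0.
  have [l hl] : exists l, Clim (fun n => it n t) l.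
    by apply: (@Clim_ex _ e); apply: Uall => n; exact: itb.
  by exists l.
pose phi t := proj1_sig (constructive_indefinite_description _ (hphi t)).
have hl t : Cmod t < d -> Clim (fun n => it n t) (phi t).
  exact: (proj2_sig (constructive_indefinite_description _ (hphi t))).
have phiPS : PS d e phi by apply: (@PS_lim d e it) => //; exact: Uall.
have phifix t : Cmod t < d -> q t (phi t) = phi t.
  move=> ht.
  have l1 : Clim (fun n => it n.+1 t - it n t)%C C0.
    apply: (@Clim0_squeeze _ (fun n => 2 * e * (/ 2) ^ n)); last by apply: Rlim_geom; lra.
    by apply: Uall => n; exact: itd.
  have l2 : Clim (fun n => q t (phi t) - q t (it n t))%C C0.
    apply: (@Clim0_squeeze _ (fun n => Cmod (it n t - phi t)%C)).
      apply: Uall => n; have := @qcontr t (phi t) (it n t) ht (PS_bound phiPS ht) (itb _ _ ht).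
      rewrite Cmod_sym (Cmod_sym (phi t)) (Cmod_sym (q t (it n t))); have := Cmod_ge0 (it n t - phi t)%C; lra.
    have h := Clim_sub (hl t ht) (@Clim_const (phi t)).
    have e1 : (phi t - phi t = C0)%C by ring.
    by rewrite e1 in h; exact: Clim0_mod.
  have l3 := Clim_add (Clim_add l1 l2) (hl t ht).
  have e1 : (C0 + C0 + phi t = phi t)%C by ring.
  rewrite e1 in l3; apply: Clim_uniq _ l3.
  apply: Clim_ext (@Clim_const (q t (phi t))); apply: Uall => n.
  have -> : it n.+1 t = q t (it n t) by [].
  ring.
have zero_fix t w : ev2 Q t w = C0 <-> q t w = w.
  rewrite /q; split=> [->|h]; first by ring.
  have -> : ev2 Q t w = (k * (w - (w - Cinv k * ev2 Q t w)))%C by field.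
  by rewrite h; ring.
exists d, e, phi; split=> //.
  by move=> t ht; apply/zero_fix; exact: phifix.
move=> t w ht hw /zero_fix hz.
have := @qcontr t w (phi t) ht hw (PS_bound phiPS ht).
rewrite hz phifix // => h; have h0 := Cmod_ge0 (w - phi t)%C.
have /Cmod_eq0 e1 : Cmod (w - phi t)%C = 0 by lra.
have -> : w = (w - phi t + phi t)%C by ring.
by rewrite e1; ring.
Qed.

Lemma ev_shift (p : {poly K}) a : exists p', forall t, ev p' t = ev p (a + t)%C.
Proof.
elim/poly_ind: p => [|p c [p' h]]; first by exists 0%R => t; rewrite !ev0.
exists (p' * ('X + (toK a)%:P) + c%:P)%R => t.
by rewrite evMXaddC !evD evM evD evX !evC toKK h; ring.
Qed.

Lemma deriv_shift (A : nzRingType) (p : {poly A}) b c :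
  (p * 'X + (p * b%:P + c%:P))^`()%R = (p^`() * 'X + p + p^`() * b%:P)%R.
Proof. by rewrite !derivD !derivM !derivC derivX GRing.mulr1 GRing.mulr0 !GRing.addr0. Qed.

Lemma ev2_shift (Q : {poly {poly K}}) a b : exists Q',
  (forall t w, ev2 Q' t w = ev2 Q (a + t)%C (b + w)%C) /\
  forall t w, ev2 Q'^`()%R t w = ev2 Q^`()%R (a + t)%C (b + w)%C.
Proof.
elim/poly_ind: Q => [|P c [P' [h1 h2]]].
  by exists 0%R; split=> t w; rewrite ?deriv0 !ev2_0.
have [c' hc] := ev_shift c a.
exists (P' * 'X + (P' * ((toK b)%:P)%:P + c'%:P))%R; split=> t w.
  by rewrite ev2MXaddC !ev2D !ev2M ev2X !ev2C evC toKK h1 hc; ring.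
rewrite ev2_derivMXaddC deriv_shift !ev2D !ev2M ev2X ev2C evC toKK h1 h2.
by move: (ev2 _ _ _) (ev2 _ _ _) => x y; ring.
Qed.

Lemma implicit_function_at (Q : {poly {poly K}}) a b e0 : 0 < e0 -> ev2 Q a b = C0 ->
  ev2 Q^`()%R a b <> C0 -> exists d e phi, [/\ 0 < d, 0 < e <= e0, PS d e phi,
    (forall t, Cmod t < d -> ev2 Q (a + t)%C (b + phi t)%C = C0) &
    forall t w, Cmod t < d -> Cmod (w - b)%C <= e -> ev2 Q (a + t)%C w = C0 -> w = (b + phi t)%C].
Proof.
move=> he0 h1 h2.
have [Q' [q1 q2]] := ev2_shift Q a b.
have e1 : (a + C0 = a)%C by ring.
have e2 : (b + C0 = b)%C by ring.
have [d [e [phi [hd he hp hz hu]]]] := @implicit_function Q' e0 he0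
  ltac:(by rewrite q1 e1 e2) ltac:(by rewrite q2 e1 e2).
exists d, e, phi; split=> //; first by move=> t ht; rewrite -q1; exact: hz.
move=> t w ht hw hzw.
have e3 : w = (b + (w - b))%C by ring.
by rewrite {1}e3 (hu t (w - b)%C) // q1 -e3.
Qed.

Lemma ev_lim (p : {poly K}) (t : nat -> C) a : Clim t a -> Clim (fun k => ev p (t k)) (ev p a).
Proof.
move=> ht; elim/poly_ind: p => [|p c IH].
  by rewrite ev0; apply: Clim_ext (Clim_const C0); apply: Uall => k; rewrite ev0.
rewrite evMXaddC; apply: Clim_ext (Clim_add (Clim_mul IH ht) (@Clim_const (ofK c))).
by apply: Uall => k; rewrite evMXaddC.
Qed.

Lemma ev2_lim (Q : {poly {poly K}}) (t w : nat -> C) a b : Clim t a -> Clim w b ->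
  Clim (fun k => ev2 Q (t k) (w k)) (ev2 Q a b).
Proof.
move=> ht hw; elim/poly_ind: Q => [|P c IH].
  by rewrite ev2_0; apply: Clim_ext (Clim_const C0); apply: Uall => k; rewrite ev2_0.
rewrite ev2MXaddC; apply: Clim_ext (Clim_add (Clim_mul IH hw) (ev_lim c ht)).
by apply: Uall => k; rewrite ev2MXaddC.
Qed.

Section PolyAlgebra.
Local Open Scope ring_scope.

Definition at0 (Q : {poly {poly K}}) : {poly K} := map_poly (horner_eval 0) Q.

Lemma coef_at0 (Q : {poly {poly K}}) j : (at0 Q)`_j = (Q`_j).[0].
Proof. by rewrite /at0 coef_map. Qed.

Lemma ofK_coef0 (Q : {poly {poly K}}) j : ofK (at0 Q)`_j = ev Q`_j C0.
Proof. by rewrite coef_at0 /ev toK0. Qed.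

Lemma ev2_at0 (Q : {poly {poly K}}) w : ev2 Q C0 w = ev (at0 Q) w.
Proof.
rewrite /ev2 /ev /at0 toK0; congr ofK.
have e : horner_eval 0 (toK w)%:P = toK w by rewrite /horner_eval hornerC.
by rewrite -{2}e horner_map.
Qed.

Lemma ev2_00 (Q : {poly {poly K}}) : ev2 Q C0 C0 = ofK (at0 Q)`_0.
Proof. by rewrite ev2_at0 /ev toK0 horner_coef0. Qed.

Lemma ev2_deriv_00 (Q : {poly {poly K}}) : ev2 Q^`() C0 C0 = ofK (at0 Q)`_1.
Proof. by rewrite ev2_00 !coef_at0 coef_deriv GRing.mulr1n. Qed.

Lemma factor_X (a : {poly K}) : a != 0 -> exists v (b : {poly K}), a = 'X^v * b /\ b.[0] != 0.
Proof.
have [n] := ubnP (size a); elim: n a => // n IH a hn ha.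
case: (eqVneq a.[0] 0) => h0; last by exists 0%N, a; rewrite GRing.expr0 GRing.mul1r.
have /factor_theorem [b hb] : root a 0 by rewrite /root h0.
rewrite polyC0 GRing.subr0 in hb.
have hb0 : b != 0 by apply: contraNneq ha => e; rewrite hb e GRing.mul0r.
have [|v [c [hc hc0]]] := IH b _ hb0.
  by move: hn; rewrite hb size_mulX // ltnS.
by exists v.+1, c; split=> //; rewrite hb hc GRing.exprSr -!GRing.mulrA (GRing.mulrC c).
Qed.

(** The substitution [t := t^e], [w := t^p w]. The coefficients are recorded as well, because the
    Newton polygon is read off from them. *)
Lemma subst_exists (Q : {poly {poly K}}) e p : exists Q1 : {poly {poly K}},
  [/\ forall t w, ev2 Q1 t w = ev2 Q (t ^ e)%C (t ^ p * w)%C,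
      forall t w, ev2 Q1^`() t w = (t ^ p * ev2 Q^`() (t ^ e) (t ^ p * w))%C &
      forall j, Q1`_j = (Q`_j \Po 'X^e) * 'X^(p * j)].
Proof.
elim/poly_ind: Q => [|P c [P1 [h1 h2 h3]]].
  exists 0; split=> *; rewrite ?deriv0 ?ev2_0 ?coef0 ?comp_poly0 ?GRing.mul0r //.
  by ring.
have evc t : ev (c \Po 'X^e) t = ev c (t ^ e)%C.
  by rewrite /ev horner_comp hornerXn; congr (ofK _.[_]); apply: ofK_inj; rewrite ofKX !toKK.
exists (P1 * ('X^p)%:P * 'X + (c \Po 'X^e)%:P); split=> [t w|t w|j].
- by rewrite !ev2MXaddC ev2M ev2C evXn evc h1; ring.
- rewrite !ev2_derivMXaddC derivM derivC GRing.mulr0 GRing.addr0 !ev2M ev2C evXn h1 h2.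
  by move: (ev2 _ _ _) (ev2 _ _ _) => x y; ring.
- rewrite !coefD !coefMX !coefC; case: j => [|j] /=.
    by rewrite !GRing.add0r muln0 GRing.expr0 GRing.mulr1.
  by rewrite !GRing.addr0 coefMC h3 mulnS GRing.exprD -!GRing.mulrA (GRing.mulrC 'X^p).
Qed.

Lemma divide_exists (Q1 : {poly {poly K}}) N : (forall j, exists b, Q1`_j = 'X^N * b) ->
  exists Q', Q1 = ('X^N)%:P * Q' /\ forall j, Q1`_j = 'X^N * Q'`_j.
Proof.
move=> h.
pose b j := proj1_sig (constructive_indefinite_description _ (h j)).
have hb j : Q1`_j = 'X^N * b j := proj2_sig (constructive_indefinite_description _ (h j)).
have e : Q1 = ('X^N)%:P * \poly_(j < size Q1) b j.
  apply/polyP => j; rewrite coefCM coef_poly.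
  by case: ltnP => hj; [exact: hb | rewrite GRing.mulr0 nth_default].
exists (\poly_(j < size Q1) b j); split=> // j.
by rewrite {1}e coefCM.
Qed.

(** Two polynomials with the same values are equal, since the field contains infinitely many natural
    numbers. *)
Lemma translate_comp (F G : {poly K}) c : (forall w, ev G w = ev F (c + w)%C) ->
  G = F \Po ('X + (toK c)%:P).
Proof.
move=> hG; apply/eqP; rewrite -GRing.subr_eq0; apply: contraT => hne.
have hroots x : root (G - (F \Po ('X + (toK c)%:P))) x.
  rewrite /root hornerD hornerN horner_comp !hornerE; apply/eqP; apply: ofK_inj.
  have := hG (ofK x); rewrite /ev ofKK => hx.
  rewrite ofK0 ofKD hx.
  have -> : toK (c + ofK x)%C = x + toK c.
    by apply: ofK_inj; rewrite ofKD !toKK; ring.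
  by rewrite -ofKD GRing.subrr.
have := max_poly_roots hne (rs := [seq (i%:R : K) | i <- iota 0 (size (G - (F \Po ('X + (toK c)%:P))))]).
rewrite size_map size_iota ltnn => /(_ _ _); apply.
  by apply/allP => x _; exact: hroots.
rewrite map_inj_uniq ?iota_uniq // => a b /eqP; by rewrite Num.Theory.eqr_nat => /eqP.
Qed.

Lemma translate_size (F G : {poly K}) c : (forall w, ev G w = ev F (c + w)%C) -> size G = size F.
Proof.
move=> /translate_comp ->; rewrite size_comp_poly2 //.
by rewrite -[(toK c)%:P]GRing.opprK -polyCN size_XsubC.
Qed.

(** The hypotheses make [F] a multiple of [(X - c)^(m+1)]. In characteristic [0] the vanishing of
    its coefficient of degree [m] gives [c = 0] or [F = 0]. This is the case in which a Newton step
    would fail to lower the multiplicity. *)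
Lemma translate_monomial (F : {poly K}) c m (G : {poly K}) :
  (forall w, ev G w = ev F (c + w)%C) -> (size F <= m.+2)%N ->
  (forall j, (j <= m)%N -> G`_j = 0) -> F`_m = 0 -> forall j, (j <= m)%N -> F`_j = 0.
Proof.
move=> hG hs hlow hFm j hj.
have eG := translate_comp hG.
have eF : F = G \Po ('X - (toK c)%:P).
  by rewrite eG -comp_polyA comp_polyD comp_polyX comp_polyC GRing.subrK comp_polyXr.
have sG : (size G <= m.+2)%N by rewrite (translate_size hG).
have eG2 : G = G`_m.+1 *: 'X^(m.+1).
  apply/polyP => i; rewrite coefZ coefXn; case: eqP => [->|hne]; first by rewrite GRing.mulr1.
  rewrite GRing.mulr0; case: (ltnP i m.+1) => hi; first exact: hlow.
  by rewrite nth_default //; apply: leq_trans sG _; lia.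
have eF2 : F = G`_m.+1 *: ('X - (toK c)%:P) ^+ m.+1.
  by rewrite eF {1}eG2 comp_polyZ comp_Xn_poly.
have hc1 : (('X - (toK c)%:P) ^+ m.+1)`_m = - (toK c *+ m.+1).
  have := @coefPn_prod_XsubC _ (nseq m.+1 (toK c)) isT.
  by rewrite size_nseq !big_nseq GRing.iter_mulr_1 Algebra.iter_addr_0.
have hn0 : (m.+1)%:R != 0 :> K by rewrite Num.Theory.pnatr_eq0.
move: hFm; rewrite eF2 coefZ hc1 => /eqP.
rewrite GRing.mulf_eq0 GRing.oppr_eq0 => /orP [/eqP hG0|]; first by rewrite hG0 GRing.scale0r coef0.
rewrite -GRing.mulr_natr GRing.mulf_eq0 (negbTE hn0) orbF => /eqP hc0.
by rewrite hc0 GRing.subr0 coefZ coefXn; case: eqP => [e|]; [lia | rewrite GRing.mulr0].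
Qed.
End PolyAlgebra.

(** * Newton-Puiseux expansions along sequences *)

Lemma min_exists (f : nat -> nat) (P : nat -> Prop) : (exists j, P j) ->
  exists j0, P j0 /\ forall j, P j -> (f j0 <= f j)%N.
Proof.
move=> [j Pj]; have [n] := ubnP (f j); elim: n j Pj => // n IH j Pj hj.
case: (classic (exists i, P i /\ (f i < f j)%N)) => [[i [Pi hi]]|hn].
  by apply: (IH i) => //; lia.
exists j; split=> // i Pi; rewrite leqNgt; apply/negP => hi.
by apply: hn; exists i.
Qed.

(* Newton polygon: [p/e] is the smallest slope [v j0 / (m - j0)]. *)
Lemma newton_slope (m : nat) (J : nat -> Prop) (v : nat -> nat) :
  (forall j, J j -> (j < m)%N /\ (0 < v j)%N) -> (exists j, J j) ->
  exists p e j0, [/\ (0 < p)%N, (0 < e)%N, J j0, (p * (m - j0) = e * v j0)%N &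
    (forall j, J j -> (p * (m - j) <= e * v j)%N) /\
    (e = 1%N \/ (J m.-1 -> (p < e * v m.-1)%N))].
Proof.
move=> hJ hex.
(* When the point at [m - 1] lies on the edge of smallest slope, that slope is an integer and
   [e = 1] can be chosen. Otherwise this point, if present, lies strictly above the edge. *)
case: (classic (J m.-1 /\ forall j, J j -> (v m.-1 * (m - j) <= v j)%N)) => [[h1 h2]|hn].
  have [h3 h4] := hJ _ h1.
  exists (v m.-1), 1%N, m.-1; split=> //; first by nia.
  by split; [move=> j /h2; rewrite mul1n | left].
(* The factor [m!] turns the slopes into integers, so that a minimum over natural numbers can be
   taken. *)
have [j0 [Jj0 hmin]] := @min_exists (fun j => v j * (m`! %/ (m - j)))%N J hex.
have [hj0 hv0] := hJ _ Jj0.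
have key j : J j -> (v j0 * (m - j) <= v j * (m - j0))%N.
  move=> Jj; have [hj hv] := hJ _ Jj.
  have d1 : (m - j %| m`!)%N by apply: dvdn_fact; lia.
  have d2 : (m - j0 %| m`!)%N by apply: dvdn_fact; lia.
  have /= hab := hmin j Jj; have ha := divnK d1; have hb := divnK d2; have hF := fact_gt0 m.
  move: (m`! %/ (m - j))%N (m`! %/ (m - j0))%N hab ha hb => a b hab ha hb.
  move: (m`!) hF ha hb {d1 d2} => F hF ha hb.
  have h5 : (v j0 * b * ((m - j) * (m - j0)) <= v j * a * ((m - j) * (m - j0)))%N by rewrite leq_mul2r hab orbT.
  have e1 : (v j0 * b * ((m - j) * (m - j0)) = v j0 * (m - j) * F)%N by nia.
  have e2 : (v j * a * ((m - j) * (m - j0)) = v j * (m - j0) * F)%N by nia.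
  by move: h5; rewrite e1 e2 leq_pmul2r.
exists (v j0), (m - j0)%N, j0; split=> //; first lia; first lia.
split; first by move=> j /key; lia.
right=> hm; rewrite ltn_neqAle; apply/andP; split; last by have := key _ hm; have [? ?] := hJ _ hm; nia.
apply/eqP => e; apply: hn; split=> // j Jj.
have h1 := key j Jj; rewrite e in h1.
have : (m - j0 > 0)%N by lia.
nia.
Qed.

Lemma Clim_root0 (tau s : nat -> C) n : Clim tau C0 -> U (fun k => (s k ^ n.+1)%C = tau k) -> Clim s C0.
Proof.
move=> ht hs eps he; have hp := pow_lt eps n.+1 he.
apply: (Um2 (ht _ hp) hs) => k h1 h2.
have e0 z : (z - C0 = z)%C by ring.
rewrite e0 in h1; rewrite e0; apply: Rnot_le_lt => hle.
have := pow_incr eps (Cmod (s k)) n.+1 ltac:(lra).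
by rewrite -CmodX h2; lra.
Qed.

Lemma ev_bound (c : {poly K}) : exists A, 0 <= A /\ forall t, Cmod t <= 1 -> Cmod (ev c t) <= A.
Proof.
have [A [hA H]] := ev_near0 c; have h0 := Cmod_ge0 (ev c C0).
exists (A + Cmod (ev c C0)); split; first lra; move=> t ht.
have := H t ht; have := Cmod_sub_ge (ev c t) (ev c C0); have := Cmod_ge0 t; nra.
Qed.

Lemma ev2_growth n (P : {poly {poly K}}) : (size P <= n.+1)%N ->
  exists A, 0 <= A /\ forall t w, Cmod t <= 1 -> Cmod (ev2 P t w) <= A * (1 + Cmod w) ^ n.
Proof.
elim: n P => [|n IH] P; elim/poly_ind: P => [|P c _] hs.
- by exists 0; split; [lra | move=> t w _; rewrite ev2_0 Cmod0; lra].
- have e : P = 0%R.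
    apply/eqP; rewrite -size_poly_eq0; move: hs; rewrite size_MXaddC; case: (eqVneq P 0%R) => [->|_] /=.
      by rewrite size_poly0.
    by case: (size P).
  have [B [hB H]] := ev_bound c.
  by exists B; split=> // t w ht; rewrite e ev2MXaddC ev2_0 /= Rmult_1_r; have := H t ht; congr (Cmod _ <= _); ring.
- by exists 0; split; [lra | move=> t w _; rewrite ev2_0 Cmod0; lra].
have hs' : (size P <= n.+1)%N.
  move: hs; rewrite size_MXaddC; case: (eqVneq P 0%R) => [->|_] /=; first by rewrite size_poly0.
  by rewrite ltnS.
have [A [hA HA]] := IH P hs'.
have [B [hB H]] := ev_bound c.
exists (A + B); split; first lra; move=> t w ht.
rewrite ev2MXaddC; apply: (Rle_trans _ _ _ (Cmod_triangle _ _)); rewrite CmodM.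
have h1 := HA t w ht; have h2 := H t ht; have h3 := Cmod_ge0 w.
have h4 : 1 <= (1 + Cmod w) ^ n by apply: pow_R1_Rle; lra.
have h5 : Cmod (ev2 P t w) * Cmod w <= A * (1 + Cmod w) ^ n * Cmod w by apply: Rmult_le_compat_r.
have e : (1 + Cmod w) ^ n.+1 = (1 + Cmod w) ^ n + (1 + Cmod w) ^ n * Cmod w by rewrite /=; ring.
rewrite e; move: ((1 + Cmod w) ^ n) h1 h4 h5 => x h1 h4 h5.
have := Rmult_le_pos A x hA ltac:(lra); have := Rmult_le_pos B (x - 1) hB ltac:(lra).
have := Rmult_le_pos (B * x) (Cmod w) ltac:(nra) h3; nra.
Qed.

Section Puiseux.
(* The sequences of parameters range over a set closed under roots:
   all complex numbers, or the positive reals. *)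
Variable D : C -> Prop.
Hypothesis (Droot : forall n x, D x -> exists y, D y /\ (y ^ n.+1)%C = x).

(** The ramification index is written [e.+1] so that it is never [0]. The equality [w = phi(s)] is
    required only along the sequence. *)
Definition expansion (tau w : nat -> C) := exists e d A phi (s : nat -> C),
  [/\ 0 < d, PS d A phi &
      U (fun k => [/\ D (s k), (s k ^ e.+1)%C = tau k & w k = phi (s k)])].

Lemma expansion_root n (tau s w : nat -> C) : U (fun k => (s k ^ n.+1)%C = tau k) ->
  expansion s w -> expansion tau w.
Proof.
move=> hs [e [d [A [phi [r [hd hp hr]]]]]].
exists (n.+1 * e.+1).-1, d, A, phi, r; split=> //.
apply: (Um2 hs hr) => k h1 [h2 h3 h4]; split=> //.
by rewrite -h1 -h3 -CpowM mulnC prednK.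
Qed.

Lemma expansion_affine p c (tau w w' : nat -> C) :
  U (fun k => w k = (tau k ^ p * (c + w' k))%C) -> expansion tau w' -> expansion tau w.
Proof.
move=> hw [e [d [A [phi [r [hd hp hr]]]]]].
exists e, d, ((d ^ e.+1) ^ p * (Cmod c + A)), (fun t => (t ^ e.+1) ^ p * (c + phi t))%C, r; split=> //.
  apply: PS_mul => //; last by apply: PS_add => //; exact: PS_const.
  by apply: PS_pow => //; apply: PS_pow => //; exact: PS_id.
by apply: (Um2 hw hr) => k h1 [h2 h3 h4]; split=> //; rewrite h1 h3 h4.
Qed.

Definition branch (Q : {poly {poly K}}) (tau w : nat -> C) := [/\ Clim tau C0, U (fun k => tau k <> C0),
  U (fun k => D (tau k)), Clim w C0 & U (fun k => ev2 Q (tau k) (w k) = C0)].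

Lemma simple_expansion Q tau w : branch Q tau w -> ((at0 Q)`_0 = 0)%R -> ((at0 Q)`_1 != 0)%R ->
  expansion tau w.
Proof.
move=> [h1 h2 h3 h4 h5] a0 a1.
have [d [e [phi [hd he hp hz hu]]]] := @implicit_function Q 1 Rlt_0_1
  ltac:(by rewrite ev2_00 a0) ltac:(by rewrite ev2_deriv_00 => /ofK_eq0 h; move/eqP: a1).
exists 0%N, d, e, phi, tau; split=> //.
apply: (Um4 h3 h5 (h1 d hd) (h4 e (proj1 he))) => k Dk hk hk1 hk2.
have e0 z : (z - C0 = z)%C by ring.
rewrite e0 in hk1; rewrite e0 in hk2.
split=> //; first by rewrite /=; ring.
by apply: hu => //; lra.
Qed.

Section Step.
Local Open Scope ring_scope.
Variables (m : nat) (Q : {poly {poly K}}).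
Hypotheses (hm : (1 < m)%N) (hlow : forall j, (j < m)%N -> (at0 Q)`_j = 0) (hlead : (at0 Q)`_m != 0).
Hypothesis hnz : exists j, (j < m)%N /\ Q`_j != 0.

(* One step of the Newton polygon process: [w = s^p w'], [tau = s^e]. *)
Lemma newton_step : exists p e (Q' : {poly {poly K}}), [/\ (0 < p)%N, (0 < e)%N,
  (forall s w, (s ^ (p * m)%N * ev2 Q' s w)%C = ev2 Q (s ^ e)%C (s ^ p * w)%C),
  (forall s w, (s ^ (p * m)%N * ev2 Q'^`() s w)%C = (s ^ p * ev2 Q^`() (s ^ e) (s ^ p * w))%C) &
  [/\ size (at0 Q') = m.+1, (at0 Q')`_m != 0,
      exists j, (j < m)%N /\ (at0 Q')`_j != 0,
      e = 1%N \/ (at0 Q')`_m.-1 = 0 &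
      forall s w, ev2 (drop_poly m Q') s w = ev2 (drop_poly m Q) (s ^ e)%C (s ^ p * w)%C]].
Proof.
pose J j := (j < m)%N /\ Q`_j != 0.
have hfac j : exists vb : nat * {poly K}, Q`_j != 0 -> Q`_j = 'X^(vb.1) * vb.2 /\ vb.2.[0] != 0.
  case: (eqVneq Q`_j 0) => h; first by exists (0%N, 0).
  by have [v [b hb]] := factor_X h; exists (v, b).
pose f j := proj1_sig (constructive_indefinite_description _ (hfac j)).
have hf j : Q`_j != 0 -> Q`_j = 'X^((f j).1) * (f j).2 /\ (f j).2.[0] != 0.
  exact: (proj2_sig (constructive_indefinite_description _ (hfac j))).
pose v j := (f j).1.
have hJ j : J j -> (j < m)%N /\ (0 < v j)%N.
  move=> [h1 h2]; split=> //; rewrite lt0n; apply/eqP => e.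
  have [h3 h4] := hf _ h2; move/eqP: h4; apply.
  have := hlow h1; rewrite coef_at0 h3 -/(v j) e GRing.expr0 GRing.mul1r => h; exact: h.
have [p [e [j0 [hp he Jj0 hj0 [hmin he1]]]]] := newton_slope hJ hnz.
have [Q1 [q1 q2 q3]] := subst_exists Q e p.
(* Points on the edge get exponent [p * m] exactly, and all others at least that, so this power of
   [s] can be divided out. *)
have evf j : J j -> Q1`_j = 'X^(p * m) * (('X^(e * v j - p * (m - j))) * ((f j).2 \Po 'X^e)).
  move=> Jj; have [h1 h2] := Jj; have [h3 _] := hf _ h2; have h4 := hmin _ Jj.
  rewrite q3 h3 comp_polyM comp_Xn_poly -/(v j) -GRing.exprM GRing.mulrAC -GRing.exprD GRing.mulrA -GRing.exprD.
  by congr ('X^ _ * _); nia.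
have evh j : (m <= j)%N -> Q1`_j = 'X^(p * m) * (('X^(p * (j - m))) * (Q`_j \Po 'X^e)).
  move=> hj; rewrite q3 GRing.mulrC GRing.mulrA -GRing.exprD; congr ('X^ _ * _); nia.
have hdiv j : exists b, Q1`_j = 'X^(p * m) * b.
  case: (ltnP j m) => hj; last by exists ('X^(p * (j - m)) * (Q`_j \Po 'X^e)); exact: evh.
  case: (eqVneq Q`_j 0) => h0; last by exists ('X^(e * v j - p * (m - j)) * ((f j).2 \Po 'X^e)); exact: evf.
  by exists 0; rewrite q3 h0 comp_poly0 GRing.mul0r GRing.mulr0.
have [Q' [hQ' cQ']] := divide_exists hdiv.
have Xn0 : ('X^(p * m) : {poly K}) != 0 by rewrite -size_poly_eq0 size_polyXn.
have bf j : J j -> Q'`_j = 'X^(e * v j - p * (m - j)) * ((f j).2 \Po 'X^e).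
  by move=> Jj; apply: (GRing.mulfI Xn0); rewrite -cQ' evf.
have bh j : (m <= j)%N -> Q'`_j = 'X^(p * (j - m)) * (Q`_j \Po 'X^e).
  by move=> hj; apply: (GRing.mulfI Xn0); rewrite -cQ' evh.
have b0 j : (j < m)%N -> Q`_j = 0 -> Q'`_j = 0.
  by move=> hj h0; apply: (GRing.mulfI Xn0); rewrite -cQ' q3 h0 comp_poly0 GRing.mul0r GRing.mulr0.
have Xe0 : ('X^e : {poly K}).[0] = 0 by rewrite hornerXn GRing.expr0n; case: e he {hj0 hmin he1 q1 q2 q3 evf evh hdiv bf bh}.
have lead : (at0 Q')`_m != 0.
  by rewrite coef_at0 bh // subnn muln0 GRing.expr0 GRing.mul1r horner_comp Xe0 -coef_at0.
exists p, e, Q'; split=> //.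
- by move=> s w; rewrite -q1 hQ' ev2M ev2C evXn.
- by move=> s w; rewrite -q2 hQ' derivM derivC GRing.mul0r GRing.add0r ev2M ev2C evXn.
split=> //.
- apply/eqP; rewrite eqn_leq; apply/andP; split; last first.
    by rewrite ltnNge; apply: contra lead => hs; rewrite nth_default.
  apply/leq_sizeP => j hj; rewrite coef_at0 bh; last by lia.
  rewrite hornerM hornerXn GRing.expr0n.
  have -> : (p * (j - m) == 0)%N = false by apply/eqP; nia.
  by rewrite GRing.mul0r.
- exists j0; have [h1 h2] := Jj0; split=> //.
  rewrite coef_at0 bf // hj0 subnn GRing.expr0 GRing.mul1r horner_comp Xe0.
  by have [] := hf _ h2.
- case: he1 => [->|h]; [by left | right].
  have hm1 : (m.-1 < m)%N by lia.
  case: (eqVneq Q`_(m.-1) 0) => h0; first by rewrite coef_at0 b0 // horner0.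
  have h3 := h (conj hm1 h0).
  rewrite coef_at0 bf // hornerM hornerXn GRing.expr0n.
  have -> : (e * v m.-1 - p * (m - m.-1) == 0)%N = false by apply/eqP; nia.
  by rewrite GRing.mul0r.
- move=> s w.
  have [D1 [d1 _ d3]] := subst_exists (drop_poly m Q) e p.
  rewrite -d1; congr ev2; apply/polyP => j.
  rewrite d3 !coef_drop_poly bh; last by lia.
  by rewrite addnK GRing.mulrC.
Qed.

End Step.
End Puiseux.

Lemma ev2Xn n t w : ev2 ('X^n)%R t w = (w ^ n)%C.
Proof.
elim: n => [|n IH]; first by rewrite GRing.expr0 /ev2 !hornerE.
by rewrite GRing.exprS ev2M ev2X IH.
Qed.

Lemma ev2_take_drop m (P : {poly {poly K}}) t w :
  ev2 P t w = (ev2 (take_poly m P) t w + ev2 (drop_poly m P) t w * w ^ m)%C.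
Proof. by rewrite -{1}(poly_take_drop m P) ev2D ev2M ev2Xn. Qed.

Lemma ev2_w0 (P : {poly {poly K}}) t : ev2 P t C0 = ev (P`_0)%R t.
Proof. by rewrite /ev2 /ev toK0 polyC0 horner_coef0. Qed.

Lemma root_bounded m (P : {poly {poly K}}) (t w : nat -> C) l : Clim t C0 -> l <> C0 ->
  U (fun k => ev2 P (t k) (w k) = C0) ->
  Clim (fun k => ev2 (drop_poly m P) (t k) (w k)) l -> exists B, U (fun k => Cmod (w k) <= B).
Proof.
move=> ht hl hz hR.
have hl0 := Cmod_gt0 hl.
have hR2 : U (fun k => Cmod l / 2 <= Cmod (ev2 (drop_poly m P) (t k) (w k))).
  apply: (Um1 (hR (Cmod l / 2) ltac:(lra))) => k; rewrite Cmod_sym.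
  by have := Cmod_sub_ge l (ev2 (drop_poly m P) (t k) (w k)); lra.
case: m hR hR2 => [|m] hR hR2.
  exists 0; apply: (Um2 hz hR2) => k h1; rewrite (ev2_take_drop 0) /= in h1.
  have e : take_poly 0 P = 0%R by rewrite take_poly0l.
  rewrite e ev2_0 in h1.
  have -> : ev2 (drop_poly 0 P) (t k) (w k) = C0 by rewrite -h1; ring.
  by rewrite Cmod0; lra.
have [A [hA H]] := @ev2_growth m (take_poly m.+1 P) (size_take_poly _ _).
exists (Rmax 1 (A * 2 ^ m / (Cmod l / 2))).
apply: (Um3 hz hR2 (ht 1 Rlt_0_1)) => k h1 h2 h3.
have e0 : (t k - C0 = t k)%C by ring.
rewrite e0 in h3.
have m1 := Rmax_l 1 (A * 2 ^ m / (Cmod l / 2)); have m2 := Rmax_r 1 (A * 2 ^ m / (Cmod l / 2)).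
case: (Rle_dec (Cmod (w k)) 1) => hw; first lra.
apply: Rle_trans m2.
rewrite (ev2_take_drop m.+1) in h1.
have h4 := H (t k) (w k) ltac:(lra).
set T := ev2 (take_poly m.+1 P) (t k) (w k) in h1 h4.
set S := ev2 (drop_poly m.+1 P) (t k) (w k) in h1 h2.
have h5 : Cmod S * Cmod (w k) ^ m.+1 = Cmod T.
  rewrite -CmodX -CmodM -(CmodN T); congr Cmod.
  have -> : (S * w k ^ m.+1 = (T + S * w k ^ m.+1) - T)%C by ring.
  by rewrite h1; ring.
have h6 : (1 + Cmod (w k)) ^ m <= 2 ^ m * Cmod (w k) ^ m.
  by rewrite -Rpow_mult_distr; apply: pow_incr; lra.
have hp : 0 < Cmod (w k) ^ m by apply: pow_lt; lra.
apply: (Rmult_le_reg_r (Cmod l / 2)); first lra.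
have -> : A * 2 ^ m / (Cmod l / 2) * (Cmod l / 2) = A * 2 ^ m by field; lra.
apply: (Rmult_le_reg_r (Cmod (w k) ^ m)) => //.
have h7 : A * (1 + Cmod (w k)) ^ m <= A * (2 ^ m * Cmod (w k) ^ m) by apply: Rmult_le_compat_l.
have h8 : Cmod (w k) ^ m.+1 = Cmod (w k) * Cmod (w k) ^ m by [].
have h9 : 0 < Cmod (w k) * Cmod (w k) ^ m by apply: Rmult_lt_0_compat; lra.
rewrite h8 in h5; nra.
Qed.

Section Puiseux.
Variable D : C -> Prop.
Hypothesis (Droot : forall n x, D x -> exists y, D y /\ (y ^ n.+1)%C = x).

(** Well-founded induction on the pair [(m, M)]: the multiplicity [m] of the root [0] at [t = 0],
    then the order [M] to which the derivative may vanish along the branch. A Newton step either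
    lowers [m], or keeps [m] and lowers [M] by [p (m - 1)]. The lower bound on the derivative
    expresses separability and guarantees termination. *)
Lemma puiseux_core m M (Q : {poly {poly K}}) tau w : branch D Q tau w ->
  (forall j, (j < m)%N -> (at0 Q)`_j = 0)%R -> ((at0 Q)`_m != 0)%R ->
  (exists c, 0 < c /\ U (fun k => c * Cmod (tau k) ^ M <= Cmod (ev2 Q^`()%R (tau k) (w k)))) ->
  expansion D tau w.
Proof.
elim/(well_founded_induction lt_wf): m M Q tau w => m IHm M.
elim/(well_founded_induction lt_wf): M => M IHM Q tau w hb hlow hlead [c [hc hder]].
have [b1 b2 b3 b4 b5] := hb.
case: (posnP m) => [m0|mpos].
  exfalso; have := ev2_lim Q b1 b4; rewrite ev2_00.
  move=> h; have := Clim_uniq h (Clim_ext _ (Clim_const C0)).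
  have h2 : U (fun k => C0 = ev2 Q (tau k) (w k)) by apply: (Um1 b5).
  move=> /(_ h2) /ofK_eq0 e; move/eqP: hlead; by rewrite m0.
case: (ltnP 1 m) => hm1; last first.
  have m1 : m = 1%N by lia.
  apply: (simple_expansion hb); first by apply: hlow; lia.
  by rewrite -m1.
(* If all coefficients below [m] vanished, then [Q] would be [w^m] times a unit, and the branch
   [w = 0] would make the derivative vanish as [m > 1]. *)
have hnz : exists j, (j < m)%N /\ (Q`_j != 0)%R.
  apply: NNPP => hn.
  have hz j : (j < m)%N -> (Q`_j = 0)%R.
    by move=> hj; apply/eqP; apply: contraT => h; case: hn; exists j.
  have htake : take_poly m Q = 0%R.
    by apply/polyP => j; rewrite coef_take_poly coef0; case: ltnP => // /hz.
  have hR := ev2_lim (drop_poly m Q) b1 b4.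
  rewrite ev2_00 coef_at0 coef_drop_poly add0n -coef_at0 in hR.
  have ha : ofK (at0 Q)`_m%R <> C0 by move=> /ofK_eq0 e; move/eqP: hlead.
  have ha0 := Cmod_gt0 ha.
  apply: Ufalse; apply: (Um4 b5 (hR _ ha0) hder b2) => k h1 h2 h3 h4.
  have hw : w k = C0.
    move: h1; rewrite (ev2_take_drop m) htake ev2_0.
    have -> : (C0 + ev2 (drop_poly m Q) (tau k) (w k) * w k ^ m = ev2 (drop_poly m Q) (tau k) (w k) * w k ^ m)%C by ring.
    move=> /Cmul_eq0 [e|e]; last by apply: NNPP => /(@Cpow_neq0 _ m).
    move: h2; rewrite e Cmod_sym; have -> : (ofK (at0 Q)`_m%R - C0 = ofK (at0 Q)`_m%R)%C by ring.
    lra.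
  move: h3; rewrite hw ev2_w0 coef_deriv hz // GRing.mul0rn ev0 Cmod0.
  have := pow_lt _ M (Cmod_gt0 h4); nra.
have [p [e [Q' [hp he q1 q2 [q3 q4 q5 q6 q7]]]]] := newton_step hm1 hlow hlead hnz.
have [s hs] : exists s : nat -> C, U (fun k => D (s k) /\ (s k ^ e)%C = tau k).
  apply: (@Uchoice C C0 (fun k y => D y /\ (y ^ e)%C = tau k)); apply: (Um1 b3) => k Dk.
  by have [y hy] := Droot e.-1 Dk; exists y; rewrite prednK in hy.
have hs1 : Clim s C0.
  by apply: (@Clim_root0 tau s e.-1) => //; rewrite prednK //; apply: (Um1 hs) => k [].
have hs0 : U (fun k => s k <> C0).
  apply: (Um2 hs b2) => k [_ h1] h2 h3; apply: h2.
  rewrite -h1 h3; case: (e) he => [//|e' _] /=; ring.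
pose w' k := (Cinv (s k ^ p) * w k)%C.
have hw' : U (fun k => w k = (s k ^ p * w' k)%C).
  by apply: (Um1 hs0) => k h; rewrite /w'; have := @Cpow_neq0 _ p h => hn; field.
have hz' : U (fun k => ev2 Q' (s k) (w' k) = C0).
  apply: (Um4 hs hs0 hw' b5) => k [_ h1] h2 h3 h4.
  have := q1 (s k) (w' k); rewrite h1 -h3 h4 => /Cmul_eq0 [h5|//].
  by have := @Cpow_neq0 _ (p * m)%N h2.
have hR : Clim (fun k => ev2 (drop_poly m Q') (s k) (w' k)) (ofK (at0 Q)`_m%R).
  have := ev2_lim (drop_poly m Q) b1 b4.
  rewrite ev2_00 coef_at0 coef_drop_poly add0n -coef_at0 => h.
  apply: Clim_ext h; apply: (Um2 hs hw') => k [_ h1] h2.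
  by rewrite q7 h1 -h2.
have ha : ofK (at0 Q)`_m%R <> C0 by move=> /ofK_eq0 e0; move/eqP: hlead.
have [B hB] := root_bounded hs1 ha hz' hR.
have [c' hc'] := Clim_ex hB.
(* The new branch is recentred at its limit [c'], so that it tends to [0] again. *)
have [Q2 [r1 r2]] := ev2_shift Q' C0 c'.
have eC0 t : (C0 + t = t)%C by ring.
pose w2 k := (w' k - c')%C.
have ew2 k : (c' + w2 k = w' k)%C by rewrite /w2; ring.
have hw2 : Clim w2 C0.
  have := Clim_sub hc' (@Clim_const c'); by have -> : (c' - c' = C0)%C by ring.
have hG v : ev (at0 Q2) v = ev (at0 Q') (c' + v)%C by rewrite -!ev2_at0 r1 eC0.
have sG := translate_size hG.
have hGm : ((at0 Q2)`_m != 0)%R.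
  have : lead_coef (at0 Q2) != 0%R by rewrite lead_coef_eq0 -size_poly_eq0 sG q3.
  by rewrite lead_coefE sG q3.
have [m2 [hm2 hmin]] := @min_exists id (fun j => (at0 Q2)`_j != 0)%R (ex_intro _ m hGm).
have hm2m : (m2 <= m)%N := hmin m hGm.
have hlow2 j : (j < m2)%N -> ((at0 Q2)`_j = 0)%R.
  move=> hj; apply/eqP; apply: contraT => h; have := hmin j h; by rewrite /= leqNgt hj.
have hb2 : branch D Q2 s w2.
  split=> //; first by apply: (Um1 hs) => k [].
  by apply: (Um1 hz') => k h; rewrite r1 eC0 ew2.
(* The lower bound on the derivative is transported through the step: the derivative of [Q'] times
   [s^(p m)] is that of [Q] times [s^p]. *)
have hder0 : U (fun k => c * Cmod (s k) ^ (e * M) * Cmod (s k) ^ p <=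
     Cmod (ev2 Q2^`()%R (s k) (w2 k)) * Cmod (s k) ^ (p * m)).
  apply: (Um4 hder hs hw' hs0) => k h1 [_ h2] h3 h4.
  rewrite r2 eC0 ew2 -!CmodX -CmodM.
  have -> : (ev2 Q'^`()%R (s k) (w' k) * s k ^ (p * m)%N = s k ^ p * ev2 Q^`()%R (tau k) (w k))%C.
    rewrite [in RHS]h3 -h2 -q2; by move: (ev2 _ _ _) => x; ring.
  rewrite CmodM !CmodX.
  have -> : Cmod (s k) ^ (e * M) = Cmod (tau k) ^ M by rewrite -h2 CmodX -pow_mult.
  have := pow_le _ p (Cmod_ge0 (s k)); nra.
suff hexp : expansion D s w2.
  apply: (@expansion_root D e.-1 tau s w); first by rewrite prednK //; apply: (Um1 hs) => k [].
  apply: (expansion_affine (p := p) (c := c') _ hexp).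
  by apply: (Um1 hw') => k ->; rewrite ew2.
have hs2 : U (fun k => Cmod (s k) < 1).
  by apply: (Um1 (hs1 1 Rlt_0_1)) => k; have -> : (s k - C0 = s k)%C by ring.
case: (ltnP m2 m) => hlt.
  apply: (IHm m2 _ (e * M)%N Q2) => //; first lia.
  exists c; split=> //; apply: (Um3 hder0 hs2 hs0) => k h1 h2 h3.
  have h4 := Cmod_gt0 h3.
  have h5 : Cmod (s k) ^ (p * m) <= Cmod (s k) ^ p.
    have -> : (p * m = p + p * m.-1)%N by nia.
    rewrite pow_add; have := @pow_le_1 (Cmod (s k)) (p * m.-1) ltac:(lra).
    have := pow_lt _ p h4; nra.
  have h6 := pow_lt _ p h4.
  apply: (Rmult_le_reg_r (Cmod (s k) ^ p)) => //.
  apply: (Rle_trans _ _ _ h1); apply: Rmult_le_compat_l => //; exact: Cmod_ge0.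
have em : m2 = m by lia.
(* The multiplicity did not drop, so the recentred [at0 Q2] is a monomial. If [e] were not [1], the
   coefficient of degree [m - 1] would vanish and [at0 Q'] would be a monomial itself, but it has a
   second nonzero coefficient. *)
have he1 : e = 1%N.
  case: q6 => // hm1z; exfalso.
  have [j [hj /eqP hj0]] := q5; apply: hj0.
  apply: (@translate_monomial (at0 Q') c' m.-1 (at0 Q2) hG) => //; last lia.
  - by rewrite q3; lia.
  - by move=> i hi; apply: hlow2; lia.
have hpm : (p * m = p * m.-1 + p)%N by nia.
have hder1 : U (fun k => c * Cmod (s k) ^ M <= Cmod (ev2 Q2^`()%R (s k) (w2 k)) * Cmod (s k) ^ (p * m.-1)).
  apply: (Um2 hder0 hs0) => k h1 h2.
  have h3 := pow_lt _ p (Cmod_gt0 h2).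
  apply: (Rmult_le_reg_r (Cmod (s k) ^ p)) => //.
  by move: h1; rewrite he1 mul1n hpm pow_add Rmult_assoc; lra.
case: (leqP (p * m.-1) M) => hM.
  apply: (IHM (M - p * m.-1)%N _ Q2) => //; first by nia.
  - by move=> j hj; apply: hlow2; rewrite em.
  exists c; split=> //; apply: (Um2 hder1 hs0) => k h1 h2.
  have h3 := pow_lt _ (p * m.-1)%N (Cmod_gt0 h2).
  apply: (Rmult_le_reg_r (Cmod (s k) ^ (p * m.-1))) => //.
  apply: Rle_trans h1; right; rewrite Rmult_assoc -pow_add; congr (_ * _ ^ _); lia.
(* If [p (m - 1) > M], the lower bound would read [c |s|^M <= A |s|^(M+1)], which is impossible for
   small [s]. *)
exfalso.
have hA := Clim_bound (ev2_lim Q2^`()%R hs1 hw2).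
set A := Cmod (ev2 Q2^`()%R C0 C0) + 1 in hA.
have hA0 : 0 < A by rewrite /A; have := Cmod_ge0 (ev2 Q2^`()%R C0 C0); lra.
have hq : 0 < c / A by apply: Rdiv_lt_0_compat.
apply: Ufalse; apply: (Um4 (Uand hder1 hs2) hA hs0 (hs1 _ hq)) => k [h1 h2] h3 h4 h5.
have es : (s k - C0 = s k)%C by ring.
rewrite es in h5.
have h6 := Cmod_gt0 h4.
have h7 : Cmod (s k) ^ (p * m.-1) <= Cmod (s k) ^ M * Cmod (s k).
  have -> : (p * m.-1 = M + (1 + (p * m.-1 - M).-1))%N by lia.
  rewrite !pow_add pow_1; have := @pow_le_1 (Cmod (s k)) (p * m.-1 - M).-1 ltac:(lra).
  have := Rmult_lt_0_compat _ _ (pow_lt _ M h6) h6; nra.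
have h8 := pow_lt _ M h6.
have h9 : Cmod (ev2 Q2^`()%R (s k) (w2 k)) * Cmod (s k) ^ (p * m.-1) <= A * (Cmod (s k) ^ M * Cmod (s k)).
  apply: Rmult_le_compat => //; first exact: Cmod_ge0.
  by left; exact: pow_lt.
have h10 : A * Cmod (s k) < c.
  have -> : c = A * (c / A) by field; lra.
  exact: Rmult_lt_compat_l.
nra.
Qed.

End Puiseux.

(** [dp] plays the part of a discriminant: where it is nonzero, all roots in [w] are simple. The
    identity is kept instead of a resultant because it is carried along directly by substitutions in
    [t]. *)
Definition bezout (P : {poly {poly K}}) (dp : {poly K}) := exists A B : {poly {poly K}},
  forall t w, (ev2 A t w * ev2 P t w + ev2 B t w * ev2 P^`()%R t w)%C = ev dp t.

Lemma ev_lower_bound (a : {poly K}) (tau : nat -> C) : (a != 0)%R -> Clim tau C0 ->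
  exists v c, 0 < c /\ U (fun k => c * Cmod (tau k) ^ v <= Cmod (ev a (tau k))).
Proof.
move=> ha h1; have [v [b [-> hb]]] := factor_X ha.
have hb0 : ev b C0 <> C0 by rewrite /ev toK0 => /ofK_eq0 e; move/eqP: hb.
have hc := Cmod_gt0 hb0.
exists v, (Cmod (ev b C0) / 2); split; first lra.
apply: (Um1 (ev_lim b h1 (ltac:(lra) : 0 < Cmod (ev b C0) / 2))) => k.
rewrite Cmod_sym evM evXn CmodM CmodX => h.
have := Cmod_sub_ge (ev b C0) (ev b (tau k)); have := pow_le _ v (Cmod_ge0 (tau k)); nra.
Qed.

(** At a root the Bezout identity reads [B * P' = dp]. Here [dp] is at least a power of [|tau|], and
    [B] is at most a negative power of it because [y] has at most a pole. *)
Lemma derivative_lower_bound (P : {poly {poly K}}) dp (tau y : nat -> C) N : bezout P dp -> (dp != 0)%R ->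
  Clim tau C0 -> U (fun k => tau k <> C0) -> U (fun k => ev2 P (tau k) (y k) = C0) ->
  U (fun k => Cmod (tau k ^ N * y k)%C < 1) ->
  exists M c, 0 < c /\ U (fun k => c * Cmod (tau k) ^ M <= Cmod (ev2 P^`()%R (tau k) (y k))).
Proof.
move=> [A [B hAB]] hdp h1 h2 hz hy.
have [v [c [hc hv]]] := ev_lower_bound hdp h1.
have [E [hE HE]] := @ev2_growth (size B) B (leqnSn _).
set b := size B in HE.
have h2b : 0 < 2 ^ b by apply: pow_lt; lra.
exists (v + N * b)%N, (c / ((E + 1) * 2 ^ b)); split.
  by apply: Rdiv_lt_0_compat => //; apply: Rmult_lt_0_compat; lra.
have ht1 : U (fun k => Cmod (tau k) < 1).
  by apply: (Um1 (h1 1 Rlt_0_1)) => k; have -> : (tau k - C0 = tau k)%C by ring.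
apply: (Um4 hv (Uand hz hy) ht1 h2) => k h3 [h4 h5] h6 h7.
have h8 := hAB (tau k) (y k); rewrite h4 in h8.
have h9 : Cmod (ev2 B (tau k) (y k)) * Cmod (ev2 P^`()%R (tau k) (y k)) = Cmod (ev dp (tau k)).
  by rewrite -h8 -CmodM; congr Cmod; ring.
have h10 := HE (tau k) (y k) ltac:(lra).
have hp := Cmod_gt0 h7.
have hN : 0 < Cmod (tau k) ^ N by apply: pow_lt.
rewrite CmodM CmodX in h5.
have hN1 := @pow_le_1 (Cmod (tau k)) N ltac:(lra).
have h11 : Cmod (tau k) ^ N * (1 + Cmod (y k)) <= 2 by nra.
have h12 : (Cmod (tau k) ^ N) ^ b * (1 + Cmod (y k)) ^ b <= 2 ^ b.
  rewrite -Rpow_mult_distr; apply: pow_incr; split=> //.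
  by apply: Rmult_le_pos; have := Cmod_ge0 (y k); lra.
have hNb : 0 < (Cmod (tau k) ^ N) ^ b by apply: pow_lt.
have -> : Cmod (tau k) ^ (v + N * b)%N = Cmod (tau k) ^ v * (Cmod (tau k) ^ N) ^ b.
  by rewrite -pow_mult -pow_add.
have hP0 := Cmod_ge0 (ev2 P^`()%R (tau k) (y k)).
move: (Cmod (ev2 P^`()%R (tau k) (y k))) hP0 h9 => p hP0 h9.
move: (Cmod (ev2 B (tau k) (y k))) h9 h10 => q h9 h10.
rewrite -h9 in h3.
have hq : 0 < (1 + Cmod (y k)) ^ b by apply: pow_lt; have := Cmod_ge0 (y k); lra.
move: ((Cmod (tau k) ^ N) ^ b) ((1 + Cmod (y k)) ^ b) (Cmod (tau k) ^ v) (2 ^ b) h12 hNb hq h10 h3 h2b => x z r u h12 hNb hq h10 h3 h2b.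
apply: (Rmult_le_reg_l ((E + 1) * u)); first by apply: Rmult_lt_0_compat; lra.
have -> : (E + 1) * u * (c / ((E + 1) * u) * (r * x)) = c * r * x by field; lra.
apply: (Rle_trans _ (q * p * x)); first by apply: Rmult_le_compat_r; lra.
have h13 : q * p <= E * z * p by apply: Rmult_le_compat_r.
have h14 : q * p * x <= E * z * p * x by apply: Rmult_le_compat_r; lra.
have h15 : E * p * (x * z) <= E * p * u by apply: Rmult_le_compat_l => //; exact: Rmult_le_pos.
have h16 : 0 <= u * p by apply: Rmult_le_pos; lra.
nra.
Qed.

Section Puiseux.
Variable D : C -> Prop.
Hypothesis (Droot : forall n x, D x -> exists y, D y /\ (y ^ n.+1)%C = x).

(** A possible zero of the leading coefficient at [t = 0] makes the roots unbounded. Passing to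
    [t^N w] turns the leading coefficient into a unit and makes the others vanish at [t = 0]. *)
Lemma rescale (P : {poly {poly K}}) n : size P = n.+1 -> exists N M Q, [/\
  (forall t w, (t ^ M * ev2 Q t (t ^ N * w))%C = (t ^ (N * n)%N * ev2 P t w)%C),
  (forall t w, (t ^ M * t ^ N * ev2 Q^`()%R t (t ^ N * w))%C = (t ^ (N * n)%N * ev2 P^`()%R t w)%C),
  (forall j, (j < n)%N -> (at0 Q)`_j = 0)%R, ((at0 Q)`_n != 0)%R & (size Q <= n.+1)%N].
Proof.
move=> sP.
have hl : (P`_n != 0)%R by have := lead_coef_eq0 P; rewrite lead_coefE sP /= => ->; rewrite -size_poly_eq0 sP.
have [v [b [hb hb0]]] := factor_X hl.
(* With [v] the order of the leading coefficient, [N = v + 1] makes every exponent [N (n - j) - v]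
   with [j < n] positive. *)
pose N := v.+1.
pose c j : {poly K} := if (j == n)%N then b else ('X^(N * (n - j) - v) * P`_j)%R.
pose Q := (\poly_(j < n.+1) c j)%R.
have key j : (j <= n)%N -> ('X^v * c j = 'X^(N * (n - j)) * P`_j)%R.
  move=> hj; rewrite /c; case: eqP => [->|hne]; first by rewrite subnn muln0 GRing.expr0 GRing.mul1r hb.
  rewrite GRing.mulrA -GRing.exprD; congr ('X^ _ * _)%R; rewrite /N; nia.
have sQ j : (Q`_j = if (j < n.+1)%N then c j else 0)%R by rewrite coef_poly.
have [Q1 [q1 q2 q3]] := subst_exists Q 1 N.
have e1 (t : C) : (t ^ 1)%C = t by rewrite /=; ring.
have idp : (('X^v)%:P * Q1 = ('X^(N * n))%:P * P)%R.
  apply/polyP => j; rewrite !coefCM q3 GRing.expr1 comp_polyXr sQ.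
  case: ltnP => hj; last by rewrite GRing.mul0r GRing.mulr0 nth_default ?GRing.mulr0 // sP.
  rewrite GRing.mulrA key // GRing.mulrAC -GRing.exprD; congr ('X^ _ * _)%R; nia.
exists N, v, Q; split.
- move=> t w; have := f_equal (fun q => ev2 q t w) idp.
  by rewrite !ev2M !ev2C !evXn q1 e1.
- move=> t w; have := f_equal (fun q => ev2 q^`()%R t w) idp.
  rewrite !derivM !derivC !GRing.mul0r !GRing.add0r !ev2M !ev2C !evXn q2 e1 => <-.
  by move: (ev2 _ _ _) => x; ring.
- move=> j hj; rewrite coef_at0 sQ.
  have -> : (j < n.+1)%N by lia.
  rewrite /c; have -> : (j == n) = false by apply/eqP; lia.
  rewrite hornerM hornerXn GRing.expr0n.
  have -> : (N * (n - j) - v == 0)%N = false by apply/eqP; rewrite /N; nia.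
  by rewrite GRing.mul0r.
- by rewrite coef_at0 sQ ltnSn /c eqxx.
- exact: size_poly.
Qed.

(** After rescaling, the roots are bounded and their limit is a root of a monomial, hence [0]. So
    [puiseux_core] applies with the bound on the derivative given by [bezout]. *)
Lemma puiseux_expansion (P : {poly {poly K}}) (dp : {poly K}) (tau y : nat -> C) : (P != 0)%R ->
  bezout P dp -> (dp != 0)%R ->
  Clim tau C0 -> U (fun k => tau k <> C0) -> U (fun k => D (tau k)) ->
  U (fun k => ev2 P (tau k) (y k) = C0) ->
  exists N, expansion D tau (fun k => tau k ^ N * y k)%C.
Proof.
move=> hP hbz hdp h1 h2 h3 h4.
have [n sP] : exists n, size P = n.+1.
  by exists (size P).-1; rewrite prednK // size_poly_gt0.
have [N [M' [Q [q1 q2 q3 q4 q5]]]] := rescale sP.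
pose w k := (tau k ^ N * y k)%C.
have hz : U (fun k => ev2 Q (tau k) (w k) = C0).
  apply: (Um2 h2 h4) => k h6 h7; have := q1 (tau k) (y k); rewrite h7 -/(w k).
  have -> : (tau k ^ (N * n)%N * C0 = C0)%C by ring.
  by move=> /Cmul_eq0 [h8|//]; have := @Cpow_neq0 _ M' h6.
exists N; change (expansion D tau w).
have hlead : ofK (at0 Q)`_n%R <> C0 by move=> /ofK_eq0 e; move/eqP: q4.
have hdrop : drop_poly n Q = ((Q`_n)%:P)%R.
  apply/polyP => j; rewrite coef_drop_poly coefC; case: j => [|j] //=.
  by rewrite nth_default //; apply: leq_trans q5 _; lia.
have [B hB] : exists B, U (fun k => Cmod (w k) <= B).
  apply: (@root_bounded n Q tau w _ h1 hlead hz).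
  rewrite ofK_coef0; apply: Clim_ext (ev_lim Q`_n%R h1).
  by apply: Uall => k; rewrite hdrop ev2C.
have [l hl] := Clim_ex hB.
have hl0 : l = C0.
  have hzl : ev2 Q C0 l = C0.
    apply: Clim_uniq (ev2_lim Q h1 hl) _; apply: Clim_ext (Clim_const C0).
    by apply: (Um1 hz).
  have eQ : at0 Q = ((at0 Q)`_n *: 'X^n)%R.
    apply/polyP => j; rewrite coefZ coefXn; case: (ltngtP j n) => hj.
    - by rewrite GRing.mulr0; exact: q3.
    - by rewrite GRing.mulr0 coef_at0 (nth_default _ (leq_trans q5 hj)) horner0.
    - by rewrite hj GRing.mulr1.
  apply: NNPP => hne; move: hzl; rewrite ev2_at0 eQ -mul_polyC evM evC evXn.
  by move=> /Cmul_eq0 [//|]; exact: Cpow_neq0.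
rewrite hl0 in hl.
have [M [c [hc h5]]] : exists M c, 0 < c /\
    U (fun k => c * Cmod (tau k) ^ M <= Cmod (ev2 P^`()%R (tau k) (y k))).
  apply: (@derivative_lower_bound P dp tau y N) => //.
  apply: (Um1 (hl 1 Rlt_0_1)) => k; rewrite -/(w k).
  by have -> : (w k - C0 = w k)%C by ring.
apply: (@puiseux_core D Droot n (N * n + M)%N Q) => //.
exists c; split=> //.
have hs2 : U (fun k => Cmod (tau k) < 1).
  by apply: (Um1 (h1 1 Rlt_0_1)) => k; have -> : (tau k - C0 = tau k)%C by ring.
apply: (Um3 h5 hs2 h2) => k h6 h7 h8.
have h9 := f_equal Cmod (q2 (tau k) (y k)); rewrite -/(w k) !CmodM !CmodX in h9.
have h10 := Cmod_gt0 h8.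
have h11 : Cmod (tau k) ^ M' * Cmod (tau k) ^ N <= 1.
  by rewrite -pow_add; have := @pow_le_1 (Cmod (tau k)) (Nat.add M' N) ltac:(lra); lra.
rewrite pow_add.
have h12 := pow_lt _ (N * n)%N h10.
have h13 := Rmult_le_compat_l _ _ _ (Rlt_le _ _ h12) h6.
have h14 := Cmod_ge0 (ev2 Q^`()%R (tau k) (w k)).
have h15 := Rmult_le_compat_r _ _ _ h14 h11.
lra.
Qed.

(** A growth bound along one sequence suffices: it forces [phi C0 = C0], a factor [t] is split off,
    and the bound is inherited by the quotient. *)
Lemma PS_divX n d A phi (s : nat -> C) B : 0 < d -> PS d A phi -> Clim s C0 -> U (fun k => s k <> C0) ->
  U (fun k => Cmod (phi (s k)) <= B * Cmod (s k) ^ n) ->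
  exists A' psi, PS d A' psi /\ forall t, Cmod t < d -> phi t = (t ^ n * psi t)%C.
Proof.
move=> hd hp hs hs0; elim: n A phi hp => [|n IH] A phi hp hB.
  by exists A, phi; split=> // t _ /=; ring.
have hphi0 : phi C0 = C0.
  apply: Clim_uniq (PS_lim0 hd hp hs) _.
  apply: (@Clim0_squeeze _ (fun k => Rabs B * Cmod (s k))).
    have hs2 : U (fun k => Cmod (s k) < 1).
      by apply: (Um1 (hs 1 Rlt_0_1)) => k; have -> : (s k - C0 = s k)%C by ring.
    apply: (Um2 hB hs2) => k h1 h2; apply: (Rle_trans _ _ _ h1).
    have h3 := Cmod_ge0 (s k).
    have h4 := @pow_le_base (Cmod (s k)) n ltac:(lra).
    have h5 := pow_le _ n.+1 h3; have h6 := Rle_abs B; have h7 := Rabs_pos B.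
    apply: (Rle_trans _ (Rabs B * Cmod (s k) ^ n.+1)); first exact: Rmult_le_compat_r.
    exact: Rmult_le_compat_l.
  have -> : 0 = Rabs B * 0 by ring.
  by apply: Rlim_mul; [exact: Rlim_const | exact: Clim0_mod].
have [h1 [hp1 e1]] := PS_div hd hp hphi0.
have [A' [psi [h2 h3]]] : exists A' psi, PS d A' psi /\ forall t, Cmod t < d -> h1 t = (t ^ n * psi t)%C.
  apply: (IH _ _ hp1); apply: (Um3 hB hs0 (hs d hd)) => k h4 h5.
  have -> : (s k - C0 = s k)%C by ring.
  move=> h6; move: h4; rewrite e1 // CmodM => h4.
  apply: (Rmult_le_reg_l (Cmod (s k))); first exact: Cmod_gt0.
  by move: h4 => /=; lra.
by exists A', psi; split=> // t ht; rewrite e1 // h3 //=; ring.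
Qed.

Lemma expansion_limit (tau s : nat -> C) e : Clim tau C0 -> U (fun k => tau k <> C0) ->
  U (fun k => (s k ^ e.+1)%C = tau k) -> Clim s C0 /\ U (fun k => s k <> C0).
Proof.
move=> h1 h2 h3; split; first exact: Clim_root0 h3.
apply: (Um2 h2 h3) => k h4 h5 h6; apply: h4; rewrite -h5 h6 /=; ring.
Qed.

End Puiseux.

(** * Separable relations *)

Definition nonconstant (x : nat -> C) := forall c, ~ U (fun k => x k = c).

Lemma ev_eq0_nonconstant (p : {poly K}) (x : nat -> C) : nonconstant x -> (p != 0)%R ->
  ~ U (fun k => ev p (x k) = C0).
Proof.
move=> hx; have [n] := ubnP (size p); elim: n p => // n IH p hn hp hU.
have [k hk] := Uex hU.
have /factor_theorem [q hq] : root p (toK (x k)).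
  by rewrite /root; apply/eqP; apply: ofK_inj.
have hq0 : (q != 0)%R by apply: contraNneq hp => e; rewrite hq e GRing.mul0r.
have h2 : U (fun j => ev q (x j) = C0 \/ x j = x k).
  apply: (Um1 hU) => j; rewrite hq evM => /Cmul_eq0 [h|h]; [by left | right].
  move: h; rewrite /ev !hornerE => /ofK_eq0 /eqP; rewrite GRing.subr_eq0 => /eqP; exact: toK_inj.
case: (Uor h2) => [h3|]; last exact: hx.
apply: (IH q) => //; move: hn.
by rewrite hq size_Mmonic ?monicXsubC // size_XsubC addn2 /= ltnS.
Qed.

Lemma ev_neq0_ex (p : {poly K}) : (p != 0)%R <-> exists t, ev p t <> C0.
Proof.
split=> [hp|[t ht]]; last by apply/eqP => e; apply: ht; rewrite e ev0.
apply: NNPP => hn.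
have := @ev_eq0_nonconstant p (fun k => RtoC (INR k)) _ hp; apply.
  move=> c hU; have [k hk] := Uex hU.
  have [j [hj hkj]] := Uex (Uand hU (Ucofin (S k))).
  have : INR j = INR k by rewrite -[INR j]/(fst (RtoC (INR j))) hj -hk.
  by move=> /INR_eq; lia.
by apply: Uall => k; apply: NNPP => h; apply: hn; exists (RtoC (INR k)).
Qed.

Lemma size1_combination (A : nzRingType) (p q : {poly A}) : size q = 1%N ->
  ((q`_0)%:P = 0 * p + 1 * q)%R.
Proof. by move=> h; rewrite GRing.mul0r GRing.add0r GRing.mul1r -size1_polyC ?h. Qed.

(** Take a relation of minimal degree in [y]. A common factor of it and its derivative would yield a
    factorization into relations of smaller degree, one of which would hold along the ultrafilter.
    So the resultant with the derivative is nonzero. *)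
Lemma separable_relation (P : {poly {poly K}}) (x y : nat -> C) : (P != 0)%R -> nonconstant x ->
  U (fun k => ev2 P (x k) (y k) = C0) ->
  exists (Q : {poly {poly K}}) n dp, [/\ size Q = n.+1, U (fun k => ev2 Q (x k) (y k) = C0), bezout Q dp, (dp != 0)%R &
    forall t, ev dp t <> C0 -> ev (Q`_n)%R t <> C0].
Proof.
move=> hP hx hU.
have [Q [[hQ0 hQU] hmin]] : exists Q : {poly {poly K}}, ((Q != 0)%R /\ U (fun k => ev2 Q (x k) (y k) = C0)) /\
   forall Q' : {poly {poly K}}, (Q' != 0)%R -> (size Q' < size Q)%N -> ~ U (fun k => ev2 Q' (x k) (y k) = C0).
  have [n] := ubnP (size P); elim: n P hP hU => // n IH P hP hU hn.
  case: (classic (exists Q' : {poly {poly K}}, [/\ (Q' != 0)%R, (size Q' < size P)%N & U (fun k => ev2 Q' (x k) (y k) = C0)])) => [[Q' [h1 h2 h3]]|h].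
    by apply: (IH Q') => //; lia.
  by exists P; split=> // Q' h1 h2 h3; apply: h; exists Q'.
have sQ1 : (1 < size Q)%N.
  rewrite ltnNge; apply/negP => hs; have e := size1_polyC hs.
  have hc : (Q`_0 != 0)%R by apply: contraNneq hQ0 => e0; rewrite e e0.
  apply: (ev_eq0_nonconstant hx hc); apply: (Um1 hQU) => k.
  by rewrite {1}e ev2C.
have [n sQ] : exists n, size Q = n.+2 by exists (size Q).-2; lia.
have hl : (Q`_n.+1 != 0)%R by have := lead_coef_eq0 Q; rewrite lead_coefE sQ /= => ->.
have hd1 : (Q^`()`_n != 0)%R.
  rewrite coef_deriv -GRing.mulr_natr GRing.mulf_neq0 //.
  by rewrite -polyC_natr polyC_eq0 Num.Theory.pnatr_eq0.
have sd : size Q^`()%R = n.+1.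
  apply/eqP; rewrite eqn_leq; apply/andP; split.
    by apply/leq_sizeP => j hj; rewrite coef_deriv nth_default ?GRing.mul0rn // sQ.
  by rewrite ltnNge; apply: contra hd1 => h; rewrite nth_default.
have [A [B [r [hr hAB]]]] : exists A B (r : {poly K}), (r != 0)%R /\ (r%:P = A * Q + B * Q^`())%R.
  (* In degree [1] the derivative is a constant in [w], and it serves itself as the element of the
     ideal. *)
  case: n sQ hl hd1 sd => [|n] sQ hl hd1 sd.
    exists 0%R, 1%R, (Q^`()`_0)%R; split=> //.
    exact: size1_combination.
  have s1 : (1 < size Q^`()%R)%N by rewrite sd.
  have [uv _ huv] := resultant_in_ideal sQ1 s1.
  exists uv.1, uv.2, (resultant Q Q^`())%R; split=> //.
  rewrite resultant_eq0 -leqNgt leqNgt; apply/negP => hg.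
  set G := gcdp Q Q^`()%R in hg.
  have hG0 : (G != 0)%R by rewrite -size_poly_gt0; lia.
  have sG : (size G < size Q)%N.
    have : (size G <= size Q^`()%R)%N.
      by apply: dvdp_leq; [rewrite -size_poly_gt0 sd | exact: dvdp_gcdr].
    by rewrite sd sQ; lia.
  have /Pdiv.Idomain.dvdpP [[c H] /= hc hcH] := dvdp_gcdl Q Q^`()%R.
  have hcQ0 : (c *: Q != 0)%R by rewrite scale_poly_eq0 negb_or hc hQ0.
  have hH0 : (H != 0)%R by apply: contraNneq hcQ0 => e; rewrite hcH e GRing.mul0r.
  have sH : (size H < size Q)%N.
    have := size_scale Q hc; rewrite hcH size_mul // -/G => <-; lia.
  have h2 : U (fun k => ev2 H (x k) (y k) = C0 \/ ev2 G (x k) (y k) = C0).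
    apply: (Um1 hQU) => k hk; apply: Cmul_eq0; rewrite -ev2M -hcH -mul_polyC ev2M hk; ring.
  by case: (Uor h2); apply: hmin.
(* The leading coefficient is included in [dp], so that no root escapes to infinity where [dp] is
   nonzero. *)
exists Q, n.+1, (Q`_n.+1 * r)%R; split=> //.
- exists (A * (Q`_n.+1)%:P)%R, (B * (Q`_n.+1)%:P)%R => t w.
  rewrite !ev2M ev2C evM -(ev2C r t w) hAB ev2D !ev2M.
  by move: (ev2 A t w) (ev2 B t w) (ev2 Q t w) (ev2 _ t w) => a b c d; ring.
- by rewrite GRing.mulf_neq0.
- by move=> t h1 h2; apply: h1; rewrite evM h2; ring.
Qed.

Lemma bezout_shift P dp a : bezout P dp -> (dp != 0)%R -> exists P' dp',
  [/\ bezout P' dp', (dp' != 0)%R & forall t w, ev2 P' t w = ev2 P (a + t)%C w].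
Proof.
move=> [A [B hAB]] /ev_neq0_ex [t0 ht0].
have [P' [p1 p2]] := ev2_shift P a C0.
have [A' [a1 _]] := ev2_shift A a C0.
have [B' [b1 _]] := ev2_shift B a C0.
have [dp' hd] := ev_shift dp a.
have e0 w : (C0 + w = w)%C by ring.
exists P', dp'; split.
- by exists A', B' => t w; rewrite p1 p2 a1 b1 hd hAB.
- apply/ev_neq0_ex; exists (t0 - a)%C; rewrite hd.
  by have -> : (a + (t0 - a) = t0)%C by ring.
- by move=> t w; rewrite p1 e0.
Qed.

Lemma ev_invert (p : {poly K}) a u : exists N p', forall t, t <> C0 ->
  ev p' t = (t ^ N * ev p (a + u * Cinv t))%C.
Proof.
elim/poly_ind: p => [|p c [N [p' h]]].
  by exists 0%N, 0%R => t _; rewrite !ev0; ring.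
exists N.+1, (p' * ((toK a)%:P * 'X + (toK u)%:P) + c%:P * 'X^(N.+1))%R => t ht.
rewrite !(evD, evM, evX, evC, evXn) !toKK h //=.
by field.
Qed.

Lemma ev2_invert (Q : {poly {poly K}}) a u : exists N Q', forall t w, t <> C0 ->
  ev2 Q' t w = (t ^ N * ev2 Q (a + u * Cinv t) w)%C /\
  ev2 Q'^`()%R t w = (t ^ N * ev2 Q^`()%R (a + u * Cinv t) w)%C.
Proof.
elim/poly_ind: Q => [|P c [N1 [P' h]]].
  by exists 0%N, 0%R => t w _; rewrite deriv0 !ev2_0; split; ring.
have [N2 [c' hc]] := ev_invert c a u.
exists (N1 + N2)%N, (P' * ('X^(N2))%:P * 'X + (c' * 'X^(N1))%:P)%R => t w ht.
have [h1 h2] := h t w ht.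
rewrite !ev2MXaddC !ev2_derivMXaddC !derivM !derivC GRing.mulr0 GRing.addr0 !ev2M !ev2C evM !evXn h1 h2 hc // !CpowD.
by move: (ev2 _ _ _) (ev2 _ _ _) (ev _ _) => x y z; split; ring.
Qed.

Lemma polyXsubC_neq0 (a : K) : ('X - a%:P != 0)%R.
Proof. by rewrite -size_poly_eq0 size_XsubC. Qed.

Lemma bezout_invert P dp a u : bezout P dp -> (dp != 0)%R -> u <> C0 -> exists N P' dp',
  [/\ bezout P' dp', (dp' != 0)%R & forall t w, t <> C0 -> ev2 P' t w = (t ^ N * ev2 P (a + u * Cinv t)%C w)%C].
Proof.
move=> [A [B hAB]] hdp hu.
have [NP [P' hP]] := ev2_invert P a u.
have [NA [A' hA]] := ev2_invert A a u.
have [NB [B' hB]] := ev2_invert B a u.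
have [ND [d' hd]] := ev_invert dp a u.
(* The surplus factors ['X] make both sides of the identity vanish at [t = 0], where the
   substitution [a + u / t] has no meaning. *)
exists NP, P', (d' * 'X^((NA + NB + NP).+1))%R; split; last by move=> t w /(hP t w) [].
- exists (A' * ('X^((NB + ND).+1))%:P)%R, (B' * ('X^((NA + ND).+1))%:P)%R => t w.
  rewrite !ev2M !ev2C evM !evXn.
  case: (classic (t = C0)) => [->|ht]; first by rewrite /=; ring.
  have [p1 p2] := hP t w ht; have [a1 _] := hA t w ht; have [b1 _] := hB t w ht.
  have := hAB (a + u * Cinv t)%C w.
  rewrite p1 p2 a1 b1 hd //= !CpowD => <-.
  by move: (ev2 A _ _) (ev2 B _ _) (ev2 P _ _) (ev2 P^`()%R _ _) => x y z v; ring.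
- have hX : (('X - (toK a)%:P) * dp != 0)%R by rewrite GRing.mulf_neq0 // polyXsubC_neq0.
  have /ev_neq0_ex [t1 ht1] := hX.
  have ha : (t1 - a)%C <> C0.
    move=> e; apply: ht1; rewrite evM.
    have -> : ev ('X - (toK a)%:P)%R t1 = (t1 - a)%C.
      by rewrite -polyCN evD evX evC; congr Cadd; rewrite -[a in RHS]toKK; case: (toK a).
    by rewrite e; ring.
  apply/ev_neq0_ex; exists (u * Cinv (t1 - a))%C.
  have hne : (u * Cinv (t1 - a))%C <> C0.
    move=> /Cmul_eq0 [//|e]; apply: C1_neq_C0.
    have -> : C1 = (Cinv (t1 - a) * (t1 - a))%C by field.
    by rewrite e; ring.
  rewrite evM evXn => /Cmul_eq0 [|]; last exact: Cpow_neq0.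
  rewrite hd // => /Cmul_eq0 [|]; first exact: Cpow_neq0.
  have -> : (a + u * Cinv (u * Cinv (t1 - a)) = t1)%C by field; split.
  by move=> e; apply: ht1; rewrite evM e; ring.
Qed.

(** * Analytic continuation of algebraic functions along a path *)

Lemma psum_arg_lim a N (t : nat -> C) l : Clim t l -> Clim (fun k => psum a N (t k)) (psum a N l).
Proof.
move=> ht; elim: N a => [|N IH] a /=; first exact: Clim_const.
by apply: Clim_add; [exact: Clim_const | apply: Clim_mul].
Qed.

Lemma PS_lim_at d M h (t : nat -> C) t0 : 0 < d -> PS d M h -> Cmod t0 < d -> Clim t t0 ->
  Clim (fun k => h (t k)) (h t0).
Proof.
move=> hd [a ha] ht0 ht eps heps.
have h0 := Cmod_ge0 t0.
pose r := (Cmod t0 + d) / 2; have hr : 0 <= r < d by rewrite /r; lra.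
have hM : 0 <= M by apply: (@PS_M_ge0 d _ h); exists a.
have hq : 0 <= r / d < 1.
  split; first by apply: Rmult_le_pos; [lra | left; apply: Rinv_0_lt_compat].
  by apply: (Rmult_lt_reg_r d) => //; rewrite /Rdiv Rmult_assoc Rinv_l; lra.
have [N hN] := Uex (Rlim_geom M hq (ltac:(lra) : 0 < eps / 4)).
rewrite Rminus_0_r in hN; have hN' := Rle_abs (M * (r / d) ^ N).
have tail s : Cmod s <= r -> Cmod (h s - psum a N s)%C <= eps / 4.
  move=> hs; have := (proj2 ha) s ltac:(lra) N => h1.
  have : M * (Cmod s / d) ^ N <= M * (r / d) ^ N.
    apply: Rmult_le_compat_l => //; apply: pow_incr; split; first exact: ratio_ge0.
    by apply: Rmult_le_compat_r; [left; apply: Rinv_0_lt_compat | ].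
  lra.
apply: (Um2 (ht (r - Cmod t0) ltac:(rewrite /r; lra)) (psum_arg_lim a N ht (ltac:(lra) : 0 < eps / 4))) => k h1 h2.
have h3 : Cmod (t k) <= r by have := Cmod_sub_ge (t k) t0; lra.
have h4 := tail (t k) h3; have h5 := tail t0 ltac:(rewrite /r; lra).
have h6 := Cmod_sub_triangle (h (t k)) (psum a N (t k)) (h t0).
have h7 := Cmod_sub_triangle (psum a N (t k)) (psum a N t0) (h t0).
rewrite (Cmod_sym (psum a N t0)) in h7; lra.
Qed.

Lemma PS_cont d M h t0 e : 0 < d -> PS d M h -> Cmod t0 < d -> 0 < e ->
  exists r, 0 < r /\ forall t, Cmod (t - t0)%C < r -> Cmod (h t - h t0)%C < e.
Proof.
move=> hd hp ht0 he; apply: NNPP => hn.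
have hk k : exists t, Cmod (t - t0)%C < / (INR k + 1) /\ e <= Cmod (h t - h t0)%C.
  apply: NNPP => hk; apply: hn; exists (/ (INR k + 1)); split; first exact: inv_nat_gt0.
  by move=> t ht; apply: Rnot_le_lt => hle; apply: hk; exists t.
pose t k := proj1_sig (constructive_indefinite_description _ (hk k)).
have ht k := proj2_sig (constructive_indefinite_description _ (hk k)).
have hl : Clim t t0.
  move=> eps heps; apply: (Um1 (Rlim_inv_nat heps)) => k.
  have := inv_nat_gt0 k; have [h1 _] := ht k; rewrite Rminus_0_r => h2.
  by rewrite Rabs_pos_eq; rewrite -/(t k) in h1; lra.
have [k h1] := Uex (PS_lim_at hd hp ht0 hl he).
by have [_ h2] := ht k; rewrite -/(t k) in h2; lra.
Qed.

Definition shiftT (a : C) (P : {poly {poly K}}) : {poly {poly K}} :=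
  map_poly (comp_poly ('X + (toK a)%:P)%R) P.

Lemma ev_comp_shift (c : {poly K}) a t : ev (c \Po ('X + (toK a)%:P))%R t = ev c (a + t)%C.
Proof.
rewrite /ev horner_comp !hornerE; congr (ofK _.[_])%R.
apply: ofK_inj; rewrite ofKD !toKK; ring.
Qed.

Lemma ev2_shiftT a P t w : ev2 (shiftT a P) t w = ev2 P (a + t)%C w.
Proof.
rewrite /shiftT; elim/poly_ind: P => [|P c IH]; first by rewrite GRing.rmorph0 !ev2_0.
by rewrite GRing.rmorphD GRing.rmorphM /= map_polyX map_polyC !ev2MXaddC IH ev_comp_shift.
Qed.

(** A nonvanishing leading coefficient at [t0] keeps the roots bounded, so they converge along the
    ultrafilter. *)
Lemma root_limit (P : {poly {poly K}}) n (t y : nat -> C) t0 : size P = n.+1 ->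
  ev (P`_n)%R t0 <> C0 -> Clim t t0 -> U (fun k => ev2 P (t k) (y k) = C0) ->
  exists l, Clim y l /\ ev2 P t0 l = C0.
Proof.
move=> sP hl ht hU.
have e1 k : (t0 + (t k - t0) = t k)%C by ring.
have ht0 : Clim (fun k => t k - t0)%C C0.
  have := Clim_sub ht (@Clim_const t0); by have -> : (t0 - t0 = C0)%C by ring.
have e0 : (t0 + C0 = t0)%C by ring.
have hdrop : drop_poly n (shiftT t0 P) = (((shiftT t0 P)`_n)%:P)%R.
  apply/polyP => j; rewrite coef_drop_poly coefC; case: j => [|j] //=.
  by rewrite coef_map /= nth_default ?comp_poly0 // sP; lia.
have [B hB] : exists B, U (fun k => Cmod (y k) <= B).
  apply: (@root_bounded n (shiftT t0 P) (fun k => t k - t0)%C y _ ht0 hl).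
    by apply: (Um1 hU) => k; rewrite ev2_shiftT e1.
  have := ev_lim ((shiftT t0 P)`_n)%R ht0.
  have -> : ev ((shiftT t0 P)`_n)%R C0 = ev (P`_n)%R t0 by rewrite coef_map /= ev_comp_shift e0.
  by apply: Clim_ext; apply: Uall => k; rewrite hdrop ev2C.
have [l hll] := Clim_ex hB.
exists l; split=> //; apply: Clim_uniq (ev2_lim P ht hll) _.
by apply: Clim_ext (Clim_const C0); apply: (Um1 hU).
Qed.

Definition path_cont (T : R -> C) := forall x e, 0 < e ->
  exists r, 0 < r /\ forall y, Rabs (y - x) < r -> Cmod (T y - T x)%C < e.

Definition cont_on (al be : R) (g : R -> C) := forall x e, al <= x <= be -> 0 < e ->
  exists r, 0 < r /\ forall y, al <= y <= be -> Rabs (y - x) < r -> Cmod (g y - g x)%C < e.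

Section Continuation.
Variables (P : {poly {poly K}}) (dp : {poly K}) (n : nat) (T : R -> C).
Hypotheses (sP : size P = n.+1) (hbz : bezout P dp)
  (hlead : forall t, ev dp t <> C0 -> ev (P`_n)%R t <> C0) (hT : path_cont T).

Lemma local_section t0 y0 : ev dp t0 <> C0 -> ev2 P t0 y0 = C0 -> exists d e phi,
  [/\ 0 < d, 0 < e, PS d e phi, phi C0 = C0 &
    (forall t, Cmod t < d -> ev2 P (t0 + t)%C (y0 + phi t)%C = C0) /\
    forall t w, Cmod t < d -> Cmod (w - y0)%C <= e -> ev2 P (t0 + t)%C w = C0 -> w = (y0 + phi t)%C].
Proof.
move=> hg hz; have [A [B hAB]] := hbz.
have hd : ev2 P^`()%R t0 y0 <> C0.
  move=> h; apply: hg; rewrite -(hAB t0 y0) hz h; ring.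
have [d [e [phi [h1 h2 h3 h4 h5]]]] := implicit_function_at Rlt_0_1 hz hd.
exists d, e, phi; split=> //; first by lra.
have h6 : y0 = (y0 + phi C0)%C.
  apply: h5; first by rewrite Cmod0.
    have -> : (y0 - y0 = C0)%C by ring.
    by rewrite Cmod0; lra.
  by have -> : (t0 + C0 = t0)%C by ring.
have -> : phi C0 = ((y0 + phi C0) - y0)%C by ring.
by rewrite -h6; ring.
Qed.

Definition root_on al be g := cont_on al be g /\ forall x, al <= x <= be -> ev2 P (T x) (g x) = C0.

Lemma root_on_sub al be al' be' g : root_on al be g -> al <= al' -> be' <= be -> root_on al' be' g.
Proof.
move=> [h1 h2] ha hb; split; last by move=> x hx; apply: h2; lra.
move=> x e hx he; have [r [hr h]] := h1 x e ltac:(lra) he.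
by exists r; split=> // y hy; apply: h; lra.
Qed.

Lemma root_local al be g x : root_on al be g -> al <= x <= be -> ev dp (T x) <> C0 ->
  exists d e phi r, [/\ 0 < d, 0 < r, PS d e phi, phi C0 = C0 &
    forall y, al <= y <= be -> Rabs (y - x) < r -> Cmod (T y - T x)%C < d /\ g y = (g x + phi (T y - T x))%C].
Proof.
move=> [h1 h2] hx hg.
have [d [e [phi [hd he hp hp0 [hz hu]]]]] := local_section hg (h2 x hx).
have [r1 [hr1 hc1]] := h1 x e hx he.
have [r2 [hr2 hc2]] := hT x hd.
exists d, e, phi, (Rmin r1 r2); split=> //; first exact: Rmin_glb_lt.
have m1 := Rmin_l r1 r2; have m2 := Rmin_r r1 r2.
move=> y hy hyx; have h3 := hc2 y ltac:(lra); split=> //.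
apply: hu => //; first by left; apply: hc1; lra.
have -> : (T x + (T y - T x) = T y)%C by ring.
exact: h2.
Qed.

(** Two continuous roots that agree at a point both follow the section through it that the implicit
    function theorem provides, and agreement is preserved in limits. *)
Lemma root_unique al be g g' : (forall x, al <= x <= be -> ev dp (T x) <> C0) ->
  root_on al be g -> root_on al be g' -> g al = g' al -> forall x, al <= x <= be -> g x = g' x.
Proof.
move=> hgood rg rg' e0 x hx.
suff : x <= be -> g x = g' x by apply; lra.
move: x {hx}(proj1 hx).
apply: (@real_induction (fun x => x <= be -> g x = g' x)) => //.
- move=> x hx h; case: (Rlt_dec x be) => hxb; last first.
    exists 1; split; first lra; move=> y hy hyb.
    by apply: h; lra.
  have exx := h x ltac:(lra) ltac:(lra).
  have [h1 h2] := rg; have [h1' h2'] := rg'.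
  have [d [e [phi [hd he hp hp0 [hz hu]]]]] := local_section (hgood x ltac:(lra)) (h2 x ltac:(lra)).
  have [r1 [hr1 hc1]] := h1 x e ltac:(lra) he.
  have [r2 [hr2 hc2]] := h1' x e ltac:(lra) he.
  have [r3 [hr3 hc3]] := hT x hd.
  have m1 := Rmin_l r1 (Rmin r2 r3); have m2 := Rmin_r r1 (Rmin r2 r3).
  have m3 := Rmin_l r2 r3; have m4 := Rmin_r r2 r3.
  have m0 : 0 < Rmin r1 (Rmin r2 r3) by do 2 (apply: Rmin_glb_lt => //).
  exists (Rmin r1 (Rmin r2 r3) / 2); split; first lra.
  move=> y hy hyb.
  have habs : Rabs (y - x) < Rmin r1 (Rmin r2 r3) by rewrite Rabs_pos_eq; lra.
  have eT : (T x + (T y - T x) = T y)%C by ring.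
  have s1 := hu (T y - T x)%C (g y) (hc3 y ltac:(lra)) (Rlt_le _ _ (hc1 y ltac:(lra) ltac:(lra))).
  have s2 := hu (T y - T x)%C (g' y) (hc3 y ltac:(lra)).
  rewrite exx in s2; have s3 := s2 (Rlt_le _ _ (hc2 y ltac:(lra) ltac:(lra))).
  rewrite eT in s1 s3; rewrite s1; last by apply: h2; lra.
  by rewrite exx -s3 //; apply: h2'; lra.
- move=> x hx h hxb; apply: NNPP => hne.
  have hne' : (g x - g' x)%C <> C0.
    move=> e; apply: hne; have -> : g x = ((g x - g' x) + g' x)%C by ring.
    by rewrite e; ring.
  have he := Cmod_gt0 hne'.
  have [r1 [hr1 hc1]] := (proj1 rg) x (Cmod (g x - g' x)%C / 2) ltac:(lra) ltac:(lra).
  have [r2 [hr2 hc2]] := (proj1 rg') x (Cmod (g x - g' x)%C / 2) ltac:(lra) ltac:(lra).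
  have m1 := Rmax_l al (x - Rmin r1 r2 / 2); have m2 := Rmax_r al (x - Rmin r1 r2 / 2).
  have m3 := Rmin_l r1 r2; have m4 := Rmin_r r1 r2.
  have m5 : 0 < Rmin r1 r2 by apply: Rmin_glb_lt.
  have m6 : Rmax al (x - Rmin r1 r2 / 2) < x by apply: Rmax_lub_lt; lra.
  move: m1 m2 m6; set y := Rmax _ _ => m1 m2 m6.
  have habs : Rabs (y - x) < Rmin r1 r2 by rewrite -Rabs_Ropp Rabs_pos_eq; lra.
  have q1 := hc1 y ltac:(lra) ltac:(lra); have q2 := hc2 y ltac:(lra) ltac:(lra).
  have q3 := h y ltac:(lra) ltac:(lra).
  rewrite Cmod_sym in q1; rewrite -q3 in q2.
  have := Cmod_sub_triangle (g x) (g y) (g' x); lra.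
Qed.

Lemma root_glue al p be g b t0 d e phi : al <= p <= be -> root_on al p g -> 0 < d -> PS d e phi ->
  (forall t, Cmod t < d -> ev2 P (t0 + t)%C (b + phi t)%C = C0) ->
  (forall x, p <= x <= be -> Cmod (T x - t0)%C < d) -> g p = (b + phi (T p - t0))%C ->
  root_on al be (fun x => if Rle_dec x p then g x else (b + phi (T x - t0))%C).
Proof.
move=> hap [h1 h2] hd hp hz hTd ep.
have sec x r : p <= x <= be -> 0 < r -> exists r', 0 < r' /\ forall y, p <= y <= be -> Rabs (y - x) < r' ->
    Cmod ((b + phi (T y - t0)) - (b + phi (T x - t0)))%C < r.
  move=> hx hr; have [r1 [hr1 hc1]] := PS_cont hd hp (hTd x hx) hr.
  have [r2 [hr2 hc2]] := hT x hr1.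
  exists r2; split=> // y hy hyx.
  have -> : ((b + phi (T y - t0)) - (b + phi (T x - t0)) = phi (T y - t0) - phi (T x - t0))%C by ring.
  apply: hc1; have -> : (T y - t0 - (T x - t0) = T y - T x)%C by ring.
  exact: hc2.
split; last first.
  move=> x hx; case: Rle_dec => hxp; first by apply: h2; lra.
  have -> : T x = (t0 + (T x - t0))%C by ring.
  have -> : (t0 + (T x - t0) - t0 = T x - t0)%C by ring.
  by apply: hz; apply: hTd; lra.
move=> x r hx hr; case: Rle_dec => hxp.
  have [r1 [hr1 hc1]] := h1 x r ltac:(lra) hr.
  case: (Rlt_dec x p) => hlt.
    have m1 := Rmin_l r1 (p - x); have m2 := Rmin_r r1 (p - x).
    exists (Rmin r1 (p - x)); split; first by apply: Rmin_glb_lt; lra.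
    move=> y hy hyx; have := Rle_abs (y - x) => h3; case: Rle_dec => hyp; last by lra.
    by apply: hc1; lra.
  have exp : x = p by lra.
  have [r2 [hr2 hc2]] := sec p r ltac:(lra) hr.
  have m1 := Rmin_l r1 r2; have m2 := Rmin_r r1 r2.
  exists (Rmin r1 r2); split; first exact: Rmin_glb_lt.
  move=> y hy hyx; case: Rle_dec => hyp; first by apply: hc1; lra.
  by move: hyx; rewrite /= exp ep => hyx; apply: hc2; lra.
have [r2 [hr2 hc2]] := sec x r ltac:(lra) hr.
have m1 := Rmin_l r2 (x - p); have m2 := Rmin_r r2 (x - p).
exists (Rmin r2 (x - p)); split; first by apply: Rmin_glb_lt; lra.
move=> y hy hyx; have h3 := Rabs_def2 _ _ hyx; case: Rle_dec => hyp; first by lra.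
by apply: hc2; lra.
Qed.

(** Real induction on the right end. A step to the right glues on a local section. At a limit end
    [x], the values of the earlier roots converge to a root [l] over [T x], and the section through
    [l] is glued at a parameter [s k] close to [x]. *)
Lemma root_extend al y0 : (forall x, al <= x -> ev dp (T x) <> C0) -> ev2 P (T al) y0 = C0 ->
  forall be, al <= be -> exists g, root_on al be g /\ g al = y0.
Proof.
move=> hgood hy0.
apply: (@real_induction (fun be => exists g, root_on al be g /\ g al = y0)).
- exists (fun _ => y0); split=> //; split; last by move=> x hx; have -> : x = al by lra.
  move=> x e hx he; exists 1; split; first lra; move=> y _ _.
  have -> : (y0 - y0 = C0)%C by ring.
    by rewrite Cmod0.
- move=> x hx h; have [g [hg e0]] := h x ltac:(lra).
  have [d [e [phi [hd he hp hp0 [hz hu]]]]] := local_section (hgood x hx) (proj2 hg x ltac:(lra)).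
  have [r [hr hc]] := hT x hd.
  exists (r / 2); split; first lra.
  move=> y hy.
  exists (fun z => if Rle_dec z x then g z else (g x + phi (T z - T x))%C); split.
    apply: (@root_glue al x y g (g x) (T x) d e phi) => //; first lra.
    - by move=> z hz'; apply: hc; rewrite Rabs_pos_eq; lra.
    - have -> : (T x - T x = C0)%C by ring.
      by rewrite hp0; ring.
  by case: Rle_dec => h3 //; lra.
- move=> x hx h.
  pose s k := x - (x - al) * / (INR k + 1).
  have hs k : al <= s k < x.
    have h1 := inv_nat_gt0 k.
    have h2 : / (INR k + 1) <= 1 by rewrite -[X in _ <= X]Rinv_1; apply: Rinv_le_contravar; [lra | have := pos_INR k; lra].
    have h3 : (x - al) * / (INR k + 1) <= (x - al) * 1 by apply: Rmult_le_compat_l; lra.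
    have h4 : 0 < (x - al) * / (INR k + 1) by apply: Rmult_lt_0_compat; lra.
    by rewrite /s; lra.
  pose g k := proj1_sig (constructive_indefinite_description _ (h (s k) (hs k))).
  have hg k : root_on al (s k) (g k) /\ g k al = y0.
    exact: (proj2_sig (constructive_indefinite_description _ (h (s k) (hs k)))).
  have slim : Rlim s x.
    have := Rlim_add (@Rlim_const x) (Rlim_mul (@Rlim_const (- (x - al))) Rlim_inv_nat).
    have -> : x + - (x - al) * 0 = x by ring.
    by congr (Rlim _ _); apply: functional_extensionality => k; rewrite /s; ring.
  have Tlim : Clim (fun k => T (s k)) (T x).
    move=> e he; have [r [hr hc]] := hT x he.
    by apply: (Um1 (slim r hr)) => k; exact: hc.
  have [l [hl hlz]] := @root_limit P n (fun k => T (s k)) (fun k => g k (s k)) (T x) sP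
    (hlead (hgood x ltac:(lra))) Tlim
    ltac:(by apply: Uall => k; have [[_ h1] _] := hg k; apply: h1; have := hs k; lra).
  have [d [e [phi [hd he hp hp0 [hz hu]]]]] := local_section (hgood x ltac:(lra)) hlz.
  have [r [hr hc]] := hT x hd.
  have [k [h1 h2]] := Uex (Uand (hl e he) (slim r hr)).
  have [hgk hgk0] := hg k; have hsk := hs k.
  have h2' := Rabs_def2 _ _ h2.
  exists (fun z => if Rle_dec z (s k) then g k z else (l + phi (T z - T x))%C); split.
    apply: (@root_glue al (s k) x (g k) l (T x) d e phi) => //; first lra.
    - by move=> z hz'; apply: hc; apply: Rabs_def1; lra.
    - apply: hu; [exact: hc | lra |].
      have -> : (T x + (T (s k) - T x) = T (s k))%C by ring.
      by apply: (proj2 hgk); lra.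
  by case: Rle_dec => h3 //; lra.
Qed.

(** By uniqueness the roots on the various intervals agree, so the diagonal choice is one root on
    the whole half-line. *)
Lemma root_extend_infinity al y0 : (forall x, al <= x -> ev dp (T x) <> C0) -> ev2 P (T al) y0 = C0 ->
  exists g, g al = y0 /\ forall be, al <= be -> root_on al be g.
Proof.
move=> hgood hy0.
have hex be : exists g, al <= be -> root_on al be g /\ g al = y0.
  case: (Rle_dec al be) => hb; last by exists (fun _ => y0).
  by have [g hg] := root_extend hgood hy0 hb; exists g.
pose G be := proj1_sig (constructive_indefinite_description _ (hex be)).
have hG be : al <= be -> root_on al be (G be) /\ G be al = y0.
  exact: (proj2_sig (constructive_indefinite_description _ (hex be))).
have key be x : al <= x <= be -> G x x = G be x.
  move=> hx; have [h1 h2] := hG x (proj1 hx); have [h3 h4] := hG be ltac:(lra).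
  apply: (@root_unique al x (G x) (G be)) => //; last lra.
  - by move=> z hz; apply: hgood; lra.
  - by apply: (root_on_sub h3); lra.
  - by rewrite h2 h4.
exists (fun x => G x x); split; first by have [] := hG al ltac:(lra).
move=> be hb; have [[h1 h2] _] := hG be hb; split.
  move=> x e hx he; have [r [hr hc]] := h1 x e hx he.
  exists r; split=> // y hy hyx; rewrite (key be y) // (key be x) //; exact: hc.
by move=> x hx; rewrite (key be x) //; exact: h2.
Qed.

End Continuation.

(** * Simultaneous expansions of several roots and polar parts *)

Lemma Croot n (z : C) : exists y : C, (y ^ n.+1)%C = z.
Proof.
have e := @Num.Theory.rootCK K n.+1 (ltn0Sn n) (toK z).
eexists (ofK _); rewrite -ofKX; apply: toK_inj; rewrite ofKK; exact: e.
Qed.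

Lemma RtoC_pow r n : RtoC (r ^ n) = (RtoC r ^ n)%C.
Proof. by elim: n => [|n IH] //=; rewrite -IH; apply: C_ext => /=; ring. Qed.

Definition positive_real (z : C) := exists r, 0 < r /\ z = RtoC r.

Lemma positive_root n z : positive_real z -> exists y, positive_real y /\ (y ^ n.+1)%C = z.
Proof.
move=> [r [hr ->]]; exists (RtoC (Rpower r (/ INR n.+1))); split.
  by exists (Rpower r (/ INR n.+1)); split=> //; exact: exp_pos.
rewrite -RtoC_pow; congr RtoC.
have hn : 0 < INR n.+1 by apply: lt_0_INR; lia.
rewrite -Rpower_pow; last exact: exp_pos.
rewrite Rpower_mult Rinv_l; last lra.
exact: Rpower_1.
Qed.

Lemma bezout_neq0 P dp : bezout P dp -> (dp != 0)%R -> (P != 0)%R.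
Proof.
move=> [A [B hAB]] /ev_neq0_ex [t ht]; apply/eqP => e; apply: ht.
by rewrite -(hAB t C0) e deriv0 !ev2_0; ring.
Qed.

Lemma bezout_pow P dp e : bezout P dp -> (dp != 0)%R -> exists P' dp',
  [/\ bezout P' dp', (dp' != 0)%R & forall t w, ev2 P' t w = ev2 P (t ^ e.+1)%C w].
Proof.
move=> [A [B hAB]] /ev_neq0_ex [t0 ht0].
have e1 (t w : C) : (t ^ 0 * w = w)%C by rewrite /=; ring.
have [P' [p1 p2 _]] := subst_exists P e.+1 0.
have [A' [a1 _ _]] := subst_exists A e.+1 0.
have [B' [b1 _ _]] := subst_exists B e.+1 0.
have evc t : ev (dp \Po 'X^(e.+1))%R t = ev dp (t ^ e.+1)%C.
  by rewrite /ev horner_comp hornerXn; congr (ofK _.[_])%R; apply: ofK_inj; rewrite ofKX !toKK.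
exists P', (dp \Po 'X^(e.+1))%R; split.
- by exists A', B' => t w; rewrite p1 p2 a1 b1 evc -(hAB _ w) !e1.
- by apply/ev_neq0_ex; have [t1 h1] := Croot e t0; exists t1; rewrite evc h1.
- by move=> t w; rewrite p1 e1.
Qed.

Lemma clear_denominators (P : {poly {poly K}}) N : exists M P', forall t w, t <> C0 ->
  ev2 P' t w = (t ^ M * ev2 P t (w * Cinv (t ^ N)))%C.
Proof.
elim/poly_ind: P => [|P c [M [P' h]]].
  by exists 0%N, 0%R => t w _; rewrite !ev2_0; ring.
exists (M + N)%N, (P' * 'X + (c * 'X^(M + N))%:P)%R => t w ht.
rewrite !ev2MXaddC evM evXn h // CpowD.
by have := @Cpow_neq0 _ N ht => hN; field.
Qed.

Lemma PS_ev d A (p : {poly K}) u : 0 < d -> PS d A u -> exists B, PS d B (fun t => ev p (u t)).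
Proof.
move=> hd hu; elim/poly_ind: p => [|p c [B hB]].
  exists (Cmod C0); apply: (@PS_ext _ _ (fun _ => C0)); first by move=> t _; rewrite ev0.
  exact: PS_const.
exists (B * A + Cmod (ofK c)); apply: (@PS_ext _ _ (fun t => ev p (u t) * u t + ofK c)%C).
  by move=> t _; rewrite evMXaddC.
by apply: PS_add => //; [apply: PS_mul | exact: PS_const].
Qed.

Lemma PS_ev2 d A A' (P : {poly {poly K}}) u w : 0 < d -> PS d A u -> PS d A' w ->
  exists B, PS d B (fun t => ev2 P (u t) (w t)).
Proof.
move=> hd hu hw; elim/poly_ind: P => [|P c [B hB]].
  exists (Cmod C0); apply: (@PS_ext _ _ (fun _ => C0)); first by move=> t _; rewrite ev2_0.
  exact: PS_const.
have [B' hB'] := PS_ev c hd hu.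
exists (B * A' + B'); apply: (@PS_ext _ _ (fun t => ev2 P (u t) (w t) * w t + ev c (u t))%C).
  by move=> t _; rewrite ev2MXaddC.
by apply: PS_add => //; apply: PS_mul.
Qed.

Lemma PS_idX d n : 0 < d -> PS d (d ^ n) (fun t => t ^ n)%C.
Proof. by move=> hd; apply: PS_pow => //; exact: PS_id. Qed.

Lemma Fin_forall n (Q : Fin.t n.+1 -> Prop) : Q Fin.F1 -> (forall j, Q (Fin.FS j)) -> forall i, Q i.
Proof. by move=> h1 h2 i; apply: (Fin.caseS' i Q). Qed.

Lemma fcons0 (A : Type) n (a : A) (f : Fin.t n -> A) : fcons a f Fin.F1 = a. Proof. by []. Qed.
Lemma fconsS (A : Type) n (a : A) (f : Fin.t n -> A) i : fcons a f (Fin.FS i) = f i. Proof. by []. Qed.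

Section Multi.
Variable D : C -> Prop.
Hypothesis (Droot : forall n x, D x -> exists y, D y /\ (y ^ n.+1)%C = x).

(** The roots are expanded one after the other, each over the parameter found for the previous ones.
    In the end all are series in one common root [s] of [tau], after multiplication by one common
    power of [s]. *)
Lemma multi_expansion n (P : Fin.t n -> {poly {poly K}}) (dp : Fin.t n -> {poly K}) (tau : nat -> C)
  (y : Fin.t n -> nat -> C) : Clim tau C0 -> U (fun k => tau k <> C0) -> U (fun k => D (tau k)) ->
  (forall i, [/\ bezout (P i) (dp i), (dp i != 0)%R & U (fun k => ev2 (P i) (tau k) (y i k) = C0)]) ->
  exists e N d phi s, [/\ 0 < d <= 1, forall i, exists A, PS d A (phi i) &
    U (fun k => [/\ D (s k), (s k ^ e.+1)%C = tau k & forall i, (s k ^ N * y i k)%C = phi i (s k)])].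
Proof.
move=> ht ht0 hD; elim: n P dp y => [|n IH] P dp y hP.
  exists 0%N, 0%N, 1, (fun _ t => t), tau; split; [lra | exact: Fin.case0 |].
  by apply: (Um1 hD) => k h; split=> //=; [ring | exact: Fin.case0].
have [e [N [d [phi [s [hd hphi hs]]]]]] := IH _ _ _ (fun i => hP (Fin.FS i)).
have [b1 b2 b3] := hP Fin.F1.
have [P' [dp' [c1 c2 c3]]] := bezout_pow e b1 b2.
have hsr : U (fun k => (s k ^ e.+1)%C = tau k) by apply: (Um1 hs) => k [].
have [hs1 hs0] := expansion_limit ht ht0 hsr.
have [N2 [e2 [d2 [A [phi2 [s2 [hd2 hp2 hs2]]]]]]] := @puiseux_expansion D Droot P' dp' s (y Fin.F1)
  (bezout_neq0 c1 c2) c1 c2 hs1 hs0 ltac:(by apply: (Um1 hs) => k [])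
  ltac:(by apply: (Um2 b3 hsr) => k h1 h2; rewrite c3 h2).
have q : 0 < Rmin d d2 by apply: Rmin_glb_lt; lra.
have q1 := Rmin_l d d2; have q2 := Rmin_r d d2.
(* Ramification indices multiply; the predecessor is due to the encoding by [e.+1]. *)
exists (e2.+1 * e.+1).-1, (e2.+1 * (N + N2))%N, (Rmin d d2),
  (fcons (fun t => (t ^ (e2.+1 * N)%N) * phi2 t)%C
     (fun i t => (t ^ (e2.+1 * N2)%N) * phi i (t ^ e2.+1))%C), s2.
split; first lra.
- apply: Fin_forall => [|j]; rewrite ?fcons0 ?fconsS.
    exists ((Rmin d d2) ^ (e2.+1 * N)%N * A); apply: PS_mul => //; first exact: PS_idX.
    by apply: (@PS_shrink d2) => //; lra.
  have [B hB] := hphi j.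
  exists ((Rmin d d2) ^ (e2.+1 * N2)%N * B); apply: PS_mul => //; first exact: PS_idX.
  by apply: PS_comp_pow; [lra | apply: (@PS_shrink d) => //; lra].
- apply: (Um2 hs hs2) => k [h1 h2 h3] [h4 h5 h6]; split=> //.
    by rewrite -h2 -h5 -CpowM prednK.
  apply: Fin_forall => [|j]; rewrite ?fcons0 ?fconsS.
    by rewrite -h6 mulnDr CpowD !CpowM h5; ring.
  by rewrite h5 -h3 // mulnDr CpowD !CpowM h5; ring.
Qed.

End Multi.

Fixpoint cpoly (p : nat -> C) (n : nat) (x : R) : C :=
  match n with
  | O => p O
  | S n' => (cpoly p n' x + RtoC (x ^ n) * p n)%C
  end.

Lemma cpolyS p n x : cpoly p n.+1 x = (cpoly p n x + RtoC (x ^ n.+1) * p n.+1)%C.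
Proof. by []. Qed.

Lemma cpoly_ext p q n x : (forall m, (m <= n)%N -> p m = q m) -> cpoly p n x = cpoly q n x.
Proof.
by elim: n => [|n IH] h; rewrite /= ?h // IH // => m hm; apply: h; lia.
Qed.

(** The coefficients of [phi] up to [t^N] give the polynomial in [x], and what is left over vanishes
    at infinity. *)
Lemma polar_part N : forall d A phi, 0 < d -> PS d A phi -> exists p rho A',
  [/\ PS d A' rho, rho C0 = C0 & forall x, / d < x ->
    (RtoC (x ^ N) * phi (RtoC (/ x)))%C = (cpoly p N x + rho (RtoC (/ x)))%C].
Proof.
elim: N => [|N IH] d A phi hd hp.
  exists (fun _ => phi C0), (fun t => phi t - phi C0)%C, (A + Cmod (phi C0)); split.
  - by apply: PS_sub => //; exact: PS_const.
  - by ring.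
  - by move=> x _ /=; apply: C_ext => /=; ring.
have hp' : PS d (A + Cmod (phi C0)) (fun t => phi t - phi C0)%C.
  by apply: PS_sub => //; exact: PS_const.
have [phi1 [hp1 e1]] := PS_div hd hp' ltac:(cbv beta; ring).
have [p [rho [A' [h1 h2 h3]]]] := IH _ _ _ hd hp1.
exists (fun m => if (m == N.+1)%N then phi C0 else p m), rho, A'; split=> // x hx.
have hd' : 0 < / d by apply: Rinv_0_lt_compat.
have hxd : / x < d.
  by rewrite -(Rinv_inv d); apply: Rinv_lt_contravar => //; apply: Rmult_lt_0_compat; lra.
have hx0 : 0 < / x by apply: Rinv_0_lt_compat; lra.
have := e1 (RtoC (/ x)) ltac:(rewrite CmodR Rabs_pos_eq; lra) => e2.
have e3 : phi (RtoC (/ x)) = (RtoC (/ x) * phi1 (RtoC (/ x)) + phi C0)%C by rewrite -e2; ring.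
have e4 : (RtoC (x ^ N.+1) * phi (RtoC (/ x)) = RtoC (x ^ N) * phi1 (RtoC (/ x)) + RtoC (x ^ N.+1) * phi C0)%C.
  rewrite e3; move: (phi1 _) (phi C0) => z z'; apply: C_ext => /=; field; lra.
rewrite e4 h3 // cpolyS eqxx (@cpoly_ext _ p); first by ring.
by move=> m hm; have -> : (m == N.+1)%N = false by apply/eqP; lia.
Qed.

(** * Curves in an invariant analytic set *)

Lemma foldD l (f h : Fin.t l -> C) : ffold Cadd C0 l (fun i => f i + h i)%C =
  (ffold Cadd C0 l f + ffold Cadd C0 l h)%C.
Proof.
elim: l f h => [|l IH] f h /=; first by ring.
rewrite (IH (fun i => f (Fin.FS i)) (fun i => h (Fin.FS i))).
by move: (ffold _ _ _ _) (ffold _ _ _ _) => s s'; ring.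
Qed.

Lemma foldZ l c (f : Fin.t l -> C) : ffold Cadd C0 l (fun i => c * f i)%C = (c * ffold Cadd C0 l f)%C.
Proof.
elim: l f => [|l IH] f /=; first by ring.
rewrite (IH (fun i => f (Fin.FS i))).
by move: (ffold _ _ _ _) => s; ring.
Qed.

Section Combination.
Variables (g n : nat) (j0 : Fin.t g) (m : Fin.t n -> Cg g).

(* The coordinate [j0] is kept as the parameter [X], so that the curve is visibly nonconstant all
   along its continuation. *)
Definition comb (X : C) (Y : Fin.t n -> C) : Cg g :=
  fun j => if Fin.eq_dec j j0 then X else ffold Cadd C0 n (fun i => Y i * m i j)%C.

Lemma PS_fold d l (A : Fin.t l -> R) (f : Fin.t l -> C -> C) : 0 < d -> (forall i, PS d (A i) (f i)) ->
  PS d (ffold Rplus 0 l A) (fun t => ffold Cadd C0 l (fun i => f i t)).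
Proof.
move=> hd; elim: l A f => [|l IH] A f h /=; first by rewrite -Cmod0; exact: PS_const.
apply: PS_add => //; exact: (IH (fun i => A (Fin.FS i)) (fun i => f (Fin.FS i)) (fun i => h _)).
Qed.

Lemma comb_PS d A X (Y : Fin.t n -> C -> C) : 0 < d -> PS d A X -> (forall i, exists B, PS d B (Y i)) ->
  PSV d (fun t => comb (X t) (fun i => Y i t)).
Proof.
move=> hd hX hY j; rewrite /comb; case: (Fin.eq_dec j j0) => hj /=; first by exists A.
have [B hB] := fin_choice hY.
exists (ffold Rplus 0 n (fun i => B i * Cmod (m i j))).
by apply: (PS_fold hd) => i; apply: PS_mul => //; exact: PS_const.
Qed.

Lemma Clim_fold l (x : Fin.t l -> nat -> C) b : (forall i, Clim (x i) (b i)) ->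
  Clim (fun k => ffold Cadd C0 l (fun i => x i k)) (ffold Cadd C0 l b).
Proof.
elim: l x b => [|l IH] x b h /=; first exact: Clim_const.
by apply: Clim_add => //; exact: (IH (fun i => x (Fin.FS i)) (fun i => b (Fin.FS i))).
Qed.

Lemma comb_lim x a (y : Fin.t n -> nat -> C) b : Clim x a -> (forall i, Clim (y i) (b i)) ->
  Vlim (fun k => comb (x k) (fun i => y i k)) (comb a b).
Proof.
move=> hx hy j; rewrite /comb; case: (Fin.eq_dec j j0) => hj //=.
by apply: (Clim_fold (x := fun i k => (y i k * m i j)%C)) => i; apply: Clim_mul => //; exact: Clim_const.
Qed.

Lemma combD X X' Y Y' : comb (X + X')%C (fun i => Y i + Y' i)%C = vadd (comb X Y) (comb X' Y').
Proof.
apply: functional_extensionality => j; rewrite /comb /vadd; case: (Fin.eq_dec j j0) => hj //=.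
rewrite -foldD; apply: ffold_ext => i; ring.
Qed.

Lemma combZ r X Y : comb (RtoC r * X)%C (fun i => RtoC r * Y i)%C = vscaleR r (comb X Y).
Proof.
apply: functional_extensionality => j; rewrite /comb /vscaleR /vscaleC; case: (Fin.eq_dec j j0) => hj //=.
rewrite -foldZ; apply: ffold_ext => i; ring.
Qed.

Lemma comb_cpoly pX (p : Fin.t n -> nat -> C) N s :
  vpoly (fun k => comb (pX k) (fun i => p i k)) N s = comb (cpoly pX N s) (fun i => cpoly (p i) N s).
Proof.
elim: N => [|N IH] //.
by rewrite -[LHS]/(vadd (vpoly _ N s) (vscaleR (s ^ N.+1) _)) IH -combZ -combD.
Qed.

Lemma comb_j0 X Y : comb X Y j0 = X.
Proof. by rewrite /comb; case: (Fin.eq_dec j0 j0). Qed.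

End Combination.

Lemma Rlim_pow s x n : Rlim s x -> Rlim (fun k => s k ^ n) (x ^ n).
Proof.
move=> h; elim: n => [|n IH] /=; last exact: Rlim_mul.
by move=> e he; apply: Uall => k; rewrite Rminus_diag Rabs_R0.
Qed.

Lemma Rlim_inv s x : 0 < x -> Rlim s x -> Rlim (fun k => / s k) (/ x).
Proof.
move=> hx h e he.
have q : 0 < Rmin (x / 2) (e * (x * x / 2)).
  by apply: Rmin_glb_lt; [lra | apply: Rmult_lt_0_compat => //; nra].
have q1 := Rmin_l (x / 2) (e * (x * x / 2)); have q2 := Rmin_r (x / 2) (e * (x * x / 2)).
apply: (Um1 (h _ q)) => k hk.
have [hk1 hk2] := Rabs_def2 _ _ hk.
have hs : x / 2 < s k by lra.
have -> : / s k - / x = (x - s k) * / (s k * x) by field; lra.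
have hp : 0 < s k * x by nra.
rewrite Rabs_mult (Rabs_pos_eq (/ _)); last by left; apply: Rinv_0_lt_compat.
apply: (Rmult_lt_reg_r (s k * x)) => //.
rewrite Rmult_assoc Rinv_l ?Rmult_1_r; last lra.
rewrite Rabs_minus_sym; apply: Rlt_le_trans hk _; apply: (Rle_trans _ _ _ q2).
by apply: Rmult_le_compat_l; nra.
Qed.

Lemma cont_on_lim al be f x s : cont_on al be f -> al <= x <= be -> (forall k, al <= s k <= be) ->
  Rlim s x -> Clim (fun k => f (s k)) (f x).
Proof.
move=> hc hx hs hl e he; have [r [hr h]] := hc x e hx he.
by apply: (Um1 (hl r hr)) => k; apply: h.
Qed.

Lemma lim_cont_on al be f : (forall x s, al <= x <= be -> (forall k, al <= s k <= be) -> Rlim s x ->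
  Clim (fun k => f (s k)) (f x)) -> cont_on al be f.
Proof.
move=> h x e hx he; apply: NNPP => hn.
have hk k : exists y, [/\ al <= y <= be, Rabs (y - x) < / (INR k + 1) & e <= Cmod (f y - f x)%C].
  apply: NNPP => hk; apply: hn; exists (/ (INR k + 1)); split; first exact: inv_nat_gt0.
  by move=> y hy hyx; apply: Rnot_le_lt => hle; apply: hk; exists y.
pose s k := proj1_sig (constructive_indefinite_description _ (hk k)).
have hs k : [/\ al <= s k <= be, Rabs (s k - x) < / (INR k + 1) & e <= Cmod (f (s k) - f x)%C].
  exact: (proj2_sig (constructive_indefinite_description _ (hk k))).
have hl : Rlim s x.
  move=> r hr; apply: (Um1 (Rlim_inv_nat hr)) => k.
  have := inv_nat_gt0 k; have [_ h1 _] := hs k; rewrite Rminus_0_r => h2.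
  by rewrite Rabs_pos_eq; lra.
have [k h1] := Uex (h x s hx (fun k => let: And3 a _ _ := hs k in a) hl e he).
by have [_ _] := hs k; lra.
Qed.

(** The exponent is adapted to the ramification at [a]: if [v^(M+1) = u], the local parameter is
    [v x] and depends linearly on [x]. *)
Definition ray (a u : C) (M : nat) (x : R) : C := (a + u * RtoC (x ^ M.+1))%C.

Lemma ray_cont a u M : path_cont (ray a u M).
Proof.
move=> x e he.
have hc : cont_on (x - 1) (x + 1) (ray a u M).
  apply: lim_cont_on => y s _ _ hl; apply: Clim_add; first exact: Clim_const.
  by apply: Clim_mul; [exact: Clim_const | apply: Clim_RtoC; apply: Rlim_pow].
have [r [hr h]] := hc x e ltac:(lra) he.
have q1 := Rmin_l r 1; have q2 := Rmin_r r 1.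
exists (Rmin r 1); split; first by apply: Rmin_glb_lt; lra.
by move=> y hy; have h1 := Rabs_def2 _ _ hy; apply: h; lra.
Qed.

(** Among the directions [1 + i k], if every one met a zero, a single [dp i] would vanish along [U]
    at points of distinct rays, which form a nonconstant sequence. *)
Lemma good_direction n (dp : Fin.t n -> {poly K}) a : (forall i, (dp i != 0)%R) ->
  exists u, u <> C0 /\ forall i r, 0 < r -> ev (dp i) (a + u * RtoC r)%C <> C0.
Proof.
move=> h0; apply: NNPP => hn; pose q k : C := (1, INR k).
have hk (k : nat) : exists i r, 0 < r /\ ev (dp i) (a + q k * RtoC r)%C = C0.
  apply: NNPP => hk; apply: hn; exists (q k); split.
    by move=> e; have := f_equal fst e => /= e1; lra.
  by move=> i r hr e; apply: hk; exists i, r.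
have [i hi] := Ufin_exists (P := fun i k => exists r, 0 < r /\ ev (dp i) (a + q k * RtoC r)%C = C0)
  (Uall hk).
have [r hr] := Uchoice 0 hi.
have hnc : ~ nonconstant (fun k => a + q k * RtoC (r k))%C.
  by move=> hnc; apply: (ev_eq0_nonconstant hnc (h0 i)); apply: (Um1 hr) => k [].
apply: hnc => c hc.
have [k1 [hk1 [hr1 _]]] := Uex (Uand hc hr).
have [k2 [[hk2 [hr2 _]] hlt]] := Uex (Uand (Uand hc hr) (Ucofin k1.+1)).
have e : (q k1 * RtoC (r k1) = q k2 * RtoC (r k2))%C.
  have -> : (q k1 * RtoC (r k1) = (a + q k1 * RtoC (r k1)) - a)%C by ring.
  by rewrite hk1 -hk2; ring.
have := f_equal fst e; have := f_equal snd e => /= e1 e2.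
have hl : INR k1 < INR k2 by apply: lt_INR; lia.
have e3 : r k1 = r k2 by lra.
by rewrite e3 in e1; nra.
Qed.

Lemma bezout_infinity P dp a u M : bezout P dp -> (dp != 0)%R -> u <> C0 -> exists P' dp',
  [/\ bezout P' dp', (dp' != 0)%R &
    forall x w, 0 < x -> ev2 P' (RtoC (/ x)) w = C0 <-> ev2 P (ray a u M x) w = C0].
Proof.
move=> h1 h2 h3; have [N [P1 [dp1 [p1 p2 p3]]]] := bezout_invert a h1 h2 h3.
have [P2 [dp2 [q1 q2 q3]]] := bezout_pow M p1 p2.
exists P2, dp2; split=> // x w hx.
have hx' : 0 < / x by apply: Rinv_0_lt_compat.
have ht : (RtoC (/ x) ^ M.+1)%C <> C0 by apply: Cpow_neq0; apply: RtoC_neq0; lra.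
have e : Cinv (RtoC (/ x) ^ M.+1)%C = RtoC (x ^ M.+1).
  rewrite -RtoC_pow pow_inv; have := pow_lt x M.+1 hx; move: (x ^ M.+1) => z hz.
  by apply: C_ext => /=; field; lra.
rewrite q3 p3 // e; split=> [/Cmul_eq0 [h|//]|h].
  by case: (Cpow_neq0 (n := N) ht h).
by rewrite /ray in h; rewrite h; ring.
Qed.

Lemma root_arc_coord P dp a u M al be x G : bezout P dp -> root_on P (ray a u M) al be G -> al < x < be ->
  ev dp (ray a u M x) <> C0 ->
  exists d w, 0 < d /\ (exists A, PS d A w) /\ forall y, Rabs (y - x) < d -> G y = w (RtoC (y - x)).
Proof.
move=> hbz hG hx hgood; have hx' : al <= x <= be by lra.
have [dd [e [phi [r [hdd hr hp hp0 hz]]]]] := root_local hbz (@ray_cont a u M) hG hx' hgood.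
pose Tc t := (a + u * (RtoC x + t) ^ M.+1)%C.
have [A hA] : exists A, PS 1 A Tc.
  exists (Cmod a + Cmod u * ((Cmod (RtoC x) + 1) ^ M.+1)).
  apply: PS_add; [lra | apply: PS_const; lra | apply: PS_scal; first lra].
  apply: PS_pow; first lra.
  by apply: PS_add; [lra | apply: PS_const; lra | apply: PS_id; lra].
have [d1 [hd1 hs]] := PS_small Rlt_0_1 (ltac:(lra) : 0 < dd / 2) hA.
have hs1 := hs d1 ltac:(lra).
have eT y : Tc (RtoC (y - x)) = ray a u M y.
  rewrite /Tc /ray RtoC_pow; congr (_ + _ * _ ^ _)%C; apply: C_ext => /=; ring.
have eT0 : Tc C0 = ray a u M x.
  by rewrite -eT; congr (Tc _); apply: C_ext => /=; ring.
pose w t := (G x + phi (Tc t - Tc C0))%C.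
pose d := Rmin (Rmin d1 r) (Rmin (x - al) (be - x)).
have m1 := Rmin_l (Rmin d1 r) (Rmin (x - al) (be - x)); have m2 := Rmin_r (Rmin d1 r) (Rmin (x - al) (be - x)).
have m3 := Rmin_l d1 r; have m4 := Rmin_r d1 r.
have m5 := Rmin_l (x - al) (be - x); have m6 := Rmin_r (x - al) (be - x).
have m0 : 0 < d.
  rewrite /d; apply: Rmin_glb_lt; apply: Rmin_glb_lt. lra. lra. lra. lra.
rewrite -/d in m1 m2; exists d, w; split=> //; split.
  exists (Cmod (G x) + e); apply: (@PS_shrink d1); first by lra.
  apply: PS_add; [lra | apply: PS_const; lra |].
  apply: (@PS_comp dd) => //; first lra.
    by apply: (@PS_mono _ (dd / 2)) => //; lra.
  by move=> t ht; have := PS_bound hs1 ht; lra.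
move=> y hy; have h1 := Rabs_def2 _ _ hy.
have [_ h2] := hz y ltac:(lra) ltac:(lra).
by rewrite h2 /w eT eT0.
Qed.

Lemma RtoC_inj x y : RtoC x = RtoC y -> x = y.
Proof. by move=> /(f_equal fst). Qed.

Section Curve.
Variables (g n : nat) (j0 : Fin.t g) (m : Fin.t n -> Cg g).
Variables (P : Fin.t n -> {poly {poly K}}) (dp : Fin.t n -> {poly K}) (sz : Fin.t n -> nat).
Hypotheses (sP : forall i, size (P i) = (sz i).+1) (hbz : forall i, bezout (P i) (dp i))
  (hdp : forall i, (dp i != 0)%R)
  (hlead : forall i t, ev (dp i) t <> C0 -> ev (P i)`_(sz i) t <> C0).
Local Notation F := (comb j0 m).

Lemma root_arc a u M al be x (G : Fin.t n -> R -> C) q :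
  (forall i, root_on (P i) (ray a u M) al be (G i)) -> al < x < be ->
  (forall i, ev (dp i) (ray a u M x) <> C0) ->
  arc_at (fun y => vadd (F (ray a u M y) (fun i => G i y)) q) x.
Proof.
move=> hG hx hgood.
have h i : exists w, exists d, 0 < d /\ (exists A, PS d A w) /\
    forall y, Rabs (y - x) < d -> G i y = w (RtoC (y - x)).
  have [d [w hw]] := root_arc_coord (hbz i) (hG i) hx (hgood i).
  by exists w, d.
have [w hw] := fin_choice h.
have [d [hd hdw]] : exists d, 0 < d /\ forall i, 0 < d /\ (exists A, PS d A (w i)) /\
    forall y, Rabs (y - x) < d -> G i y = w i (RtoC (y - x)).
  apply: fin_min => i; last by have [d [h1 h2]] := hw i; exists d.
  move=> d d' hd' [h1 [[A hA] h3]]; split; first lra; split.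
    by exists A; apply: (@PS_shrink d) => //; lra.
  by move=> y hy; apply: h3; lra.
pose Tc t := (a + u * (RtoC x + t) ^ M.+1)%C.
have hA : PS d (Cmod a + Cmod u * ((Cmod (RtoC x) + d) ^ M.+1)) Tc.
  apply: PS_add; [lra | apply: PS_const; lra | apply: PS_scal; first lra].
  apply: PS_pow; first lra.
  by apply: PS_add; [lra | apply: PS_const; lra | apply: PS_id; lra].
exists d, (fun t => vadd (F (Tc t) (fun i => w i t)) q); split=> //.
  move=> i; have [B hB] := comb_PS j0 m hd hA (fun i => proj1 (proj2 (hdw i))) i.
  by exists (B + Cmod (q i)); apply: PS_add => //; exact: PS_const.
move=> y hy; congr (vadd (F _ _) _).
  rewrite /Tc /ray RtoC_pow; congr (_ + _ * _ ^ _)%C; apply: C_ext => /=; ring.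
by apply: functional_extensionality => i; have [_ [_ h1]] := hdw i; apply: h1.
Qed.

(** The roots are expanded along the parameters [1 / (k + 1)]. Positive real roots are extracted, so
    the new parameter [1/x] is real and the expansion can be compared with the continued roots [G]
    on a half-line. *)
Lemma branch_at_infinity a u M al (G : Fin.t n -> R -> C) : u <> C0 -> 0 <= al ->
  (forall i be, al <= be -> root_on (P i) (ray a u M) al be (G i)) ->
  (forall i x, al <= x -> ev (dp i) (ray a u M x) <> C0) ->
  exists e N d phi X, [/\ 0 < d <= 1, / d < X, forall i, exists A, PS d A (phi i) &
    forall x, X <= x -> al <= x ^ e.+1 /\
      forall i, G i (x ^ e.+1) = (RtoC (x ^ N) * phi i (RtoC (/ x)))%C].
Proof.
move=> hu hal hG hgood.
have [P2 hP2] := fin_choice (fun i => bezout_infinity a M (hbz i) (hdp i) hu).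
have [dp2 hdp2] := fin_choice hP2.
pose tau k := RtoC (/ (INR k + 1)).
have htau : Clim tau C0 by apply: Clim_RtoC; exact: Rlim_inv_nat.
have htau0 k : tau k <> C0 by apply: RtoC_neq0; have := inv_nat_gt0 k; lra.
have [k0 hk0] := INR_unbounded al.
have hal' : U (fun k => al <= INR k + 1).
  by apply: (Um1 (Ucofin k0)) => k /le_INR; lra.
have hroot i : U (fun k => ev2 (P2 i) (tau k) (G i (INR k + 1)) = C0).
  apply: (Um1 hal') => k hk; have [_ _ h3] := hdp2 i.
  rewrite /tau; apply/h3; first by have := pos_INR k; lra.
  by apply: (proj2 (hG i _ hk)); lra.
have [e [N [d [phi [s [hd hphi hs]]]]]] := @multi_expansion positive_real positive_root n P2 dp2 tau
  (fun i k => G i (INR k + 1)) htau (Uall htau0)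
  ltac:(by apply: Uall => k; exists (/ (INR k + 1)); split=> //; exact: inv_nat_gt0)
  ltac:(by move=> i; have [h1 h2 _] := hdp2 i).
have [slim snz] := @expansion_limit tau s e htau (Uall htau0) ltac:(by apply: (Um1 hs) => k []).
have hsX k r : s k = RtoC r -> (s k ^ e.+1)%C = tau k -> (/ r) ^ e.+1 = INR k + 1.
  by move=> -> ; rewrite -RtoC_pow => /RtoC_inj h; rewrite pow_inv h Rinv_inv.
(* The expansion satisfies the equation at the points [s k], hence on its whole disc by the identity
   theorem. Denominators are cleared first so that a power series is being tested. *)
have hroots i : forall t, Cmod t < d -> forall M' P3,
    (forall x w, 0 < x -> ev2 P3 (RtoC (/ x)) w = C0 <-> ev2 (P i) (ray a u (M.+1 * e.+1).-1 x) w = C0) ->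
    (forall Q, (forall t w, t <> C0 -> ev2 Q t w = (t ^ M' * ev2 P3 t (w * Cinv (t ^ N)))%C) ->
    ev2 Q t (phi i t) = C0).
  move=> t ht M' P3 h3 Q hQ.
  have [A hA] := hphi i.
  have [B hB] := PS_ev2 Q (proj1 hd) (PS_id (proj1 hd)) hA.
  apply: (@ps_identity d B (fun t => ev2 Q t (phi i t)) s (proj1 hd) hB slim snz) => //.
  apply: (Um2 hs hal') => k [[r [hr er]] h5 h6] hk.
  have hrN : (s k ^ N)%C <> C0 by apply: Cpow_neq0; rewrite er; apply: RtoC_neq0; lra.
  have hr' : 0 < / r by apply: Rinv_0_lt_compat.
  rewrite hQ; last by rewrite er; apply: RtoC_neq0; lra.
  have -> : ev2 P3 (s k) (phi i (s k) * Cinv (s k ^ N)) = C0; last by ring.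
  rewrite -h6; move: (INR k + 1) (hsX k r er h5) hk => q eq hk.
  have -> : (s k ^ N * G i q * Cinv (s k ^ N) = G i q)%C by field.
  rewrite er -(Rinv_inv r); apply/h3 => //.
  have -> : ray a u (M.+1 * e.+1).-1 (/ r) = ray a u M q.
    by rewrite /ray prednK // mulnC -eq -pow_mult multE.
  by apply: (proj2 (hG i _ hk)); lra.
have hinv x : / d < x -> 0 < x /\ Cmod (RtoC (/ x)) < d.
  move=> hx; have hd' : 0 < / d by apply: Rinv_0_lt_compat; lra.
  have hx' : 0 < / x by apply: Rinv_0_lt_compat; lra.
  rewrite CmodR Rabs_pos_eq; last lra.
  split; first lra.
  rewrite -(Rinv_inv d); apply: Rinv_lt_contravar => //; apply: Rmult_lt_0_compat; lra.
have hroot2 i x : / d < x -> ev2 (P i) (ray a u M (x ^ e.+1)) (RtoC (x ^ N) * phi i (RtoC (/ x)))%C = C0.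
  move=> hx; have [hx0 hxd] := hinv x hx.
  have [P3 [_ [_ _ h3]]] := bezout_infinity a (M.+1 * e.+1).-1 (hbz i) (hdp i) hu.
  have [M' [Q hQ]] := clear_denominators P3 N.
  have := hroots i _ hxd M' P3 h3 Q hQ.
  have hx' : 0 < / x by apply: Rinv_0_lt_compat.
  have hne : RtoC (/ x) <> C0 by apply: RtoC_neq0; lra.
  rewrite hQ // => /Cmul_eq0 [h|]; first by case: (Cpow_neq0 (n := M') hne h).
  move/h3 => h; have := h hx0.
  have -> : ray a u (M.+1 * e.+1).-1 x = ray a u M (x ^ e.+1).
    by rewrite /ray prednK // mulnC -pow_mult multE.
  have -> : (phi i (RtoC (/ x)) * Cinv (RtoC (/ x) ^ N) = RtoC (x ^ N) * phi i (RtoC (/ x)))%C => //.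
  rewrite -RtoC_pow pow_inv; have := pow_lt x N hx0; move: (x ^ N) (phi _ _) => z w hz.
  by apply: C_ext => /=; field; lra.
(* A single index fixes the base point [/ r], where the expansion and [G] take the same values.
   Uniqueness of continuation extends the equality to all larger parameters. *)
have [k [[[[r [hr er]] h5 h6] hk] hsm]] := Uex (Uand (Uand hs hal') (slim d (proj1 hd))).
have hr' : 0 < / r by apply: Rinv_0_lt_compat.
have hrd : / d < / r.
  apply: Rinv_lt_contravar; first by apply: Rmult_lt_0_compat; lra.
  move: hsm; have -> : (s k - C0 = s k)%C by ring.
  by rewrite er CmodR Rabs_pos_eq; lra.
have eX := hsX k r er h5.
exists e, N, d, phi, (/ r); split=> // x hx.
have hge y : / r <= y -> al <= y ^ e.+1.
  by move=> hy; have := pow_incr (/ r) y e.+1 ltac:(lra); rewrite eX; lra.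
split; first exact: hge.
move=> i.
pose T' y := ray a u M (y ^ e.+1).
have hpow y s' : Rlim s' y -> Rlim (fun k => s' k ^ e.+1) (y ^ e.+1) by exact: Rlim_pow.
have hT' : path_cont T'.
  move=> y e0 he0.
  have hc : cont_on (y - 1) (y + 1) T'.
    apply: lim_cont_on => z s' _ _ hl; apply: Clim_add; first exact: Clim_const.
    by apply: Clim_mul; [exact: Clim_const | apply: Clim_RtoC; apply: Rlim_pow; apply: Rlim_pow].
  have [r0 [hr0 h]] := hc y e0 ltac:(lra) he0.
  have q1 := Rmin_l r0 1; have q2 := Rmin_r r0 1.
  exists (Rmin r0 1); split; first by apply: Rmin_glb_lt; lra.
  by move=> z hz; have h1 := Rabs_def2 _ _ hz; apply: h; lra.
have hxx := pow_incr (/ r) x e.+1 ltac:(lra).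
have hmon y : / r <= y <= x -> al <= y ^ e.+1 <= x ^ e.+1.
  by move=> hy; split; [apply: hge; lra | apply: pow_incr; lra].
have [hc hz] := hG i (x ^ e.+1) (hge x hx).
apply: (@root_unique (P i) (dp i) T' (hbz i) hT' (/ r) x (fun y => G i (y ^ e.+1))
  (fun y => RtoC (y ^ N) * phi i (RtoC (/ y)))%C); last by lra.
- by move=> y hy; apply: hgood; apply: hge; lra.
- split; last by move=> y hy; apply: hz; apply: hmon.
  apply: lim_cont_on => y s' hy hs' hl.
  apply: (cont_on_lim (s := fun k => s' k ^ e.+1) hc); [exact: hmon | | exact: Rlim_pow].
  by move=> k'; apply: hmon.
- split; last by move=> y hy; apply: hroot2; lra.
  apply: lim_cont_on => y s' hy hs' hl; apply: Clim_mul; first by apply: Clim_RtoC; exact: Rlim_pow.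
  have [A hA] := hphi i; have [hy0 hyd] := hinv y ltac:(lra).
  by apply: (PS_lim_at (proj1 hd) hA hyd); apply: Clim_RtoC; apply: Rlim_inv.
- rewrite eX Rinv_inv -er -h6 er -RtoC_pow pow_inv; have := pow_lt r N hr; move: (r ^ N) (G _ _) => z w hz'.
  by apply: C_ext => /=; field; lra.
Qed.

End Curve.

Lemma cpoly_const p N x : (forall m, (0 < m <= N)%N -> p m = C0) -> cpoly p N x = p 0%N.
Proof.
elim: N => [|N IH] h //; rewrite cpolyS IH; last by move=> m hm; apply: h; lia.
by rewrite (h N.+1) ?ltnSn //; ring.
Qed.

Lemma vspanS g (p : nat -> Cg g) n t :
  vspan p n.+1 t = vadd (vspan p n t) (vscaleR (t n.+1) (p n.+1)).
Proof. by []. Qed.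

Lemma vspan_bump g (p : nat -> Cg g) N t m c :
  vspan p N (fun j => t j + (if (j == m)%N then c else 0)) =
  vadd (vspan p N t) (if (0 < m <= N)%N then vscaleR c (p m) else vzero).
Proof.
elim: N => [|N IH].
  have -> : (0 < m <= 0)%N = false by case: m.
  by rewrite /vzero /=; V_eq.
rewrite !vspanS IH.
case: eqP => [<-|hne].
  have -> : (0 < N.+1 <= N)%N = false by rewrite ltnn andbF.
  by rewrite ltnSn /= /vzero; move: (vspan _ _ _) => w; V_eq.
have -> : (0 < m <= N.+1)%N = (0 < m <= N)%N by rewrite [(m <= N.+1)%N]leq_eqVlt ltnS; case: eqP => // e; case: hne.
case: ifP => _; rewrite Rplus_0_r; last by rewrite /vzero; move: (vspan _ _ _) => w; V_eq.
by move: (vspan _ _ _) => w; V_eq.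
Qed.

Section Main.
Variables (g n : nat) (j0 : Fin.t g) (m : Fin.t n -> Cg g).
Variables (P : Fin.t n -> {poly {poly K}}) (dp : Fin.t n -> {poly K}) (sz : Fin.t n -> nat).
Hypotheses (sP : forall i, size (P i) = (sz i).+1) (hbz : forall i, bezout (P i) (dp i))
  (hdp : forall i, (dp i != 0)%R)
  (hlead : forall i t, ev (dp i) t <> C0 -> ev (P i)`_(sz i) t <> C0).
Variables (L Z : Cg g -> Prop).
Hypotheses (hL : cocompact L) (han : analytic_set Z) (hinv : invariant L Z).
Local Notation F := (comb j0 m).

(** Near infinity the arc is a polynomial plus a vanishing remainder, so [asymptotic_span] allows
    each coefficient of the polynomial to be moved freely. The translated arc is then followed back
    to [al], using the same roots [G]. *)
Lemma asymptotic_line a u M al (G : Fin.t n -> R -> C) : u <> C0 -> 0 <= al ->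
  (forall i be, al <= be -> root_on (P i) (ray a u M) al be (G i)) ->
  (forall i x, al <= x -> ev (dp i) (ray a u M x) <> C0) ->
  (forall x, al <= x -> Z (F (ray a u M x) (fun i => G i x))) ->
  exists q, q <> vzero /\ forall t x, al < x ->
    Z (vadd (F (ray a u M x) (fun i => G i x)) (vscaleR t q)).
Proof.
move=> hu hal hG hgood hZ.
have [e [N [d [phi [X [hd hX hphi hcurve]]]]]] := branch_at_infinity hbz hdp hu hal hG hgood.
have hd' : 0 < / d by apply: Rinv_0_lt_compat; lra.
(* [E] is the degree in [x] of the coordinate [j0] on the ray. Raising the degree to [N + E] lets
   one polynomial degree serve for all coordinates. *)
pose E := (M.+1 * e.+1)%N; pose N' := (N + E)%N.
have hpol i : exists p rho, (exists A, PS d A rho) /\ rho C0 = C0 /\ forall x, X <= x ->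
    (RtoC (x ^ N) * phi i (RtoC (/ x)))%C = (cpoly p N' x + rho (RtoC (/ x)))%C.
  have [A hA] := hphi i.
  have hA' : PS d (d ^ E * A) (fun t => t ^ E * phi i t)%C.
    by apply: PS_mul; [lra | apply: PS_idX; lra |].
  have [p [rho [A' [h1 h2 h3]]]] := polar_part N' (proj1 hd) hA'.
  exists p, rho; split; first by exists A'.
  split=> // x hx; rewrite -h3; last lra.
  rewrite /N' -RtoC_pow pow_inv -plusE pow_add.
  have := pow_lt x E ltac:(lra); move: (x ^ N) (x ^ E) (phi _ _) => z z' w hz.
  by apply: C_ext => /=; field; lra.
have hxX : exists p rho, (exists A, PS d A rho) /\ rho C0 = C0 /\ forall x, X <= x ->
    ray a u M (x ^ e.+1) = (cpoly p N' x + rho (RtoC (/ x)))%C.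
  have hA' : PS d (d ^ N' * Cmod a + d ^ N * Cmod u) (fun t => t ^ N' * a + t ^ N * u)%C.
    by apply: PS_add; [lra | apply: PS_mul; [lra | apply: PS_idX; lra | apply: PS_const; lra] |
      apply: PS_mul; [lra | apply: PS_idX; lra | apply: PS_const; lra]].
  have [p [rho [A' [h1 h2 h3]]]] := polar_part N' (proj1 hd) hA'.
  exists p, rho; split; first by exists A'.
  split=> // x hx; rewrite -h3; last lra.
  rewrite /ray -!RtoC_pow !pow_inv /N' -pow_mult multE mulnC -/E -plusE pow_add.
  have := pow_lt x E ltac:(lra); have := pow_lt x N ltac:(lra); move: (x ^ N) (x ^ E) => z z' hz hz'.
  by apply: C_ext => /=; field; lra.
have [p hp] := fin_choice hpol; have [rho hrho] := fin_choice hp.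
have [pX [rhoX [hX1 [hX2 hX3]]]] := hxX.
pose pv k := F (pX k) (fun i => p i k).
pose r t := F (rhoX t) (fun i => rho i t).
have hpv x : X <= x -> vadd (vpoly pv N' x) (r (RtoC (/ x))) =
    F (ray a u M (x ^ e.+1)) (fun i => G i (x ^ e.+1)).
  move=> hxx; rewrite /pv comb_cpoly /r -combD -hX3 //; congr (F _ _).
  apply: functional_extensionality => i; have [_ [_ h]] := hrho i; have [_ h'] := hcurve x hxx.
  by rewrite h' h.
have hr : PSV d r.
  have [A hA] := hX1; apply: (comb_PS j0 m (proj1 hd) hA) => i.
  by have [[B hB] _] := hrho i; exists B.
have r0 : r C0 = vzero.
  have e0 : (RtoC 0 * C0 = C0)%C by ring.
  rewrite /r hX2; have -> : (fun i => rho i C0) = (fun _ => C0).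
    by apply: functional_extensionality => i; have [_ [-> _]] := hrho i.
  have := combZ j0 m 0 C0 (fun _ => C0); rewrite e0 => ->.
  by rewrite /vzero; move: (comb _ _ _ _) => w; V_eq.
have [eps [heps hspan]] := @asymptotic_span g L Z r d hL han hinv (proj1 hd) hr r0 pv N' X
  ltac:(by move=> s hs; rewrite hpv //; apply: hZ; have [] := hcurve s hs).
(* If all higher coefficients vanished, the coordinate [j0] would be bounded, but it is [a + u x^E]
   with [u] nonzero. *)
have [l [hl hpl]] : exists l, (0 < l <= N')%N /\ pv l <> vzero.
  apply: NNPP => hn.
  have hc l : (0 < l <= N')%N -> pX l = C0.
    move=> hl; have : pv l = vzero by apply: NNPP => h; apply: hn; exists l.
    by move=> /(f_equal (fun w => w j0)); rewrite /pv comb_j0.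
  have [A hA] := hX1.
  have hb x : X <= x -> Cmod (u * RtoC (x ^ E))%C <= Cmod (pX 0%N) + A + Cmod a.
    move=> hxx; have := hX3 x hxx; rewrite (cpoly_const _ hc) => h.
    have hxd : Cmod (RtoC (/ x)) < d.
      have hx' : 0 < / x by apply: Rinv_0_lt_compat; lra.
      rewrite CmodR Rabs_pos_eq; last lra.
      rewrite -(Rinv_inv d); apply: Rinv_lt_contravar; [apply: Rmult_lt_0_compat; lra | lra].
    have h1 := PS_bound hA hxd.
    have -> : (u * RtoC (x ^ E) = (pX 0%N + rhoX (RtoC (/ x))) - a)%C.
      rewrite -h /ray -pow_mult multE [(e.+1 * _)%N]mulnC -/E; ring.
    have h2 := Cmod_sub_le (pX 0%N + rhoX (RtoC (/ x)))%C a.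
    have h3 := Cmod_triangle (pX 0%N) (rhoX (RtoC (/ x))); lra.
  have hu0 := Cmod_gt0 hu.
  pose B := Cmod (pX 0%N) + A + Cmod a.
  pose x := Rmax (Rmax X 1) ((B + 1) / Cmod u).
  have q1 := Rmax_l (Rmax X 1) ((B + 1) / Cmod u); have q2 := Rmax_r (Rmax X 1) ((B + 1) / Cmod u).
  have q3 := Rmax_l X 1; have q4 := Rmax_r X 1.
  rewrite -/x in q1 q2.
  have := hb x ltac:(lra); rewrite CmodM CmodR -/B.
  have hxE : x <= x ^ E.
    by have := @Rle_pow x 1 E ltac:(lra); rewrite pow_1; apply; rewrite /E; lia.
  rewrite Rabs_pos_eq; last lra.
  have : Cmod u * ((B + 1) / Cmod u) = B + 1 by field; lra.
  nra.
exists (pv l); split=> // t x hxal.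
pose S1 := Rmax X (/ eps + 1).
have q1 := Rmax_l X (/ eps + 1); have q2 := Rmax_r X (/ eps + 1); rewrite -/S1 in q1 q2.
have he' : 0 < / eps by apply: Rinv_0_lt_compat.
have hlarge y : S1 ^ e.+1 <= y -> Z (vadd (F (ray a u M y) (fun i => G i y)) (vscaleR t (pv l))).
  move=> hy.
  have hy0 : 0 < y by have := pow_lt S1 e.+1 ltac:(lra); lra.
  have [s' [[s [hs ->]]]] := positive_root e (ex_intro _ y (conj hy0 (erefl (RtoC y)))).
  rewrite -RtoC_pow => /RtoC_inj hsy.
  have hs1 : S1 <= s.
    apply: Rnot_lt_le => hlt.
    have h1 := pow_incr s S1 e ltac:(lra); have h2 := pow_lt s e hs.
    by move: hy; rewrite -hsy -!tech_pow_Rmult; nra.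
  have hs' : 0 < / s by apply: Rinv_0_lt_compat.
  (* The actual powers of [s] are kept except for the coefficient [l], which is increased by [t];
     the result is the point of the curve translated by [t] times [pv l]. *)
  have := hspan (fun j => s ^ j + (if (j == l)%N then t else 0)) (RtoC (/ s)).
  rewrite vspan_bump hl -vpoly_vspan -hsy -hpv; last lra.
  have -> : vadd (vadd (vpoly pv N' s) (vscaleR t (pv l))) (r (RtoC (/ s))) =
    vadd (vadd (vpoly pv N' s) (r (RtoC (/ s)))) (vscaleR t (pv l)).
    by move: (vpoly _ _ _) (r _) => w w'; V_eq.
  apply; rewrite CmodR Rabs_pos_eq; last lra.
  rewrite -(Rinv_inv eps); apply: Rinv_lt_contravar; [apply: Rmult_lt_0_compat; lra | lra].
pose a1 := Rmax x (S1 ^ e.+1) + 1.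
have q3 := Rmax_l x (S1 ^ e.+1); have q4 := Rmax_r x (S1 ^ e.+1).
apply: (@arc_left g Z (fun y => vadd (F (ray a u M y) (fun i => G i y)) (vscaleR t (pv l))) al a1 (a1 + 1)) => //.
- move=> y hy; apply: (@root_arc g n j0 m P dp hbz a u M al (a1 + 1) y G) => //.
  + by move=> i; apply: hG; lra.
  + by move=> i; apply: hgood; lra.
- by rewrite /a1; lra.
- by exists 1; split; [lra | move=> y hy; apply: hlarge; rewrite /a1 in hy; lra].
- by rewrite /a1; lra.
Qed.

(** The arc exists in two descriptions: by the Puiseux series [psi] near [a], and by the continued
    roots [G] from [r1] onwards. They agree on an overlap, through which membership in [Z] is
    carried outwards for the arc and back inwards for its translates. *)
Lemma algebraic_sequence_line (x : nat -> C) (y : Fin.t n -> nat -> C) a b : Clim x a ->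
  U (fun k => x k <> a) -> (forall i, Clim (y i) (b i)) ->
  (forall i, U (fun k => ev2 (P i) (x k) (y i k) = C0)) ->
  U (fun k => Z (F (x k) (fun i => y i k))) -> on_line Z (F a b).
Proof.
move=> hx hxa hy hroot hZ.
have [P1 hP1] := fin_choice (fun i => bezout_shift a (hbz i) (hdp i)).
have [dp1 hdp1] := fin_choice hP1.
pose tau k := (x k - a)%C.
have exk k : x k = (a + tau k)%C by rewrite /tau; ring.
have htau : Clim tau C0.
  have -> : C0 = (a - a)%C by ring.
  by apply: Clim_sub => //; exact: Clim_const.
have htau0 : U (fun k => tau k <> C0).
  by apply: (Um1 hxa) => k h e; apply: h; rewrite exk e; ring.
have [e [N [d [phi [s [hd hphi hs]]]]]] := @multi_expansion (fun _ => True)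
  (fun l z _ => let: ex_intro w hw := Croot l z in ex_intro _ w (conj I hw)) n P1 dp1 tau y htau htau0 (Uall (fun _ => I))
  ltac:(by move=> i; have [h1 h2 h3] := hdp1 i; split=> //; apply: (Um1 (hroot i)) => k; rewrite h3 -exk).
have [slim snz] := @expansion_limit tau s e htau htau0 ltac:(by apply: (Um1 hs) => k []).
(* The [y i] are bounded, so the factor [s^N] introduced by the expansion divides [phi i]. *)
have hpsi i : exists psi, (exists A, PS d A psi) /\ (forall t, Cmod t < d -> phi i t = (t ^ N * psi t)%C).
  have [A hA] := hphi i.
  have [A' [psi [h1 h2]]] := @PS_divX N d A (phi i) s (Cmod (b i) + 1) (proj1 hd) hA slim snz
    ltac:(by apply: (Um2 hs (Clim_bound (hy i))) => k [_ _ h] h'; rewrite -h CmodM CmodX Rmult_comm;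
      apply: Rmult_le_compat_r => //; apply: pow_le; exact: Cmod_ge0).
  by exists psi; split=> //; exists A'.
have [psi hpsi'] := fin_choice hpsi.
have hyp i : U (fun k => y i k = psi i (s k)).
  apply: (Um3 hs snz (slim d (proj1 hd))) => k [_ _ h] hnz hsm.
  have [_ h2] := hpsi' i.
  have hsd : Cmod (s k) < d by move: hsm; have -> : (s k - C0 = s k)%C by ring.
  have hN := Cpow_neq0 (n := N) hnz.
  have -> : y i k = (Cinv (s k ^ N) * (s k ^ N * y i k))%C by field.
  by rewrite h h2 //; field.
have hyall := Ufin_forall hyp.
have hb i : psi i C0 = b i.
  have [[A hA] _] := hpsi' i.
  apply: (Clim_uniq (PS_lim0 (proj1 hd) hA slim)).
  by apply: Clim_ext (hy i).
have hX : PS d (Cmod a + d ^ e.+1) (fun t => a + t ^ e.+1)%C.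
  by apply: PS_add; [lra | apply: PS_const; lra | apply: PS_idX; lra].
have hxs : U (fun k => x k = (a + s k ^ e.+1)%C) by apply: (Um1 hs) => k [_ h _]; rewrite h exk.
have hid i t : Cmod t < d -> ev2 (P i) (a + t ^ e.+1)%C (psi i t) = C0.
  have [[A hA] _] := hpsi' i.
  have [B hB] := PS_ev2 (P i) (proj1 hd) hX hA.
  apply: (@ps_identity d B (fun t => ev2 (P i) (a + t ^ e.+1)%C (psi i t)) s (proj1 hd) hB slim snz).
  by apply: (Um3 hxs (hyp i) (hroot i)) => k <- <-.
have hV := comb_PS j0 m (proj1 hd) hX (fun i => proj1 (hpsi' i)).
have [d' [hd' hgerm]] := analytic_set_germ han (proj1 hd) hV.
have hZ0 t : Cmod t < d' -> Z (F (a + t ^ e.+1)%C (fun i => psi i t)).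
  apply: (hgerm s slim snz); apply: (Um3 hZ hxs hyall) => k h <- h'.
  by have -> : (fun i => psi i (s k)) = (fun i => y i k) by apply: functional_extensionality => i.
have [u [hu hgood]] := good_direction a hdp.
have [v hv] := Croot e u.
have hv0 : v <> C0 by move=> h; apply: hu; rewrite -hv h /=; ring.
have hv1 := Cmod_gt0 hv0.
have eray t : ray a u e t = (a + (v * RtoC t) ^ e.+1)%C by rewrite /ray CpowMl hv RtoC_pow.
(* Then [v t] stays in the disc of the germ for [t <= 3 r1], which leaves room for an overlap on
   [[r1, 3 r1]]. *)
pose r1 := d' / (4 * Cmod v).
have hr1 : 0 < r1 by apply: Rdiv_lt_0_compat; lra.
have hsmall t : 0 <= t <= 3 * r1 -> Cmod (v * RtoC t)%C < d'.
  move=> ht; rewrite CmodM CmodR Rabs_pos_eq; last lra.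
  have : Cmod v * (4 * r1) = d' by rewrite /r1; field; lra.
  have : Cmod v * t <= Cmod v * (3 * r1) by apply: Rmult_le_compat_l; lra.
  nra.
have hgr i t : 0 < t -> ev (dp i) (ray a u e t) <> C0 by move=> ht; apply: hgood; exact: pow_lt.
have hpr i al be : 0 <= al -> be <= 3 * r1 -> root_on (P i) (ray a u e) al be (fun t => psi i (v * RtoC t)%C).
  move=> hal hbe; split; last first.
    by move=> t ht; rewrite eray; apply: hid; have := hsmall t ltac:(lra); lra.
  apply: lim_cont_on => t w ht hw hl.
  have [[A hA] _] := hpsi' i.
  apply: (PS_lim_at (proj1 hd) hA); first by have := hsmall t ltac:(lra); lra.
  by apply: Clim_mul; [exact: Clim_const | exact: Clim_RtoC].
(* The continuation starts at [r1] and not at [0], because [dp i] may vanish at [a]. *)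
have hG i : exists G, G r1 = psi i (v * RtoC r1)%C /\ forall be, r1 <= be -> root_on (P i) (ray a u e) r1 be G.
  apply: (root_extend_infinity (sP i) (hbz i) (@hlead i) (@ray_cont a u e)).
    by move=> t ht; apply: hgr; lra.
  by rewrite eray; apply: hid; have := hsmall r1 ltac:(lra); lra.
have [G hG'] := fin_choice hG.
have hGp t : r1 <= t <= 3 * r1 -> (fun i => G i t) = (fun i => psi i (v * RtoC t)%C).
  move=> ht; apply: functional_extensionality => i; have [h1 h2] := hG' i.
  apply: (@root_unique (P i) (dp i) (ray a u e) (hbz i) (@ray_cont a u e) r1 (3 * r1) (G i)
    (fun t => psi i (v * RtoC t)%C)) => //.
  - by move=> z hz; apply: hgr; lra.
  - by apply: h2; lra.
  - by apply: hpr; lra.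
have hZp t : 0 <= t <= 3 * r1 -> Z (F (ray a u e t) (fun i => psi i (v * RtoC t)%C)).
  by move=> ht; rewrite eray; apply: hZ0; apply: hsmall.
have vadd0 (w : Cg g) : vadd w vzero = w by rewrite /vzero; V_eq.
have hZG t : 3 / 2 * r1 <= t -> Z (F (ray a u e t) (fun i => G i t)).
  move=> ht; rewrite -[comb _ _ _ _]vadd0.
  apply: (@arc_right g Z (fun t => vadd (F (ray a u e t) (fun i => G i t)) vzero) r1 (3 / 2 * r1) (t + 1)) => //; last by lra.
  - move=> z hz; apply: (@root_arc g n j0 m P dp hbz a u e r1 (t + 1) z G) => //.
    + by move=> i; apply: (proj2 (hG' i)); lra.
    + by move=> i; apply: hgr; lra.
  - by lra.
  - exists r1; split=> // z hz; rewrite vadd0 hGp; last lra.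
    by apply: hZp; lra.
have [q [hq hline]] := @asymptotic_line a u e (3 / 2 * r1) G hu ltac:(lra)
  ltac:(move=> i be hbe; apply: (root_on_sub (proj2 (hG' i) be ltac:(lra))); lra)
  ltac:(by move=> i z hz; apply: hgr; lra) hZG.
exists q; split=> // t.
(* Beyond [3/2 r1] the lines are known for [G], hence for [psi] just below [2 r1]; [arc_left] moves
   them towards [0]. *)
have hall z : 0 < z <= 2 * r1 -> Z (vadd (F (ray a u e z) (fun i => psi i (v * RtoC z)%C)) (vscaleR t q)).
  move=> hz.
  apply: (@arc_left g Z (fun z => vadd (F (ray a u e z) (fun i => psi i (v * RtoC z)%C)) (vscaleR t q))
    0 (2 * r1) (3 * r1)) => //.
  - move=> w hw; apply: (@root_arc g n j0 m P dp hbz a u e 0 (3 * r1) w (fun i z => psi i (v * RtoC z)%C)) => //.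
    + by move=> i; apply: hpr; lra.
    + by move=> i; apply: hgr; lra.
  - by lra.
  - exists (r1 / 4); split; first lra.
    by move=> w hw; rewrite -hGp; [apply: hline; lra | lra].
pose sg k := 2 * r1 * / (INR k + 1).
have hsg k : 0 < sg k <= 2 * r1.
  have h1 := inv_nat_gt0 k.
  have h2 : / (INR k + 1) <= 1 by rewrite -[X in _ <= X]Rinv_1; apply: Rinv_le_contravar; [lra | have := pos_INR k; lra].
  split; first by apply: Rmult_lt_0_compat; lra.
  by rewrite /sg -[X in _ <= X]Rmult_1_r; apply: Rmult_le_compat_l; lra.
have sglim : Rlim sg 0.
  have := Rlim_mul (@Rlim_const (2 * r1)) Rlim_inv_nat.
  by rewrite Rmult_0_r.
have vlim : Clim (fun k => v * RtoC (sg k))%C C0.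
  have -> : C0 = (v * RtoC 0)%C by rewrite -[RtoC 0]/C0; ring.
  by apply: Clim_mul; [exact: Clim_const | exact: Clim_RtoC].
(* The point [a] itself is excluded from the arcs and is reached as a limit. *)
apply: (analytic_set_closed (z := fun k => vadd (F (ray a u e (sg k)) (fun i => psi i (v * RtoC (sg k))%C)) (vscaleR t q)) han);
  last by apply: Uall => k; exact: hall.
apply: Vlim_add; last exact: Vlim_const.
apply: comb_lim.
  have := Clim_add (@Clim_const a) (Clim_mul (@Clim_const u) (Clim_RtoC (Rlim_pow e.+1 sglim))).
  rewrite pow_i; last by lia.
  by have -> : (a + u * RtoC 0 = a)%C by rewrite -[RtoC 0]/C0; ring.
by move=> i; rewrite -hb; have [[A hA] _] := hpsi' i; apply: (PS_lim0 (proj1 hd) hA vlim).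
Qed.

End Main.

(** * Elimination *)

Section Elimination.
Import GRing.Theory.
Local Open Scope ring_scope.
Variable F : fieldType.

Lemma linear_relation (S L : finType) (V : S -> L -> F) : (#|L| < #|S|)%N ->
  exists r : S -> F, (exists s, r s != 0) /\ forall l, \sum_s r s * V s l = 0.
Proof.
move=> hlt; pose M := \matrix_(i < #|S|, j < #|L|) V (enum_val i) (enum_val j).
have hk : kermx M != 0.
  rewrite kermx_eq0 /row_free; apply/eqP => e; move: hlt; rewrite -e.
  by rewrite ltnNge (rank_leq_col M).
have [i hi] : exists i, row i (kermx M) != 0.
  apply/existsP; apply: contraR hk; rewrite negb_exists => /forallP h.
  by apply/eqP/row_matrixP => i; rewrite row0; apply/eqP; have := h i; rewrite negbK.
exists (fun s => kermx M i (enum_rank s)); split.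
  have [j hj] : exists j, row i (kermx M) 0 j != 0.
    apply/existsP; apply: contraR hi; rewrite negb_exists => /forallP h.
    by apply/eqP/rowP => j; have := h j; rewrite negbK => /eqP ->; rewrite [RHS]mxE.
  by exists (enum_val j); rewrite enum_valK; rewrite mxE in hj.
move=> l; have /matrixP/(_ i (enum_rank l)) := mulmx_ker M; rewrite !mxE => hl; apply: etrans hl.
rewrite [RHS](reindex (@enum_rank S)) /=; last by apply: onW_bij; exact: enum_rank_bij.
by apply: eq_bigr => s _; rewrite [M _ _]mxE !enum_rankK.
Qed.

(** The pseudo-remainder of [lead_coef P ^ i * X^i] modulo [P], computed by one multiplication by
    ['X] at a time so that its degree in [t] grows linearly in [i]. *)
Fixpoint reduced (P : {poly {poly F}}) (i : nat) : {poly {poly F}} :=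
  match i with
  | O => 1
  | S i' => lead_coef P *: (reduced P i' * 'X) - (reduced P i')`_((size P).-2) *: P
  end.

Lemma reduced_eq P i t w : P.[w%:P].[t] = 0 ->
  (lead_coef P).[t] ^+ i * w ^+ i = (reduced P i).[w%:P].[t].
Proof.
move=> hP; elim: i => [|i IH] /=; first by rewrite !expr0 mulr1 !hornerE.
rewrite !hornerE hP mulr0 subr0 -IH !exprS.
rewrite -[RHS]/((lead_coef P).[t] * ((lead_coef P).[t] ^+ i * w ^+ i) * w).
by rewrite -!mulrA [w * _]mulrC.
Qed.

Lemma size_reduced (P : {poly {poly F}}) n i : size P = n.+2 -> (size (reduced P i) <= n.+1)%N.
Proof.
move=> sP; elim: i => [|i IH] /=; first by rewrite size_poly1.
apply/leq_sizeP => j hj; rewrite coefB !coefZ coefMX.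
case: j hj => [|j] //= hj; rewrite sP /=.
case: (eqVneq j n) => [->|hne]; first by rewrite /lead_coef sP /= mulrC subrr.
have hnj : (n < j)%N by rewrite ltn_neqAle eq_sym hne.
by rewrite (nth_default _ (leq_trans IH hnj)) [P`_j.+1]nth_default ?sP // !mulr0 subrr.
Qed.

Lemma size_coef_reduced (P : {poly {poly F}}) D i j : (forall k, size (P`_k)%R <= D.+1)%N -> (size ((reduced P i)`_j)%R <= (D * i).+1)%N.
Proof.
move=> hD; elim: i j => [|i IH] j /=.
  by rewrite coef1; case: eqP; rewrite ?size_poly1 ?size_poly0.
have hmul (a b : {poly F}) : (size a <= D.+1)%N -> (size b <= (D * i).+1)%N -> (size (a * b)%R <= (D * i.+1).+1)%N.
  by move=> ha hb; apply: leq_trans (size_polyMleq _ _) _; rewrite mulnS; move: (D * i)%N hb => x; lia.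
rewrite coefB !coefZ coefMX; apply: leq_trans (size_polyD _ _) _; rewrite size_polyN geq_max; apply/andP; split.
  by case: eqP => _; [rewrite mulr0 size_poly0 | apply: hmul (IH _); exact: hD].
by rewrite mulrC; apply: hmul (hD _) (IH _).
Qed.

Lemma horner2_coef (A : {poly {poly F}}) n t w : (size A <= n)%N ->
  A.[w%:P].[t] = \sum_(a < n) (A`_a).[t] * w ^+ a.
Proof.
move=> h; rewrite (horner_coef_wide _ h) horner_sum; apply: eq_bigr => a _.
by rewrite -polyC_exp hornerM hornerC.
Qed.

Lemma coef_size_bound (P : {poly {poly F}}) : exists D, forall k, (size (P`_k)%R <= D.+1)%N.
Proof.
exists (\max_(k < size P) size (P`_k)%R) => k.
case: (ltnP k (size P)) => hk; last by rewrite nth_default ?size_poly0.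
exact: leqW (leq_bigmax (F := fun k : 'I_(size P) => size (P`_k)%R) (Ordinal hk)).
Qed.

(* Dimension count: up to powers of the leading coefficients, the [N^2] monomials [x^i y^j] with
   [i, j < N] lie in a space whose dimension grows linearly with [N]. *)
Lemma elimination (P Q : {poly {poly F}}) : (1 < size P)%N -> (1 < size Q)%N ->
  exists R : {poly {poly F}}, R != 0 /\ forall t x y, P.[x%:P].[t] = 0 -> Q.[y%:P].[t] = 0 ->
    (lead_coef P).[t] != 0 -> (lead_coef Q).[t] != 0 -> R.[y%:P].[x] = 0.
Proof.
move=> hp hq.
have [n sP] : exists n, size P = n.+2 by exists (size P).-2; lia.
have [m sQ] : exists m, size Q = m.+2 by exists (size Q).-2; lia.
have [D hD] := coef_size_bound P; have [E hE] := coef_size_bound Q.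
pose p := lead_coef P; pose q := lead_coef Q.
(* With this [N], the number [N^2] of unknowns exceeds the number [(n+1) (m+1) M] of equations. *)
pose N := (n.+1 * m.+1 * (D + E).+1).+1; pose M := ((D + E) * N).+1.
(* The exponents [N - s.1] and [N - s.2] bring all monomials to the common denominator [p^N q^N]. *)
pose c (s : 'I_N * 'I_N) (l : 'I_n.+1 * 'I_m.+1) :=
  p ^+ (N - s.1) * q ^+ (N - s.2) * (reduced P s.1)`_(l.1) * (reduced Q s.2)`_(l.2).
have hc s l : (size (c s l) <= M)%N.
  have hexp (a : {poly F}) A k : (size a <= A.+1)%N -> (size (a ^+ k)%R <= (A * k).+1)%N.
    move=> ha; apply: leq_trans (size_poly_exp_leq _ _) _.
    by rewrite ltnS leq_mul2r; apply/orP; right; lia.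
  have hmul (a b : {poly F}) A B : (size a <= A.+1)%N -> (size b <= B.+1)%N -> (size (a * b)%R <= (A + B).+1)%N.
    by move=> ha hb; apply: leq_trans (size_polyMleq _ _) _; lia.
  have h1 := hexp p D (N - s.1)%N ltac:(by rewrite /p /lead_coef).
  have h2 := hexp q E (N - s.2)%N ltac:(by rewrite /q /lead_coef).
  have h3 := size_coef_reduced s.1 l.1 hD; have h4 := size_coef_reduced s.2 l.2 hE.
  apply: leq_trans (hmul _ _ _ _ (hmul _ _ _ _ (hmul _ _ _ _ h1 h2) h3) h4) _.
  rewrite /M ltnS; have := ltn_ord s.1; have := ltn_ord s.2.
  move: (nat_of_ord s.1) (nat_of_ord s.2) => i j hi hj.
  have e1 : (D * (N - i) + D * i = D * N)%N by rewrite -mulnDr subnK // ltnW.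
  have e2 : (E * (N - j) + E * j = E * N)%N by rewrite -mulnDr subnK // ltnW.
  by rewrite mulnDl -e1 -e2; lia.
have [r [[s0 hs0] hr]] := @linear_relation _ _
  (fun (s : 'I_N * 'I_N) (l : ('I_n.+1 * 'I_m.+1) * 'I_M) => (c s l.1)`_(l.2))
  ltac:(rewrite !card_prod !card_ord /M /N; move: (D + E)%N (n.+1 * m.+1)%N (ltn0Sn (n.+1 * m.+1).-1) => d k hk; nia).
exists (\poly_(j < N) \poly_(i < N) r (inord i, inord j)); split.
  apply/eqP => /(congr1 (fun R : {poly {poly F}} => (R`_(s0.2))`_(s0.1))).
  rewrite coef_poly ltn_ord coef_poly ltn_ord !coef0 !inord_val => e.
  by move: hs0; rewrite [s0]surjective_pairing e eqxx.
move=> t x y hPt hQt hpt hqt.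
rewrite (horner2_coef _ _ (size_poly _ _)).
have hne : p.[t] ^+ N * q.[t] ^+ N != 0 by rewrite mulf_neq0 ?expf_neq0.
apply: (mulfI hne); rewrite mulr0.
have e1 (s : 'I_N * 'I_N) : p.[t] ^+ N * q.[t] ^+ N * (x ^+ s.1 * y ^+ s.2) =
    \sum_l \sum_(k < M) (c s l)`_k * t ^+ k * (x ^+ l.1 * y ^+ l.2).
  have -> : p.[t] ^+ N * q.[t] ^+ N * (x ^+ s.1 * y ^+ s.2) = p.[t] ^+ (N - s.1) * q.[t] ^+ (N - s.2) *
      ((p.[t] ^+ s.1 * x ^+ s.1) * (q.[t] ^+ s.2 * y ^+ s.2)).
    have eN (z : F) (k : 'I_N) : z ^+ N = z ^+ (N - k) * z ^+ k by rewrite -exprD subnK // ltnW.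
    have sh (a b a' b' u v : F) : a * a' * (b * b') * (u * v) = a * b * (a' * u * (b' * v)).
      by rewrite (mulrACA a a') -[LHS]mulrA (mulrACA a' b').
    by rewrite (eN p.[t] s.1) (eN q.[t] s.2) sh.
  rewrite (reduced_eq s.1 hPt) (reduced_eq s.2 hQt).
  rewrite (horner2_coef _ _ (size_reduced s.1 sP)) (horner2_coef _ _ (size_reduced s.2 sQ)).
  rewrite big_distrlr /= pair_bigA /= big_distrr /=; apply: eq_bigr => l _.
  rewrite -mulr_suml -(horner_coef_wide _ (hc s l)) /c !hornerM !horner_exp.
  by rewrite -!mulrA; do 2 congr (_ * _); congr (_ * _); rewrite mulrCA.
rewrite (eq_bigr (fun j : 'I_N => \sum_(i < N) r (i, j) * (x ^+ i * y ^+ j))); last first.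
  move=> j _; rewrite coef_poly ltn_ord horner_poly mulr_suml; apply: eq_bigr => i _.
  by rewrite !inord_val mulrA.
rewrite exchange_big pair_bigA /= big_distrr /=.
rewrite (eq_bigr (fun s : 'I_N * 'I_N => \sum_l \sum_(k < M) r s * (c s l)`_k * (t ^+ k * (x ^+ l.1 * y ^+ l.2)))); last first.
  move=> s _; rewrite -surjective_pairing mulrCA e1 big_distrr; apply: eq_bigr => l _ /=.
  by rewrite big_distrr; apply: eq_bigr => k _ /=; rewrite !mulrA.
rewrite exchange_big big1 // => l _; rewrite exchange_big big1 // => k _.
by rewrite -mulr_suml (hr (l, k)) mul0r.
Qed.

End Elimination.

(** * Algebraic points of semi-algebraic sets *)

Section Cells.
Import Order.TTheory GRing.Theory Num.Theory.
Local Open Scope ring_scope.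
Variable F : rcfType.

(* If [w] is not a root, it lies between two consecutive roots of [h], because [S] is bounded, and
   Rolle's theorem applies between them. *)
Lemma bounded_cell_root (fs : seq {poly F}) (S : F -> bool) (h : {poly F}) (B w : F) : h != 0 ->
  (forall f x, f \in fs -> f != 0 -> root f x -> root h x) ->
  (forall x y, {in fs, forall f : {poly F}, Num.sg f.[x] = Num.sg f.[y]} -> S x = S y) ->
  (forall x, S x -> `|x| <= B) -> S w ->
  exists c, S c /\ (root h c \/ h^`() != 0 /\ root h^`() c).
Proof.
move=> h0 hfs hS hB Sw.
case: (boolP (root h w)) => hw; first by exists w; split=> //; left.
have same (i : interval F) x : {in i, forall z, ~~ root h z} -> w \in i -> x \in i -> S x.
  move=> hi hwi hxi; rewrite (hS x w) // => f hf.
  case: (eqVneq f 0) => [->|f0]; first by rewrite !horner0.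
  apply: (polyrN0_itv (i := i)) => // z hz.
  by apply/negP => hr; move: (hi z hz); rewrite (hfs f z hf f0 hr).
have hwB := hB w Sw; have [hw1 hw2] : - B <= w /\ w <= B by apply/andP; rewrite -ler_norml.
have hB0 : 0 <= B by apply: le_trans hwB.
have lt1 : w < B + 2 by apply: le_lt_trans hw2 _; rewrite ltrDl.
have lt2 : - B - 2 < w by apply: lt_le_trans hw1; rewrite gtrDl oppr_lt0.
have [y1 hy1 [hy1r hy1n]] : exists2 y1, w < y1 & root h y1 /\ {in `]w, y1[, forall z, ~~ root h z}.
  case: (next_rootP h w (B + 2)) => [e|y _ py hy hn|c _ _ hn]; first by rewrite e eqxx in h0.
    by exists y; [rewrite (itvP hy) | split=> //; apply/eqP].
  have hn' : {in `[w, (B + 2)[, forall z, ~~ root h z}.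
    move=> z; rewrite in_itv /= le_eqVlt => /andP[/orP[/eqP <- //|hz1] hz2].
    by apply: hn; rewrite in_itv /= hz1.
  have h1 : S (B + 1).
    apply: (same _ _ hn'); rewrite in_itv /= ?lexx ?lt1 //.
    by rewrite ltrD2l (le_trans hw2) ?lerDl ?ler01 //= ltr1n.
  have := hB _ h1; rewrite ger0_norm; last by rewrite addr_ge0.
  by rewrite gerDl ler10.
have [y0 hy0 [hy0r hy0n]] : exists2 y0, y0 < w & root h y0 /\ {in `]y0, w[, forall z, ~~ root h z}.
  case: (prev_rootP h (- B - 2) w) => [e|y _ py hy hn|c _ _ hn]; first by rewrite e eqxx in h0.
    by exists y; [rewrite (itvP hy) | split=> //; apply/eqP].
  have hn' : {in `](- B - 2), w], forall z, ~~ root h z}.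
    move=> z; rewrite in_itv /= [z <= w]le_eqVlt => /andP[hz1 /orP[/eqP -> //|hz2]].
    by apply: hn; rewrite in_itv /= hz1.
  have h1 : S (- B - 1).
    apply: (same _ _ hn'); rewrite in_itv /= ?lexx ?lt2 //.
    by rewrite ltrD2l ltrN2 ltr1n /= (le_trans _ hw1) // gerDl oppr_le0.
  have := hB _ h1; rewrite -opprD normrN ger0_norm; last by rewrite addr_ge0.
  by rewrite gerDl ler10.
have hn : {in `]y0, y1[, forall z, ~~ root h z}.
  move=> z; rewrite in_itv /= => /andP[hz1 hz2].
  case: (ltrgtP z w) => [hz|hz|-> //]; first by apply: hy0n; rewrite in_itv /= hz1.
  by apply: hy1n; rewrite in_itv /= hz.
have hwi : w \in `]y0, y1[ by rewrite in_itv /= hy0.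
have [c hc hc0] := rolle (lt_trans hy0 hy1) (etrans (rootP hy0r) (esym (rootP hy1r))).
exists c; split; first exact: same hn hwi hc.
right; split; last by apply/rootP.
apply/eqP => e.
have [a ha] : exists a, h = a%:P.
  exists h`_0; apply/polyP => i; rewrite coefC; case: i => [|i] //=.
  have := congr1 (fun p : {poly F} => p`_i) e; rewrite coef_deriv coef0 => /eqP.
  by rewrite mulrn_eq0 /= => /eqP.
move: hy0r h0; rewrite ha /root hornerC => /eqP ->; by rewrite eqxx.
Qed.

End Cells.

(** * Quantifier-free formulas in two variables and existential blocks *)

Section Formulas.
Import Order.TTheory GRing.Theory Num.Theory.
Local Open Scope ring_scope.
Variable F : rcfType.

(** Variable [0] becomes the inner variable and variable [1] the outer one. The value for inverses
    is a default, excluded by [rterm]. *)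
Fixpoint term_poly (t : GRing.term F) : {poly {poly F}} :=
  match t with
  | GRing.Var i => if i == 0%N then ('X)%:P else if i == 1%N then 'X else 0
  | GRing.Const c => c%:P%:P
  | GRing.NatConst n => n%:R
  | GRing.Add t1 t2 => term_poly t1 + term_poly t2
  | GRing.Opp t1 => - term_poly t1
  | GRing.NatMul t1 n => term_poly t1 *+ n
  | GRing.Mul t1 t2 => term_poly t1 * term_poly t2
  | GRing.Inv _ => 0
  | GRing.Exp t1 n => term_poly t1 ^+ n
  end.

Lemma term_polyE (t : GRing.term F) x w : GRing.rterm t ->
  GRing.eval [:: x; w] t = (term_poly t).[w%:P].[x].
Proof.
elim: t => //=.
- by move=> [|[|i]] _ /=; rewrite ?hornerC ?hornerX ?hornerC ?horner0 ?nth_nil.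
- by move=> c _; rewrite !hornerC.
- by move=> n _; rewrite -!polyC_natr !hornerC.
- by move=> t1 IH1 t2 IH2 /andP[h1 h2]; rewrite !hornerD IH1 ?IH2.
- by move=> t1 IH1 h1; rewrite !hornerN IH1.
- by move=> t1 IH1 n h1; rewrite !hornerMn IH1.
- by move=> t1 IH1 t2 IH2 /andP[h1 h2]; rewrite !hornerM IH1 ?IH2.
- by move=> t1 IH1 n h1; rewrite !horner_exp IH1.
Qed.

Fixpoint atoms (f : ord.formula F) : seq {poly {poly F}} :=
  match f with
  | ord.Equal t1 t2 | ord.Lt t1 t2 | ord.Le t1 t2 => [:: term_poly t1 - term_poly t2]
  | ord.And f1 f2 | ord.Or f1 f2 | ord.Implies f1 f2 => atoms f1 ++ atoms f2
  | ord.Not f1 => atoms f1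
  | _ => [::]
  end.

Lemma sign_determines (f : ord.formula F) x w w' : ord.qf_form f -> ord.rformula f ->
  {in atoms f, forall p : {poly {poly F}}, Num.sg p.[w%:P].[x] = Num.sg p.[w'%:P].[x]} ->
  ord.qf_eval [:: x; w] f = ord.qf_eval [:: x; w'] f.
Proof.
have hsub t1 t2 z : GRing.rterm t1 -> GRing.rterm t2 -> (term_poly t1 - term_poly t2).[z%:P].[x] =
    GRing.eval [:: x; z] t1 - GRing.eval [:: x; z] t2.
  by move=> h1 h2; rewrite !term_polyE // !hornerE.
elim: f => //=.
- move=> t1 t2 _ /andP[h1 h2] h; have := h _ (mem_head _ _); rewrite !hsub // => e.
  by rewrite -[LHS]subr_eq0 -[RHS]subr_eq0 -[LHS]sgr_eq0 e sgr_eq0.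
- move=> t1 t2 _ /andP[h1 h2] h; have := h _ (mem_head _ _); rewrite !hsub // => e.
  by rewrite -[LHS]subr_lt0 -[RHS]subr_lt0 -[LHS]sgr_lt0 e sgr_lt0.
- move=> t1 t2 _ /andP[h1 h2] h; have := h _ (mem_head _ _); rewrite !hsub // => e.
  by rewrite -[LHS]subr_le0 -[RHS]subr_le0 -[LHS]sgr_le0 e sgr_le0.
- move=> f1 IH1 f2 IH2 /andP[q1 q2] /andP[r1 r2] h.
  by rewrite IH1 ?IH2 // => p hp; apply: h; rewrite mem_cat hp ?orbT.
- move=> f1 IH1 f2 IH2 /andP[q1 q2] /andP[r1 r2] h.
  by rewrite IH1 ?IH2 // => p hp; apply: h; rewrite mem_cat hp ?orbT.
- move=> f1 IH1 f2 IH2 /andP[q1 q2] /andP[r1 r2] h.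
  by rewrite IH1 ?IH2 // => p hp; apply: h; rewrite mem_cat hp ?orbT.
- by move=> f1 IH1 q1 r1 h; rewrite IH1.
Qed.

Definition fiber (x : F) (p : {poly {poly F}}) : {poly F} := map_poly (horner_eval x) p.

Lemma fiberE x p w : (fiber x p).[w] = p.[w%:P].[x].
Proof.
rewrite /fiber -[w in LHS](hornerC w x) -[(w%:P).[x]]/(horner_eval x w%:P).
by rewrite (horner_map (horner_eval x)).
Qed.

(** All atoms keep their signs on a fibre between the roots of their product [G], so
    [bounded_cell_root] yields a root of [G] or of its derivative. The condition on [c] prevents [G]
    from vanishing identically on the fibre. *)
Lemma bounded_formula_root (f : ord.formula F) : ord.qf_form f -> ord.rformula f ->
  exists (P : {poly {poly F}}) (c : {poly F}), [/\ P != 0, c != 0 & forall x B w, c.[x] != 0 ->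
    (forall w, ord.qf_eval [:: x; w] f -> `|w| <= B) -> ord.qf_eval [:: x; w] f ->
    exists w', ord.qf_eval [:: x; w'] f /\ P.[w'%:P].[x] = 0].
Proof.
move=> hqf hr; pose G := \prod_(p <- atoms f | p != 0) p.
have G0 : G != 0 by rewrite prodf_seq_neq0; apply/allP => p _; apply/implyP.
exists (if G^`() == 0 then G else G * G^`()), (lead_coef G); split.
- by case: ifP => // h; rewrite mulf_neq0 // h.
- by rewrite lead_coef_eq0.
move=> x B w hc hB hw.
have h0 : fiber x G != 0.
  apply/eqP => e; move/eqP: hc; apply; have := congr1 (fun p : {poly F} => p`_((size G).-1)) e.
  by rewrite /fiber coef_map coef0.
have [w' [h1 h2]] := @bounded_cell_root F [seq fiber x p | p <- atoms f]
  (fun w => ord.qf_eval [:: x; w] f) (fiber x G) B w h0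
  ltac:(move=> q z /mapP[p hp ->] hq hz; rewrite /root fiberE /G horner_prod horner_prod;
    rewrite (big_rem p hp) /=;
    have -> : p != 0 by [apply: contraNN hq => /eqP ->; rewrite /fiber map_poly0];
    by rewrite -fiberE (rootP hz) mul0r eqxx)
  ltac:(by move=> y z hyz; apply: sign_determines => // p hp; rewrite -!fiberE; apply: hyz; apply: map_f)
  hB hw.
exists w'; split=> //; have eG : fiber x G^`() = (fiber x G)^`() by rewrite /fiber deriv_map.
case: ifP => hG.
  case: h2 => [/rootP|[h3 _]]; first by rewrite fiberE.
  by move: h3; rewrite -eG (eqP hG) /fiber map_poly0 eqxx.
rewrite !hornerM -!fiberE eG; case: h2 => [/rootP ->|[_ /rootP ->]]; by rewrite ?mul0r ?mulr0.
Qed.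

(** The variables [2] to [k + 1] are bound, while [0] and [1] stay free. *)
Fixpoint exists_block (k : nat) (f : ord.formula F) : ord.formula F :=
  match k with
  | O => f
  | S k' => ord.Exists k'.+2 (exists_block k' f)
  end.

Lemma exists_blockP k f e : ord.holds e (exists_block k f) <->
  exists e' : seq F, (forall i, ~~ (1 < i < k.+2)%N -> e'`_i = e`_i) /\ ord.holds e' f.
Proof.
elim: k e => [|k IH] e /=.
  split=> [h|[e' [h1 h2]]]; first by exists e.
  by apply: ord.eq_holds h2 => i; apply: h1; case: i => [|[|i]].
split=> [[x /IH [e' [h1 h2]]]|[e' [h1 h2]]].
  exists e'; split=> // i hi; rewrite h1; last by apply: contra hi; lia.
  by rewrite nth_set_nth /=; case: eqP hi => // ->; rewrite ltnSn.
exists e'`_k.+2; apply/IH; exists e'; split=> // i hi; rewrite nth_set_nth /=.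
by case: eqP => [->//|hne]; apply: h1; apply: contra hi; lia.
Qed.

Lemma exists_block_rformula k f : ord.rformula (exists_block k f) = ord.rformula f.
Proof. by elim: k. Qed.

End Formulas.

Section Semialgebraic.
Import Order.TTheory GRing.Theory Num.Theory.
Variable n : nat.
Implicit Types (p a b : rpoly n) (f : saform n).

(* The variables [0] and [1] are reserved for the values of two polynomials. *)
Fixpoint term_of (p : rpoly n) : GRing.term R :=
  match p with
  | Pconst c => GRing.Const c
  | Pvar i => GRing.Var R (proj1_sig (Fin.to_nat i)).+2
  | Padd p1 p2 => GRing.Add (term_of p1) (term_of p2)
  | Pmul p1 p2 => GRing.Mul (term_of p1) (term_of p2)
  end.

Definition point (e : seq R) (i : Fin.t n) : R := nth 0%R e (proj1_sig (Fin.to_nat i)).+2.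

Lemma term_ofE p e : GRing.eval e (term_of p) = peval p (point e).
Proof. by elim: p => //= p1 -> p2 ->. Qed.

Lemma rterm_term_of p : GRing.rterm (term_of p).
Proof. by elim: p => //= p1 -> p2 ->. Qed.

Fixpoint formula_of (f : saform n) : ord.formula R :=
  match f with
  | Fpos p => ord.Lt (GRing.Const 0%R) (term_of p)
  | Fzero p => ord.Equal (term_of p) (GRing.Const 0%R)
  | Fnot f1 => ord.Not (formula_of f1)
  | Fand f1 f2 => ord.And (formula_of f1) (formula_of f2)
  | For f1 f2 => ord.Or (formula_of f1) (formula_of f2)
  end.

Lemma formula_ofP f e : ord.holds e (formula_of f) <-> sa_holds f (point e).
Proof.
elim: f => /=.
- by move=> p; rewrite term_ofE; split=> /RltP.
- by move=> p; rewrite term_ofE.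
- by move=> f1 IH; rewrite IH.
- by move=> f1 IH1 f2 IH2; rewrite IH1 IH2.
- by move=> f1 IH1 f2 IH2; rewrite IH1 IH2.
Qed.

Lemma rformula_formula_of f : ord.rformula (formula_of f).
Proof.
elim: f => //= [p|p|f1 -> f2 ->|f1 -> f2 ->] //; by rewrite rterm_term_of.
Qed.

Lemma point_surj (x : Fin.t n -> R) t w : exists e : seq R,
  [/\ nth 0%R e 0 = t, nth 0%R e 1 = w, point e = x & forall i, (n.+2 <= i)%N -> nth 0%R e i = 0%R].
Proof.
pose h k := match lt_dec k n with left h => x (Fin.of_nat_lt h) | right _ => 0 end.
exists [:: t, w & mkseq h n]; split=> //.
  apply: functional_extensionality => i; rewrite /point /=.
  have hi := proj2_sig (Fin.to_nat i).
  rewrite nth_mkseq; last by apply/ssrnat.ltP.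
  rewrite /h; case: lt_dec => [hlt|] //.
  rewrite -[in RHS](Fin.of_nat_to_nat_inv i); congr (x _); exact: Fin.of_nat_ext.
by move=> [|[|i]] //= hi; rewrite nth_default // size_mkseq.
Qed.

(** Quantifier elimination describes the pairs of values of [a] and [b] on the set by a formula in
    two variables. Its fibres over a value of [a] are bounded, so the value of [b] can be replaced
    by one algebraic over that of [a]. *)
Lemma semialgebraic_round f a b B : (forall x, sa_holds f x -> Rabs (peval b x) <= B) ->
  exists (P : {poly {poly R}}) (c : {poly R}), [/\ (P != 0)%R, (c != 0)%R &
    forall x, sa_holds f x -> (c.[peval a x] != 0)%R ->
      exists x', [/\ sa_holds f x', peval a x' = peval a x &
        P.[(peval b x')%:P].[peval a x] = 0]%R].
Proof.
move=> hB.
pose g := exists_block n (ord.And (formula_of f) (ord.And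
  (ord.Equal (term_of a) (GRing.Var R 0)) (ord.Equal (term_of b) (GRing.Var R 1)))).
have hg : ord.rformula g.
  by rewrite exists_block_rformula /= rformula_formula_of !rterm_term_of.
pose q := ord.quantifier_elim (fun i bc => qe_rcf.qfr_to_formula (@qe_rcf.wproj R i bc)) g.
have [q1 q2] : ord.qf_form q /\ ord.rformula q.
  apply/andP; apply: ord.quantifier_elim_wf hg; exact: qe_rcf.wf_QE_wproj.
have hq e : reflect (ord.holds e g) (ord.qf_eval e q).
  by apply: ord.quantifier_elim_rformP hg; [exact: qe_rcf.wf_QE_wproj | exact: qe_rcf.valid_QE_wproj].
have hgP t w : ord.holds [:: t; w] g <-> exists x, [/\ sa_holds f x, peval a x = t & peval b x = w].
  split=> [/exists_blockP [e [h1 /= [h2 [h3 h4]]]]|[x [h1 h2 h3]]].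
    exists (point e); split; first exact/formula_ofP.
    - by rewrite -term_ofE h3; apply: (h1 0%N).
    - by rewrite -term_ofE h4; apply: (h1 1%N).
  have [e [e0 e1 ex ebig]] := point_surj x t w.
  apply/exists_blockP; exists e; split.
    move=> [|[|i]] //= hi; rewrite nth_nil; apply: ebig; lia.
  by rewrite /= !term_ofE ex e0 e1; split; [apply/formula_ofP; rewrite ex | ].
have [P [c [P0 c0 h]]] := bounded_formula_root q1 q2.
exists P, c; split=> // x hx hcx.
have [w' [/hq/hgP [x' [h1 h2 h3]] h4]] := h (peval a x) B (peval b x) hcx
  ltac:(by move=> w /hq/hgP [x' [h1 _ <-]]; rewrite -RabsE; apply/RleP; apply: hB)
  ltac:(by apply/hq/hgP; exists x).
by exists x'; split=> //; rewrite h3.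
Qed.

Lemma horner_rpoly (c : {poly R}) a : exists r, forall x, peval r x = c.[peval a x]%R.
Proof.
elim/poly_ind: c => [|c d [r hr]]; first by exists (Pconst 0) => x; rewrite horner0.
by exists (Padd (Pmul r a) (Pconst d)) => x /=; rewrite hr hornerMXaddC.
Qed.

Lemma horner2_rpoly (P : {poly {poly R}}) a b : exists r, forall x,
  peval r x = P.[(peval b x)%:P].[peval a x]%R.
Proof.
elim/poly_ind: P => [|P c [r hr]]; first by exists (Pconst 0) => x; rewrite !horner0.
have [r' hr'] := horner_rpoly c a.
by exists (Padd (Pmul r b) r') => x /=; rewrite hr hr' hornerMXaddC hornerD hornerM hornerC.
Qed.

(** Each round adds the relation just obtained to the formula, so later rounds move the point
    without destroying it. *)
Lemma algebraic_points l f a (b : Fin.t l -> rpoly n) B :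
  (forall i x, sa_holds f x -> Rabs (peval (b i) x) <= B) ->
  exists (P : Fin.t l -> {poly {poly R}}) (c : {poly R}), [/\ forall i, (P i != 0)%R, (c != 0)%R &
    forall x, sa_holds f x -> (c.[peval a x] != 0)%R ->
      exists x', [/\ sa_holds f x', peval a x' = peval a x &
        forall i, (P i).[(peval (b i) x')%:P].[peval a x] = 0]%R].
Proof.
elim: l f b => [|l IH] f b hB.
  exists (fun _ => 1%R), 1%R; split; [by move=> i; rewrite oner_neq0 | by rewrite oner_neq0 |].
  by move=> x hx _; exists x; split=> //; exact: Fin.case0.
have [P1 [c1 [hP1 hc1 h1]]] := @semialgebraic_round f a (b Fin.F1) B (hB Fin.F1).
have [r hr] := horner2_rpoly P1 a (b Fin.F1).
have [P2 [c2 [hP2 hc2 h2]]] := IH (Fand f (Fzero r)) (fun i => b (Fin.FS i))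
  ltac:(by move=> i x [hx _]; apply: hB).
exists (fcons P1 P2), (c1 * c2)%R; split.
- by apply: Fin_forall.
- by rewrite mulf_neq0.
move=> x hx; rewrite hornerM mulf_eq0 negb_or => /andP[k1 k2].
have [x1 [m1 m2 m3]] := h1 x hx k1.
have [x2 [[m4 m5] m6 m7]] := h2 x1 ltac:(by split=> //=; rewrite hr m2) ltac:(by rewrite m2).
exists x2; rewrite -m2; split=> //; apply: Fin_forall => [|i]; rewrite ?fcons0 ?fconsS //.
by move: m5; rewrite /= hr m6.
Qed.

End Semialgebraic.

(** * Lines near points of semi-algebraic sets *)

Definition real_embedding : {rmorphism R -> K} := real_complex R.

Definition complexify (P : {poly {poly R}}) : {poly {poly K}} := map_poly (map_poly real_embedding) P.

Lemma RtoC_muladd (x y z : R) : RtoC (x * y + z)%R = (RtoC x * RtoC y + RtoC z)%C.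
Proof. by rewrite -RmultE -RplusE; apply: C_ext => /=; ring. Qed.

Lemma ev_real (c : {poly R}) t : ev (map_poly real_embedding c) (RtoC t) = RtoC c.[t]%R.
Proof.
elim/poly_ind: c => [|c d IH]; first by rewrite GRing.rmorph0 ev0 horner0.
rewrite GRing.rmorphD GRing.rmorphM /= map_polyX map_polyC evMXaddC IH hornerMXaddC.
by rewrite RtoC_muladd.
Qed.

Lemma ev2_complexify P t w : ev2 (complexify P) (RtoC t) (RtoC w) = RtoC P.[w%:P].[t]%R.
Proof.
rewrite /complexify; elim/poly_ind: P => [|P c IH]; first by rewrite GRing.rmorph0 ev2_0 !horner0.
rewrite GRing.rmorphD GRing.rmorphM /= map_polyX map_polyC ev2MXaddC IH hornerMXaddC hornerD hornerM hornerC.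
by rewrite [ev _ _]ev_real RtoC_muladd.
Qed.

Lemma complexify_neq0 P : (P != 0)%R -> (complexify P != 0)%R.
Proof.
move=> h; apply/eqP => e; move/eqP: h; apply; apply/polyP => i.
have := congr1 (fun p : {poly {poly K}} => p`_i)%R e.
by rewrite /complexify coef_map !coef0 => /eqP; rewrite map_poly_eq0 => /eqP.
Qed.

Lemma ev2_comp P Q t w : ev2 (P \Po Q) t w = ev2 P t (ev2 Q t w).
Proof.
elim/poly_ind: P => [|P c IH]; first by rewrite comp_poly0 !ev2_0.
by rewrite comp_poly_MXaddC ev2MXaddC ev2D ev2M ev2C IH.
Qed.

Lemma ev2_affine (P : {poly {poly K}}) al be : be <> C0 -> (P != 0)%R -> exists P' : {poly {poly K}},
  (P' != 0)%R /\ forall t w, ev2 P' t (al * t + be * w)%C = ev2 P t w.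
Proof.
move=> hbe hP.
pose Q : {poly {poly K}} := (((toK (Cinv be))%:P)%:P * 'X + ((toK (- (Cinv be * al))%C)%:P * 'X)%:P)%R.
have hc : toK (Cinv be) != 0%R.
  apply/eqP => e; have : Cinv be = C0 by rewrite -[LHS]toKK e.
  move=> h; have := Cinv_l hbe; rewrite h => h1; apply: C1_neq_C0; rewrite -h1; ring.
exists (P \Po Q)%R; split.
  rewrite comp_poly2_eq0 // /Q size_MXaddC !polyC_eq0 (negPf hc) /=.
  by rewrite size_polyC polyC_eq0 hc.
move=> t w; rewrite ev2_comp; congr (ev2 P t _).
rewrite /Q ev2MXaddC ev2C !evM !evC evX !toKK.
by field.
Qed.

(** As [t] is nonconstant, no nonzero polynomial in [t] alone vanishes along it. So both relations
    involve their second variable, and their leading coefficients are nonzero along the sequence. *)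
Lemma elimination_sequence (P Q : {poly {poly K}}) (t x y : nat -> C) : nonconstant t ->
  (P != 0)%R -> (Q != 0)%R -> U (fun k => ev2 P (t k) (x k) = C0) -> U (fun k => ev2 Q (t k) (y k) = C0) ->
  exists R : {poly {poly K}}, (R != 0)%R /\ U (fun k => ev2 R (x k) (y k) = C0).
Proof.
move=> ht hP hQ hx hy.
have hs (S : {poly {poly K}}) z : (S != 0)%R -> U (fun k => ev2 S (t k) (z k) = C0) -> (1 < size S)%N.
  move=> hS hz; rewrite ltnNge; apply/negP => /size1_polyC e.
  have h0 : (S`_0 != 0)%R by apply: contra hS => /eqP h; rewrite e h.
  apply: (ev_eq0_nonconstant ht h0); apply: (Um1 hz) => k.
  by rewrite {1}e ev2C.
have hl (S : {poly {poly K}}) : (S != 0)%R -> U (fun k => ev (lead_coef S) (t k) <> C0).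
  by move=> hS; apply: Unot; apply: ev_eq0_nonconstant; rewrite ?lead_coef_eq0.
have [R [hR h]] := elimination (hs P x hP hx) (hs Q y hQ hy).
exists R; split=> //; apply: (Um4 hx hy (hl P hP) (hl Q hQ)) => k h1 h2 h3 h4.
apply/ofK_eq0; apply: (h (toK (t k))).
- exact/ofK_eq0.
- exact/ofK_eq0.
- by apply/eqP => e; apply: h3; apply/ofK_eq0.
- by apply/eqP => e; apply: h4; apply/ofK_eq0.
Qed.

Lemma coord_rpoly g l n (s : Fin.t l -> Fin.t n) (v : Fin.t l -> Cg g) j : exists p q : rpoly n,
  forall x : Fin.t n -> R, vsum (fun i => vscaleR (x (s i)) (v i)) j = (peval p x, peval q x).
Proof.
rewrite /vsum; elim: l s v => [|l IH] s v /=; first by exists (Pconst 0), (Pconst 0).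
have [p [q h]] := IH (fun i => s (Fin.FS i)) (fun i => v (Fin.FS i)).
exists (Padd (Pmul (Pvar (s Fin.F1)) (Pconst (fst (v Fin.F1 j)))) p),
  (Padd (Pmul (Pvar (s Fin.F1)) (Pconst (snd (v Fin.F1 j)))) q) => x.
by rewrite /vadd h; apply: C_ext => /=; ring.
Qed.

Lemma rpoly_lim n (p : rpoly n) (x : nat -> Fin.t n -> R) x0 : (forall i, Rlim (fun k => x k i) (x0 i)) ->
  Rlim (fun k => peval p (x k)) (peval p x0).
Proof.
move=> h; elim: p => [c|i|p1 h1 p2 h2|p1 h1 p2 h2] /=.
- exact: Rlim_const.
- exact: h.
- exact: Rlim_add.
- exact: Rlim_mul.
Qed.

Lemma rpoly_bounded n (p : rpoly n) x0 : exists B, forall x, (forall i, Rabs (x i - x0 i) < 1) ->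
  Rabs (peval p x) <= B.
Proof.
elim: p => [c|i|p1 [B1 h1] p2 [B2 h2]|p1 [B1 h1] p2 [B2 h2]] /=.
- by exists (Rabs c) => x _; lra.
- exists (Rabs (x0 i) + 1) => x hx; have := Rabs_triang (x i - x0 i) (x0 i).
  by rewrite Rplus_assoc Rplus_opp_l Rplus_0_r; have := hx i; lra.
- by exists (B1 + B2) => x hx; have := Rabs_triang (peval p1 x) (peval p2 x); have := h1 x hx; have := h2 x hx; lra.
- exists (B1 * B2) => x hx; rewrite Rabs_mult.
  by apply: Rmult_le_compat; [exact: Rabs_pos | exact: Rabs_pos | exact: h1 | exact: h2].
Qed.

Lemma vsum_coord g l (f : Fin.t l -> Cg g) j : vsum f j = ffold Cadd C0 l (fun i => f i j).
Proof. by rewrite /vsum; elim: l f => [|l IH] f //=; rewrite /vadd IH. Qed.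

Section Assembly.
Variables (g : nat) (lam : Fin.t (Nat.mul 2 g) -> Cg g) (Z : Cg g -> Prop).
Hypotheses (Hlam : R_indep lam) (Hper : periodic lam Z) (Han : analytic_set Z).
Local Notation n := (Nat.mul 2 g).

Lemma comb_coord_map j0 (x : Fin.t n -> R) : comb j0 lam (coord_map lam x j0) (fun i => RtoC (x i)) = coord_map lam x.
Proof.
apply: functional_extensionality => j; rewrite /comb; case: (Fin.eq_dec j j0) => h /=; first by rewrite h.
by rewrite /coord_map vsum_coord.
Qed.

Lemma coord_map_inj x y : coord_map lam x = coord_map lam y -> x = y.
Proof.
move=> h; apply: functional_extensionality => i.
have : coord_map lam (fun i => x i + -1 * y i) = vzero.
  by rewrite coord_mapD coord_mapZ h; move: (coord_map _ _) => w; rewrite /vzero; V_eq.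
by move=> /(coord_map0 Hlam)/(_ i); lra.
Qed.

(** A real coordinate function [a] that is nonconstant along the sequence serves first as parameter.
    Over it all coordinates are made algebraic, and elimination then exchanges it for the complex
    coordinate [T], as [algebraic_sequence_line] requires. *)
Lemma line_near (f : saform n) (x : nat -> Fin.t n -> R) x0 eps : 0 < eps <= 1 ->
  (forall x, sa_holds f x -> Z (coord_map lam x)) -> (forall k, sa_holds f (x k)) ->
  (forall i, Rlim (fun k => x k i) (x0 i)) -> (forall k, x k <> x0) ->
  exists b, (forall i, Rabs (b i - x0 i) <= eps) /\ on_line Z (coord_map lam b).
Proof.
move=> heps hfZ hfx hx hx0.
have [j0 hj0] : exists j0, U (fun k => coord_map lam (x k) j0 <> coord_map lam x0 j0).
  apply: Ufin_exists; apply: Uall => k; apply: NNPP => hn; apply: (hx0 k); apply: coord_map_inj.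
  by apply: functional_extensionality => j; apply: NNPP => hj; apply: hn; exists j.
have [p [q hpq]] := coord_rpoly (fun i => i) lam j0.
(* [a] is the real or imaginary part that varies and [a'] the other one; [pi] recovers [a] from the
   complex coordinate. *)
have [a [a' [al [be [pi [hbe hab hpi ha]]]]]] : exists (a a' : rpoly n) al be (pi : C -> R),
  [/\ be <> C0, forall x, coord_map lam x j0 = (al * RtoC (peval a x) + be * RtoC (peval a' x))%C,
    forall x, pi (coord_map lam x j0) = peval a x & U (fun k => peval a (x k) <> peval a x0)].
  have : U (fun k => peval p (x k) <> peval p x0 \/ peval q (x k) <> peval q x0).
    apply: (Um1 hj0) => k; rewrite /coord_map !hpq => h.
    apply: NNPP => hn; apply: h; congr pair; apply: NNPP => h; apply: hn; [by left | by right].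
  case/Uor => h.
    exists p, q, C1, (0, 1), fst; split=> //.
    - by move=> /(f_equal snd) /= h1; lra.
    - by move=> z; rewrite /coord_map hpq; apply: C_ext => /=; ring.
    - by move=> z; rewrite /coord_map hpq.
  exists q, p, (0, 1), C1, snd; split=> //.
  - exact: C1_neq_C0.
  - by move=> z; rewrite /coord_map hpq; apply: C_ext => /=; ring.
  - by move=> z; rewrite /coord_map hpq.
pose t k := peval a (x k).
(* [t] converges to [peval a x0] without taking this value, so it is not constant along [U]. *)
have htc c : ~ U (fun k => t k = c).
  move=> h; apply: Ufalse; have hc : c = peval a x0.
    apply: RtoC_inj.
    apply: (Clim_uniq (x := fun k => RtoC (t k))); last by apply: Clim_RtoC; exact: rpoly_lim.
    by apply: Clim_ext (Clim_const (RtoC c)); apply: (Um1 h) => k ->.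
  by apply: (Um2 h ha) => k h1; rewrite -hc.
have htC : nonconstant (fun k => RtoC (t k)).
  by move=> c h; apply: (htc (fst c)); apply: (Um1 h) => k <-.
(* The box around [x0] makes the polynomials bounded and keeps the replaced points, and hence their
   limit, within [eps]. *)
have [G hG] := @sa_conj n n (fun i => Fand
  (Fpos (Padd (Pconst (eps + x0 i)) (Pmul (Pconst (-1)) (Pvar i))))
  (Fpos (Padd (Pconst (eps - x0 i)) (Pvar i)))).
have hG' z : sa_holds G z <-> forall i, Rabs (z i - x0 i) < eps.
  rewrite hG; split=> h i; have := h i => /=; first by move=> h1; apply: Rabs_def1; lra.
  by move/Rabs_def2; lra.
pose b := fcons a' (@Pvar n).
have hb i : exists B, forall z, sa_holds (Fand f G) z -> Rabs (peval (b i) z) <= B.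
  have [B hB] := rpoly_bounded (b i) x0; exists B => z [_ /hG' hz]; apply: hB => j.
  by have := hz j; lra.
have [B [_ hB]] := fin_max (P := fun i B => forall z, sa_holds (Fand f G) z -> Rabs (peval (b i) z) <= B)
  ltac:(by move=> i d d' hd h z hz; have := h z hz; lra) hb.
have [P [c [hP hc h]]] := algebraic_points a hB.
have hct : U (fun k => (c.[t k] != 0)%R).
  have hc' : (map_poly real_embedding c != 0)%R by rewrite map_poly_eq0.
  apply: (Um1 (Unot (ev_eq0_nonconstant htC hc'))) => k hk; apply/eqP => e; apply: hk.
  by rewrite ev_real e.
have hGx : U (fun k => sa_holds G (x k)).
  have hi := Ufin_forall (fun i => hx i eps (proj1 heps)).
  by apply: (Um1 hi) => k hk; apply/hG'.
have [x' hx'] := Uchoice x0 (Um2 hct hGx (fun k h1 h2 => h (x k) (conj (hfx k) h2) h1)).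
have hbd i : U (fun k => Rabs (x' k i - x0 i) <= eps).
  by apply: (Um1 hx') => k [[_ /hG' h1] _ _]; left.
have hlim i : exists l, Rlim (fun k => x' k i) l.
  apply: (@Rlim_ex _ (Rabs (x0 i) + eps)); apply: (Um1 (hbd i)) => k hk.
  have := Rabs_triang (x' k i - x0 i) (x0 i).
  by rewrite Rplus_assoc Rplus_opp_l Rplus_0_r; lra.
have [l hl] := fin_choice hlim.
have hl' : Vlim (fun k => coord_map lam (x' k)) (coord_map lam l) by exact: vsum_lim.
exists l; split.
  move=> i; have := Clim_mod_le (M := eps) (Clim_RtoC (Rlim_add (hl i) (@Rlim_const (- x0 i)))).
  by rewrite CmodR; apply; apply: (Um1 (hbd i)) => k; rewrite CmodR.
pose T k := coord_map lam (x' k) j0; pose y i k := RtoC (x' k i).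
have hT : nonconstant T.
  move=> d hd; apply: (htc (pi d)); apply: (Um2 hd hx') => k <- [_ h1 _].
  by rewrite /t -h1 -hpi.
(* [T] is an affine combination of [a] and [a'], so the relation between them becomes one between
   [t] and [T]. *)
have [P0 [hP0 hP0T]] := ev2_affine al hbe (complexify_neq0 (hP Fin.F1)).
have hTrel : U (fun k => ev2 P0 (RtoC (t k)) (T k) = C0).
  apply: (Um1 hx') => k [_ h1 h2]; rewrite /T hab h1 -/(t k) hP0T ev2_complexify.
  by have := h2 Fin.F1; rewrite /b fcons0 -/(t k) => ->.
have hrel i : exists (Q : {poly {poly K}}) (sz : nat) (dp : {poly K}), [/\ size Q = sz.+1,
    U (fun k => ev2 Q (T k) (y i k) = C0), bezout Q dp, (dp != 0)%R &
    forall t, ev dp t <> C0 -> ev (Q`_sz)%R t <> C0].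
  have [Q [hQ hQr]] := @elimination_sequence P0 (complexify (P (Fin.FS i))) (fun k => RtoC (t k)) T (y i)
    htC hP0 (complexify_neq0 (hP _)) hTrel
    ltac:(by apply: (Um1 hx') => k [_ h1 h2]; rewrite /y ev2_complexify;
      have := h2 (Fin.FS i); rewrite /b fconsS /= -/(t k) => ->).
  exact: separable_relation hQ hT hQr.
have [Q hQ] := fin_choice hrel; have [sz hsz] := fin_choice hQ; have [dp hdp] := fin_choice hsz.
have := @algebraic_sequence_line g n j0 lam Q dp sz
  (fun i => let: And5 h1 _ _ _ _ := hdp i in h1) (fun i => let: And5 _ _ h1 _ _ := hdp i in h1)
  (fun i => let: And5 _ _ _ h1 _ := hdp i in h1) (fun i => let: And5 _ _ _ _ h1 := hdp i in h1)
  (in_lattice lam) Z (lattice_cocompact Hlam) Han (periodic_invariant Hper) T y (coord_map lam l j0)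
  (fun i => RtoC (l i)).
rewrite comb_coord_map; apply.
- exact: hl'.
- by apply: Unot; apply: hT.
- by move=> i; apply: Clim_RtoC.
- by move=> i; have [] := hdp i.
- by apply: (Um1 hx') => k [[h1 _] _ _]; rewrite /T /y comb_coord_map; apply: hfZ.
Qed.

(** If [x0] were isolated, a small box around it and the complement of [x0] would disconnect [A];
    positive dimension supplies a point other than [x0]. *)
Lemma connected_not_isolated (A : (Fin.t n -> R) -> Prop) x0 eps : connected A -> dim_ge A 1 -> A x0 -> 0 < eps ->
  exists x, [/\ A x, x <> x0 & forall i, Rabs (x i - x0 i) < eps].
Proof.
move=> hcon [s [_ [c [r [hr hd]]]]] hx0 heps; apply: NNPP => hn.
have hne i (x : Fin.t n -> R) : x i <> x0 i -> x <> x0 by move=> h e; apply: h; rewrite e.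
apply: hcon; exists (fun x => forall i, Rabs (x i - x0 i) < eps), (fun x => exists i, x i <> x0 i).
split.
  move=> x hx.
  have [d [hd0 hdx]] : exists d, 0 < d /\ forall i, Rabs (x i - x0 i) + d <= eps.
    apply: (fin_min (P := fun i d => Rabs (x i - x0 i) + d <= eps)); first by move=> i d d' hd' h; lra.
    by move=> i; exists (eps - Rabs (x i - x0 i)); have := hx i; split; lra.
  exists d; split=> // y hy i; have := hy i; have := hdx i.
  have := Rabs_triang (y i - x i) (x i - x0 i).
  have -> : y i - x i + (x i - x0 i) = y i - x0 i by ring.
  lra.
split.
  move=> x [i hi]; exists (Rabs (x i - x0 i)); split; first by apply: Rabs_pos_lt; lra.
  move=> y hy; exists i => e; have := hy i; rewrite e Rabs_minus_sym; lra.
split.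
  by exists x0; split=> // i; rewrite Rminus_diag Rabs_R0.
split.
  pose v (k : R) : Fin.t 1 -> R := fun _ => k.
  have hv k : Rabs (k - c Fin.F1) < r -> exists x, A x /\ x (s Fin.F1) = k.
    move=> hk; have [x [h1 h2]] := hd (v k) ltac:(move=> j; apply: (Fin.caseS' j (fun j => Rabs (v k j - c j) < r)) => // j'; exact: (Fin.case0 (fun _ => _) j')).
    by exists x; split=> //; exact: h2.
  have [x1 [h1 e1]] := hv (c Fin.F1) ltac:(by rewrite Rminus_diag Rabs_R0).
  have [x2 [h2 e2]] := hv (c Fin.F1 + r / 2) ltac:(by rewrite /Rminus Rplus_comm -Rplus_assoc Rplus_opp_l Rplus_0_l Rabs_pos_eq; lra).
  case: (Req_dec (x1 (s Fin.F1)) (x0 (s Fin.F1))) => h3; last by exists x1; split=> //; exists (s Fin.F1).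
  by exists x2; split=> //; exists (s Fin.F1); lra.
split.
  move=> x hx; case: (classic (x = x0)) => [->|hne']; first by left=> i; rewrite Rminus_diag Rabs_R0.
  right; apply: NNPP => h; apply: hne'; apply: functional_extensionality => i.
  by apply: NNPP => hi; apply: h; exists i.
by move=> x hx h1 [i hi]; apply: hn; exists x; split=> //; exact: hne hi.
Qed.

(** [line_near] gives lines only through points near [x0]. Letting the distance tend to [0],
    [on_line_closed] gives one through [x0] itself. *)
Lemma alg_torus w : Zalg lam Z w -> Ztorus lam Z w.
Proof.
move=> [A [[f hf] [hcon [hdim [hAZ [x0 [hx0 ->]]]]]]].
apply: (on_line_torus Hlam Hper Han).
have hacc k := connected_not_isolated hcon hdim hx0 (inv_nat_gt0 k).
pose x k := proj1_sig (constructive_indefinite_description _ (hacc k)).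
have hx k : [/\ A (x k), x k <> x0 & forall i, Rabs (x k i - x0 i) < / (INR k + 1)].
  exact: (proj2_sig (constructive_indefinite_description _ (hacc k))).
have hlim i : Rlim (fun k => x k i) (x0 i).
  move=> e he; apply: (Um1 (Rlim_inv_nat he)) => k; have [_ _ h] := hx k.
  by rewrite Rminus_0_r => h1; have := h i; have := Rle_abs (/ (INR k + 1)); lra.
have heps k : 0 < / (INR k + 1) <= 1.
  split; first exact: inv_nat_gt0.
  by rewrite -[X in _ <= X]Rinv_1; apply: Rinv_le_contravar; [lra | have := pos_INR k; lra].
have hb k := line_near (heps k) (fun x h => hAZ x (proj2 (hf x) h))
  (fun k => proj1 (hf _) (let: And3 h _ _ := hx k in h)) hlim (fun k => let: And3 _ h _ := hx k in h).
pose b k := proj1_sig (constructive_indefinite_description _ (hb k)).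
have hb' k : (forall i, Rabs (b k i - x0 i) <= / (INR k + 1)) /\ on_line Z (coord_map lam (b k)).
  exact: (proj2_sig (constructive_indefinite_description _ (hb k))).
apply: (on_line_closed Han (z := fun k => coord_map lam (b k))); last by apply: Uall => k; have [] := hb' k.
apply: vsum_lim => i e he; apply: (Um1 (Rlim_inv_nat he)) => k; have [h _] := hb' k.
by rewrite Rminus_0_r => h1; have := h i; have := Rle_abs (/ (INR k + 1)); lra.
Qed.

End Assembly.

Unset Implicit Arguments.
(* [ssrnat] rebinds this notation to [muln]. *)
Notation "m * n" := (Nat.mul m n) : nat_scope.

Theorem theorem2p1 (g : nat) (lam : Fin.t (2 * g) -> Cg g)
  (Hlam : R_indep lam) (Z : Cg g -> Prop)
  (Hper : periodic lam Z) (Han : analytic_set Z) :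
  forall w : Cg g, Zalg lam Z w <-> Ztorus lam Z w.
Proof.
move=> w; split; first exact: alg_torus Hlam Hper Han w.
exact: torus_alg Hlam.
Qed.
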